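(* Let $T>0$, $\alpha\in(0,1)$, $n\in\{1,2,3\}$ and $p>1$. For every $\delta>0$ there is a constant $C$ independent of $N$ such that for all $N\ge1$ $$\mathbb E\sup_{0\le t\le T}\|Z^{:n:}_{-\infty,t}-(Z^N_{-\infty,t})^{:n:}\|_{-\alpha}^p\le C(1+N^2)^{-\frac{p(\alpha-\delta)}2},$$ and for every $\beta>\alpha$ and every $\delta>0$ there is a constant $C$ independent of $N$ such that for all $N\ge1$ $$\mathbb E\sup_{0\le t\le T}t^{\frac{(n-1)(\alpha+\beta)p}2}\|Z^{:n:}_t-(Z^N_t)^{:n:}\|_{-\alpha}^p\le C(1+N^2)^{-\frac{p(\alpha-\delta)}2}.$$ Here $Z^{:n:}_{-\infty,\cdot}$, $(Z^N_{-\infty,\cdot})^{:n:}$, $Z^{:n:}$, $(Z^N)^{:n:}$ are the Wick powers of the stochastic heat equation and of its Galerkin approximations, defined in the context.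
   Context: Besov spaces. $\mathbb T^2$ is the torus of size $1$, $e_m(x)=e^{\iota 2\pi m\cdot x}$ for $m\in\mathbb Z^2$, $\hat f(m)=\int_{\mathbb T^2}e^{-\iota2\pi m\cdot x}f(x)\,dx$. Fix nonnegative radial $\chi,\theta\in C_c^\infty(\mathbb R^2)$ with $\mathrm{supp}\,\chi\subset B(0,4/3)$, $\mathrm{supp}\,\theta\subset B(0,8/3)\setminus B(0,3/4)$, $\chi(z)+\sum_{j\ge0}\theta(z/2^j)=1$ for all $z$, $\mathrm{supp}\,\chi\cap\mathrm{supp}\,\theta(\cdot/2^j)=\emptyset$ for $j\ge1$, $\mathrm{supp}\,\theta(\cdot/2^i)\cap\mathrm{supp}\,\theta(\cdot/2^j)=\emptyset$ for $|i-j|>1$. Put $\chi_{-1}=\chi$, $\chi_j=\theta(\cdot/2^j)$ for $j\ge0$, and $\Delta_jf=\sum_{m}\chi_j(m)\hat f(m)e_m$. For $\alpha\in\mathbb R$, $\mathcal C^\alpha$ is the completion of $C^\infty(\mathbb T^2)$ with respect to $\|u\|_\alpha:=\sup_{j\ge-1}2^{j\alpha}\|\Delta_ju\|_{L^\infty}$. $P_Nf=\sum_{|m|\le N}\hat f(m)e_m$ ($|m|$ Euclidean, $N\ge1$). Noise and Wick powers. $\xi$ is space-time white noise on $\mathbb R\times\mathbb T^2$, i.e. a centered Gaussian family $(\xi(\phi))_{\phi\in L^2(\mathbb R\times\mathbb T^2)}$ with $\mathbb E(\xi(\phi)\xi(\psi))=\langle\phi,\psi\rangle_{L^2}$. $A=\Delta-\mathrm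 I$ (periodic boundary conditions), $S(t)=e^{tA}$, $I_m=1+4\pi^2|m|^2$, $H(r,x)=\sum_{m\in\mathbb Z^2}e^{-rI_m}e_m(x)$, $H_N=P_NH$, $\mathfrak R^N=\|1_{[0,\infty)}H_N\|^2_{L^2(\mathbb R\times\mathbb T^2)}$. For $n=1,2,3$ and $\phi\in C^\infty(\mathbb T^2)$ define the multiple (iterated Wiener–Itô) stochastic integral $$Z^{:n:}_{-\infty,t}(\phi)=\int_{((-\infty,t]\times\mathbb T^2)^n}\Big\langle\phi,\prod_{i=1}^nH(t-s_i,x_i-\cdot)\Big\rangle\,\xi(\otimes_{i=1}^nds_i,\otimes_{i=1}^ndx_i),$$ and $Z_{-\infty,t}=Z^{:1:}_{-\infty,t}$. These are identified with their modifications in $C([0,T];\mathcal C^{-\alpha})$. Put $Z^N_{-\infty,t}=P_NZ_{-\infty,t}$, $(Z^N_{-\infty,t})^{:1:}=Z^N_{-\infty,t}$, $(Z^N_{-\infty,t})^{:2:}=(Z^N_{-\infty,t})^2-\mathfrak R^N$, $(Z^N_{-\infty,t})^{:3:}=(Z^N_{-\infty,t})^3-3\mathfrak R^NZ^N_{-\infty,t}$. With the convention $z^{:0:}=1$, for $t\ge0$, $$Z_t^{:n:}=\sum_{k=0}^n\binom nk(-1)^k(S(t)Z_{-\infty,0})^kZ_{-\infty,t}^{:n-k:},\qquad (Z^N_t)^{:n:}=\sum_{k=0}^n\binom nk(-1)^k(S(t)Z^N_{-\infty,0})^k(Z^N_{-\infty,t})^{:n-k:}.$$ Here $Z_t=Z_t^{:1:}$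 solves $\partial_tZ=AZ+\xi$, $Z(0)=0$, and $Z^N_t=(Z^N_t)^{:1:}$ solves $\partial_tZ^N=P_NAZ^N+P_N\xi$, $Z^N(0)=0$. Convention: wherever an expression is not defined at $t=0$, suprema over $0\le t\le T$ are over $0<t\le T$. *)

(* Defs.v *)
From HB Require Import structures.
From mathcomp Require Import all_boot all_order all_algebra.
From mathcomp Require Import all_classical all_reals all_analysis ess_sup_inf.
From mathcomp Require Import complex.

Set Implicit Arguments.
Unset Strict Implicit.
Unset Printing Implicit Defensive.

Import Order.TTheory GRing.Theory Num.Theory.
Import numFieldNormedType.Exports.

Local Open Scope classical_set_scope.
Local Open Scope ring_scope.

(** * The torus, test functions, distributions

    The torus of size 1 is R^2 modulo Z^2: functions on it are 1-periodic
    functions on the plane, integrals on it are taken over [0, 1)^2. *)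

(* The instance inferred for [m1 \x m2] stops at measures; sigma-finiteness is
   needed to form triple products. *)
Lemma sigma_finite_product d1 d2 (T1 : measurableType d1) (T2 : measurableType d2)
    (R : realType) (m1 : {sigma_finite_measure set T1 -> \bar R})
    (m2 : {sigma_finite_measure set T2 -> \bar R}) :
  sigma_finite setT (m1 \x m2)%E.
Proof.
have /sigma_finiteP[F [TF ndF Foo]] := sigma_finiteT m1.
have /sigma_finiteP[G [TG ndG Goo]] := sigma_finiteT m2.
exists (fun n => F n `*` G n).
  rewrite -setXTT TF TG predeqE => -[x y]; split.
    move=> [/= [n _ Fnx] [k _ Gky]]; exists (maxn n k) => //; split.
    - by move: x Fnx; exact/subsetPset/ndF/leq_maxl.
    - by move: y Gky; exact/subsetPset/ndG/leq_maxr.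
  by move=> [n _ []/= ? ?]; split; exists n.
move=> k; have [? ?] := Foo k; have [? ?] := Goo k.
split; first exact: measurableX.
by rewrite product_measure1E// lte_mul_pinfty// ge0_fin_numE.
Qed.

Notation plane R := (measurableTypeR R * measurableTypeR R)%type.
Notation spacetime R := (measurableTypeR R * plane R)%type.

Section Torus.
Context {R : realType}.

Definition plane_measure : set (plane R) -> \bar R :=
  (@lebesgue_measure R \x @lebesgue_measure R)%E.

HB.instance Definition _ := Measure.on plane_measure.
HB.instance Definition _ := @Measure_isSigmaFinite.Build _ _ _ plane_measure
  (sigma_finite_product (@lebesgue_measure R) (@lebesgue_measure R)).

Definition spacetime_measure : set (spacetime R) -> \bar R :=
  (@lebesgue_measure R \x plane_measure)%E.

HB.instance Definition _ := Measure.on spacetime_measure.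
HB.instance Definition _ := @Measure_isSigmaFinite.Build _ _ _ spacetime_measure
  (sigma_finite_product (@lebesgue_measure R) plane_measure).

Definition torus : set (R * R) := [set` `[0, 1[] `*` [set` `[0, 1[].

Definition axis (i : bool) : R * R := if i then (1, 0) else (0, 1).

Definition periodic (f : R * R -> R) : Prop :=
  forall i x, f (x + axis i) = f x.

Fixpoint C_n (k : nat) (f : R * R -> R) : Prop :=
  continuous f /\
  match k with
  | 0 => True
  | k'.+1 => forall i, (forall x, derivable f x (axis i)) /\
                       C_n k' (fun x => 'D_(axis i) f x)
  end.

Definition smooth (f : R * R -> R) : Prop := forall k, C_n k f.

Definition test_function (f : R * R -> R) : Prop := periodic f /\ smooth f.

(* Only the values on test functions are meaningful. Linearity and continuity
   are not imposed here: they follow from [in_besov] below. *)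
Definition torus_distribution : Type := (R * R -> R) -> R.

Definition distr_of_fun (f : R * R -> R) : torus_distribution :=
  fun phi => \int[plane_measure]_(x in torus) (f x * phi x).

Definition distr_sub (u v : torus_distribution) : torus_distribution :=
  fun phi => u phi - v phi.

Definition distr_mul (f : R * R -> R) (u : torus_distribution) : torus_distribution :=
  fun phi => u (fun x => f x * phi x).

(** * Fourier series *)

Definition norm2 (x : R * R) : R := Num.sqrt (x.1 ^+ 2 + x.2 ^+ 2).

Definition lattice (m : int * int) : R * R := (m.1%:~R, m.2%:~R).

Definition phase (m : int * int) (x : R * R) : R :=
  2 * pi * ((lattice m).1 * x.1 + (lattice m).2 * x.2).

Definition fourier_mode (m : int * int) (x : R * R) : R[i] :=
  (cos (phase m x) +i* sin (phase m x))%C.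

(* u(e_{-m}), with u extended to complex test functions by linearity. *)
Definition fourier_coef (u : torus_distribution) (m : int * int) : R[i] :=
  (u (fun x => complex.Re (fourier_mode (- m) x)) +i*
   u (fun x => complex.Im (fourier_mode (- m) x)))%C.

Definition disc (N : nat) : set (int * int) :=
  [set m | norm2 (lattice m) <= N%:R].

(* The sums over |m| <= N of the next three definitions are real for real u;
   [Re] only changes the type. *)
Definition galerkin (N : nat) (u : torus_distribution) (x : R * R) : R :=
  complex.Re (\sum_(m \in disc N) fourier_coef u m * fourier_mode m x).

Definition eigen (m : int * int) : R := 1 + 4 * pi ^+ 2 * norm2 (lattice m) ^+ 2.

Definition heat_kernelN (N : nat) (r : R) (x : R * R) : R :=
  complex.Re (\sum_(m \in disc N) (expR (- (r * eigen m)))%:C%C * fourier_mode m x).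

Definition heat_kernel (r : R) (x : R * R) : R :=
  limn (fun N => heat_kernelN N r x).

(* exp(t (Laplacian - 1)) as a Fourier multiplier; used for t > 0 only, where
   it maps the Besov spaces below to smooth functions. *)
Definition heat_semigroup (t : R) (u : torus_distribution) (x : R * R) : R :=
  limn (fun N => complex.Re (\sum_(m \in disc N)
    (expR (- (t * eigen m)))%:C%C * fourier_coef u m * fourier_mode m x)).

(** * Besov spaces *)

Definition supp (f : R * R -> R) : set (R * R) := closure [set z | f z != 0].

Definition obal (r : R) : set (R * R) := [set z | norm2 z < r].

Definition radial (f : R * R -> R) : Prop :=
  forall z w, norm2 z = norm2 w -> f z = f w.

(* theta(./2^j) *)
Definition dyadic (theta : R * R -> R) (j : nat) (z : R * R) : R :=
  theta (z.1 / 2 ^+ j, z.2 / 2 ^+ j).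

Record dyadic_partition (chi theta : R * R -> R) : Prop := DyadicPartition {
  chi_smooth : smooth chi;
  theta_smooth : smooth theta;
  chi_ge0 : forall z, 0 <= chi z;
  theta_ge0 : forall z, 0 <= theta z;
  chi_radial : radial chi;
  theta_radial : radial theta;
  chi_supp : supp chi `<=` obal (4 / 3);
  theta_supp : supp theta `<=` obal (8 / 3) `\` obal (3 / 4);
  partition1 : forall z,
    (fun n => chi z + \sum_(0 <= j < n) dyadic theta j z) @ \oo --> (1 : R);
  chi_theta_disj : forall j, (1 <= j)%N ->
    supp chi `&` supp (dyadic theta j) = set0;
  theta_theta_disj : forall i j, (i.+1 < j)%N || (j.+1 < i)%N ->
    supp (dyadic theta i) `&` supp (dyadic theta j) = set0
}.

(* Dyadic blocks are indexed by integers j >= -1. *)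
Definition block_symbol (chi theta : R * R -> R) (j : int) : R * R -> R :=
  match j with
  | Posz k => dyadic theta k
  | Negz _ => chi
  end.

(* For each j only finitely many terms are nonzero. *)
Definition block (chi theta : R * R -> R) (j : int) (u : torus_distribution)
    (x : R * R) : R[i] :=
  \sum_(m \in [set: int * int])
    (block_symbol chi theta j (lattice m))%:C%C * fourier_coef u m * fourier_mode m x.

(* The essential supremum over the plane of a periodic function is its
   essential supremum over the torus. *)
Definition besov_norm (chi theta : R * R -> R) (a : R) (u : torus_distribution) : \bar R :=
  ereal_sup [set ((2 `^ (j%:~R * a))%R%:E *
      ess_sup plane_measure
        (fun x => (ComplexField.Normc.normc (block chi theta j u x))%:E))%E
    | j in [set j : int | -1 <= j]].

(* The completion of the smooth functions, realised inside distributions. *)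
Definition in_besov (chi theta : R * R -> R) (a : R) (u : torus_distribution) : Prop :=
  exists v : nat -> R * R -> R,
    [/\ forall k, test_function (v k),
        besov_norm chi theta a (distr_sub u (distr_of_fun (v k))) @[k --> \oo]
          --> (0 : \bar R)%E &
        forall phi, test_function phi ->
          distr_of_fun (v k) phi @[k --> \oo] --> u phi].

(* u restricted to [0, T] belongs to C([0, T]; C^a) *)
Definition besov_path (chi theta : R * R -> R) (a T : R) (u : R -> torus_distribution) : Prop :=
  (forall t, 0 <= t <= T -> in_besov chi theta a (u t)) /\
  (forall t, 0 <= t <= T -> forall e : R, 0 < e -> exists2 r : R, 0 < r &
    forall s, 0 <= s <= T -> `|s - t| < r ->
      (besov_norm chi theta a (distr_sub (u s) (u t)) < e%:E)%E).

(** * Space-time white noise and multiple stochastic integrals *)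

Definition cylinder : set (spacetime R) := [set: R] `*` torus.

Definition square_integrable (f : spacetime R -> R) : Prop :=
  measurable_fun cylinder f /\
  (\int[spacetime_measure]_(z in cylinder) ((f z) ^+ 2)%:E < +oo)%E.

(* The n-fold integral over (R x T^2)^n. *)
Fixpoint integral_n (n : nat) : (n.-tuple (spacetime R) -> \bar R) -> \bar R :=
  match n with
  | 0 => fun F => F [tuple]
  | n'.+1 => fun F => (\int[spacetime_measure]_(z in cylinder)
                        integral_n (fun zs => F [tuple of z :: zs]))%E
  end.

(* sum of a_(i_1, ..., i_n) 1_(A_(i_1) x ... x A_(i_n)), with pairwise disjoint
   sets and coefficients vanishing on the diagonals *)
Record elementary (n : nat) := Elementary {
  el_size : nat;
  el_set : 'I_el_size -> set (spacetime R);
  el_coef : {ffun 'I_n -> 'I_el_size} -> R;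
  el_measurable : forall i, measurable (el_set i);
  el_cylinder : forall i, el_set i `<=` cylinder;
  el_finite : forall i, (spacetime_measure (el_set i) < +oo)%E;
  el_disjoint : trivIset setT el_set;
  el_diagonal : forall tau : {ffun 'I_n -> 'I_el_size}, ~ injective tau -> el_coef tau = 0
}.

Definition elementary_fun (n : nat) (e : elementary n)
    (z : n.-tuple (spacetime R)) : R :=
  \sum_(tau : {ffun 'I_n -> 'I_(el_size e)})
    el_coef tau * \prod_(i < n) \1_(el_set (tau i)) (tnth z i).

(* 1_{s_1, ..., s_n <= t} <phi, prod_i H(t - s_i, x_i - .)> *)
Definition wick_kernel (n : nat) (t : R) (phi : R * R -> R)
    (z : n.-tuple (spacetime R)) : R :=
  (\prod_(i < n) \1_[set` `]-oo, t]] (tnth z i).1) *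
  distr_of_fun (fun y => \prod_(i < n)
    heat_kernel (t - (tnth z i).1) ((tnth z i).2 - y)) phi.

Section Noise.
Context {d : measure_display} {Omega : measurableType d} (P : probability Omega R).

(* The case of zero variance is separate because [normal_prob _ 0] is not a
   Dirac mass in the library. *)
Definition centered_gaussian (X : Omega -> R) : Prop :=
  exists2 sigma : R, 0 <= sigma & forall A : set (measurableTypeR R), measurable A ->
    P (X @^-1` A) = if sigma == 0 then dirac (0 : R) A else normal_prob 0 sigma A.

Definition white_noise (xi : (spacetime R -> R) -> {RV P >-> R}) : Prop :=
  (forall (k : nat) (f : 'I_k -> spacetime R -> R) (c : 'I_k -> R),
     (forall i, square_integrable (f i)) ->
     centered_gaussian (fun w => \sum_(i < k) c i * xi (f i) w)) /\
  (forall f g, square_integrable f -> square_integrable g ->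
     ('E_P[fun w => (xi f w * xi g w)%R] =
      \int[spacetime_measure]_(z in cylinder) (f z * g z)%:E)%E).

Definition elementary_int (xi : (spacetime R -> R) -> {RV P >-> R}) (n : nat)
    (e : elementary n) (w : Omega) : R :=
  \sum_(tau : {ffun 'I_n -> 'I_(el_size e)})
    el_coef tau * \prod_(i < n) xi \1_(el_set (tau i)) w.

(* X is (a version of) the multiple Wiener-Ito integral of F: the L^2(P) limit
   of the integrals of elementary functions converging to F in L^2. *)
Definition multiple_integral (xi : (spacetime R -> R) -> {RV P >-> R}) (n : nat)
    (F : n.-tuple (spacetime R) -> R) (X : Omega -> R) : Prop :=
  measurable_fun setT X /\
  exists e : nat -> elementary n,
    (integral_n (fun z => ((F z - elementary_fun (e k) z) ^+ 2)%:E) @[k --> \oo]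
       --> (0 : \bar R)%E) /\
    ((\int[P]_w ((X w - elementary_int xi (e k) w) ^+ 2)%:E)%E @[k --> \oo]
       --> (0 : \bar R)%E).

(** * Wick powers *)

(* Z n t is the n-th Wick power at time t of the stationary solution, for
   n = 1, 2, 3 and t in [0, T], in its modification with paths in
   C([0, T]; C^(-alpha)). *)
Definition stationary_wick_powers (chi theta : R * R -> R)
    (xi : (spacetime R -> R) -> {RV P >-> R}) (T alpha : R)
    (Z : nat -> R -> Omega -> torus_distribution) : Prop :=
  forall n, (1 <= n <= 3)%N ->
    (forall t phi, 0 <= t <= T -> test_function phi ->
       multiple_integral xi (@wick_kernel n t phi) (fun w => Z n t w phi)) /\
    (forall w, besov_path chi theta (- alpha) T (fun t => Z n t w)).

End Noise.

Definition renorm (N : nat) : R :=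
  \int[spacetime_measure]_(z in cylinder)
    (\1_[set` `[0, +oo[] z.1 * heat_kernelN N z.1 z.2) ^+ 2.

Definition wick_poly (c : R) (n : nat) (z : R) : R :=
  match n with
  | 0 => 1
  | 1 => z
  | 2 => z ^+ 2 - c
  | 3 => z ^+ 3 - 3 * c * z
  | _ => 0
  end.

Section Processes.
Context {Omega : Type} (Z : nat -> R -> Omega -> torus_distribution).

(* (Z^N_{-oo,t})^{:n:} *)
Definition stationaryN (N n : nat) (t : R) (w : Omega) (x : R * R) : R :=
  wick_poly (renorm N) n (galerkin N (Z 1 t w) x).

(* Z_{-oo,t}^{:n:}, with z^{:0:} = 1 *)
Definition stationary (n : nat) (t : R) (w : Omega) : torus_distribution :=
  if n == 0%N then distr_of_fun (fun _ => 1) else Z n t w.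

(* Z_t^{:n:}, for t > 0 *)
Definition wick (n : nat) (t : R) (w : Omega) : torus_distribution :=
  fun phi => \sum_(k < n.+1) 'C(n, k)%:R * (-1) ^+ k *
    distr_mul (fun x => heat_semigroup t (Z 1 0 w) x ^+ k)
              (stationary (n - k) t w) phi.

(* (Z^N_t)^{:n:}, for t > 0 *)
Definition wickN (N n : nat) (t : R) (w : Omega) (x : R * R) : R :=
  \sum_(k < n.+1) 'C(n, k)%:R * (-1) ^+ k *
    heat_semigroup t (distr_of_fun (stationaryN N 1 0 w)) x ^+ k *
    stationaryN N (n - k) t w x.

End Processes.

End Torus.

(* Main.v *)
(* Stationary powers. Tested against a trigonometric polynomial, the error
   Z^{:n:} - (Z^N)^{:n:} is an L^2 limit of elements of the n-th Wiener chaos, so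
   hypercontractivity reduces all its moments, and those of its time increments,
   to second moments; these are lattice sums over m_1 + ... + m_n of products of
   1 / I_m, where the frequencies above N yield the factor N^(-2 gam) and the
   increment the factor |t - s|^kappa, as long as gam + kappa < lambda < alpha.
   Chaining over dyadic times bounds the supremum in time; Nikolskii's inequality
   on a finite grid (a trigonometric polynomial of degree D is controlled by its
   values at O(D^2) points) bounds the supremum in space of every dyadic block.
   Averages over such grids replace integrals over the torus throughout.

   Powers started from zero. A weighted Cauchy-Schwarz inequality for the kernel
   gives the boundedness of Fourier multipliers localised in dyadic blocks, hence
     |S(t) u . v|_{-alpha} <= C t^(-(alpha + beta) / 2) |u|_{-alpha} |v|_{-alpha}
   for beta > alpha. Telescoping
     f^k u - g^k v = f (f^(k-1) u - g^(k-1) v) + (f - g) g^(k-1) v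
   turns the estimates on stationary powers into the second estimate; the term
   k = n costs only t^(-(n-1) (alpha + beta) / 2) because S(t) itself is bounded. *)
Require Import Defs.
From HB Require Import structures.
From mathcomp Require Import all_boot all_order all_algebra.
From mathcomp Require Import all_classical all_reals all_analysis ess_sup_inf.
From mathcomp Require Import measurable_realfun complex ring lra zify.
From mathcomp Require Import -(notations) mpoly.

Set Implicit Arguments.
Unset Strict Implicit.
Unset Printing Implicit Defensive.

Import Order.TTheory GRing.Theory Num.Theory.
Import numFieldNormedType.Exports.

Local Open Scope classical_set_scope.
Local Open Scope ring_scope.

(** * Gaussian moments and hypercontractivity *)

(** The obstacle is that [multiple_integral] offers only an L^2 limit of integrals of elementary
    functions, without product formula or orthogonality. Every estimate is therefore made on a
    finite Gaussian family: the indicators of the elementary functions together with the kernels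
    [field_kernel] of the Galerkin field. There expectations are a linear functional on polynomials,
    Wick products are polynomials, second moments are at most n! times squared L^2 norms of kernels,
    and Fatou's lemma carries the moment bounds to the limit. Moments of order 2Q with Q large pay
    for the two suprema: the increments have to beat the 2^k dyadic intervals of level k, and the
    decay 4^(-k Q (alpha - lambda)) the 4^k grid points of block k. The kernels without cutoff are
    reached only as limits of truncated ones. Likewise the products with S(t)u are computed on
    Fourier coefficients with finitely many blocks and reached coefficient by coefficient, since a
    [torus_distribution] is a bare function whose only regularity is the approximation by smooth
    functions in [in_besov]. *)

Lemma ler_of_eq (R : numDomainType) (x y : R) : x = y -> x <= y.
Proof. by move=> ->. Qed.

(** Young's inequality with exponents q + 1 and (q + 1)/q, by induction on q so that only integer
    powers occur. In the moment induction it separates [U] from [V ^+ q]. *)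
Lemma young_exprn (R : realType) (q : nat) (x y : R) : 0 <= x -> 0 <= y ->
  q.+1%:R * x * y ^+ q <= x ^+ q.+1 + q%:R * y ^+ q.+1.
Proof.
move=> x0 y0; elim: q => [|q IH]; first by rewrite mul1r mulr1 mul0r addr0 expr1.
have h : 0 <= q.+1%:R * y ^+ q * (x - y) ^+ 2.
  by rewrite mulr_ge0 ?sqr_ge0// mulr_ge0 ?exprn_ge0.
have h2 := ler_wpM2l x0 IH.
rewrite !exprS in h h2 *; rewrite -!natr1 in h h2 *; nra.
Qed.

Lemma sum_cauchy_schwarz (R : realType) (I : Type) (s : seq I) (a b : I -> R) :
  (\sum_(i <- s) a i * b i) ^+ 2 <= (\sum_(i <- s) a i ^+ 2) * (\sum_(i <- s) b i ^+ 2).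
Proof.
set B := \sum_(i <- s) b i ^+ 2; set C := \sum_(i <- s) a i * b i.
have B0 : 0 <= B by apply: sumr_ge0 => i _; exact: sqr_ge0.
have key : forall t : R, 0 <= (\sum_(i <- s) a i ^+ 2) - t * 2 * C + t ^+ 2 * B.
  move=> t; rewrite /C /B !mulr_sumr -sumrB -big_split/=.
  by apply: sumr_ge0 => i _; have := sqr_ge0 (a i - t * b i); nra.
have [B_eq0|Bn0] := eqVneq B 0.
  have [-> |Cn0] := eqVneq C 0; first by rewrite expr0n B_eq0 mulr0.
  have := key ((\sum_(i <- s) a i ^+ 2 + 1) / (2 * C)).
  by rewrite B_eq0 mulr0 addr0 -mulrA mulfVK ?mulf_neq0//; lra.
have Bp : 0 < B by rewrite lt_def Bn0.
have := key (C / B); have : B * (C / B) = C by field; exact: lt0r_neq0.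
nra.
Qed.

Section HypercontractivityAlgebra.
Context {R : realType} {A : comAlgType R} {I : finType} {T : Type}.
Variables (E : {scalar A}) (D : I -> {linear A -> A}) (ev : T -> {rmorphism A -> R}).
Hypothesis E1 : E 1 = 1.
Hypothesis E_le : forall p q, (forall w, ev w p <= ev w q) -> E p <= E q.
Hypothesis DM : forall i p q, D i (p * q) = D i p * q + p * D i q.
Hypothesis evZ : forall w c p, ev w (c *: p) = c * ev w p.

(** The n-th Wiener chaos seen through the Ornstein-Uhlenbeck operator: tested against every [G],
    [F] is an eigenvector with eigenvalue n, and its derivatives lie one level lower. The moment
    induction works from this weak form, with neither Hermite polynomials nor a semigroup. *)
Fixpoint chaos (n : nat) (F : A) : Prop :=
  match n with
  | 0 => exists c : R, F = c%:A
  | m.+1 => (forall G, m.+1%:R * E (F * G) = \sum_i E (D i F * D i G)) /\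
            forall i, chaos m (D i F)
  end.

Lemma chaosD n F G : chaos n F -> chaos n G -> chaos n (F + G).
Proof.
elim: n F G => [|n IH] F G /=.
  by move=> [c ->] [d ->]; exists (c + d); rewrite scalerDl.
move=> [F1 F2] [G1 G2]; split=> [H|i]; last by rewrite linearD; exact: IH.
rewrite mulrDl linearD/= mulrDr F1 G1 -big_split/=; apply: eq_bigr => i _.
by rewrite -linearD -mulrDl linearD.
Qed.

Lemma chaosZ n c F : chaos n F -> chaos n (c *: F).
Proof.
elim: n F => [|n IH] F /=; first by move=> [d ->]; exists (c * d); rewrite scalerA.
move=> [F1 F2]; split=> [H|i]; last by rewrite linearZ/=; exact: IH.
rewrite -scalerAl linearZ/= mulrCA F1 mulr_sumr; apply: eq_bigr => i _.
by rewrite linearZ/= -scalerAl linearZ.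
Qed.

Lemma chaos_sum n (J : Type) (s : seq J) (F : J -> A) :
  (forall j, chaos n (F j)) -> chaos n (\sum_(j <- s) F j).
Proof.
move=> Fn; elim: s => [|j s IH]; last by rewrite big_cons; exact: chaosD.
by rewrite big_nil -(scale0r (0 : A)); apply: chaosZ; elim: n {Fn} => [|n IH];
  [exists 0; rewrite scale0r|split=> [H|i]; rewrite ?linear0//;
   rewrite mul0r linear0 mulr0 big1// => i _; rewrite !linear0 mul0r linear0].
Qed.

Let DX i p k : D i (p ^+ k) = k%:R *: (p ^+ k.-1 * D i p).
Proof.
elim: k => [|k IH].
  rewrite expr0 scale0r; apply/(addIr (D i 1)); rewrite add0r.
  by rewrite -{3}(mulr1 1) DM mulr1 mul1r.
rewrite exprS DM IH /= -scalerAr mulrA; case: k IH => [|k] _ /=.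
  by rewrite !expr0 mulr1 mul1r scale0r addr0 scale1r.
by rewrite -exprS mulrC -{1}[_ * D i p]scale1r -scalerDl addrC natr1.
Qed.

(** The statement concerns finite families because the induction on the order replaces [F] by its
    gradient. Integration by parts and Cauchy-Schwarz bound [n.+1 * E (V ^+ q.+1)] by [q.*2.+1]
    times [E (U * V ^+ q)], where [U] is the squared norm of the gradient; Young's inequality then
    absorbs [V] on the left. *)
Theorem chaos_hypercontractive n (J : finType) (F : J -> A) q :
  (forall j, chaos n (F j)) ->
  E ((\sum_j F j ^+ 2) ^+ q.+1) <=
    ((q.*2.+1)%:R ^+ n) ^+ q.+1 * E (\sum_j F j ^+ 2) ^+ q.+1.
Proof.
elim: n J F => [|n IH] J F Fn.
  have [c cE] : exists c : J -> R, forall j, F j = (c j)%:A.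
    by have [c] := boolp.choice Fn; exists c.
  have -> : \sum_j F j ^+ 2 = (\sum_j c j ^+ 2)%:A.
    rewrite scaler_suml; apply: eq_bigr => j _.
    by rewrite cE expr2 -scalerAl mul1r scalerA expr2.
  by rewrite exprZn expr1n !linearZ/= E1 expr0 expr1n mul1r !mulr1.
pose V := \sum_j F j ^+ 2; pose U := \sum_(ji : J * I) D ji.2 (F ji.1) ^+ 2.
have evV w : ev w V = \sum_j ev w (F j) ^+ 2.
  by rewrite rmorph_sum; apply: eq_bigr => j _; rewrite rmorphXn.
have evU w : ev w U = \sum_i \sum_j ev w (D i (F j)) ^+ 2.
  rewrite exchange_big/= pair_bigA rmorph_sum; apply: eq_bigr => j _.
  by rewrite rmorphXn.
have V0 w : 0 <= ev w V by rewrite evV sumr_ge0// => j _; exact: sqr_ge0.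
have U0 w : 0 <= ev w U.
  by rewrite evU sumr_ge0// => i _; rewrite sumr_ge0// => j _; exact: sqr_ge0.
have EV : n.+1%:R * E V = E U.
  rewrite /V /U linear_sum mulr_sumr -(pair_bigA _ (fun j i => D i (F j) ^+ 2))/=.
  rewrite linear_sum; apply: eq_bigr => j _; have [/(_ (F j)) + _] := Fn j.
  by rewrite -expr2 => ->; rewrite linear_sum.
have IBP : n.+1%:R * E (V ^+ q.+1) <= (q.*2.+1)%:R * E (U * V ^+ q).
  pose W := \sum_i (\sum_j F j * D i (F j)) ^+ 2.
  have -> : n.+1%:R * E (V ^+ q.+1) = E (U * V ^+ q + (2 * q%:R) *: (V ^+ q.-1 * W)).
    rewrite exprS {1}/V mulr_suml linear_sum mulr_sumr.
    transitivity (\sum_j \sum_i E (D i (F j) * D i (F j * V ^+ q))).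
      apply: eq_bigr => j _; have [/(_ (F j * V ^+ q)) + _] := Fn j.
      by rewrite mulrA -expr2.
    have DV i : D i V = 2 *: (\sum_j F j * D i (F j)).
      rewrite linear_sum scaler_sumr; apply: eq_bigr => j _.
      by rewrite DX expr1.
    rewrite exchange_big/=; under eq_bigr do rewrite -linear_sum.
    rewrite -linear_sum; congr (E _).
    have -> : U * V ^+ q = \sum_i (\sum_j D i (F j) * D i (F j)) * V ^+ q.
      rewrite -mulr_suml; congr (_ * _); rewrite exchange_big pair_bigA.
      by apply: eq_bigr.
    rewrite mulr_sumr scaler_sumr -big_split/=; apply: eq_bigr => i _.
    under eq_bigr do rewrite DM DX mulrDr mulrA.
    rewrite big_split/= -mulr_suml; congr (_ + _).
    under eq_bigr do rewrite mulrCA mulrA -!scalerAr DV -!scalerAr.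
    rewrite -scaler_sumr -scaler_sumr scalerA mulrC; congr (_ *: _).
    by rewrite -mulr_suml expr2 mulrCA mulrA mulrC; congr (_ * _).
  rewrite -linearZ/=; apply: E_le => w.
  rewrite rmorphD !evZ !rmorphM !rmorphXn/=.
  have WVU : ev w W <= ev w V * ev w U.
    rewrite /W rmorph_sum evV evU mulr_sumr; apply: ler_sum => i _.
    rewrite rmorphXn rmorph_sum; under eq_bigr do rewrite rmorphM.
    exact: sum_cauchy_schwarz.
  have := ler_wpM2l (exprn_ge0 q.-1 (V0 w)) WVU.
  case: (q) => [|r]/=; first by rewrite !expr0 double0; lra.
  rewrite mulrA -exprSr => h.
  have : 0 <= 2 * r.+1%:R :> R by rewrite mulr_ge0.
  move=> /ler_wpM2l - /(_ _ _ h).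
  by have -> : r.+1.*2.+1%:R = 2 * r.+1%:R + 1 :> R; [rewrite -natr1 -mul2n natrM | nra].
(* The denominator [n.+1] of [K] cancels against [E U = n.+1 * E V] at the end, so each order costs
   exactly the factor [q.*2.+1]. *)
have K0 : 0 <= q.*2.+1%:R / n.+1%:R :> R by rewrite divr_ge0.
set K : R := _ / _ in K0.
have step : E (V ^+ q.+1) <= K ^+ q.+1 * E (U ^+ q.+1).
  have E2 : q.+1%:R * K * E (U * V ^+ q) <= K ^+ q.+1 * E (U ^+ q.+1) + q%:R * E (V ^+ q.+1).
    rewrite -!linearZ/= -linearD/=; apply: E_le => w.
    rewrite rmorphD !evZ !rmorphM !rmorphXn/=.
    have := young_exprn q (mulr_ge0 K0 (U0 w)) (V0 w).
    by rewrite exprMn !mulrA.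
  have : E (V ^+ q.+1) <= K * E (U * V ^+ q).
    by rewrite /K mulrAC ler_pdivlMr ?ltr0n// mulrC.
  move=> /(ler_wpM2l (ler0n R q.+1)); move: E2; rewrite -natr1; lra.
apply: (le_trans step).
have /(IH _ (fun ji : J * I => D ji.2 (F ji.1))) h : forall ji : J * I, chaos n (D ji.2 (F ji.1)).
  by move=> [j i]; have [_ /(_ i)] := Fn j.
apply: (le_trans (ler_wpM2l (exprn_ge0 q.+1 K0) h)).
rewrite -/U -EV -/V -!exprMn le_eqVlt; apply/orP; left; apply/eqP.
congr (_ ^+ _); rewrite exprS /K; field.
by rewrite nat1r pnatr_eq0.
Qed.
End HypercontractivityAlgebra.

Lemma sqr_sum_le (R : realType) n (x : 'I_n -> R) :
  (\sum_i x i) ^+ 2 <= n%:R * \sum_i x i ^+ 2.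
Proof.
have := sum_cauchy_schwarz (index_enum 'I_n) (fun=> 1) x.
rewrite (eq_bigr x) => [|j _]; last exact: mul1r.
rewrite [X in _ <= X * _](eq_bigr (fun=> 1)) => [|j _]; last exact: expr1n.
by rewrite sumr_const card_ord.
Qed.

Lemma poly_eq_horner (R : numFieldType) (p q : {poly R}) :
  (forall s, p.[s] = q.[s]) -> p = q.
Proof.
move=> pq; apply/eqP; rewrite -subr_eq0; apply/negPn/negP => /max_poly_roots.
move=> /(_ [seq i%:R | i <- iota 0 (size (p - q)%R)]).
rewrite size_map size_iota ltnn => h; suff: false by [].
apply: h; last by rewrite map_inj_uniq ?iota_uniq//; exact/mulrIn/oner_neq0.
by apply/allP => _ /mapP[i _ ->]; rewrite rootE !hornerE pq subrr.
Qed.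

Section LinearPowers.
Context {R : realType} {A : comAlgType R}.
Variable E : {scalar A}.

Lemma horner_linear_power (P L X : A) n s :
  (\poly_(i < n.+1) (E (P * L ^+ (n - i) * X ^+ i) *+ 'C(n, i))).[s] =
  E (P * (L + s *: X) ^+ n).
Proof.
rewrite horner_poly exprDn mulr_sumr linear_sum; apply: eq_bigr => i _.
rewrite exprZn -scalerAr mulrnAr -scalerAr linearMn/= linearZ/= mulrA.
by rewrite mulrC mulrnAr.
Qed.

(** Polarization: the coefficient of s in [E (P * (L + s *: X) ^+ n.+1)] is [n.+1] times
    [E (P * L ^+ n * X)]. *)
Lemma linear_power_eq0 (P L X : A) n :
  (forall s, E (P * (L + s *: X) ^+ n.+1) = 0) -> E (P * L ^+ n * X) = 0.
Proof.
move=> h; have : \poly_(i < n.+2) (E (P * L ^+ (n.+1 - i) * X ^+ i) *+ 'C(n.+1, i)) = 0.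
  by apply: poly_eq_horner => s; rewrite horner_linear_power h horner0.
move=> /(congr1 (fun p : {poly R} => p`_1)); rewrite coef_poly coef0/= subn1 /= bin1 expr1.
by move=> /eqP; rewrite mulrn_eq0/= => /eqP.
Qed.

End LinearPowers.

(** * Gaussian integration by parts and Wick products on polynomials *)

Section GaussianFunctional.
Context {R : realType} {k : nat}.
Local Notation poly := (mpoly k R).
Local Notation Xi a := (mpolyX R (mnm1 a) : poly).
Variables (C : 'I_k -> 'I_k -> R) (E : {scalar poly}).
Hypothesis Csym : forall a b, C a b = C b a.

Definition linear_form (c : 'I_k -> R) : poly := \sum_a c a *: Xi a.
Definition quadratic_form (c : 'I_k -> R) : R := \sum_a \sum_b c a * c b * C a b.

Hypothesis E_odd : forall c, E (linear_form c) = 0.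
Hypothesis E_pow : forall c m, E (linear_form c ^+ m.+2) =
  m.+1%:R * quadratic_form c * E (linear_form c ^+ m).

(** The derivation sending the variable b to [C a b], that is, the Malliavin derivative paired with
    the kernel of the variable a. *)
Definition cov_deriv (a : 'I_k) (p : poly) : poly := \sum_b C a b *: mderiv b p.

Lemma cov_deriv_is_linear a : linear (cov_deriv a).
Proof.
move=> r p q; rewrite /cov_deriv scaler_sumr -big_split; apply: eq_bigr => b _.
by rewrite linearP scalerDr !scalerA mulrC.
Qed.
HB.instance Definition _ a := GRing.isLinear.Build R poly poly _ (cov_deriv a)
  (cov_deriv_is_linear a).

Lemma cov_derivM a p q : cov_deriv a (p * q) = cov_deriv a p * q + p * cov_deriv a q.
Proof.
rewrite /cov_deriv mulr_suml mulr_sumr -big_split; apply: eq_bigr => b _.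
by rewrite mderivM scalerDr scalerAl scalerAr.
Qed.

Lemma cov_derivX a b : cov_deriv a (Xi b) = (C a b)%:A.
Proof.
rewrite /cov_deriv (bigD1 b)//= mderivX big1 => [|i ib].
  rewrite addr0 mnm1E eqxx scale1r; congr (_ *: _).
  by rewrite -[RHS]mpolyX0; congr mpolyX; apply/mnmP => j; rewrite mnmBE mnm0E subnn.
by rewrite mderivX mnm1E eq_sym (negbTE ib) scale0r scaler0.
Qed.

Lemma cov_deriv_form a c : cov_deriv a (linear_form c) = (\sum_b C a b * c b)%:A.
Proof.
rewrite linear_sum scaler_suml; apply: eq_bigr => b _.
by rewrite linearZ/= cov_derivX scalerA mulrC.
Qed.

Lemma cov_deriv_powform a c m : cov_deriv a (linear_form c ^+ m) =
  (m%:R * \sum_b C a b * c b) *: linear_form c ^+ m.-1.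
Proof.
elim: m => [|m IH].
  rewrite mul0r scale0r expr0; apply/(addIr (cov_deriv a 1)).
  by rewrite add0r -{3}(mulr1 1) cov_derivM mulr1 mul1r.
rewrite exprS cov_derivM IH cov_deriv_form -scalerAr -scalerAl mul1r.
case: m {IH} => [|m] /=.
  by rewrite !mul0r mul1r expr0 scale0r addr0.
by rewrite -exprS -scalerDl -[m.+2%:R]nat1r mulrDl mul1r.
Qed.

Lemma linear_formD c d : linear_form (fun i => c i + d i) = linear_form c + linear_form d.
Proof. by rewrite -big_split; apply: eq_bigr => i _; rewrite scalerDl. Qed.

Lemma linear_formDX c s a :
  linear_form c + s *: Xi a = linear_form (fun i => c i + s * (i == a)%:R).
Proof.
rewrite linear_formD; congr (_ + _).
rewrite /linear_form (bigD1 a)//= eqxx mulr1 big1 ?addr0// => i ia.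
by rewrite (negbTE ia) mulr0 scale0r.
Qed.

Lemma quadratic_formDX c s a :
  quadratic_form (fun i => c i + s * (i == a)%:R) =
  quadratic_form c + s * (2 * \sum_b C a b * c b) + s ^+ 2 * C a a.
Proof.
have sumD (f : 'I_k -> R) (b : 'I_k) : \sum_i f i * (i == b)%:R = f b.
  by rewrite (bigD1 b)//= eqxx mulr1 big1 ?addr0// => i /negbTE ->; rewrite mulr0.
rewrite /quadratic_form.
transitivity (\sum_i (\sum_j c i * c j * C i j + s * (c i * C i a)
   + (s * (\sum_j c j * C i j)) * (i == a)%:R + (s ^+ 2 * C i a) * (i == a)%:R)).
  apply: eq_bigr => i _; rewrite -(sumD (fun j => s * (c i * C i j))).
  rewrite -(sumD (fun j => s ^+ 2 * C i j)) [_ * \sum_j _]mulr_sumr !mulr_suml.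
  rewrite -!big_split/=; apply: eq_bigr => j _.
  case: (j == a) (i == a) => -[]/=; ring.
rewrite !big_split/= !sumD -mulr_sumr; congr (_ + _); rewrite -addrA; congr (_ + _).
have -> : \sum_i c i * C i a = \sum_b C a b * c b.
  by apply: eq_bigr => i _; rewrite Csym mulrC.
have -> : \sum_i c i * C a i = \sum_b C a b * c b.
  by apply: eq_bigr => i _; rewrite mulrC.
ring.
Qed.

(** Compares the coefficients of s on both sides of [E_pow], taken at the form [c] shifted by s in
    the direction a. The remaining term, with one factor [Xi a] and a lower power, is given by the
    induction hypothesis. *)
Lemma wick_powform a c m : E (Xi a * linear_form c ^+ m) =
  m%:R * (\sum_b C a b * c b) * E (linear_form c ^+ m.-1).
Proof.
set v := \sum_b _.
elim/ltn_ind: m => -[|m] IH.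
  rewrite !mul0r expr0 mulr1 -(E_odd (fun i => (i == a)%:R)); congr (E _).
  rewrite /linear_form (bigD1 a)//= eqxx scale1r big1 ?addr0// => i /negbTE ->.
  by rewrite scale0r.
have := linear_formDX c.
set P := fun n => \poly_(i < n.+1)
  (E (1 * linear_form c ^+ (n - i) * Xi a ^+ i) *+ 'C(n, i)).
move=> LD.
have : P m.+2 = (m.+1%:R *: ((quadratic_form c)%:P + (2 * v)%:P * 'X + (C a a)%:P * 'X ^+ 2)) * P m.
  apply: poly_eq_horner => s; rewrite hornerM hornerZ !hornerE.
  rewrite !horner_linear_power !mul1r LD E_pow quadratic_formDX -/v.
  by congr (_ * _ * _); rewrite /=; ring.
move=> /(congr1 (fun p : {poly R} => p`_1)).
rewrite -scalerAl coefZ coefM !big_ord_recl big_ord0/=.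
rewrite !coefD !coefCM !coefXn !coefX !coefC/= !coef_poly/= !subn0 !subn1 !bin0 !bin1/=.
rewrite !mulr0 !addr0 !add0r.
set x := mpolyX R _; rewrite (expr0 (x : poly)) (expr1 (x : poly)) !mul1r !mulr1 mulr1n.
set L := linear_form c.
have {}IH : (if (1 < m.+1)%N then E (L ^+ m.-1 * x) *+ m else 0) * quadratic_form c =
    m%:R * v * E (L ^+ m).
  case: m IH => [|m] IH; first by rewrite !mul0r.
  rewrite /= mulrC [_ * x]mulrC IH// -mulr_natl; case: m {IH} => [|m]/=.
    by rewrite !mul0r !mulr0 expr1 /L E_odd mulr0.
  rewrite /L E_pow; ring.
rewrite [_ * (if _ then _ else _)]mulrC {}IH [L ^+ _ * _]mulrC => h.
apply: (@mulfI _ m.+2%:R); first by rewrite pnatr_eq0.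
rewrite mulr_natl h -[m.+2%:R]nat1r -[m.+1%:R]nat1r; ring.
Qed.

Definition creation (a : 'I_k) (p : poly) : poly := Xi a * p - cov_deriv a p.

Lemma creation_is_linear a : linear (creation a).
Proof.
by move=> r p q; rewrite /creation linearP mulrDr -scalerAr scalerBr opprD addrACA.
Qed.
HB.instance Definition _ a := GRing.isLinear.Build R poly poly _ (creation a)
  (creation_is_linear a).

Let Lambda a (p : poly) := E (creation a p).
Let Lambda_is_linear a : linear_for *%R (Lambda a).
Proof. by move=> r p q; rewrite /Lambda !linearP. Qed.
HB.instance Definition _ a := GRing.isLinear.Build R poly R _ (Lambda a)
  (Lambda_is_linear a).

(* Integration by parts holds for powers of linear forms; a product of linear
   forms is reached by taking coefficients of [s] in powers of [L + s X]. *)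
Lemma gaussian_ibp a p : E (Xi a * p) = E (cov_deriv a p).
Proof.
apply/eqP; rewrite -subr_eq0 -linearB/= -[X in X == 0]/(Lambda a p); apply/eqP.
have prod0 (s : seq 'I_k) c m : Lambda a (\prod_(b <- s) Xi b * linear_form c ^+ m) = 0.
  elim: s c m => [|b s IH] c m.
    rewrite big_nil mul1r /Lambda /creation linearB/= wick_powform cov_deriv_powform.
    by rewrite linearZ/= subrr.
  rewrite big_cons -mulrA mulrC.
  by apply: (linear_power_eq0 (E := Lambda a)) => r; rewrite linear_formDX; exact: IH.
rewrite [p]mpolyE linear_sum big1// => m _; rewrite linearZ/=.
suff -> : mpolyX R m = \prod_(b <- flatten [seq nseq (m i) i | i <- enum 'I_k]) Xi b *
    linear_form (fun=> 0) ^+ 0 by rewrite prod0 mulr0.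
rewrite expr0 mulr1 mpolyXE_id big_flatten big_map big_enum/=; apply: eq_bigr => i _.
by rewrite big_nseq -Monoid.iteropE.
Qed.

(** The Wick product of the variables [tau], built by creation operators. It is a Hermite polynomial
    when [tau] is constant and the plain product when the variables are orthogonal, the two cases
    used later. *)
Fixpoint wick_poly_mono (n : nat) : ('I_n -> 'I_k) -> poly :=
  match n with
  | 0 => fun _ => 1
  | n'.+1 => fun tau => creation (tau ord0) (wick_poly_mono (fun i => tau (lift ord0 i)))
  end.

Lemma eq_wick_poly_mono n (tau tau' : 'I_n -> 'I_k) : tau =1 tau' ->
  wick_poly_mono tau = wick_poly_mono tau'.
Proof. by move=> /funext ->. Qed.

Lemma creation_adjoint a p q : E (creation a p * q) = E (p * cov_deriv a q).
Proof.
by rewrite /creation mulrBl linearB/= -mulrA gaussian_ibp cov_derivM linearD/= addrC addKr.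
Qed.

Context {I : finType}.
Variable A : 'I_k -> I -> R.
Hypothesis CA : forall a b, C a b = \sum_i A a i * A b i.

(** With C = A A^T the variable a is the sum of the [A a i] g_i for independent standard normals
    g_i, and this is the derivative in g_i. The chaos relation contracts gradients without weights,
    hence asks for such orthonormal directions. *)
Definition cov_direction (i : I) (p : poly) : poly := \sum_a A a i *: mderiv a p.

Lemma cov_direction_is_linear i : linear (cov_direction i).
Proof.
move=> r p q; rewrite /cov_direction scaler_sumr -big_split; apply: eq_bigr => b _.
by rewrite linearP scalerDr !scalerA mulrC.
Qed.
HB.instance Definition _ i := GRing.isLinear.Build R poly poly _ (cov_direction i)
  (cov_direction_is_linear i).

Lemma cov_directionM i p q :
  cov_direction i (p * q) = cov_direction i p * q + p * cov_direction i q.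
Proof.
rewrite /cov_direction mulr_suml mulr_sumr -big_split; apply: eq_bigr => b _.
by rewrite mderivM scalerDr scalerAl scalerAr.
Qed.

Lemma cov_directionX i a : cov_direction i (Xi a) = (A a i)%:A.
Proof.
rewrite /cov_direction (bigD1 a)//= mderivX big1 => [|b ib].
  rewrite addr0 mnm1E eqxx scale1r; congr (_ *: _).
  by rewrite -[RHS]mpolyX0; congr mpolyX; apply/mnmP => j; rewrite mnmBE mnm0E subnn.
by rewrite mderivX mnm1E eq_sym (negbTE ib) scale0r scaler0.
Qed.

Lemma cov_directionC i j p :
  cov_direction i (cov_direction j p) = cov_direction j (cov_direction i p).
Proof.
have expand i' j' : cov_direction i' (cov_direction j' p) =
    \sum_b \sum_a (A b j' * A a i') *: mderiv a (mderiv b p).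
  rewrite {2}/cov_direction linear_sum; apply: eq_bigr => b _.
  by rewrite linearZ/= scaler_sumr; apply: eq_bigr => a _; rewrite scalerA.
rewrite !expand exchange_big/=; apply: eq_bigr => a _; apply: eq_bigr => b _.
by rewrite mulrC mderiv_comm.
Qed.

Lemma cov_derivE a p : cov_deriv a p = \sum_i A a i *: cov_direction i p.
Proof.
under eq_bigr do rewrite scaler_sumr; rewrite exchange_big/=; apply: eq_bigr => b _.
by rewrite CA scaler_suml; apply: eq_bigr => i _; rewrite scalerA.
Qed.

(** Canonical commutation relation between annihilation and creation. *)
Lemma cov_direction_creation i a p :
  cov_direction i (creation a p) = A a i *: p + creation a (cov_direction i p).
Proof.
rewrite /creation linearB/= cov_directionM cov_directionX mulr_algl -!addrA; congr (_ + (_ - _)).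
rewrite !cov_derivE linear_sum; apply: eq_bigr => j _.
by rewrite linearZ/= cov_directionC.
Qed.

Lemma cov_direction_wick i n (tau : 'I_n.+1 -> 'I_k) :
  cov_direction i (wick_poly_mono tau) =
  \sum_(j < n.+1) A (tau j) i *: wick_poly_mono (fun l => tau (lift j l)).
Proof.
elim: n tau => [|n IH] tau.
  rewrite big_ord1 [wick_poly_mono tau]/= cov_direction_creation/=.
  suff -> : cov_direction i 1 = 0 by rewrite linear0 addr0.
  apply/(addIr (cov_direction i 1)).
  by rewrite add0r -{3}(mulr1 1) cov_directionM mulr1 mul1r.
rewrite big_ord_recl [wick_poly_mono tau]/= cov_direction_creation.
congr (_ + _); rewrite -[creation _ (wick_poly_mono _)]/(wick_poly_mono (fun l => tau (lift ord0 l))).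
rewrite IH linear_sum; apply: eq_bigr => j _; rewrite linearZ/=; congr (_ *: _).
rewrite -[RHS]/(creation (tau (lift (lift ord0 j) ord0))
  (wick_poly_mono (fun l => tau (lift (lift ord0 j) (lift ord0 l))))).
congr (creation (tau _) _); first exact: val_inj.
by apply: eq_wick_poly_mono => l; congr tau; apply: val_inj; rewrite /= /bump; lia.
Qed.

Lemma expectation_direction_wick i n (tau : 'I_n.+1 -> 'I_k) G :
  E (cov_direction i (wick_poly_mono tau) * G) =
  \sum_(j < n.+1) A (tau j) i * E (wick_poly_mono (fun l => tau (lift j l)) * G).
Proof.
rewrite cov_direction_wick mulr_suml linear_sum.
by apply: eq_bigr => j _; rewrite -scalerAl linearZ/=.
Qed.

(** The count n + 1 splits as 1 + n. Differentiating the variable created last gives, by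
    adjointness, the term of weight 1; the other slots give weight n through the induction
    hypothesis tested against the derivatives of [G], because derivatives in different directions
    commute. *)
Lemma wick_chaos n (tau : 'I_n -> 'I_k) :
  chaos E cov_direction n (wick_poly_mono tau).
Proof.
elim: n tau => [|n IH] tau; first by exists 1; rewrite scale1r.
split=> [G|i]; last first.
  apply: (eq_ind_r (chaos E (fun i0 => cov_direction i0) n) _ (cov_direction_wick i tau)).
  by apply: chaos_sum => j; apply: chaosZ; exact: IH.
rewrite -nat1r mulrDl mul1r.
transitivity (\sum_i E ((\sum_(j < n.+1) A (tau j) i *:
    wick_poly_mono (fun l => tau (lift j l))) * cov_direction i G)); last first.
  by apply: eq_bigr => i _; rewrite -cov_direction_wick.
under eq_bigr do rewrite big_ord_recl mulrDl linearD/=.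
rewrite big_split/=; congr (_ + _).
  rewrite creation_adjoint cov_derivE mulr_sumr linear_sum; apply: eq_bigr => i _.
  by rewrite -scalerAr -scalerAl.
rewrite creation_adjoint cov_derivE mulr_sumr linear_sum mulr_sumr.
case: n tau IH => [|n] tau IH.
  rewrite big1; last by move=> i _; rewrite mul0r.
  by rewrite big1// => i _; rewrite big_ord0 mul0r linear0.
have [h _] := IH (fun i => tau (lift ord0 i)).
transitivity (\sum_i \sum_(j < n.+1) A (tau (lift ord0 j)) i *
    E (wick_poly_mono (fun l => tau (lift (lift ord0 j) l)) * cov_direction i G)); last first.
  apply: eq_bigr => i _; rewrite mulr_suml linear_sum; apply: eq_bigr => j _.
  by rewrite -scalerAl linearZ.
transitivity (\sum_(i : I) A (tau ord0) i * \sum_i' \sum_(j < n.+1) A (tau (lift ord0 j)) i' *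
   E (wick_poly_mono (fun l => tau (lift ord0 (lift j l))) * cov_direction i (cov_direction i' G))).
  apply: eq_bigr => i _; rewrite -scalerAr linearZ/= mulrCA h; congr (_ * _).
  apply: eq_bigr => i' _; apply: (etrans (expectation_direction_wick _ _ _)).
  by apply: eq_bigr => j _; rewrite -cov_directionC.
under eq_bigr do rewrite mulr_sumr.
rewrite exchange_big/=; apply: eq_bigr => i' _.
under eq_bigr do rewrite mulr_sumr.
rewrite exchange_big/=; apply: eq_bigr => j _.
under eq_bigr do rewrite mulrCA; rewrite -mulr_sumr; congr (_ * _).
transitivity (E (creation (tau ord0) (wick_poly_mono (fun l => tau (lift ord0 (lift j l)))) *
  cov_direction i' G)); last first.
  congr (E (creation (tau _) _ * _)); first exact: val_inj.
  by apply: eq_wick_poly_mono => l; congr tau; apply: val_inj; rewrite /= /bump; lia.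
rewrite creation_adjoint cov_derivE mulr_sumr linear_sum; apply: eq_bigr => i _.
by rewrite -scalerAr linearZ.
Qed.

Lemma cov_deriv1 a : cov_deriv a 1 = 0.
Proof.
apply/(addIr (cov_deriv a 1)).
by rewrite add0r -{3}(mulr1 1) cov_derivM mulr1 mul1r.
Qed.

Lemma wick_orthogonal n (tau : 'I_n -> 'I_k) :
  (forall i j, i != j -> C (tau i) (tau j) = 0) ->
  wick_poly_mono tau = \prod_i Xi (tau i).
Proof.
elim: n tau => [|n IH] tau orth; first by rewrite big_ord0.
rewrite big_ord_recl [LHS]/= IH => [|i j ij]; last by rewrite orth// (inj_eq lift_inj).
rewrite /creation; suff -> : cov_deriv (tau ord0) (\prod_i Xi (tau (lift ord0 i))) = 0.
  by rewrite subr0.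
have : forall i : 'I_n, C (tau ord0) (tau (lift ord0 i)) = 0 by move=> i; exact: orth.
elim/big_ind: _ => [|p q hp hq h|i _ h]; first by rewrite cov_deriv1.
  by rewrite cov_derivM hp// hq// mul0r mulr0 addr0.
by rewrite cov_derivX h scale0r.
Qed.

Lemma wick_const1 a : wick_poly_mono (fun _ : 'I_1 => a) = Xi a.
Proof. by rewrite /= /creation cov_deriv1 subr0 mulr1. Qed.

Lemma wick_const2 a : wick_poly_mono (fun _ : 'I_2 => a) = Xi a ^+ 2 - (C a a)%:A.
Proof.
rewrite -[LHS]/(creation a (wick_poly_mono (fun _ : 'I_1 => a))) wick_const1.
by rewrite /creation cov_derivX.
Qed.

Lemma wick_const3 a : wick_poly_mono (fun _ : 'I_3 => a) = Xi a ^+ 3 - (3 * C a a) *: Xi a.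
Proof.
rewrite -[LHS]/(creation a (wick_poly_mono (fun _ : 'I_2 => a))) wick_const2.
have c2 : cov_deriv a (Xi a * Xi a - (C a a)%:A) = (C a a)%:A * Xi a + Xi a * (C a a)%:A.
  rewrite linearB/= linearZ/= -[GRing.Linear.sort _ 1]/(cov_deriv a 1) cov_deriv1 scaler0 subr0.
  by apply: etrans (cov_derivM _ _ _) _; rewrite cov_derivX.
rewrite /creation expr2 c2.
rewrite mulr_algl mulr_algr mulrBr mulr_algr -expr2 -exprS -addrA -opprD.
by congr (_ - _); rewrite -!scalerDl; congr (_ *: _); ring.
Qed.

Context {T : Type}.
Variable ev : T -> 'I_k -> R.
Hypothesis E1 : E 1 = 1.
Hypothesis E_le : forall p q : poly, (forall w, meval (ev w) p <= meval (ev w) q) -> E p <= E q.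

(** The exact value is a sum over permutations. The chaos relation, followed by Cauchy-Schwarz over
    the [n.+1] slots of the derivative, bounds it by n! times the unpermuted term, so that kernels
    never have to be symmetrized. *)
Lemma wick_second_moment n (V : Type) (s : seq V) (c : V -> R) (tau : V -> 'I_n -> 'I_k) :
  E ((\sum_(v <- s) c v *: wick_poly_mono (tau v)) ^+ 2) <=
  n`!%:R * \sum_(v <- s) \sum_(w <- s) c v * c w * \prod_i C (tau v i) (tau w i).
Proof.
elim: n c tau => [|n IH] c tau.
  rewrite fact0 mul1r -scaler_suml exprZn expr1n linearZ/= E1 mulr1 expr2 mulr_suml.
  apply: ler_of_eq; apply: eq_bigr => v _.
  by rewrite mulr_sumr; apply: eq_bigr => w _; rewrite big_ord0 mulr1.
set F : poly := \sum_(v <- s) c v *: _.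
have [FG _] : chaos E (fun i => cov_direction i) n.+1 F.
  by apply: chaos_sum => v; apply: chaosZ; exact: wick_chaos.
pose G i j := \sum_(v <- s) (c v * A (tau v j) i) *: wick_poly_mono (fun l => tau v (lift j l)).
have FGij i : cov_direction i F = \sum_(j < n.+1) G i j.
  rewrite /G exchange_big linear_sum; apply: eq_bigr => v _.
  rewrite linearZ/=; apply: etrans (congr1 (GRing.scale (c v)) (cov_direction_wick i (tau v))) _.
  by rewrite scaler_sumr; apply: eq_bigr => j _; rewrite scalerA.
rewrite -(ler_pM2l (ltr0Sn R n)) expr2 FG.
apply: (@le_trans _ _ (\sum_i \sum_(j < n.+1) n.+1%:R * E (G i j ^+ 2))).
  apply: ler_sum => i _.
  apply: (@le_trans _ _ (E ((\sum_(j < n.+1) G i j) * (\sum_(j < n.+1) G i j)))).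
    by rewrite -FGij.
  rewrite -mulr_sumr -linear_sum -linearZ/=; apply: E_le => w.
  have evZ r (p : poly) : meval (ev w) (r *: p) = r * meval (ev w) p by rewrite mevalZ.
  rewrite evZ !rmorphM/= !rmorph_sum/= -expr2.
  apply: le_trans (sqr_sum_le _) _; apply: ler_of_eq.
  by congr (_ * _); apply: eq_bigr => j _; rewrite rmorphXn.
rewrite exchange_big/=.
apply: (@le_trans _ _ (\sum_(j < n.+1) n.+1%:R * (n`!%:R * \sum_(v <- s) \sum_(w <- s)
    c v * c w * \prod_i C (tau v i) (tau w i)))).
  apply: ler_sum => j _; rewrite -mulr_sumr ler_wpM2l//.
  apply: le_trans.
    by apply: ler_sum => i _; apply: IH.
  rewrite -mulr_sumr ler_wpM2l// exchange_big/= le_eqVlt; apply/orP; left; apply/eqP.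
  apply: eq_bigr => v _; rewrite exchange_big/=; apply: eq_bigr => w _.
  rewrite (bigD1_ord j)//= CA mulrA [c v * c w * _]mulr_sumr mulr_suml.
  by apply: eq_bigr => i _; ring.
rewrite sumr_const card_ord -mulr_natl factS natrM; lra.
Qed.

Lemma wick_hypercontractive n (V : Type) (s : seq V) (c : V -> R) (tau : V -> 'I_n -> 'I_k) q :
  E ((\sum_(v <- s) c v *: wick_poly_mono (tau v)) ^+ 2 ^+ q.+1) <=
  ((q.*2.+1)%:R ^+ n) ^+ q.+1 *
  E ((\sum_(v <- s) c v *: wick_poly_mono (tau v)) ^+ 2) ^+ q.+1.
Proof.
set F : poly := \sum_(v <- s) c v *: _.
have := @chaos_hypercontractive R _ I T E (fun i => cov_direction i)
  (fun w => meval (ev w)) E1 E_le cov_directionM (fun w r p => mevalZ _ _ _)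
  n unit (fun _ => F) q.
rewrite !big_const card_unit/= addr0; apply=> _.
by apply: chaos_sum => v; apply: chaosZ; exact: wick_chaos.
Qed.
End GaussianFunctional.

(** * Moments of the centered normal law *)

Section GaussianMoments.
Context {R : realType}.
Local Notation mu := (@lebesgue_measure R).

Lemma ge0_integral_normal_prob (m s : R) (f : measurableTypeR R -> \bar R) :
  (forall x, (0 <= f x)%E) -> measurable_fun setT f ->
  (\int[normal_prob m s]_x f x = \int[mu]_x (f x * (normal_pdf m s x)%:E))%E.
Proof.
move=> f0 mf; have dom := @normal_prob_dominates R m s.
rewrite -(Radon_Nikodym_SigmaFinite.change_of_variables dom f0 measurableT mf).
have intf := Radon_Nikodym_SigmaFinite.f_integrable dom.
apply: ae_eq_integral => //.
- by apply: emeasurable_funM => //; exact: measurable_int intf.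
- apply: emeasurable_funM => //; apply/measurable_EFinP; exact: measurable_normal_pdf.
apply: ae_eqe_mul2l; apply: integral_ae_eq => //.
- by apply/measurable_EFinP; exact: measurable_normal_pdf.
- by move=> A _ mA; rewrite -Radon_Nikodym_SigmaFinite.f_integral.
Qed.

Lemma is_derive_normal_pdf (s x : R) : s != 0 ->
  is_derive x 1 (normal_pdf 0 s) (- (x / s ^+ 2) * normal_pdf 0 s x).
Proof.
move=> s0; rewrite normal_pdfE//.
rewrite (_ : (fun x0 : R => _) = (fun y => normal_peak s * expR (- y ^+ 2 / (s ^+ 2 *+ 2)))); last first.
  by apply/funext => y; rewrite /normal_fun subr0.
apply: is_derive_eq.
rewrite /normal_fun subr0 /GRing.scale/=.
set e := expR _; field.
by rewrite s0.
Qed.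

Lemma continuous_normal_pdf0 (s : R) : s != 0 -> continuous (normal_pdf 0 s).
Proof.
by move=> s0 x; apply/differentiable_continuous/derivable1_diffP; have [] := is_derive_normal_pdf x s0.
Qed.

Lemma normal_pdf_decay (s : R) m : s != 0 ->
  (n%:R ^+ m * normal_pdf 0 s n%:R) @[n --> \oo] --> (0 : R).
Proof.
move=> s0.
(* Origin of the constant: only the term of degree [m.+1] of the exponential series at n^2 / (2 s^2)
   is kept. *)
pose c := normal_peak s * ((s ^+ 2 *+ 2) ^+ m.+1 * m.+1`!%:R).
have s2 : 0 < s ^+ 2 *+ 2 by rewrite pmulrn_lgt0// exprn_even_gt0.
have c0 : 0 <= c by rewrite mulr_ge0 ?normal_peak_ge0// mulr_ge0// exprn_ge0// ltW.
apply/cvgr0Pnorm_lt => e e0.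
near=> n.
have n0 : (0 < n)%N by near: n; exists 1%N.
have nR : 0 < n%:R :> R by rewrite ltr0n.
rewrite ger0_norm ?mulr_ge0 ?exprn_ge0 ?normal_pdf_ge0//.
apply: (@le_lt_trans _ _ (c / n%:R)); last first.
  rewrite ltr_pdivrMr// mulrC -ltr_pdivrMr//; near: n; exact: nbhs_infty_gtr.
rewrite normal_pdfE// /normal_fun subr0 mulrCA -mulrA ler_wpM2l ?normal_peak_ge0//.
have x0 : 0 <= n%:R ^+ 2 / (s ^+ 2 *+ 2) :> R by rewrite divr_ge0 ?sqr_ge0 ?ltW.
have := expR_ge1Dxn m x0; rewrite mulNr expRN => h.
have {}h : (n%:R ^+ 2 / (s ^+ 2 *+ 2)) ^+ m.+1 / (m.+1)`!%:R <= expR (n%:R ^+ 2 / (s ^+ 2 *+ 2)).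
  by apply: le_trans h; rewrite ler_wpDl.
rewrite ler_pdivrMr ?expR_gt0//.
apply: le_trans (ler_wpM2l _ h); last by rewrite divr_ge0// mulr_ge0 ?exprn_ge0// ltW.
rewrite expr_div_n -exprM mul2n -addnn exprD.
have -> : (s ^+ 2 *+ 2) ^+ m.+1 * (m.+1)`!%:R / n%:R *
  (n%:R ^+ m.+1 * n%:R ^+ m.+1 / (s ^+ 2 *+ 2) ^+ m.+1 / (m.+1)`!%:R) =
  n%:R ^+ m * n%:R ^+ m.+1.
  set d := (s ^+ 2 *+ 2) ^+ m.+1; set f := (m.+1)`!%:R : R.
  have d0 : d != 0 by rewrite expf_neq0// gt_eqF.
  have f0 : f != 0 by rewrite pnatr_eq0 -lt0n fact_gt0.
  by rewrite !(exprS n%:R); field; rewrite d0 f0 gt_eqF.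
by rewrite ler_peMr ?exprn_ge0// exprn_ege1// ler1n.
Unshelve. all: by end_near. Qed.

(** Integration by parts on [0, n], with x phi(x) the derivative of - s^2 phi. Working on the half
    line keeps the integrands nonnegative, so monotone convergence removes the cutoff n. *)
Lemma normal_moment_step (s : R) m : s != 0 ->
  (\int[mu]_(x in `[0%R, +oo[) (x ^+ m.+2 * normal_pdf 0 s x)%:E =
  (s ^+ 2 * m.+1%:R)%:E * \int[mu]_(x in `[0%R, +oo[) (x ^+ m * normal_pdf 0 s x)%:E)%E.
Proof.
move=> s0; set phi := normal_pdf 0 s.
have phi0 x : 0 <= phi x by exact: normal_pdf_ge0.
have cphi : continuous phi by exact: continuous_normal_pdf0.
have cX k : continuous (fun x : R => x ^+ k) by exact: exprn_continuous.
have cXphi k : continuous (fun x : R => x ^+ k * phi x).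
  by move=> x; apply: cvgM; [exact: cX|exact: cphi].
have mXphi k : measurable_fun [set: R] (fun x : R => x ^+ k * phi x).
  exact: continuous_measurable_fun.
have cvgk k : (\int[mu]_(x in `[0%R, n%:R]) (x ^+ k * phi x)%:E @[n --> \oo] -->
    \int[mu]_(x in `[0%R, +oo[) (x ^+ k * phi x)%:E)%E.
  rewrite itv_bndy_bigcup_BRight.
  under eq_cvg do rewrite -[X in `[0%R, X]]add0r.
  apply: ge0_nondecreasing_set_cvg_integral.
  - apply/nondecreasing_seqP => n; apply/subsetPset; apply: subset_itvl.
    by rewrite bnd_simp lerD2l ler_nat.
  - by move=> i; exact: measurable_itv.
  - by move=> i; apply/measurable_EFinP/measurable_funTS; exact: mXphi.
  - move=> i x /=; rewrite in_itv/= => /andP[x0 _].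
    by rewrite lee_fin mulr_ge0// exprn_ge0.
have parts n : (0 < n)%N -> (\int[mu]_(x in `[0%R, n%:R]) (x ^+ m.+2 * phi x)%:E +
    (s ^+ 2 * (n%:R ^+ m.+1 * phi n%:R))%:E =
    (s ^+ 2 * m.+1%:R)%:E * \int[mu]_(x in `[0%R, n%:R]) (x ^+ m * phi x)%:E)%E.
  move=> n0.
  have dX (x : R) : is_derive x 1 (fun x : R => x ^+ m.+1) (m.+1%:R * x ^+ m).
    have h := @is_deriveX R R id m.+1 x 1 1 (is_derive_id x 1).
    rewrite (_ : (fun x : R => x ^+ m.+1) = id ^+ m.+1); last by apply/funext => y; rewrite exprfctE.
    by apply: (is_derive_eq h); rewrite /GRing.scale/= mulr1.
  have dG (x : R) : is_derive x 1 (fun x : R => - s ^+ 2 * phi x) (x * phi x).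
    have h := is_deriveZ (- s ^+ 2) (is_derive_normal_pdf x s0).
    apply: (is_derive_eq h); rewrite /GRing.scale/= -/(phi x); field.
    by rewrite s0.
  have cvgL (F : R -> R) : continuous F -> forall x, F y @[y --> x^'+] --> F x.
    by move=> cF x; apply: cvg_at_right_filter; exact: cF.
  have cvgR (F : R -> R) : continuous F -> forall x, F y @[y --> x^'-] --> F x.
    by move=> cF x; apply: cvg_at_left_filter; exact: cF.
  have cG : continuous (fun x : R => - s ^+ 2 * phi x).
    by move=> x; apply: cvgM; [exact: cvg_cst|exact: cphi].
  have := @integration_by_parts R (fun x => x ^+ m.+1) (fun x => - s ^+ 2 * phi x)
    (fun x => m.+1%:R * x ^+ m) (fun x => x * phi x) 0 n%:R.
  rewrite ltr0n n0 => /(_ isT).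
  have h1 : {within `[0, n%:R], continuous (fun x : R => m.+1%:R * x ^+ m)}.
    by apply: continuous_subspaceT => x; apply: cvgM; [exact: cvg_cst|exact: cX].
  have h2 : derivable_oo_LRcontinuous (fun x : R => x ^+ m.+1) 0 n%:R.
    by split; [move=> x _; have [] := dX x|exact: cvgL|exact: cvgR].
  have h3 : {in `]0, n%:R[, (fun x : R => x ^+ m.+1)^`()%classic =1 (fun x => m.+1%:R * x ^+ m)}.
    by move=> x _; rewrite derive1E; have [_ ->] := dX x.
  have h4 : {within `[0, n%:R], continuous (fun x : R => x * phi x)}.
    by apply: continuous_subspaceT => x; exact: (cXphi 1%N).
  have h5 : derivable_oo_LRcontinuous (fun x : R => - s ^+ 2 * phi x) 0 n%:R.
    by split; [move=> x _; have [] := dG x|exact: cvgL|exact: cvgR].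
  have h6 : {in `]0, n%:R[, (fun x : R => - s ^+ 2 * phi x)^`()%classic =1 (fun x => x * phi x)}.
    by move=> x _; rewrite derive1E; have [_ ->] := dG x.
  move=> /(_ h1 h2 h3 h4 h5 h6).
  under eq_integral do rewrite mulrA -exprSr.
  move=> ->; rewrite expr0n/= mul0r subr0.
  have -> : (\int[mu]_(x in `[0%R, n%:R]) (m.+1%:R * x ^+ m * (- s ^+ 2 * phi x))%:E =
    (- (s ^+ 2 * m.+1%:R))%:E * \int[mu]_(x in `[0%R, n%:R]) (x ^+ m * phi x)%:E)%E.
    rewrite -integralZl//; last first.
      apply: continuous_compact_integrable; first exact: segment_compact.
      exact: continuous_subspaceT.
    by apply: eq_integral => x _; rewrite -EFinM; congr EFin; ring.
  rewrite EFinN mulNe oppeK addeAC -EFinD.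
  have -> : n%:R ^+ m.+1 * (- s ^+ 2 * phi n%:R) + s ^+ 2 * (n%:R ^+ m.+1 * phi n%:R) = 0 by ring.
  by rewrite add0e.
apply: (@cvg_unique _ (@ereal_hausdorff R) ((fun n => \int[mu]_(x in `[0%R, n%:R]) (x ^+ m.+2 * phi x)%:E +
    (s ^+ 2 * (n%:R ^+ m.+1 * phi n%:R))%:E)%E @ \oo)).
  rewrite /= -[X in _ --> X]adde0; apply: cvgeD; first exact: fin_num_adde_defl.
    exact: cvgk.
  apply: cvg_EFin; first by apply: nearW.
  rewrite -[X in _ --> X](mulr0 (s ^+ 2)); apply: cvgM; first exact: cvg_cst.
  exact: normal_pdf_decay.
apply: (@cvg_trans _ ((fun n => (s ^+ 2 * m.+1%:R)%:E * \int[mu]_(x in `[0%R, n%:R]) (x ^+ m * phi x)%:E)%E @ \oo)).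
  by apply: near_eq_cvg; exists 1%N => // n /= n0; rewrite parts.
by apply: cvgeZl => //; exact: cvgk.
Qed.
End GaussianMoments.

(** * Random variables with moments of all orders *)

Section FiniteMoments.
Context {R : realType} {d : measure_display} {T : measurableType d} (P : probability T R).

Definition finite_moments (X : T -> R) : Prop :=
  measurable_fun [set: T] X /\ forall m, P.-integrable [set: T] (EFin \o (fun w => X w ^+ m)).

Lemma finite_moments_integrable X : finite_moments X -> P.-integrable [set: T] (EFin \o X).
Proof. by move=> [_ /(_ 1%N)]; under eq_fun do rewrite expr1. Qed.

Lemma finite_moments_even (X : T -> R) : measurable_fun [set: T] X ->
  (forall k, (\int[P]_w (X w ^+ k.*2)%:E < +oo)%E) -> finite_moments X.
Proof.
move=> mX Xk; split=> // m.
have mXm k : measurable_fun [set: T] (fun w => X w ^+ k) by exact: measurable_funX.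
have Xe k : P.-integrable [set: T] (EFin \o (fun w => X w ^+ k.*2)).
  apply/integrableP; split; first exact/measurable_EFinP.
  apply: le_lt_trans (Xk k); rewrite le_eqVlt; apply/orP; left; apply/eqP.
  by apply: eq_integral => w _ /=; rewrite ger0_norm// -muln2 exprM sqr_ge0.
apply: (@le_integrable _ _ _ _ _ _ _ (EFin \o (fun w => 1 + X w ^+ m.*2))) => //.
- exact/measurable_EFinP.
- move=> w _ /=; rewrite lee_fin normrX.
  rewrite [X in _ <= X]ger0_norm; last by rewrite addr_ge0// -muln2 exprM sqr_ge0.
  rewrite -muln2 exprM -normrX -[in leRHS](real_normK (num_real (X w ^+ m))) normrX.
  have := sqr_ge0 (`|X w| ^+ m - 2^-1); nra.
- have h := integrableD measurableT (finite_measure_integrable_cst P 1 measurableT) (Xe m).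
  by apply: eq_integrable h => // w _ /=; rewrite EFinD.
Qed.

Lemma finite_moments_cst c : finite_moments (cst c).
Proof. by split=> // m; exact: (finite_measure_integrable_cst P (c ^+ m) measurableT). Qed.

(** Common criterion for sums and products: each even power of [Z] is dominated by powers of twice
    that order of [X] and [Y]. *)
Lemma le_finite_moments (X Y Z : T -> R) : measurable_fun [set: T] Z -> finite_moments X -> finite_moments Y ->
  (forall k, exists C, forall w, Z w ^+ k.*2 <= C * (X w ^+ k.*2.*2 + Y w ^+ k.*2.*2 + 1)) ->
  finite_moments Z.
Proof.
move=> mZ Xm Ym h; apply: finite_moments_even => // k.
have [C hC] := h k; have [[mX iX] [mY iY]] := (Xm, Ym).
have Zi : P.-integrable [set: T] (fun w => C%:E * ((X w ^+ k.*2.*2)%:E + (Y w ^+ k.*2.*2)%:E + 1))%E.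
  apply: integrableZl => //; apply: integrableD => //; last exact: finite_measure_integrable_cst.
  by apply: integrableD => //; [exact: iX|exact: iY].
have mZk : measurable_fun [set: T] (EFin \o (fun w => Z w ^+ k.*2)).
  by apply/measurable_EFinP; exact: measurable_funX.
have : P.-integrable [set: T] (EFin \o (fun w => Z w ^+ k.*2)).
  apply: le_integrable Zi => // w _ /=; rewrite lee_fin.
  rewrite ger0_norm; last by rewrite -muln2 exprM sqr_ge0.
  exact: le_trans (hC w) (ler_norm _).
move=> /integrableP[_]; apply: le_lt_trans; apply: le_trans (lee_abs _) _.
exact: le_abse_integral.
Qed.

Lemma finite_momentsM X Y : finite_moments X -> finite_moments Y ->
  finite_moments (fun w => X w * Y w).
Proof.
move=> Xm Ym; apply: (le_finite_moments _ Xm Ym).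
  by apply: measurable_funM; [case: Xm|case: Ym].
move=> k; exists 1 => w; rewrite mul1r exprMn -[X in X ^+ k.*2.*2]/(X w) -[k.*2.*2]muln2 !exprM.
by have := sqr_ge0 (X w ^+ k.*2 - Y w ^+ k.*2); nra.
Qed.

Lemma finite_momentsD X Y : finite_moments X -> finite_moments Y ->
  finite_moments (fun w => X w + Y w).
Proof.
move=> Xm Ym; apply: (le_finite_moments _ Xm Ym).
  by apply: measurable_funD; [case: Xm|case: Ym].
move=> k; exists (2 ^+ k.*2 * 2) => w.
have h (x : R) : (x ^+ k.*2) <= x ^+ k.*2.*2 + 1.
  by rewrite -[k.*2.*2]muln2 exprM; have := sqr_ge0 (x ^+ k.*2 - 2^-1); nra.
have e (x : R) : 0 <= x ^+ k.*2 by rewrite -muln2 exprM sqr_ge0.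
have e2 (x : R) : 0 <= x ^+ k.*2.*2 by rewrite -muln2 exprM sqr_ge0.
have xn (x : R) : x ^+ k.*2 = `|x| ^+ k.*2.
  by rewrite -mul2n !exprM real_normK ?num_real.
apply: (@le_trans _ _ (2 ^+ k.*2 * (X w ^+ k.*2 + Y w ^+ k.*2))).
  have le x y : `|x| <= `|y| -> (x + y) ^+ k.*2 <= 2 ^+ k.*2 * (y ^+ k.*2 : R).
    move=> xy; rewrite -exprMn (xn (x + y)) (xn (_ * y)) lerXn2r ?nnegrE ?normr_ge0//.
    rewrite normrM ger0_norm//; apply: le_trans (ler_normD _ _) _; lra.
  have [/le xy|/ltW/le yx] := leP `|X w| `|Y w|.
    by apply: le_trans xy _; rewrite ler_wpM2l ?exprn_ge0// ler_wpDl.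
  by rewrite addrC; apply: le_trans yx _; rewrite ler_wpM2l ?exprn_ge0// ler_wpDr.
rewrite -mulrA ler_wpM2l ?exprn_ge0//.
have := h (X w); have := h (Y w); have := e2 (X w); have := e2 (Y w); lra.
Qed.

Lemma finite_momentsX X k : finite_moments X -> finite_moments (fun w => X w ^+ k).
Proof.
move=> Xm; elim: k => [|k IH].
  by under eq_fun do rewrite expr0; exact: finite_moments_cst.
by under eq_fun do rewrite exprS; exact: finite_momentsM.
Qed.

Lemma finite_moments_sum (I : Type) (s : seq I) (X : I -> T -> R) :
  (forall i, finite_moments (X i)) -> finite_moments (fun w => \sum_(i <- s) X i w).
Proof.
move=> Xm; elim: s => [|i s IH].
  by under eq_fun do rewrite big_nil; exact: finite_moments_cst.
by under eq_fun do rewrite big_cons; exact: finite_momentsD.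
Qed.

Lemma finite_moments_prod (I : Type) (s : seq I) (X : I -> T -> R) :
  (forall i, finite_moments (X i)) -> finite_moments (fun w => \prod_(i <- s) X i w).
Proof.
move=> Xm; elim: s => [|i s IH].
  by under eq_fun do rewrite big_nil; exact: finite_moments_cst.
by under eq_fun do rewrite big_cons; exact: finite_momentsM.
Qed.
End FiniteMoments.

(** Cholesky factorization by induction on the size, through the Schur complement of the first
    diagonal entry. A zero pivot forces the rest of its row to vanish, so singular matrices are
    covered. *)
Lemma psd_factor (R : rcfType) n (C : 'M[R]_n) : C^T = C ->
  (forall v : 'rV[R]_n, 0 <= (v *m C *m v^T) 0 0) -> exists A : 'M[R]_n, C = A *m A^T.
Proof.
elim: n C => [|n IH] C.
  by move=> _ _; exists 0; apply/matrixP => -[].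
rewrite -[C](@submxK _ 1 n 1 n).
set c := ulsubmx _; set u := ursubmx _; set u' := dlsubmx _; set D := drsubmx _.
rewrite (@tr_block_mx _ 1 n 1 n) => /(@eq_block_mx _ 1 n 1 n)[_ u'E _ DE] psd.
have {}u'E : u' = u^T by rewrite -u'E trmxK.
rewrite {}u'E in psd *; clear u'; clearbody c u D.
have form (t : R) (v : 'rV[R]_n) :
    0 <= t ^+ 2 * c 0 0 + 2 * t * (u *m v^T) 0 0 + (v *m D *m v^T) 0 0.
  have := psd (row_mx t%:M v).
  rewrite (@tr_row_mx _ 1 1 n) (@mul_row_block _ 1 1 n 1 n) (@mul_row_col _ 1 1 n 1).
  rewrite !mulmxDl tr_scalar_mx !mul_mx_scalar !mul_scalar_mx -!scalemxAl !scalerA.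
  have -> : v *m u^T = u *m v^T.
    by rewrite [LHS]mx11_scalar -tr_scalar_mx -mx11_scalar trmx_mul trmxK.
  set a := u *m v^T; set b := v *m D *m v^T.
  by move: a b (c) => a b c'; rewrite !mxE => h; lra.
have c0 : 0 <= c 0 0.
  by have := form 1 0; rewrite trmx0 mulmx0 !mul0mx !mxE mulr0 !addr0 expr1n mul1r.
have cE : c = (c 0 0)%:M by rewrite [LHS]mx11_scalar.
have [c00|cn0] := eqVneq (c 0 0) 0.
  have u0 : u = 0.
    apply/rowP => i; rewrite mxE; apply/eqP/negPn/negP => ui.
    (* With a zero pivot the form is affine in the first coordinate; at this value it equals -1. *)
    have := form (- (D i i + 1) / (2 * u 0 i)) (delta_mx 0 i).
    rewrite c00 mulr0 add0r trmx_delta -colE -rowE -colE !mxE.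
    have -> : 2 * (- (D i i + 1) / (2 * u 0 i)) * u 0 i = - (D i i + 1) by field.
    lra.
  have [A' DA] : exists A : 'M[R]_n, D = A *m A^T.
    apply: IH => // v; have := form 0 v.
    by rewrite expr0n mul0r mulr0 mul0r !add0r.
  exists (block_mx 0 0 0 A' : 'M[R]_(1 + n)).
  rewrite (@tr_block_mx _ 1 n 1 n) (@mulmx_block _ 1 n 1 n 1 n) !trmx0 !mulmx0 !mul0mx !add0r -DA.
  by rewrite u0 trmx0 cE c00 -scalemx1 scale0r.
have cp : 0 < c 0 0 by rewrite lt_def cn0.
have [A' DA] : exists A : 'M[R]_n, D - (c 0 0)^-1 *: (u^T *m u) = A *m A^T.
  apply: IH => [|v].
    by rewrite linearB linearZ/= trmx_mul trmxK DE.
  have := form (- (u *m v^T) 0 0 / c 0 0) v.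
  rewrite mulmxBr mulmxBl -scalemxAr -scalemxAl mulmxA.
  have -> : v *m u^T = ((u *m v^T) 0 0)%:M.
    by rewrite -tr_scalar_mx -mx11_scalar trmx_mul trmxK.
  rewrite mul_scalar_mx -scalemxAl.
  move: (u *m v^T) (v *m D *m v^T) => a b; rewrite !mxE => h; apply: le_trans h _.
  apply: ler_of_eq; field.
  by rewrite cn0.
have sc : Num.sqrt (c 0 0) ^+ 2 = c 0 0 by rewrite sqr_sqrtr.
have sc0 : Num.sqrt (c 0 0) != 0 by rewrite gt_eqF// sqrtr_gt0.
exists (block_mx (Num.sqrt (c 0 0))%:M 0 ((Num.sqrt (c 0 0))^-1 *: u^T) A' : 'M[R]_(1 + n)).
rewrite (@tr_block_mx _ 1 n 1 n) (@mulmx_block _ 1 n 1 n 1 n) !trmx0 !mulmx0 !mul0mx !addr0 -DA.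
rewrite tr_scalar_mx linearZ/= trmxK; congr (@block_mx _ 1 n 1 n _ _ _ _).
- by rewrite -scalar_mxM -expr2 sc -cE.
- by rewrite -scalemxAr mul_scalar_mx scalerA mulVf ?scale1r.
- by rewrite mul_mx_scalar scalerA mulfV ?scale1r.
- by rewrite -scalemxAr -scalemxAl scalerA -expr2 exprVn sc addrC subrK.
Qed.

(** * Moments of centered Gaussian variables *)

Section CenteredGaussian.
Context {R : realType} {d : measure_display} {T : measurableType d} (P : probability T R).
Local Notation mu := (@lebesgue_measure R).

Lemma Rintegral_probability_cst (c : R) : \int[P]_w c = c.
Proof. by rewrite /Rintegral integral_cst//= probability_setT mule1. Qed.

Lemma centered_gaussian_integral (X : T -> R) (s : R) (g : measurableTypeR R -> \bar R) :
  measurable_fun [set: T] (X : T -> measurableTypeR R) ->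
  (forall A : set (measurableTypeR R), measurable A ->
    P (X @^-1` A) = if s == 0 then dirac (0 : R) A else normal_prob 0 s A) ->
  (forall x, 0 <= g x)%E -> measurable_fun [set: measurableTypeR R] g ->
  (\int[P]_w g (X w) = if (s == 0)%R then g 0%R else
     \int[mu]_x (g x * (normal_pdf 0 s x)%:E))%E.
Proof.
move=> mX PX g0 mg.
transitivity (\int[pushforward P (X : T -> measurableTypeR R)]_x g x)%E.
  by rewrite ge0_integral_pushforward// preimage_setT.
case: (eqVneq s 0) PX => [_|s0] PX.
  rewrite (eq_measure_integral (dirac (0%R : measurableTypeR R))); last by move=> A mA _; exact: PX.
  by rewrite integral_dirac// diracT mul1e.
rewrite (eq_measure_integral (normal_prob 0 s)); last by move=> A mA _; exact: PX.
exact: ge0_integral_normal_prob.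
Qed.

Lemma normal_even_moment (s : R) k : s != 0 ->
  (\int[mu]_x ((x ^+ k.+1.*2)%:E * (normal_pdf 0 s x)%:E) =
  (s ^+ 2 * k.*2.+1%:R)%:E * \int[mu]_x ((x ^+ k.*2)%:E * (normal_pdf 0 s x)%:E))%E.
Proof.
move=> s0.
have half j : (\int[mu]_x ((x ^+ j.*2)%:E * (normal_pdf 0 s x)%:E) =
    2%:E * \int[mu]_(x in `[0%R, +oo[) (x ^+ j.*2 * normal_pdf 0 s x)%:E)%E.
  under eq_integral do rewrite -EFinM.
  rewrite set_itvcy; apply: (@ge0_symfun_integralT R (fun x => x ^+ j.*2 * normal_pdf 0 s x)).
  - by move=> x; rewrite mulr_ge0 ?normal_pdf_ge0// -muln2 exprM sqr_ge0.
  - by move=> x; apply: cvgM; [exact: exprn_continuous|exact: continuous_normal_pdf0].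
  - move=> x /=; rewrite !normal_pdfE// /normal_fun !subr0 sqrrN.
    by rewrite -mul2n !exprM sqrrN.
by rewrite !half doubleS normal_moment_step// muleCA.
Qed.

Lemma centered_gaussian_even (X : T -> R) : measurable_fun [set: T] X -> centered_gaussian P X ->
  exists2 s : R, 0 <= s & forall k, (\int[P]_w (X w ^+ k.+1.*2)%:E =
   (s ^+ 2 * k.*2.+1%:R)%:E * \int[P]_w (X w ^+ k.*2)%:E)%E.
Proof.
move=> mX [s s0 PX]; exists s => // k.
have mpow j : measurable_fun [set: measurableTypeR R] (fun x : R => (x ^+ j.*2)%:E).
  by apply/measurable_EFinP; exact: measurable_funX.
have pow0 j (x : R) : (0 <= (x ^+ j.*2)%:E)%E by rewrite lee_fin -muln2 exprM sqr_ge0.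
rewrite (centered_gaussian_integral mX PX (pow0 _) (mpow _)).
rewrite (centered_gaussian_integral mX PX (pow0 _) (mpow _)).
case: eqVneq => [->|s1]; last exact: normal_even_moment.
by rewrite !expr0n/= mul0r mul0e.
Qed.

Lemma centered_gaussian_finite_moments (X : T -> R) :
  measurable_fun [set: T] X -> centered_gaussian P X -> finite_moments P X.
Proof.
move=> mX GX; have [s s0 rec] := centered_gaussian_even mX GX.
apply: finite_moments_even => //; elim=> [|k IH].
  under eq_integral do rewrite expr0.
  by rewrite integral_cst//= probability_setT mul1e ltry.
by rewrite rec lte_mul_pinfty// lee_fin mulr_ge0// sqr_ge0.
Qed.

Lemma centered_gaussian_variance (X : T -> R) :
  measurable_fun [set: T] X -> centered_gaussian P X ->
  forall k, \int[P]_w (X w ^+ k.+1.*2) =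
    k.*2.+1%:R * \int[P]_w (X w ^+ 2) * \int[P]_w (X w ^+ k.*2).
Proof.
move=> mX GX; have [s s0 rec] := centered_gaussian_even mX GX.
have [_ iX] := centered_gaussian_finite_moments mX GX.
have fin k : (\int[P]_w (X w ^+ k)%:E)%E \is a fin_num by apply: integrable_fin_num => //; exact: iX.
have r k : \int[P]_w (X w ^+ k.+1.*2) = s ^+ 2 * k.*2.+1%:R * \int[P]_w (X w ^+ k.*2).
  by rewrite /Rintegral rec fineM//.
move=> k; rewrite r; have := r 0%N; rewrite /= => ->.
have -> : \int[P]_w X w ^+ 0 = 1.
  under eq_Rintegral do rewrite expr0.
    exact: Rintegral_probability_cst.
by rewrite double0 !mulr1 [k.*2.+1%:R * _]mulrC.
Qed.

(** The hypothesis on [- X] plays the part of the symmetry of the density: [X] and [- X] have the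
    same variance, hence the same law. *)
Lemma centered_gaussian_odd (X : T -> R) : measurable_fun [set: T] X ->
  centered_gaussian P X -> centered_gaussian P (fun w => - X w) ->
  forall k, odd k -> \int[P]_w (X w ^+ k) = 0.
Proof.
move=> mX GX GX' k odk.
have mX' : measurable_fun [set: T] (fun w => - X w) by exact: measurableT_comp.
have [_ iX] := centered_gaussian_finite_moments mX GX.
have [_ iX'] := centered_gaussian_finite_moments mX' GX'.
have mpow : measurable_fun [set: measurableTypeR R] (fun x : R => (x ^+ k)%:E).
  by apply/measurable_EFinP; exact: measurable_funX.
suff h : \int[P]_w (X w ^+ k) = \int[P]_w ((- X w) ^+ k).
  have : \int[P]_w ((- X w) ^+ k) = - \int[P]_w (X w ^+ k).
    rewrite -mulN1r -RintegralZl//; apply: eq_Rintegral => w _.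
    by rewrite exprNn -signr_odd odk expr1.
  rewrite -h; lra.
have sqrE : \int[P]_w (X w ^+ 2) = \int[P]_w ((- X w) ^+ 2).
  by apply: eq_Rintegral => w _; rewrite sqrrN.
have var (Y : T -> R) : measurable_fun [set: T] Y -> forall s,
  (forall A : set (measurableTypeR R), measurable A ->
    P (Y @^-1` A) = if s == 0 then dirac (0 : R) A else normal_prob 0 s A) ->
  (\int[P]_w (Y w ^+ 2)%:E = (s ^+ 2)%:E)%E.
  move=> mY s PY.
  have m2 : measurable_fun [set: measurableTypeR R] (fun x : R => (x ^+ 2)%:E).
    by apply/measurable_EFinP; exact: measurable_funX.
  rewrite (centered_gaussian_integral mY PY _ m2); last by move=> x; rewrite lee_fin sqr_ge0.
  case: eqVneq => [->|s0]; first by rewrite expr0n.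
  rewrite (normal_even_moment 0 s0)/= mulr1.
  under eq_integral do rewrite expr0 mul1e.
  by rewrite integral_normal_pdf mule1.
have [[s s0 Ps] [s' s'0 Ps']] := (GX, GX').
have ss' : s = s'.
  apply/eqP; rewrite -(eqrXn2 (n := 2))//; apply/eqP.
  apply: EFin_inj; rewrite -(var _ mX _ Ps) -(var _ mX' _ Ps').
  by apply: eq_integral => w _; rewrite sqrrN.
have := @integral_pushforward _ _ _ _ R (X : T -> measurableTypeR R) mX P setT _ mpow (iX k) measurableT.
have := @integral_pushforward _ _ _ _ R ((fun w => - X w) : T -> measurableTypeR R) mX' P setT _ mpow (iX' k) measurableT.
rewrite !preimage_setT /Rintegral => <- <-; congr fine.
apply: eq_measure_integral => A mA _.
by have := Ps' A mA; rewrite -ss' -(Ps A mA) => /esym.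
Qed.
End CenteredGaussian.

(** * Expectation of polynomials in jointly Gaussian variables *)

Section JointlyGaussian.
Context {R : realType} {d : measure_display} {T : measurableType d} (P : probability T R).
Context {k : nat} (X : 'I_k -> T -> R).
Hypothesis mX : forall i, measurable_fun [set: T] (X i).
Hypothesis GX : forall c : 'I_k -> R, centered_gaussian P (fun w => \sum_i c i * X i w).
Local Notation poly := (mpoly k R).
Let ev w : 'I_k -> R := fun i => X i w.

Let X_moments i : finite_moments P (X i).
Proof.
apply: centered_gaussian_finite_moments => //.
have := GX (fun j => (j == i)%:R); congr centered_gaussian; apply/funext => w.
rewrite (bigD1 i)//= eqxx mul1r big1 ?addr0// => j /negbTE ->.
by rewrite mul0r.
Qed.

Lemma meval_finite_moments (p : poly) : finite_moments P (fun w => meval (ev w) p).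
Proof.
under eq_fun do rewrite mevalE.
apply: finite_moments_sum => m; apply: finite_momentsM; first exact: finite_moments_cst.
by apply: finite_moments_prod => i; exact: (finite_momentsX _ (X_moments i)).
Qed.

Let integrable_meval (p : poly) : P.-integrable [set: T] (EFin \o (fun w => meval (ev w) p)).
Proof. exact: finite_moments_integrable (meval_finite_moments p). Qed.

Definition gaussian_expectation (p : poly) : R := \int[P]_w meval (ev w) p.
Local Notation E := gaussian_expectation.

Lemma gaussian_expectation_is_linear : linear_for *%R gaussian_expectation.
Proof.
move=> r p q; rewrite /E -RintegralZl// -RintegralD//; last first.
  have h := integrableZl measurableT r (integrable_meval p).
  by apply: eq_integrable h => // w _ /=; rewrite EFinM.
by apply: eq_Rintegral => w _; rewrite mevalD mevalZ.
Qed.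
HB.instance Definition _ := GRing.isLinear.Build R poly R _ gaussian_expectation
  gaussian_expectation_is_linear.

Definition gaussian_cov (a b : 'I_k) : R := \int[P]_w (X a w * X b w).

Let E1 : E 1 = 1.
Proof.
rewrite -[RHS](Rintegral_probability_cst P); apply: eq_Rintegral => w _.
by rewrite rmorph1.
Qed.

Let E_le (p q : poly) : (forall w, meval (ev w) p <= meval (ev w) q) -> E p <= E q.
Proof. by move=> pq; apply: le_Rintegral. Qed.

Let meval_linear_form w c : meval (ev w) (linear_form c) = \sum_i c i * X i w.
Proof.
rewrite rmorph_sum; apply: eq_bigr => i _; apply: etrans (mevalZ _ _ _) _.
by rewrite mevalXU.
Qed.

Let m_linear c : measurable_fun [set: T] (fun w => \sum_i c i * X i w).
Proof.
have [+ _] := meval_finite_moments (linear_form c).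
by under eq_fun do rewrite meval_linear_form.
Qed.

Let E_linear_pow c m : E (linear_form c ^+ m) = \int[P]_w ((\sum_i c i * X i w) ^+ m).
Proof. by apply: eq_Rintegral => w _; rewrite rmorphXn/= meval_linear_form. Qed.

Lemma gaussian_covE a b : gaussian_cov a b = E (mpolyX R (mnm1 a) * mpolyX R (mnm1 b)).
Proof. by apply: eq_Rintegral => w _; rewrite mevalM !mevalXU. Qed.

Lemma gaussian_cov_sym a b : gaussian_cov a b = gaussian_cov b a.
Proof. by apply: eq_Rintegral => w _; rewrite mulrC. Qed.

Lemma gaussian_quadratic_form c : E (linear_form c ^+ 2) = quadratic_form gaussian_cov c.
Proof.
rewrite /quadratic_form expr2 {1}/linear_form mulr_suml linear_sum; apply: eq_bigr => a _.
rewrite /linear_form mulr_sumr linear_sum; apply: eq_bigr => b _.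
by rewrite -scalerAl -scalerAr !linearZ/= gaussian_covE mulrA.
Qed.

Let E_odd c m : odd m -> E (linear_form c ^+ m) = 0.
Proof.
move=> om; rewrite E_linear_pow; apply: centered_gaussian_odd => //.
have := GX (fun i => - c i); congr centered_gaussian; apply/funext => w.
by rewrite -sumrN; apply: eq_bigr => i _; rewrite mulNr.
Qed.

Lemma gaussian_linear_odd c : E (linear_form c) = 0.
Proof. by rewrite -[linear_form c]expr1 E_odd. Qed.

Lemma gaussian_linear_pow c m : E (linear_form c ^+ m.+2) =
  m.+1%:R * quadratic_form gaussian_cov c * E (linear_form c ^+ m).
Proof.
case: (boolP (odd m)) => om; first by rewrite !E_odd//= ?mulr0// negbK.
rewrite -gaussian_quadratic_form -(even_halfK om) -doubleS !E_linear_pow.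
exact: centered_gaussian_variance.
Qed.

(** Positivity holds because the quadratic form is a second moment. The covariance is often
    singular, since the families to come list the same function several times. *)
Let factor : exists A : 'I_k -> 'I_k -> R,
  forall a b, gaussian_cov a b = \sum_i A a i * A b i.
Proof.
have [||A AE] := @psd_factor R k (\matrix_(a, b) gaussian_cov a b).
- by apply/matrixP => a b; rewrite !mxE gaussian_cov_sym.
- move=> v.
  have -> : (v *m (\matrix_(a, b) gaussian_cov a b) *m v^T) 0 0 = quadratic_form gaussian_cov (v 0).
    rewrite -mulmxA mxE; apply: eq_bigr => a _; rewrite mxE mulr_sumr.
    by apply: eq_bigr => b _; rewrite !mxE; ring.
  rewrite -gaussian_quadratic_form; apply: Rintegral_ge0 => w _.
  by rewrite rmorphXn sqr_ge0.
exists (fun a i => A a i) => a b.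
move/matrixP/(_ a b) : AE; rewrite !mxE => ->.
by apply: eq_bigr => i _; rewrite mxE.
Qed.

Definition wick_rv n (tau : 'I_n -> 'I_k) w := meval (ev w) (wick_poly_mono gaussian_cov tau).

Let wick_rv_sumE n (V : Type) (s : seq V) (c : V -> R) (tau : V -> 'I_n -> 'I_k) w :
  \sum_(v <- s) c v * wick_rv (tau v) w =
  meval (ev w) (\sum_(v <- s) c v *: wick_poly_mono gaussian_cov (tau v)).
Proof. by rewrite rmorph_sum; apply: eq_bigr => v _; apply: esym; exact: mevalZ. Qed.

Lemma wick_rv_sum_moments n (V : Type) (s : seq V) (c : V -> R) (tau : V -> 'I_n -> 'I_k) :
  finite_moments P (fun w => \sum_(v <- s) c v * wick_rv (tau v) w).
Proof. by under eq_fun do rewrite wick_rv_sumE; exact: meval_finite_moments. Qed.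

Lemma gaussian_wick_second_moment n (V : Type) (s : seq V) (c : V -> R) (tau : V -> 'I_n -> 'I_k) :
  \int[P]_w ((\sum_(v <- s) c v * wick_rv (tau v) w) ^+ 2) <=
  n`!%:R * \sum_(v <- s) \sum_(u <- s) c v * c u * \prod_i gaussian_cov (tau v i) (tau u i).
Proof.
have [A CA] := factor.
apply: le_trans (wick_second_moment gaussian_cov_sym gaussian_linear_odd gaussian_linear_pow
  CA E1 E_le s c tau).
by apply: ler_of_eq; apply: eq_Rintegral => w _; rewrite wick_rv_sumE rmorphXn.
Qed.

Lemma gaussian_wick_hypercontractive n (V : Type) (s : seq V) (c : V -> R)
    (tau : V -> 'I_n -> 'I_k) q :
  \int[P]_w ((\sum_(v <- s) c v * wick_rv (tau v) w) ^+ 2 ^+ q.+1) <=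
  ((q.*2.+1)%:R ^+ n) ^+ q.+1 *
  (\int[P]_w ((\sum_(v <- s) c v * wick_rv (tau v) w) ^+ 2)) ^+ q.+1.
Proof.
have [A CA] := factor.
have := wick_hypercontractive gaussian_cov_sym gaussian_linear_odd gaussian_linear_pow
  CA E1 E_le s c tau q.
rewrite /gaussian_expectation; congr (_ <= _ * _ ^+ _);
  by apply: eq_Rintegral => w _; rewrite wick_rv_sumE !rmorphXn.
Qed.

Lemma wick_rv_orthogonal n (tau : 'I_n -> 'I_k) w :
  (forall i j, i != j -> gaussian_cov (tau i) (tau j) = 0) ->
  wick_rv tau w = \prod_i X (tau i) w.
Proof.
move=> orth; rewrite /wick_rv wick_orthogonal// rmorph_prod.
by apply: eq_bigr => i _; exact: mevalXU.
Qed.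

Lemma wick_rv_const n a w : (1 <= n <= 3)%N ->
  wick_rv (fun _ : 'I_n => a) w = wick_poly (gaussian_cov a a) n (X a w).
Proof.
have evZ r (p : poly) : meval (ev w) (r *: p) = r * meval (ev w) p by exact: mevalZ.
case: n => [|[|[|[|n]]]]//= _; rewrite /wick_rv.
- by rewrite wick_const1; exact: mevalXU.
- by rewrite wick_const2 rmorphB rmorphXn/= evZ rmorph1 mulr1; congr (_ ^+ _ - _); exact: mevalXU.
- rewrite wick_const3 rmorphB rmorphXn/= evZ.
  by congr (_ ^+ _ - _ * _); exact: mevalXU.
Qed.
End JointlyGaussian.

Lemma integrable_sumZ (R : realType) d (T : measurableType d) (mu : {measure set T -> \bar R})
    (D : set T) (I : Type) (s : seq I) (b : I -> R) (h : I -> T -> R) : measurable D ->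
  (forall i, mu.-integrable D (EFin \o h i)) ->
  mu.-integrable D (EFin \o (fun z => \sum_(i <- s) b i * h i z)).
Proof.
move=> mD ih; elim: s => [|i s IH].
  by apply: eq_integrable (integrable0 _ _) => // z _ /=; rewrite big_nil.
apply: eq_integrable (integrableD mD (integrableZl mD (b i) (ih i)) IH) => // z _ /=.
by rewrite big_cons EFinD.
Qed.

Lemma Rintegral_sumZ (R : realType) d (T : measurableType d) (mu : {measure set T -> \bar R})
    (D : set T) (I : Type) (s : seq I) (b : I -> R) (h : I -> T -> R) : measurable D ->
  (forall i, mu.-integrable D (EFin \o h i)) ->
  \int[mu]_(z in D) (\sum_(i <- s) b i * h i z) =
  \sum_(i <- s) b i * \int[mu]_(z in D) h i z.
Proof.
move=> mD ih; elim: s => [|i s IH].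
  rewrite big_nil; transitivity (\int[mu]_(z in D) (0 : R)).
    by apply: eq_Rintegral => z _; rewrite big_nil.
  by rewrite /Rintegral integral0.
rewrite big_cons -IH -RintegralZl// -RintegralD//; last first.
- exact: integrable_sumZ.
- by have := integrableZl mD (b i) (ih i); apply: eq_integrable.
by apply: eq_Rintegral => z _; rewrite big_cons.
Qed.

(** * Wick products of white noise *)

Section WhiteNoiseChaos.
Context {R : realType} {d : measure_display} {Omega : measurableType d} (P : probability Omega R).
Variable xi : (spacetime R -> R) -> {RV P >-> R}.
Hypothesis xi_white : white_noise xi.

Definition inner (f g : spacetime R -> R) : R :=
  \int[spacetime_measure]_(z in cylinder) (f z * g z).

Lemma white_noise_cov f g : square_integrable f -> square_integrable g ->
  \int[P]_w (xi f w * xi g w) = inner f g.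
Proof.
by move=> f2 g2; have [_ /(_ _ _ f2 g2)] := xi_white; rewrite /Rintegral unlock => ->.
Qed.

(* The random variables whose finite linear combinations are handled: powers
   [:xi(h)^n:] and products over orthogonal families. *)
Definition is_wick n (g : 'I_n -> spacetime R -> R) (Y : Omega -> R) : Prop :=
  (exists h, [/\ forall i, g i = h, (1 <= n <= 3)%N &
     forall w, Y w = wick_poly (inner h h) n (xi h w)]) \/
  ((forall i j, i != j -> inner (g i) (g j) = 0) /\ forall w, Y w = \prod_i xi (g i) w).

Section Family.
Context {n : nat} {V : finType} (c : V -> R) (g : V -> 'I_n -> spacetime R -> R)
  (Y : V -> Omega -> R).
Hypothesis g2 : forall v i, square_integrable (g v i).
Hypothesis gY : forall v, is_wick (g v) (Y v).

Let J : finType := (V * 'I_n)%type.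
Let f (a : 'I_#|J|) := g (enum_val a).1 (enum_val a).2.
Let X (a : 'I_#|J|) w := xi (f a) w.
Let mX a : measurable_fun [set: Omega] (X a). Proof. exact: measurable_funPT. Qed.
Let GX (b : 'I_#|J| -> R) : centered_gaussian P (fun w => \sum_i b i * X i w).
Proof. by have [/(_ _ f b (fun a => g2 _ _))] := xi_white. Qed.

Let cov a b : gaussian_cov P X a b = inner (f a) (f b).
Proof. exact: (white_noise_cov (g2 _ _) (g2 _ _)). Qed.

(** A Wick power uses one index repeated n times, whose variance is [inner h h]; an orthogonal
    product uses n different indices. Both become instances of [wick_rv], so sums mixing the two
    kinds lie in a single chaos. *)
Let index : exists tau : V -> 'I_n -> 'I_#|J|, forall v,
  (forall i, f (tau v i) = g v i) /\ forall w, Y v w = wick_rv P X (tau v) w.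
Proof.
suff /boolp.choice[tau tauE] : forall v, exists t : 'I_n -> 'I_#|J|,
  (forall i, f (t i) = g v i) /\ forall w, Y v w = wick_rv P X t w by exists tau.
move=> v; have [[h [gh n13 Yv]]|[orth Yv]] := gY v.
  have n0 : (0 < n)%N by case/andP: n13.
  have fh : f (enum_rank (v, Ordinal n0)) = h by rewrite /f enum_rankK gh.
  exists (fun=> enum_rank (v, Ordinal n0)); split=> [i|w]; first by rewrite fh gh.
  by rewrite wick_rv_const// cov fh Yv /X fh.
have fg i : f (enum_rank (v, i)) = g v i by rewrite /f enum_rankK.
exists (fun i => enum_rank (v, i)); split=> // w.
rewrite Yv wick_rv_orthogonal//; first by apply: eq_bigr => i _; rewrite /X fg.
by move=> i j ij; rewrite cov !fg orth.
Qed.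

Lemma is_wick_finite_moments : finite_moments P (fun w => \sum_v c v * Y v w).
Proof.
have [tau tauE] := index; have := wick_rv_sum_moments mX GX (index_enum V) c tau.
by congr finite_moments; apply/funext => w; apply: eq_bigr => v _; have [_ ->] := tauE v.
Qed.

Lemma is_wick_second_moment :
  \int[P]_w ((\sum_v c v * Y v w) ^+ 2) <=
  n`!%:R * \sum_v \sum_u c v * c u * \prod_i inner (g v i) (g u i).
Proof.
have [tau tauE] := index.
have := gaussian_wick_second_moment mX GX (index_enum V) c tau; congr (_ <= _ * _).
  apply: eq_Rintegral => w _; congr (_ ^+ 2); apply: eq_bigr => v _.
  by have [_ ->] := tauE v.
apply: eq_bigr => v _; apply: eq_bigr => u _; congr (_ * _); apply: eq_bigr => i _.
by rewrite cov; have [-> _] := tauE v; have [-> _] := tauE u.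
Qed.

Lemma is_wick_hypercontractive q :
  \int[P]_w ((\sum_v c v * Y v w) ^+ 2 ^+ q.+1) <=
  ((q.*2.+1)%:R ^+ n) ^+ q.+1 * (\int[P]_w ((\sum_v c v * Y v w) ^+ 2)) ^+ q.+1.
Proof.
have [tau tauE] := index.
have := gaussian_wick_hypercontractive mX GX (index_enum V) c tau q.
by congr (_ <= _ * _ ^+ _); apply: eq_Rintegral => w _; [congr (_ ^+ 2 ^+ _)|congr (_ ^+ 2)];
  apply: eq_bigr => v _; have [_ ->] := tauE v.
Qed.
End Family.


Lemma measurable_cylinder : measurable (cylinder : set (spacetime R)).
Proof. by apply: measurableX => //; apply: measurableX; exact: measurable_itv. Qed.

Lemma integrable_mul_sq (f g : spacetime R -> R) : square_integrable f -> square_integrable g ->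
  (@spacetime_measure R).-integrable cylinder (EFin \o (fun z => f z * g z)).
Proof.
move=> [mf f2] [mg g2].
have mfg : measurable_fun cylinder (EFin \o (fun z => f z * g z)).
  by apply/measurable_EFinP; exact: measurable_funM.
have m2 (h : spacetime R -> R) : measurable_fun cylinder h -> measurable_fun cylinder (fun z => (h z ^+ 2)%:E).
  by move=> mh; apply/measurable_EFinP; exact: measurable_funX.
apply/integrableP; split=> //.
have mC := measurable_cylinder.
apply: (@le_lt_trans _ _ (\int[spacetime_measure]_(z in cylinder)
    ((f z ^+ 2)%:E + (g z ^+ 2)%:E))%E).
  apply: ge0_le_integral => //.
  - exact: measurableT_comp.
  - by apply: emeasurable_funD; exact: m2.
  - move=> z _; rewrite /= -EFinD lee_fin normrM.
    rewrite -(real_normK (num_real (f z))) -(real_normK (num_real (g z))).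
    have := sqr_ge0 (`|f z| - `|g z|); have := normr_ge0 (f z); have := normr_ge0 (g z); nra.
rewrite ge0_integralD//; first by rewrite lte_add_pinfty.
- by move=> z _; rewrite lee_fin sqr_ge0.
- exact: m2.
- by move=> z _; rewrite lee_fin sqr_ge0.
- exact: m2.
Qed.

End WhiteNoiseChaos.

(** * Multiple stochastic integrals *)

(** The integral of a nonnegative function is a supremum over the simple functions below it, so
    monotonicity holds for arbitrary functions. This is how suprema over uncountably many times are
    integrated at the end. *)
Lemma ge0_le_integral_lower (R : realType) d (T : measurableType d)
    (mu : {measure set T -> \bar R}) (D : set T) (f g : T -> \bar R) :
  (forall x, D x -> 0 <= f x)%E -> (forall x, D x -> f x <= g x)%E ->
  (\int[mu]_(x in D) f x <= \int[mu]_(x in D) g x)%E.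
Proof.
move=> f0 fg; rewrite !ge0_integralE//; last by move=> x Dx; exact: le_trans (f0 _ Dx) (fg _ Dx).
apply: le_ereal_sup => _ [h hf <-]; exists h => // x; apply: le_trans (hf x) _.
by rewrite !patchE; case: ifPn => // /set_mem/fg.
Qed.

Section IteratedIntegral.
Context {R : realType}.
Local Notation S := (spacetime R).
Local Notation mu := (@spacetime_measure R).

Lemma integral_n_ge0 n (F : n.-tuple S -> \bar R) : (forall z, 0 <= F z)%E ->
  (0 <= integral_n F)%E.
Proof.
by elim: n F => [|n IH] F F0 //=; apply: integral_ge0 => z _; exact: IH.
Qed.

Lemma le_integral_n n (F G : n.-tuple S -> \bar R) : (forall z, 0 <= F z)%E ->
  (forall z, F z <= G z)%E -> (integral_n F <= integral_n G)%E.
Proof.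
elim: n F G => [|n IH] F G F0 FG //=.
apply: ge0_le_integral_lower => z _; first exact: integral_n_ge0.
exact: IH.
Qed.

(** The parameter space [A] is arbitrary because the induction moves one variable of the tuple into
    it; each step is the measurability part of Tonelli's theorem. *)
Lemma measurable_integral_n n d (A : measurableType d) (F : A * n.-tuple S -> \bar R) :
  (forall p, 0 <= F p)%E -> measurable_fun [set: A * n.-tuple S] F ->
  measurable_fun [set: A] (fun a => integral_n (fun z => F (a, z))).
Proof.
elim: n d A F => [|n IH] d A F F0 mF /=.
  by apply: measurableT_comp mF _; exact: measurable_fun_pair.
pose G (p : A * S) := integral_n (fun zs => F (p.1, [tuple of p.2 :: zs])).
have G0 p : (0 <= G p)%E by apply: integral_n_ge0.
have mG : measurable_fun [set: A * S] G.
  apply: (IH _ _ (fun q : (A * S) * n.-tuple S => F (q.1.1, [tuple of q.1.2 :: q.2]))) => //.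
  apply: measurableT_comp mF _; apply: measurable_fun_pair.
    exact: measurableT_comp.
  by apply: measurable_cons => //; exact: measurableT_comp.
have mGc : measurable_fun [set: A * S] (G \_ ([set: A] `*` cylinder)).
  apply/(measurable_restrictT G); last exact: measurable_funTS.
  by apply: measurableX => //; exact: measurable_cylinder.
have Gc0 p : (0 <= (G \_ ([set: A] `*` cylinder)) p)%E by exact: erestrict_ge0.
have := measurable_fun_fubini_tonelli_F (m2 := mu) _ mGc Gc0.
congr measurable_fun; apply/funext => a; rewrite /fubini_F [RHS]integral_mkcond.
apply: eq_integral => z _; rewrite !patchE.
have -> : ((a, z) \in [set: A] `*` cylinder) = (z \in cylinder) by rewrite in_setX in_setT.
by [].
Qed.

Lemma measurable_integral_n_cons n (F : n.+1.-tuple S -> \bar R) :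
  (forall p, 0 <= F p)%E -> measurable_fun [set: n.+1.-tuple S] F ->
  measurable_fun [set: S] (fun z => integral_n (fun zs => F [tuple of z :: zs])).
Proof.
move=> F0 mF.
apply: (@measurable_integral_n n _ S (fun p : S * n.-tuple S => F [tuple of p.1 :: p.2])) => //.
by apply: measurableT_comp mF _; exact: measurable_cons.
Qed.

Let measurable_slice n (F : n.+1.-tuple S -> \bar R) (z : S) :
  measurable_fun [set: n.+1.-tuple S] F ->
  measurable_fun [set: n.-tuple S] (fun zs => F [tuple of z :: zs]).
Proof. by move=> mF; apply: measurableT_comp mF _; exact: measurable_cons. Qed.

Lemma integral_nD n (F G : n.-tuple S -> \bar R) :
  (forall p, 0 <= F p)%E -> measurable_fun [set: n.-tuple S] F ->
  (forall p, 0 <= G p)%E -> measurable_fun [set: n.-tuple S] G ->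
  (integral_n (fun z => F z + G z) = integral_n F + integral_n G)%E.
Proof.
elim: n F G => [|n IH] F G F0 mF G0 mG //=.
rewrite -ge0_integralD//; [|exact: measurable_cylinder| | | |].
- by apply: eq_integral => z _; apply: IH => //; exact: measurable_slice.
- by move=> z _; exact: integral_n_ge0.
- by apply: measurable_funTS; exact: measurable_integral_n_cons.
- by move=> z _; exact: integral_n_ge0.
- by apply: measurable_funTS; exact: measurable_integral_n_cons.
Qed.

Lemma integral_nZ n (c : R) (F : n.-tuple S -> \bar R) : 0 <= c ->
  (forall p, 0 <= F p)%E -> measurable_fun [set: n.-tuple S] F ->
  (integral_n (fun z => c%:E * F z) = c%:E * integral_n F)%E.
Proof.
move=> c0; elim: n F => [|n IH] F F0 mF //=.
rewrite -ge0_integralZl//; [|exact: measurable_cylinder| | ].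
- by apply: eq_integral => z _; apply: IH => //; exact: measurable_slice.
- by apply: measurable_funTS; exact: measurable_integral_n_cons.
- by move=> z _; exact: integral_n_ge0.
Qed.

Lemma fatou_integral_n n (F : nat -> n.-tuple S -> \bar R) :
  (forall k p, 0 <= F k p)%E -> (forall k, measurable_fun [set: n.-tuple S] (F k)) ->
  (integral_n (fun z => limn_einf (F^~ z)) <= limn_einf (fun k => integral_n (F k)))%E.
Proof.
elim: n F => [|n IH] F F0 mF //=.
have einf_ge0 (u : (\bar R)^nat) : (forall k, 0 <= u k)%E -> (0 <= limn_einf u)%E.
  move=> u0; rewrite limn_einf_lim; apply: lime_ge; first exact: is_cvg_einfs.
  by apply: nearW => k; apply: le_ereal_inf_tmp => _ [j _ <-].
apply: (@le_trans _ _ (\int[mu]_(z in cylinder)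
    limn_einf (fun k => integral_n (fun zs => F k [tuple of z :: zs])))%E).
  apply: ge0_le_integral_lower => z _; first by apply: integral_n_ge0 => zs; exact: einf_ge0.
  by apply: IH => // k; exact: measurable_slice.
apply: (fatou mu measurable_cylinder) => [k|k z _]; last exact: integral_n_ge0.
by apply: measurable_funTS; exact: measurable_integral_n_cons.
Qed.

Lemma integral_n_cvg_le n (F : nat -> n.-tuple S -> R) (G : n.-tuple S -> R) (e : R) K :
  (forall k p, 0 <= F k p) -> (forall k, measurable_fun [set: n.-tuple S] (F k)) ->
  (forall z, F k z @[k --> \oo] --> G z) ->
  (forall k, (K <= k)%N -> (integral_n (fun z => (F k z)%:E) <= e%:E)%E) ->
  (integral_n (fun z => (G z)%:E) <= e%:E)%E.
Proof.
move=> F0 mF FG Fe.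
have -> : (fun z => (G z)%:E) = (fun z => limn_einf (fun k => (F k z)%:E)).
  apply/funext => z; rewrite is_cvg_limn_einfE; last by apply/cvg_ex; exists (G z)%:E; apply: cvg_EFin; [exact: nearW|exact: FG].
  by apply/esym/cvg_lim => //; apply: cvg_EFin; [exact: nearW|exact: FG].
apply: le_trans (fatou_integral_n _ _) _ => [k p|k|].
- by rewrite lee_fin.
- exact/measurable_EFinP.
- rewrite limn_einf_lim; apply: lime_le; first exact: is_cvg_einfs.
  exists K => // k /= Kk; apply: le_trans (Fe k Kk).
  by apply: ereal_inf_lbound; exists k => /=.
Qed.

(** The value is the Gram sum that bounds variances in [is_wick_second_moment]: through it L^2
    distances between kernels control second moments of random variables. *)
Lemma integral_n_tensor n (V : finType) (c : V -> R) (g : V -> 'I_n -> S -> R) :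
  (forall v i, square_integrable (g v i)) ->
  integral_n (fun z => ((\sum_v c v * \prod_i g v i (tnth z i)) ^+ 2)%:E) =
  (\sum_v \sum_u c v * c u * \prod_i inner (g v i) (g u i))%:E.
Proof.
elim: n c g => [|n IH] c g g2.
  rewrite /= expr2 mulr_suml; congr EFin; apply: eq_bigr => v _; rewrite mulr_sumr.
  by apply: eq_bigr => u _; rewrite !big_ord0 !mulr1.
have mC := @measurable_cylinder R.
rewrite /=.
transitivity (\int[mu]_(z in cylinder) (\sum_(vu : V * V)
   (c vu.1 * c vu.2 * \prod_i inner (g vu.1 (lift ord0 i)) (g vu.2 (lift ord0 i))) *
   (g vu.1 ord0 z * g vu.2 ord0 z))%:E)%E.
  apply: eq_integral => z _.
  have h := IH (fun v => c v * g v ord0 z) (fun v i => g v (lift ord0 i)) (fun v i => g2 v _).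
  apply: etrans (etrans _ h) _.
    congr integral_n; apply/funext => zs; congr ((_ ^+ 2)%:E).
    apply: eq_bigr => v _; rewrite big_ord_recl -mulrA tnth0; congr (_ * (_ * _)).
    by apply: eq_bigr => i _; rewrite tnthS.
  congr EFin; rewrite -(pair_bigA _ (fun v u => (c v * c u *
     \prod_i inner (g v (lift ord0 i)) (g u (lift ord0 i))) * (g v ord0 z * g u ord0 z)))/=.
  by apply: eq_bigr => v _; apply: eq_bigr => u _; ring.
have int (vu : V * V) : mu.-integrable cylinder (EFin \o (fun z => g vu.1 ord0 z * g vu.2 ord0 z)).
  exact: integrable_mul_sq.
rewrite -[LHS]fineK; last by apply: integrable_fin_num => //; exact: integrable_sumZ.
congr EFin; rewrite -[LHS]/(\int[mu]_(z in cylinder) _) Rintegral_sumZ// pair_bigA/=.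
by apply: eq_bigr => vu _; rewrite big_ord_recl mulrCA mulrC mulrA.
Qed.

Lemma measurable_tensor n (V : finType) (c : V -> R) (g : V -> 'I_n -> S -> R) :
  (forall v i, measurable_fun [set: S] (g v i)) ->
  measurable_fun [set: n.-tuple S] (fun z => \sum_v c v * \prod_i g v i (tnth z i)).
Proof.
move=> mg; apply: measurable_sum => v; apply: measurable_funM => //.
apply: measurable_prod => i _; apply: measurableT_comp (mg v i) _; exact: measurable_tnth.
Qed.
End IteratedIntegral.

Notation normc := ComplexField.Normc.normc.

(** * Fourier modes on the torus *)

Section FourierModes.
Context {R : realType}.
Local Notation e := (@fourier_mode R).
Local Notation Rc := R[i].

Lemma phaseDl m l x : phase (m + l) x = phase m x + phase l x :> R.
Proof. by rewrite /phase /lattice/= !intrD; ring. Qed.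

Lemma phaseNl m x : phase (- m) x = - phase m x :> R.
Proof. by rewrite /phase /lattice/= !mulrNz; ring. Qed.

Lemma phaseDr m (x y : R * R) : phase m (x + y) = phase m x + phase m y.
Proof. by rewrite /phase/=; ring. Qed.

Lemma phaseNr m (x : R * R) : phase m (- x) = - phase m x.
Proof. by rewrite /phase/=; ring. Qed.

Lemma modeDl m l x : e (m + l) x = e m x * e l x.
Proof.
rewrite /fourier_mode phaseDl; apply/eqP; rewrite eq_complex/=.
by rewrite cosD sinD eqxx/= addrC mulrC eqxx.
Qed.

Lemma modeDr m (x y : R * R) : e m (x + y) = e m x * e m y.
Proof.
rewrite /fourier_mode phaseDr; apply/eqP; rewrite eq_complex/=.
by rewrite cosD sinD eqxx/= addrC mulrC eqxx.
Qed.

Lemma modeNl m (x : R * R) : e (- m) x = (e m x)^*%C.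
Proof. by rewrite /fourier_mode phaseNl cosN sinN. Qed.

Lemma modeNr m (x : R * R) : e m (- x) = e (- m) x.
Proof. by rewrite /fourier_mode phaseNl phaseNr. Qed.

Lemma mode0l (x : R * R) : e 0 x = 1.
Proof. by rewrite /fourier_mode /phase/= !mul0r addr0 mulr0 cos0 sin0. Qed.

Lemma mode0r m : e m (0 : R * R) = 1.
Proof. by rewrite /fourier_mode /phase/= !mulr0 addr0 mulr0 cos0 sin0. Qed.

Lemma normc_mode m (x : R * R) : normc (e m x) = 1.
Proof. by rewrite /= cos2Dsin2 sqrtr1. Qed.

Lemma mode_sum (I : Type) (s : seq I) (f : I -> int * int) (x : R * R) :
  e (\sum_(i <- s) f i) x = \prod_(i <- s) e (f i) x.
Proof.
elim: s => [|i s IH]; first by rewrite !big_nil mode0l.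
by rewrite !big_cons modeDl IH.
Qed.

Lemma normc_ge0 (z : Rc) : 0 <= normc z.
Proof. by case: z => a b; exact: sqrtr_ge0. Qed.

Lemma normc_sum (I : Type) (s : seq I) (P : pred I) (f : I -> Rc) :
  normc (\sum_(i <- s | P i) f i) <= \sum_(i <- s | P i) normc (f i).
Proof.
elim/big_rec2: _ => [|i y1 y2 _ h]; first by rewrite ComplexField.Normc.normc0.
by apply: le_trans (le_normcD _ _) _; rewrite lerD2l.
Qed.

Lemma normc_sqr (z : Rc) : ((normc z) ^+ 2)%:C%C = z * z^*%C.
Proof. by rewrite -sqr_normc rmorphXn; congr (_ ^+ 2). Qed.

Lemma normc_conj (z : Rc) : normc z^*%C = normc z.
Proof. by case: z => a b; rewrite /= sqrrN. Qed.

Lemma normc_real (x : R) : normc x%:C%C = `|x|.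
Proof. by rewrite /= expr0n/= addr0 sqrtr_sqr. Qed.

Lemma normcX (z : Rc) n : normc (z ^+ n) = normc z ^+ n.
Proof.
elim: n => [|n IH]; first by rewrite !expr0 ComplexField.Normc.normc1.
by rewrite !exprS ComplexField.Normc.normcM IH.
Qed.

Lemma normr_Re (z : Rc) : `|complex.Re z| <= normc z.
Proof. by case: z => a b; rewrite /= -sqrtr_sqr ler_wsqrtr// lerDl sqr_ge0. Qed.

Lemma normr_Im (z : Rc) : `|complex.Im z| <= normc z.
Proof. by case: z => a b; rewrite /= -sqrtr_sqr ler_wsqrtr// lerDr sqr_ge0. Qed.

Lemma normc_le (z : Rc) : normc z <= `|complex.Re z| + `|complex.Im z|.
Proof.
case: z => a b /=; rewrite -(ler_pXn2r (n := 2)) ?nnegrE ?sqrtr_ge0 ?addr_ge0//.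
rewrite sqr_sqrtr ?addr_ge0 ?sqr_ge0// sqrrD !real_normK ?num_real//.
by rewrite -addrA lerD2l lerDr mulrn_wge0// mulr_ge0.
Qed.

(** * Modes in a box, averages over a grid *)

(** A finite type standing for the square [-D, D]^2 of frequencies, so that sums over discs and over
    all of Z^2 become ordinary finite sums. *)
Definition box D : finType := ('I_D.*2.+1 * 'I_D.*2.+1)%type.

Definition box_mode D (k : box D) : int * int := (k.1%:Z - D%:Z, k.2%:Z - D%:Z).

Definition in_box D (m : int * int) : bool := (`|m.1| <= D)%N && (`|m.2| <= D)%N.

Lemma box_mode_inj D : injective (@box_mode D).
Proof. by move=> [k1 k2] [l1 l2] [/= h1 h2]; congr pair; apply: val_inj => /=; lia. Qed.

Lemma box_modeP D (k : box D) : in_box D (box_mode k).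
Proof. by case: k => [k1 k2]; rewrite /in_box/=; move: (ltn_ord k1) (ltn_ord k2); lia. Qed.

Lemma in_boxP D m : in_box D m -> exists k : box D, box_mode k = m.
Proof.
case: m => a b; rewrite /in_box/= => /andP[ha hb].
have h1 : (`|(a + D%:Z)%R|%N < D.*2.+1)%N by lia.
have h2 : (`|(b + D%:Z)%R|%N < D.*2.+1)%N by lia.
by exists (Ordinal h1, Ordinal h2); rewrite /box_mode/=; congr pair; lia.
Qed.

Lemma in_box_le D D' m : (D <= D')%N -> in_box D m -> in_box D' m.
Proof. by rewrite /in_box; lia. Qed.

Lemma in_boxD D D' m m' : in_box D m -> in_box D' m' -> in_box (D + D') (m + m').
Proof. by rewrite /in_box/=; lia. Qed.

Lemma in_boxN D m : in_box D (- m) = in_box D m.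
Proof. by rewrite /in_box/=; lia. Qed.

Lemma fsbig_box (V : nmodType) D (A : set (int * int)) (F : int * int -> V) :
  (forall m, A m -> in_box D m) ->
  \sum_(m \in A) F m = \sum_(k : box D | box_mode k \in A) F (box_mode k).
Proof.
move=> AD; pose G m := if m \in A then F m else 0.
rewrite (eq_fsbigr G) => [|m mA]; last by rewrite /G mA.
rewrite (fsbig_fwiden [seq box_mode k | k : box D]).
- by rewrite big_map big_enum/= [RHS]big_mkcond.
- by move=> m /AD/in_boxP[k <-] /=; apply/mapP; exists k; rewrite ?mem_enum.
- by rewrite map_inj_uniq ?enum_uniq//; exact: box_mode_inj.
- by move=> m [_ mA]/=; rewrite /G memNset.
Qed.

Lemma fsbigT_box (V : nmodType) D (F : int * int -> V) :
  (forall m, ~~ in_box D m -> F m = 0) ->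
  \sum_(m \in [set: int * int]) F m = \sum_(k : box D) F (box_mode k).
Proof.
move=> F0; rewrite -(fsbig_widen [set m | in_box D m]) => [|//|m [_ /= /negP mD]]; last exact: F0.
rewrite (@fsbig_box _ D)//; apply: eq_bigl => k; apply/mem_set; exact: box_modeP.
Qed.

Lemma big_box (V : nmodType) D D' (F : int * int -> V) : (D <= D')%N ->
  (forall m, ~~ in_box D m -> F m = 0) ->
  \sum_(k : box D') F (box_mode k) = \sum_(k : box D) F (box_mode k).
Proof.
move=> DD' F0; rewrite -!fsbigT_box// => m mD'; apply: F0.
by apply: contra mD'; exact: in_box_le.
Qed.

Definition grid_point L (k : 'I_L * 'I_L) : R * R := (k.1%:R / L%:R, k.2%:R / L%:R).

Definition grid_avg L (f : R * R -> Rc) : Rc :=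
  ((L%:R : R) ^- 2)%:C%C * \sum_(k : 'I_L * 'I_L) f (grid_point k).

Let mode1 (n : int) (x : R) : Rc := e (n, 0) (x, 0).

Let mode_split m x : e m x = mode1 m.1 x.1 * mode1 m.2 x.2.
Proof.
rewrite /mode1 /fourier_mode /phase/=; set a := 2 * pi * _; set b := 2 * pi * (_ * x.1 + _).
set c := 2 * pi * (_ * x.2 + _); have -> : a = b + c by rewrite /a /b /c; ring.
by rewrite cosD sinD; apply/eqP; rewrite eq_complex/= eqxx/= addrC mulrC eqxx.
Qed.

Let cos_lt1 (t : R) : 0 < t < 1 -> cos (2 * pi * t) != 1.
Proof.
move=> /andP[t0 t1]; have -> : 2 * pi * t = (pi * t) *+ 2 by rewrite mulr2n; ring.
rewrite cos_mulr2n; have s : 0 < sin (pi * t).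
  by apply: sin_gt0_pi; rewrite mulr_gt0 ?pi_gt0//= -[X in _ < X]mulr1 ltr_pM2l ?pi_gt0.
have := cos2Dsin2 (pi * t); have := exprn_gt0 2 s.
by move=> h1 h2; apply/eqP; lra.
Qed.

Let mode1_sum L n : (`|n| < L)%N -> \sum_(k < L) mode1 n (k%:R / L%:R) = (L%:R * (n == 0)%:R : R)%:C%C.
Proof.
move=> nL; have L0 : (0 < L)%N by case: L nL.
have Ln0 : L%:R != 0 :> R by rewrite pnatr_eq0 -lt0n.
have [->|n0] := eqVneq n 0.
  rewrite mulr1 (eq_bigr (fun=> 1)) => [|k _]; first by rewrite sumr_const card_ord rmorph_nat.
  exact: mode0l.
rewrite mulr0; pose w := mode1 n L%:R^-1.
have wk k : mode1 n (k%:R / L%:R) = w ^+ k.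
  elim: k => [|k IH]; first by rewrite mul0r expr0; exact: mode0r.
  rewrite exprSr -IH /w /mode1 -modeDr; congr (e _ (_, _)).
    by rewrite -natr1 mulrDl mul1r.
  by rewrite addr0.
under eq_bigr do rewrite wk.
have wL : w ^+ L = 1.
  rewrite -wk divff// /mode1.
  have e1 : e (1, 0) (1, 0) = 1.
    rewrite /fourier_mode; have -> : phase (1, 0) (1, 0) = pi + pi :> R by rewrite /phase/=; ring.
    rewrite cosD sinD.
    by rewrite sinpi cospi !mul0r !mulr0 addr0 subr0 mulrNN mulr1.
  have eN k : e (Posz k, 0) (1, 0) = 1.
    elim: k => [|k IH]; first exact: mode0l.
    have -> : (Posz k.+1, 0) = (Posz k, 0) + (1, 0) :> (int * int)%type by congr pair; rewrite -addn1 PoszD.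
    by rewrite modeDl IH e1 mulr1.
  case: n {n0 nL w wk} => k; first exact: eN.
  have -> : (Negz k, 0) = - (Posz k.+1, 0) :> (int * int)%type by [].
  by rewrite modeNl eN conjc1.
have w1 : w != 1.
  rewrite /w /mode1 /fourier_mode /phase/= mulr0 addr0; apply/eqP => -[/eqP + _].
  apply/negP.
  wlog n1 : n n0 nL {w wk wL} / (0 < n)%R => [wl|].
    have [/wl|] := ltP 0 n; first exact.
    rewrite le_eqVlt (negbTE n0)/= => nn.
    have := wl (- n); rewrite oppr_eq0 n0 oppr_gt0 nn abszN nL => /(_ isT isT isT).
    by rewrite mulrNz mulNr mulrN cosN.
  apply: cos_lt1; rewrite divr_gt0 ?ltr0z ?ltr0n//= ltr_pdivrMr ?ltr0n// mul1r.
  by rewrite pmulrn ltr_int; lia.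
have := subrX1 w L; rewrite wL subrr => /esym/eqP.
by rewrite mulf_eq0 subr_eq0 (negbTE w1)/= => /eqP.
Qed.

Lemma grid_avg_mode L m : (`|m.1| < L)%N -> (`|m.2| < L)%N ->
  grid_avg L (e m) = (m == 0)%:R.
Proof.
move=> m1 m2; have L0 : L%:R != 0 :> R by rewrite pnatr_eq0 -lt0n; case: L m1 {m2}.
rewrite /grid_avg.
under eq_bigr do rewrite mode_split/=.
rewrite -(pair_bigA _ (fun i j : 'I_L => mode1 m.1 (i%:R / L%:R) * mode1 m.2 (j%:R / L%:R)))/=.
under eq_bigr do rewrite -mulr_sumr.
rewrite -mulr_suml !mode1_sum// -!(rmorphM (real_complex R))/= -[RHS](rmorph_nat (real_complex R)); congr (_%:C%C).
have -> : (m == 0) = (m.1 == 0) && (m.2 == 0) by case: m {m1 m2}.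
rewrite mulrACA -expr2 mulKf ?expf_neq0//.
by case: (m.1 == 0) (m.2 == 0) => -[]; rewrite ?mulr0 ?mul0r ?mulr1.
Qed.

Lemma grid_avg_sum L (I : Type) (s : seq I) (f : I -> R * R -> Rc) :
  grid_avg L (fun x => \sum_(i <- s) f i x) = \sum_(i <- s) grid_avg L (f i).
Proof. by rewrite /grid_avg exchange_big mulr_sumr. Qed.

Lemma grid_avgZ L (c : Rc) (f : R * R -> Rc) :
  grid_avg L (fun x => c * f x) = c * grid_avg L f.
Proof. by rewrite /grid_avg -mulr_sumr mulrCA. Qed.

Lemma eq_grid_avg L (f g : R * R -> Rc) : f =1 g -> grid_avg L f = grid_avg L g.
Proof. by move=> /funext ->. Qed.


(** * Trigonometric polynomials *)

Definition trig D (c : int * int -> Rc) (x : R * R) : Rc :=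
  \sum_(k : box D) c (box_mode k) * e (box_mode k) x.

Definition is_trig D (f : R * R -> Rc) : Prop := exists c, f =1 trig D c.

(** [trig D] ignores coefficients outside the box; setting them to 0 lets the same polynomial be
    read with any larger degree. *)
Definition cut D (c : int * int -> Rc) m : Rc := if in_box D m then c m else 0.

Lemma trig_cut D D' c x : (D <= D')%N -> trig D' (cut D c) x = trig D c x.
Proof.
move=> DD'; rewrite /trig (@big_box _ _ _ (fun m => cut D c m * e m x) DD').
  by apply: eq_bigr => k _; rewrite /cut box_modeP.
by move=> m /negbTE mD; rewrite /cut mD mul0r.
Qed.

Lemma is_trig_le D D' f : (D <= D')%N -> is_trig D f -> is_trig D' f.
Proof. by move=> DD' [c fc]; exists (cut D c) => x; rewrite trig_cut. Qed.

Lemma eq_is_trig D f g : f =1 g -> is_trig D f -> is_trig D g.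
Proof. by move=> /funext ->. Qed.

Lemma is_trigD D f g : is_trig D f -> is_trig D g -> is_trig D (fun x => f x + g x).
Proof.
move=> [a fa] [b gb]; exists (fun m => a m + b m) => x.
by rewrite fa gb /trig -big_split/=; apply: eq_bigr => k _; rewrite mulrDl.
Qed.

Lemma is_trigZ D (c : Rc) f : is_trig D f -> is_trig D (fun x => c * f x).
Proof.
move=> [a fa]; exists (fun m => c * a m) => x.
by rewrite fa /trig mulr_sumr; apply: eq_bigr => k _; rewrite mulrA.
Qed.

Lemma is_trig_mode D m : in_box D m -> is_trig D (e m).
Proof.
move=> /in_boxP[k <-]; exists (fun l => (l == box_mode k)%:R) => x.
rewrite /trig (bigD1 k)//= eqxx mul1r big1 ?addr0// => l lk.
by rewrite (inj_eq (@box_mode_inj D)) (negbTE lk) mul0r.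
Qed.

Lemma is_trig_cst D (c : Rc) : is_trig D (fun=> c).
Proof.
apply: (eq_is_trig (f := fun x => c * e 0 x)); first by move=> x; rewrite mode0l mulr1.
by apply/is_trigZ/is_trig_mode; rewrite /in_box/=.
Qed.

Lemma is_trig_sum D (I : Type) (s : seq I) (P : pred I) (f : I -> R * R -> Rc) :
  (forall i, P i -> is_trig D (f i)) -> is_trig D (fun x => \sum_(i <- s | P i) f i x).
Proof.
move=> h; elim: s => [|i s IH].
  by apply: (eq_is_trig (f := fun=> 0)); [move=> x; rewrite big_nil|exact: is_trig_cst].
apply: (eq_is_trig (f := fun x => (if P i then f i x else 0) + \sum_(i <- s | P i) f i x)).
  by move=> x; rewrite big_cons; case: ifP => //; rewrite add0r.
by apply: is_trigD => //; case: (boolP (P i)) => [/h//|_]; exact: is_trig_cst.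
Qed.

Lemma is_trigM D D' f g : is_trig D f -> is_trig D' g -> is_trig (D + D') (fun x => f x * g x).
Proof.
move=> [a fa] [b gb].
apply: (eq_is_trig (f := fun x => \sum_(k : box D) \sum_(l : box D')
   (a (box_mode k) * b (box_mode l)) * e (box_mode k + box_mode l) x)).
  move=> x; rewrite fa gb /trig big_distrl/=; apply: eq_bigr => k _.
  by rewrite big_distrr/=; apply: eq_bigr => l _; rewrite modeDl mulrACA.
do 2! (apply: is_trig_sum => ? _); apply/is_trigZ/is_trig_mode/in_boxD; exact: box_modeP.
Qed.

Lemma is_trigX D f n : is_trig D f -> is_trig (n * D) (fun x => f x ^+ n).
Proof.
move=> fD; elim: n => [|n IH]; first exact: is_trig_cst.
by apply: (eq_is_trig (f := fun x => f x * f x ^+ n)); [move=> x; rewrite exprS|exact: is_trigM].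
Qed.

Lemma is_trig_prod D (I : Type) (s : seq I) (f : I -> R * R -> Rc) :
  (forall i, is_trig D (f i)) -> is_trig (size s * D) (fun x => \prod_(i <- s) f i x).
Proof.
move=> h; elim: s => [|i s IH].
  by apply: (eq_is_trig (f := fun=> 1)); [move=> x; rewrite big_nil|exact: is_trig_cst].
by apply: (eq_is_trig (f := fun x => f i x * \prod_(i <- s) f i x));
  [move=> x; rewrite big_cons|exact: is_trigM].
Qed.

Lemma is_trig_conj D f : is_trig D f -> is_trig D (fun x => (f x)^*%C).
Proof.
move=> [a fa].
apply: (eq_is_trig (f := fun x => \sum_(k : box D) (a (box_mode k))^*%C * e (- box_mode k) x)).
  move=> x; rewrite fa /trig rmorph_sum; apply: eq_bigr => k _; by rewrite rmorphM modeNl.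
by apply: is_trig_sum => k _; apply/is_trigZ/is_trig_mode; rewrite in_boxN box_modeP.
Qed.

Lemma is_trig_shift D f y : is_trig D f -> is_trig D (fun x => f (x + y)).
Proof.
move=> [a fa].
apply: (eq_is_trig (f := fun x => \sum_(k : box D) (a (box_mode k) * e (box_mode k) y) * e (box_mode k) x)).
  by move=> x; rewrite fa /trig; apply: eq_bigr => k _; rewrite modeDr mulrAC mulrA.
by apply: is_trig_sum => k _; apply/is_trigZ/is_trig_mode/box_modeP.
Qed.

Lemma is_trig_opp D f : is_trig D f -> is_trig D (fun x => f (- x)).
Proof.
move=> [a fa].
apply: (eq_is_trig (f := fun x => \sum_(k : box D) a (box_mode k) * e (- box_mode k) x)).
  by move=> x; rewrite fa /trig; apply: eq_bigr => k _; rewrite modeNr.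
by apply: is_trig_sum => k _; apply/is_trigZ/is_trig_mode; rewrite in_boxN box_modeP.
Qed.

Lemma is_trig_Re D f : is_trig D f -> is_trig D (fun x => (complex.Re (f x))%:C%C).
Proof.
move=> fD; apply: (eq_is_trig (f := fun x => (2^-1 : R)%:C%C * (f x + (f x)^*%C))).
  move=> x; case: (f x) => u v; apply/eqP; rewrite eq_complex/=; apply/andP.
  by split; apply/eqP; field.
by apply/is_trigZ/is_trigD => //; exact: is_trig_conj.
Qed.

(** The condition |m| + D < L excludes aliasing: no frequency of the polynomial other than m agrees
    with m modulo L. *)
Lemma grid_avg_trig L D c m : (`|m.1| + D < L)%N -> (`|m.2| + D < L)%N ->
  grid_avg L (fun x => trig D c x * e (- m) x) = cut D c m.
Proof.
move=> m1 m2.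
rewrite (eq_grid_avg L (g := fun x => \sum_(k : box D) c (box_mode k) * e (box_mode k - m) x)); last first.
  by move=> x; rewrite /trig mulr_suml; apply: eq_bigr => k _; rewrite modeDl mulrA.
rewrite grid_avg_sum.
rewrite (eq_bigr (fun k : box D => c (box_mode k) * (box_mode k == m)%:R)) => [|k _]; last first.
  by rewrite grid_avgZ grid_avg_mode ?subr_eq0//=;
    move: (box_modeP k); rewrite /in_box => /andP[/= h1 h2]; lia.
rewrite /cut; case: ifPn => [/in_boxP[k <-]|mD].
  rewrite (bigD1 k)//= eqxx mulr1 big1 ?addr0// => l lk.
  by rewrite (inj_eq (@box_mode_inj D)) (negbTE lk) mulr0.
rewrite big1// => k _; case: eqP => [km|]; last by rewrite mulr0.
by rewrite -km box_modeP in mD.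
Qed.

Lemma grid_avg_trig0 L D c : (D < L)%N -> grid_avg L (trig D c) = c 0.
Proof.
move=> DL; have := @grid_avg_trig L D c 0 DL DL; rewrite /cut oppr0.
have -> : in_box D 0 by rewrite /in_box.
by move=> <-; apply: eq_grid_avg => x; rewrite mode0l mulr1.
Qed.

Lemma parseval L D c : (D.*2 < L)%N ->
  grid_avg L (fun x => trig D c x * (trig D c x)^*%C) =
  \sum_(k : box D) ((normc (c (box_mode k))) ^+ 2)%:C%C.
Proof.
move=> DL.
rewrite (eq_grid_avg L (g := fun x => \sum_(k : box D) (c (box_mode k))^*%C *
    (trig D c x * e (- box_mode k) x))); last first.
  move=> x; rewrite {2}/trig rmorph_sum mulr_sumr; apply: eq_bigr => k _.
  by rewrite rmorphM modeNl mulrCA.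
rewrite grid_avg_sum; apply: eq_bigr => k _; rewrite grid_avgZ grid_avg_trig.
- by rewrite /cut box_modeP normc_sqr mulrC.
- by move: (box_modeP k); rewrite /in_box => /andP[/= h1 h2]; lia.
- by move: (box_modeP k); rewrite /in_box => /andP[/= h1 h2]; lia.
Qed.

Lemma parsevalr L D c : (D.*2 < L)%N ->
  \sum_(k : box D) (normc (c (box_mode k))) ^+ 2 =
  L%:R ^- 2 * \sum_(k : 'I_L * 'I_L) (normc (trig D c (grid_point k))) ^+ 2.
Proof.
move=> /(parseval c) h; apply: (@complexI R); rewrite rmorph_sum/= -h /grid_avg rmorphM rmorph_sum/=.
by congr (_ * _); apply: eq_bigr => k _; rewrite -normc_sqr.
Qed.

(** Applied to the q-th power of [f], of degree qD: its supremum is at most the l^1 norm of the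
    coefficients, which Cauchy-Schwarz and Parseval bound by the sum of squares on the coarsest
    admissible grid. There are as many coefficients as grid points, so the constant is 1. *)
Lemma nikolskii D q f x : is_trig D f ->
  normc (f x) ^+ (2 * q) <=
  \sum_(k : 'I_(q * D).*2.+1 * 'I_(q * D).*2.+1) normc (f (grid_point k)) ^+ (2 * q).
Proof.
move=> fD; have [c fc] := is_trigX q fD; set E := (q * D)%N in c fc *.
have -> : normc (f x) ^+ (2 * q) = normc (trig E c x) ^+ 2 by rewrite -fc normcX -exprM mulnC.
rewrite [leRHS](eq_bigr (fun k => normc (trig E c (grid_point k)) ^+ 2)); last first.
  by move=> k _; rewrite -fc normcX -exprM mulnC.
have L0 : (E.*2.+1%:R : R) != 0 by rewrite pnatr_eq0.
have := @parsevalr E.*2.+1 E c (leqnn _).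
move=> /(congr1 (fun z => E.*2.+1%:R ^+ 2 * z)); rewrite mulVKf ?expf_neq0// => <-.
apply: (@le_trans _ _ ((\sum_(k : box E) normc (c (box_mode k))) ^+ 2)).
  rewrite ler_pXn2r ?nnegrE ?normc_ge0 ?sumr_ge0//; last by move=> *; exact: normc_ge0.
  apply: le_trans (normc_sum _ _ _) _; apply: ler_sum => k _.
  by rewrite ComplexField.Normc.normcM normc_mode mulr1.
have := sum_cauchy_schwarz (index_enum (box E)) (fun=> 1) (fun k => normc (c (box_mode k))).
under eq_bigr do rewrite mul1r.
move=> /le_trans; apply; rewrite ler_wpM2r ?sumr_ge0 => // [*|]; first exact: exprn_ge0 (normc_ge0 _).
by under eq_bigr do rewrite expr1n; rewrite sumr_const card_prod card_ord natrM -expr2.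
Qed.

End FourierModes.

(** * Integrals of products over product sets *)

Section ProductIntegral.
Context {d1 d2 : measure_display} {T1 : measurableType d1} {T2 : measurableType d2} {R : realType}.
Context (m1 : {sigma_finite_measure set T1 -> \bar R}) (m2 : {sigma_finite_measure set T2 -> \bar R}).
Context (D1 : set T1) (D2 : set T2) (f : T1 -> R) (g : T2 -> R).
Hypotheses (mD1 : measurable D1) (mD2 : measurable D2).
Hypotheses (if1 : m1.-integrable D1 (EFin \o f)) (ig : m2.-integrable D2 (EFin \o g)).

Let F z := (f \_ D1) z.1 * (g \_ D2) z.2.

Let patchE : (fun z => f z.1 * g z.2) \_ (D1 `*` D2) = F.
Proof.
apply/funext => -[x y]; rewrite /F !patchE in_setX/=.
by case: (x \in D1) => /=; case: (y \in D2); rewrite ?mulr0 ?mul0r.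
Qed.

Let if' : m1.-integrable setT (EFin \o (f \_ D1)).
Proof. by have /(_ mD1)[/(_ if1)] := integrable_mkcond (mu := m1) (D := D1) (EFin \o f); rewrite restrict_EFin. Qed.

Let ig' : m2.-integrable setT (EFin \o (g \_ D2)).
Proof. by have /(_ mD2)[/(_ ig)] := integrable_mkcond (mu := m2) (D := D2) (EFin \o g); rewrite restrict_EFin. Qed.

Let iF : (m1 \x m2)%E.-integrable setT (EFin \o F).
Proof.
have mf : measurable_fun setT (f \_ D1) by have /integrableP[/measurable_EFinP] := if'.
have mg : measurable_fun setT (g \_ D2) by have /integrableP[/measurable_EFinP] := ig'.
apply/integrable12ltyP.
  apply/measurable_EFinP; apply: measurable_funM.
    by apply: measurableT_comp mf _; exact: measurable_fst.
  by apply: measurableT_comp mg _; exact: measurable_snd.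
have -> : (\int[m1]_x \int[m2]_y `|(EFin \o F) (x, y)| =
    \int[m1]_x (`|(f \_ D1) x|%:E * \int[m2]_y `|(g \_ D2) y|%:E))%E.
  apply: eq_integral => x _; rewrite -ge0_integralZl//; last first.
    by apply/measurable_EFinP; exact: measurableT_comp.
  by apply: eq_integral => y _; rewrite /F /= normrM EFinM.
have [_ hf] := integrableP _ _ _ if'; have [_ hg] := integrableP _ _ _ ig'.
rewrite ge0_integralZr//; last 2 first.
- by apply/measurable_EFinP; exact: measurableT_comp.
- by apply: integral_ge0 => y _; rewrite lee_fin.
apply: lte_mul_pinfty => //.
- by apply: integral_ge0 => y _; rewrite lee_fin.
- by rewrite ge0_fin_numE//; apply: integral_ge0 => y _; rewrite lee_fin.
Qed.

Lemma integrable_prod_measure :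
  (m1 \x m2)%E.-integrable (D1 `*` D2) (EFin \o (fun z => f z.1 * g z.2)).
Proof.
apply/integrable_mkcond; first exact: measurableX.
by rewrite restrict_EFin patchE.
Qed.

Lemma Rintegral_prod_measure :
  \int[(m1 \x m2)%E]_(z in D1 `*` D2) (f z.1 * g z.2) =
  (\int[m1]_(x in D1) f x) * (\int[m2]_(y in D2) g y).
Proof.
rewrite Rintegral_mkcond patchE [in RHS]Rintegral_mkcond [X in _ * X]Rintegral_mkcond.
rewrite /Rintegral -(integral12_prod_meas1 iF).
have fg := integrable_fin_num measurableT ig'; have ff := integrable_fin_num measurableT if'.
rewrite -fineM//; congr fine.
rewrite -(fineK fg) muleC -integralZl//; congr (integral _ _ _); apply/funext => x.
rewrite fineK// muleC [LHS](_ : _ = \int[m2]_y (((f \_ D1) x)%:E * ((g \_ D2) y)%:E))%E.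
  by rewrite integralZl.
by apply: eq_integral => y _; rewrite /F/= EFinM.
Qed.

End ProductIntegral.

(** * Integrals of modes over the torus *)

Section TorusIntegral.
Context {R : realType}.
Local Notation e := (@fourier_mode R).
Local Notation mu := (@lebesgue_measure R).

Lemma mode_axis m b : e m (axis b) = 1.
Proof.
have e1 : e (1, 0) (1, 0) = 1.
  rewrite /fourier_mode; have -> : phase (1, 0) (1, 0) = pi + pi :> R by rewrite /phase/=; ring.
  by rewrite cosD sinD sinpi cospi !mul0r !mulr0 addr0 subr0 mulrNN mulr1.
have eN k : e (Posz k, 0) (1, 0) = 1.
  elim: k => [|k IH]; first exact: mode0l.
  have -> : (Posz k.+1, 0) = (Posz k, 0) + (1, 0) :> (int * int)%type by congr pair; rewrite -addn1 PoszD.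
  by rewrite modeDl IH e1 mulr1.
have eZ k : e (k, 0) (1, 0) = 1.
  case: k => k; first exact: eN.
  have -> : (Negz k, 0) = - (Posz k.+1, 0) :> (int * int)%type by [].
  by rewrite modeNl eN conjc1.
rewrite -(eZ (if b then m.1 else m.2)) /fourier_mode /phase; case: b => /=.
  by rewrite !mulr0 !mulr1 !addr0.
by rewrite !mulr0 !mulr1 !addr0 add0r.
Qed.

Lemma mode_periodic m b x : e m (x + axis b) = e m x.
Proof. by rewrite modeDr mode_axis mulr1. Qed.

Let w (n : int) : R := 2 * pi * n%:~R.

Let wcos n : cos (w n) = 1 /\ sin (w n) = 0.
Proof.
have := mode_axis (n, 0) true; rewrite /fourier_mode /phase/= mulr1 mulr0 addr0 -/(w n).
by move=> [-> ->].
Qed.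

Lemma is_derive_affine (c a x : R) : is_derive x 1 (fun y : R => c * y + a) c.
Proof. by apply: is_derive_eq; rewrite addr0 /GRing.scale/= mulr1. Qed.

Lemma is_derive_sin_scale (c a x : R) :
  is_derive x 1 (fun y => sin (c * y + a)) (c * cos (c * x + a)).
Proof.
have h := is_derive_affine c a x.
by apply: is_derive_eq; rewrite /GRing.scale/= mulrC.
Qed.

Lemma is_derive_cos_scale (c a x : R) :
  is_derive x 1 (fun y => cos (c * y + a)) (- c * sin (c * x + a)).
Proof.
have h := is_derive_affine c a x.
by apply: is_derive_eq; rewrite /GRing.scale/=; ring.
Qed.

Let cont_cos (c a : R) : continuous (fun y : R => cos (c * y + a)).
Proof.
move=> x; apply: differentiable_continuous; apply/derivable1_diffP.
by have [] := is_derive_cos_scale c a x.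
Qed.

Let cos_integrable (c a : R) : mu.-integrable `[0, 1[ (EFin \o (fun x : R => cos (c * x + a))).
Proof.
have : mu.-integrable `[0, 1] (EFin \o (fun x : R => cos (c * x + a))).
  apply: continuous_compact_integrable; first exact: segment_compact.
  by apply: continuous_subspaceT; exact: cont_cos.
by apply: integrableS => //; exact: subset_itv_co_cc.
Qed.

Let int_cos n a : \int[mu]_(x in `[0, 1[) cos (w n * x + a) = (n == 0)%:R * cos a.
Proof.
rewrite Rintegral_itv_bndo_bndc; last exact: cos_integrable.
have [->|n0] := eqVneq n 0.
  rewrite mul1r /w mulr0; transitivity (\int[mu]_(x in `[0, 1]) (cos a * cst 1 x)).
    by apply: eq_Rintegral => x _; rewrite mul0r add0r mulr1.
  rewrite RintegralZl//; last first.
    apply: (@continuous_compact_integrable _ (cst 1)); first exact: segment_compact.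
    by apply: continuous_subspaceT => x; exact: cvg_cst.
  rewrite Rintegral_cst//= lebesgue_measure_itv/= lte_fin ltr01 mul1r.
  by rewrite -EFinB subr0 mulr1.
have wn : w n != 0.
  apply: mulf_neq0; last by rewrite intr_eq0.
  by apply: mulf_neq0; rewrite ?pnatr_eq0// gt_eqF ?pi_gt0.
rewrite mul0r /Rintegral (@continuous_FTC2 _ _ (fun x => (w n)^-1 * sin (w n * x + a)))//=.
- rewrite mulr1 mulr0 add0r sinD; have [-> ->] := wcos n.
  by rewrite mul0r add0r mul1r subrr.
- by apply: continuous_subspaceT; exact: cont_cos.
- have h (x : R) : is_derive x (1 : R) (fun x : R => (w n)^-1 * sin (w n * x + a)) (cos (w n * x + a)).
    apply: (is_derive_eq (is_deriveZ _ (is_derive_sin_scale (w n) a x))).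
    by rewrite /GRing.scale/= mulKf.
  have c x : {for x, continuous (fun x => (w n)^-1 * sin (w n * x + a))}.
    by apply: differentiable_continuous; apply/derivable1_diffP; have [] := h x.
  split; [by move=> x _; have [] := h x| | ].
    by apply: cvg_at_right_filter; exact: c.
  by apply: cvg_at_left_filter; exact: c.
- move=> x _; rewrite derive1E.
  apply: (@derive_val _ _ _ _ _ _ _ (is_derive_eq (is_deriveZ _ (is_derive_sin_scale (w n) a x)) _)).
  by rewrite /GRing.scale/= mulKf.
Qed.

Lemma sin_cos (x : R) : sin x = cos (x - pi / 2).
Proof. by rewrite cosB cos_pihalf sin_pihalf mulr0 mulr1 add0r. Qed.

(** Separation of variables; sines are written as shifted cosines so that [int_cos] evaluates every
    factor. *)
Let cosE m a (x : R * R) : cos (phase m x + a) =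
  cos (w m.1 * x.1 + a) * cos (w m.2 * x.2 + 0) -
  cos (w m.1 * x.1 + (a - pi / 2)) * cos (w m.2 * x.2 + (- (pi / 2))).
Proof.
have -> : phase m x + a = (w m.1 * x.1 + a) + w m.2 * x.2 by rewrite /phase /w/=; ring.
by rewrite cosD !addrA -!sin_cos addr0.
Qed.

Lemma integrable_torus_cos m a :
  (@plane_measure R).-integrable torus (EFin \o (fun x => cos (phase m x + a))).
Proof.
rewrite (_ : _ \o _ = (fun x : R * R => (cos (w m.1 * x.1 + a) * cos (w m.2 * x.2 + 0))%:E -
  (cos (w m.1 * x.1 + (a - pi / 2)) * cos (w m.2 * x.2 + (- (pi / 2))))%:E)%E); last first.
  by apply/funext => x /=; rewrite cosE EFinB.
apply: integrableB; first exact: measurableX.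
- exact: (integrable_prod_measure (m1 := mu) (m2 := mu) _ _ (cos_integrable _ _) (cos_integrable _ _)).
- exact: (integrable_prod_measure (m1 := mu) (m2 := mu) _ _ (cos_integrable _ _) (cos_integrable _ _)).
Qed.

Lemma Rintegral_torus_cos m a :
  \int[@plane_measure R]_(x in torus) cos (phase m x + a) = (m == 0)%:R * cos a.
Proof.
transitivity (\int[@plane_measure R]_(x in torus) (cos (w m.1 * x.1 + a) * cos (w m.2 * x.2 + 0) -
  cos (w m.1 * x.1 + (a - pi / 2)) * cos (w m.2 * x.2 + (- (pi / 2))))).
  by apply: eq_Rintegral => x _; exact: cosE.
rewrite RintegralB; [|exact: measurableX| | ]; last 2 first.
- exact: (integrable_prod_measure (m1 := mu) (m2 := mu) _ _ (cos_integrable _ _) (cos_integrable _ _)).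
- exact: (integrable_prod_measure (m1 := mu) (m2 := mu) _ _ (cos_integrable _ _) (cos_integrable _ _)).
have h a1 a2 : \int[@plane_measure R]_(x in torus) (cos (w m.1 * x.1 + a1) * cos (w m.2 * x.2 + a2)) =
    ((m.1 == 0)%:R * cos a1) * ((m.2 == 0)%:R * cos a2).
  rewrite -!int_cos.
  exact: (Rintegral_prod_measure (m1 := mu) (m2 := mu) _ _ (cos_integrable _ _) (cos_integrable _ _)).
rewrite !h cos0 cosN cos_pihalf !mulr0 subr0 mulr1 mulrAC -natrM mulnb.
by congr (_ %:R * _); case: m {h}.
Qed.

(** * Real trigonometric polynomials *)

Definition rtrig D (g : R * R -> R) : Prop := is_trig D (fun x => (g x)%:C%C).

Definition ravg L (g : R * R -> R) : R :=
  L%:R ^- 2 * \sum_(k : 'I_L * 'I_L) g (grid_point k).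

Lemma ravgE L g : grid_avg L (fun x => (g x)%:C%C) = (ravg L g)%:C%C.
Proof. by rewrite /grid_avg /ravg -rmorph_sum -rmorphM. Qed.

Lemma rtrigP D g : rtrig D g -> exists c : int * int -> R[i], forall x,
  g x = \sum_(k : box D) (complex.Re (c (box_mode k)) * cos (phase (box_mode k) x) -
                          complex.Im (c (box_mode k)) * sin (phase (box_mode k) x)).
Proof.
move=> [c gc]; exists c => x; have /(congr1 (@complex.Re R)) := gc x => /= ->.
rewrite /trig raddf_sum; apply: eq_bigr => k _; rewrite /fourier_mode.
by case: (c _).
Qed.

Lemma rtrig_integrable D g : rtrig D g -> (@plane_measure R).-integrable torus (EFin \o g).
Proof.
move=> /rtrigP[c gc].
have -> : EFin \o g = EFin \o (fun x => \sum_(k <- index_enum (box D)) 1 *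
    (complex.Re (c (box_mode k)) * cos (phase (box_mode k) x) -
                          complex.Im (c (box_mode k)) * sin (phase (box_mode k) x))).
  by apply/funext => x /=; rewrite gc; congr EFin; apply: eq_bigr => k _; rewrite mul1r.
have mT : measurable (@torus R) by exact: measurableX.
apply: integrable_sumZ => // k.
rewrite (_ : _ \o _ = (fun x : R * R => (complex.Re (c (box_mode k)))%:E * (cos (phase (box_mode k) x + 0))%:E -
    (complex.Im (c (box_mode k)))%:E * (cos (phase (box_mode k) x + (- (pi / 2))))%:E)%E); last first.
  by apply/funext => x /=; rewrite addr0 sin_cos EFinB !EFinM.
by apply: integrableB => //; apply: integrableZl => //; exact: integrable_torus_cos.
Qed.

(** Both sides are the coefficient of frequency 0: the grid average because D < L excludes aliasing,
    the integral because every other mode integrates to 0. *)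
Lemma rtrig_Rintegral D L g : rtrig D g -> (D < L)%N ->
  \int[@plane_measure R]_(x in torus) g x = ravg L g.
Proof.
move=> gD DL; apply: (@complexI R); rewrite -ravgE.
have [c gc] := gD.
have -> : (fun x => (g x)%:C%C) = trig D c by apply/funext.
rewrite grid_avg_trig0//; have -> : c 0 = (complex.Re (c 0))%:C%C.
  have : (ravg L g)%:C%C = c 0 by rewrite -ravgE -(grid_avg_trig0 c DL); exact: eq_grid_avg.
  by move=> <-.
congr (_%:C%C).
have mT : measurable (@torus R) by exact: measurableX.
transitivity (\int[@plane_measure R]_(x in torus) (\sum_(k <- index_enum (box D)) 1 *
    (complex.Re (c (box_mode k)) * cos (phase (box_mode k) x + 0) -
     complex.Im (c (box_mode k)) * cos (phase (box_mode k) x + - (pi / 2))))).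
  apply: eq_Rintegral => x _; have /(congr1 (@complex.Re R)) := gc x => /= ->.
  rewrite /trig raddf_sum; apply: eq_bigr => k _; rewrite /fourier_mode mul1r addr0 -sin_cos.
  by case: (c _).
have i1 (b : R) m a : (@plane_measure R).-integrable torus (EFin \o (fun x => b * cos (phase m x + a))).
  rewrite (_ : _ \o _ = (fun x : R * R => b%:E * (cos (phase m x + a))%:E)%E).
    exact: integrableZl (integrable_torus_cos m a).
  by apply/funext => x /=; rewrite EFinM.
rewrite Rintegral_sumZ//; last first.
  move=> k; rewrite (_ : _ \o _ = (fun x : R * R => (complex.Re (c (box_mode k)) * cos (phase (box_mode k) x + 0))%:E -
     (complex.Im (c (box_mode k)) * cos (phase (box_mode k) x + - (pi / 2)))%:E)%E).
    by apply: integrableB; [exact: mT|exact: i1|exact: i1].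
  by apply/funext => x /=; rewrite EFinB.
have k0 : exists k : box D, box_mode k = 0 by apply: in_boxP; rewrite /in_box.
case: k0 => k0 k0E; rewrite (bigD1 k0)//= big1 ?addr0 => [|k kk]; last first.
  rewrite RintegralB// !RintegralZl//; [|exact: integrable_torus_cos|exact: integrable_torus_cos].
  rewrite !Rintegral_torus_cos -k0E (inj_eq (@box_mode_inj D)) (negbTE kk).
  by rewrite !mul0r !mulr0 subrr mulr0.
rewrite RintegralB// !RintegralZl//; [|exact: integrable_torus_cos|exact: integrable_torus_cos].
by rewrite !Rintegral_torus_cos k0E eqxx cosN cos_pihalf cos0 !mulr0 subr0 !mul1r mulr1.
Qed.

Lemma rtrig_le D D' g : (D <= D')%N -> rtrig D g -> rtrig D' g.
Proof. exact: is_trig_le. Qed.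

Lemma rtrigD D f g : rtrig D f -> rtrig D g -> rtrig D (fun x => f x + g x).
Proof. by move=> fD gD; apply: eq_is_trig (is_trigD fD gD) => x /=; rewrite rmorphD. Qed.

Lemma rtrigZ D c f : rtrig D f -> rtrig D (fun x => c * f x).
Proof. by move=> fD; apply: eq_is_trig (is_trigZ c%:C%C fD) => x /=; rewrite rmorphM. Qed.

Lemma rtrigM D D' f g : rtrig D f -> rtrig D' g -> rtrig (D + D') (fun x => f x * g x).
Proof. by move=> fD gD; apply: eq_is_trig (is_trigM fD gD) => x /=; rewrite rmorphM. Qed.

Lemma rtrigX D n f : rtrig D f -> rtrig (n * D) (fun x => f x ^+ n).
Proof. by move=> fD; apply: eq_is_trig (is_trigX n fD) => x /=; rewrite rmorphXn. Qed.

Lemma rtrig_prod D n (f : 'I_n -> R * R -> R) : (forall i, rtrig D (f i)) ->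
  rtrig (n * D) (fun x => \prod_i f i x).
Proof.
move=> fD; have := is_trig_prod (index_enum 'I_n) fD.
have -> : size (index_enum 'I_n) = n by rewrite /index_enum; case: index_enum_key; rewrite -enumT size_enum_ord.
by apply: eq_is_trig => x; rewrite rmorph_prod.
Qed.

Lemma rtrig_cst D c : rtrig D (fun=> c).
Proof. exact: is_trig_cst. Qed.

Lemma rtrig_Re D f : is_trig D f -> rtrig D (fun x => complex.Re (f x)).
Proof. exact: is_trig_Re. Qed.

Lemma rtrig_Im D f : is_trig D f -> rtrig D (fun x => complex.Im (f x)).
Proof.
move=> /(is_trigZ (- 'i%C)) /rtrig_Re; apply: eq_is_trig => x; congr (_%:C%C).
by case: (f x) => a b /=; rewrite oppr0 !mul0r sub0r mulN1r opprK.
Qed.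

Lemma rtrig_opp D f : rtrig D f -> rtrig D (fun x => f (- x)).
Proof. exact: is_trig_opp. Qed.

Lemma rtrig_shift D f y : rtrig D f -> rtrig D (fun x => f (x + y)).
Proof. exact: is_trig_shift. Qed.

(** * Time integrals *)

Lemma integral_exp_le (c t : R) : 0 < c ->
  (\int[mu]_(s in `]-oo, t]) (expR (- ((t - s) * c)))%:E = c^-1%:E)%E.
Proof.
move=> c0; have ct (b : R) : continuous (fun x : R => expR (- ((t - x) * b))).
  by move=> x; apply: continuous_comp; [|exact: continuous_expR];
    apply: cvgN; apply: cvgM; [apply: cvgB; [exact: cvg_cst|exact: cvg_id]|exact: cvg_cst].
rewrite -[t in `]-oo, t]]opprK ge0_integration_by_substitutionNy; last 2 first.
- by rewrite opprK; apply: continuous_subspaceT; exact: ct.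
- by move=> x _; exact: expR_ge0.
pose F (x : R) : R := - c^-1 * expR (- ((t + x) * c)).
have dF (x : R) : is_derive x (1 : R) F (expR (- ((t + x) * c))).
  have h : is_derive x 1 (fun y : R => - ((t + y) * c)) (- c).
    rewrite (_ : (fun y : R => _) = (fun y => (- c) * y + (- (t * c)))); last by apply/funext => y; ring.
    exact: is_derive_affine.
  have h2 : is_derive x 1 (fun y : R => expR (- ((t + y) * c))) (expR (- ((t + x) * c)) * (- c)).
    by apply: is_derive_eq; rewrite /GRing.scale/= mulrC.
  apply: (is_derive_eq (is_deriveZ _ h2)); rewrite /GRing.scale/=.
  by rewrite mulrCA mulrNN mulVf ?gt_eqF// mulr1.
have cF x : {for x, continuous F}.
  by apply: differentiable_continuous; apply/derivable1_diffP; have [] := dF x.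
rewrite (_ : (fun x => _) = (fun x : R => (expR (- ((t + x) * c)))%:E)); last first.
  by apply/funext => x /=; rewrite opprK.
rewrite (@ge0_continuous_FTC2y _ _ F _ 0).
- by rewrite /F subrr mul0r oppr0 expR0 mulr1 sub0e -EFinN opprK.
- by move=> x _; exact: expR_ge0.
- apply: continuous_subspaceT => x.
  by apply: continuous_comp; [|exact: continuous_expR];
    apply: cvgN; apply: cvgM; [apply: cvgD; [exact: cvg_cst|exact: cvg_id]|exact: cvg_cst].
- rewrite -[X in _ --> X](mulr0 (- c^-1)); apply: cvgM; first exact: cvg_cst.
  apply: (@cvg_comp _ _ _ (fun x : R => (t + x) * c) (fun y => expR (- y)) _ +oo); last exact: cvgr_expR.
  apply/cvgryPge => A; near=> x; rewrite -ler_pdivrMr// -lerBlDl.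
  by near: x; apply: nbhs_pinfty_ge; rewrite num_real.
- by move=> x _; have [] := dF x.
- by apply: cvg_at_right_filter; exact: cF.
- by move=> x _; rewrite derive1E; have [] := dF x.
Unshelve. all: by end_near. Qed.

Lemma integral_exp_ge (c : R) : 0 < c ->
  (\int[mu]_(s in `[(0 : R)%R, +oo[) (expR (- (s * c)))%:E = c^-1%:E)%E.
Proof.
move=> c0; rewrite -(integral_exp_le 0 c0) -[in RHS]oppr0 ge0_integration_by_substitutionNy.
- by apply: eq_integral => s _ /=; rewrite oppr0 add0r opprK.
- apply: continuous_subspaceT => x.
  by apply: continuous_comp; [|exact: continuous_expR];
    apply: cvgN; apply: cvgM; [apply: cvgB; [exact: cvg_cst|exact: cvg_id]|exact: cvg_cst].
- by move=> x _; exact: expR_ge0.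
Qed.

End TorusIntegral.

Lemma ge0_integrable (R : realType) d (T : measurableType d) (mu : {measure set T -> \bar R})
    (D : set T) (f : T -> R) : (forall x, 0 <= f x) -> measurable_fun D f ->
  (\int[mu]_(x in D) (f x)%:E < +oo)%E -> mu.-integrable D (EFin \o f).
Proof.
move=> f0 mf fi; apply/integrableP; split; first exact/measurable_EFinP.
rewrite (_ : (fun x => `|(EFin \o f) x|%E) = EFin \o f)//.
by apply/funext => x /=; rewrite ger0_norm.
Qed.

(** * Truncated heat kernels and the covariance of the stationary field *)

Section HeatKernels.
Context {R : realType}.
Local Notation mu := (@lebesgue_measure R).
Local Notation eigen := (@eigen R).

Lemma eigen_ge1 m : 1 <= eigen m.
Proof. by rewrite /eigen lerDl; apply: mulr_ge0; [apply: mulr_ge0 => //|]; exact: sqr_ge0. Qed.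

Lemma eigen_gt0 m : 0 < eigen m.
Proof. exact: lt_le_trans ltr01 (eigen_ge1 m). Qed.

Lemma eigenE m : eigen m = 1 + 4 * pi ^+ 2 * (m.1%:~R ^+ 2 + m.2%:~R ^+ 2).
Proof. by rewrite /eigen /norm2 sqr_sqrtr// addr_ge0 ?sqr_ge0. Qed.

Lemma eigenN m : eigen (- m) = eigen m.
Proof. by rewrite !eigenE/= !mulrNz !sqrrN. Qed.

Lemma disc_in_box M m : @disc R M m -> in_box M m.
Proof.
have h (a b : int) : Num.sqrt ((a%:~R : R) ^+ 2 + b%:~R ^+ 2) <= M%:R -> (`|a| <= M)%N.
  move=> hab; have : `|a%:~R : R| <= M%:R.
    by apply: le_trans hab; rewrite -sqrtr_sqr ler_wsqrtr// lerDl sqr_ge0.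
  by rewrite -intr_norm -[M%:R]/((Posz M)%:~R) ler_int; lia.
rewrite /disc/= /norm2 /lattice /in_box/= => hm.
by rewrite (h m.1 m.2)//= (h m.2 m.1)// addrC.
Qed.

Lemma discN M m : @disc R M (- m) = @disc R M m.
Proof. by rewrite /disc /norm2/= !mulrNz !sqrrN. Qed.

Definition in_disc M m : R := (m \in @disc R M)%:R.

Lemma in_discN M m : in_disc M (- m) = in_disc M m.
Proof. by rewrite /in_disc; congr (nat_of_bool _)%:R; apply/idP/idP => /set_mem h; apply/mem_set; move: h; rewrite discN. Qed.

Lemma heat_kernelNE K M r (x : R * R) : (M <= K)%N -> heat_kernelN M r x =
  \sum_(k : box K) in_disc M (box_mode k) * expR (- (r * eigen (box_mode k))) * cos (phase (box_mode k) x).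
Proof.
move=> MK; rewrite /heat_kernelN (@fsbig_box _ K); last by move=> m /disc_in_box; exact: in_box_le.
rewrite raddf_sum big_mkcond; apply: eq_bigr => k _; rewrite /in_disc.
by case: (_ \in _); rewrite ?mul0r//= mul0r subr0 mul1r.
Qed.

(** Common form of [field_kernel] and of the kernel in [renorm], so that inner products are computed
    once. *)
Definition modes_kernel K (a : int * int -> R -> R) (y : R * R) (z : spacetime R) : R :=
  \sum_(k : box K) a (box_mode k) z.1 * cos (phase (box_mode k) (z.2 - y)).

Section ModesInner.
Variables (K : nat) (a b : int * int -> R -> R) (v : int * int -> R) (y y' : R * R).
Hypothesis iab : forall m l, mu.-integrable setT (EFin \o (fun s => a m s * b l s)).
Hypothesis bN : forall m, b (- m) = b m.
Hypothesis abv : forall m, \int[mu]_s (a m s * b m s) = v m.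

Let t m l (x : plane R) : R := cos (phase m (x - y)) * cos (phase l (x - y')).

Let tE m l x : t m l x = 2^-1 * (cos (phase (m - l) x + (phase l y' - phase m y)) +
  cos (phase (m + l) x + (- phase l y' - phase m y))).
Proof.
rewrite /t phaseDl phaseDl phaseNl !phaseDr !phaseNr.
set A := phase m x; set B := phase l x; set A' := phase m y; set B' := phase l y'.
have -> : A - B + (B' - A') = (A - A') - (B - B') by ring.
have -> : A + B + (- B' - A') = (A - A') + (B - B') by ring.
by rewrite [cos (_ - _ - _)]cosB [cos (_ - _ + _)]cosD; field.
Qed.

Let it m l : (@plane_measure R).-integrable torus (EFin \o t m l).
Proof.
rewrite (_ : _ \o _ = (fun x : R * R => (2^-1)%:E * ((cos (phase (m - l) x + (phase l y' - phase m y)))%:E +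
  (cos (phase (m + l) x + (- phase l y' - phase m y)))%:E))%E); last first.
  by apply/funext => x /=; rewrite tE EFinM EFinD.
have mT : measurable (@torus R) by exact: measurableX.
by apply: integrableZl => //; apply: integrableD => //; exact: integrable_torus_cos.
Qed.

Let It m l : \int[@plane_measure R]_(x in torus) t m l x =
  2^-1 * ((m == l)%:R + (m == - l)%:R) * cos (phase m (y - y')).
Proof.
have mT : measurable (@torus R) by exact: measurableX.
transitivity (\int[@plane_measure R]_(x in torus) (2^-1 * (cos (phase (m - l) x + (phase l y' - phase m y)) +
  cos (phase (m + l) x + (- phase l y' - phase m y))))).
  by apply: eq_Rintegral => x _; exact: tE.
rewrite RintegralZl//; last first.
  rewrite (_ : _ \o _ = (fun x : R * R => ((cos (phase (m - l) x + (phase l y' - phase m y)))%:E +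
  (cos (phase (m + l) x + (- phase l y' - phase m y)))%:E))%E)//.
  by apply: integrableD => //; exact: integrable_torus_cos.
rewrite RintegralD//; [|exact: integrable_torus_cos|exact: integrable_torus_cos].
rewrite !Rintegral_torus_cos subr_eq0 addr_eq0 -mulrA; congr (_ * _).
rewrite mulrDl; congr (_ + _).
  by case: eqP => [->|]; rewrite ?mul0r// !mul1r phaseDr phaseNr -opprB cosN.
case: eqP => [->|]; rewrite ?mul0r// !mul1r !phaseNl phaseDr phaseNr.
by rewrite -[RHS]cosN; congr cos; ring.
Qed.

Let prodE z : modes_kernel K a y z * modes_kernel K b y' z =
  \sum_(p <- index_enum (box K * box K)%type) 1 *
    ((a (box_mode p.1) z.1 * b (box_mode p.2) z.1) * t (box_mode p.1) (box_mode p.2) z.2).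
Proof.
rewrite /modes_kernel big_distrl/=.
rewrite [RHS](eq_bigr (fun p => (a (box_mode p.1) z.1 * b (box_mode p.2) z.1) *
   t (box_mode p.1) (box_mode p.2) z.2)) => [|p _]; last by rewrite mul1r.
rewrite -(pair_bigA _ (fun k l => a (box_mode k) z.1 * b (box_mode l) z.1 * t (box_mode k) (box_mode l) z.2))/=.
by apply: eq_bigr => k _; rewrite big_distrr/=; apply: eq_bigr => l _; rewrite mulrACA.
Qed.

Let iprod m l : (@spacetime_measure R).-integrable cylinder
  (EFin \o (fun z => (a m z.1 * b l z.1) * t m l z.2)).
Proof.
apply: (integrable_prod_measure (m1 := mu) (m2 := @plane_measure R) _ _ (iab m l) (it m l)) => //.
exact: measurableX.
Qed.

Lemma integrable_modes_kernel : (@spacetime_measure R).-integrable cylinder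
  (EFin \o (fun z => modes_kernel K a y z * modes_kernel K b y' z)).
Proof.
rewrite (_ : _ \o _ = EFin \o (fun z => \sum_(p <- index_enum (box K * box K)%type) 1 *
    ((a (box_mode p.1) z.1 * b (box_mode p.2) z.1) * t (box_mode p.1) (box_mode p.2) z.2))).
  by apply: integrable_sumZ => [|p]; [exact: measurable_cylinder|exact: iprod].
by apply/funext => z; rewrite /comp prodE.
Qed.

(** In the product of two cosines only the frequencies m = l and m = - l survive the integral over
    the torus, with weight 1/2 each; the evenness of [b] in frequency merges them. *)
Lemma inner_modes_kernel : inner (modes_kernel K a y) (modes_kernel K b y') =
  \sum_(k : box K) v (box_mode k) * cos (phase (box_mode k) (y - y')).
Proof.
transitivity (\int[@spacetime_measure R]_(z in cylinder) (\sum_(p <- index_enum (box K * box K)%type) 1 *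
    ((a (box_mode p.1) z.1 * b (box_mode p.2) z.1) * t (box_mode p.1) (box_mode p.2) z.2))).
  by apply: eq_Rintegral => z _; exact: prodE.
rewrite Rintegral_sumZ; [|exact: measurable_cylinder|by move=> p; exact: iprod].
have I m l : \int[@spacetime_measure R]_(z in cylinder) ((a m z.1 * b l z.1) * t m l z.2) =
    (\int[mu]_s (a m s * b l s)) * (2^-1 * ((m == l)%:R + (m == - l)%:R) * cos (phase m (y - y'))).
  rewrite -It; apply: (Rintegral_prod_measure (m1 := mu) (m2 := @plane_measure R) _ _ (iab m l) (it m l)) => //.
  exact: measurableX.
rewrite (eq_bigr (fun p : box K * box K => (fun k l => (\int[mu]_s (a (box_mode k) s * b (box_mode l) s)) *
  (2^-1 * ((box_mode k == box_mode l)%:R + (box_mode k == - box_mode l)%:R) *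
   cos (phase (box_mode k) (y - y')))) p.1 p.2)) => [|p _]; last by rewrite mul1r; exact: I.
rewrite -(pair_bigA _ (fun k l => (\int[mu]_s (a (box_mode k) s * b (box_mode l) s)) *
  (2^-1 * ((box_mode k == box_mode l)%:R + (box_mode k == - box_mode l)%:R) *
   cos (phase (box_mode k) (y - y')))))/=.
apply: eq_bigr => k _; have [k' k'E] : exists k' : box K, box_mode k' = - box_mode k.
  by apply: in_boxP; rewrite in_boxN box_modeP.
have d (j : box K) (F : box K -> R) : \sum_l F l * (j == l)%:R = F j.
  by rewrite (bigD1 j)//= eqxx mulr1 big1 ?addr0// => l /negbTE lj; rewrite eq_sym lj mulr0.
rewrite (eq_bigr (fun l => (2^-1 * cos (phase (box_mode k) (y - y'))) *
   ((\int[mu]_s (a (box_mode k) s * b (box_mode l) s)) * (k == l)%:R +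
   (\int[mu]_s (a (box_mode k) s * b (box_mode l) s)) * (k' == l)%:R))); last first.
  move=> l _; rewrite (inj_eq (@box_mode_inj K)).
  have -> : (box_mode k == - box_mode l) = (k' == l).
    by rewrite -(inj_eq (@box_mode_inj K)) k'E eqr_oppLR.
  by ring.
by rewrite -mulr_sumr big_split/= !d k'E bN !abv; field.
Qed.

End ModesInner.

Definition time_mode M t m (s : R) : R :=
  \1_[set` `]-oo, t[] s * (in_disc M m * expR (- ((t - s) * eigen m))).

(* The integrand of Z^M_{-oo,t}(y); the strict cut differs from the one of
   [wick_kernel] on a null set, where the series of [heat_kernel] diverges. *)
Definition field_kernel M t y (z : spacetime R) : R :=
  \1_[set` `]-oo, t[] z.1 * heat_kernelN M (t - z.1) (z.2 - y).

Lemma field_kernelE K M t y : (M <= K)%N -> field_kernel M t y = modes_kernel K (time_mode M t) y.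
Proof.
move=> MK; apply/funext => z; rewrite /field_kernel (heat_kernelNE _ _ MK) mulr_sumr.
by apply: eq_bigr => k _; rewrite /time_mode !mulrA.
Qed.

Let iexp t c : 0 < c ->
  mu.-integrable setT (EFin \o (fun s => \1_[set` `]-oo, t[] s * expR (- ((t - s) * c)))) /\
  \int[mu]_s (\1_[set` `]-oo, t[] s * expR (- ((t - s) * c))) = c^-1.
Proof.
move=> c0; have mE : measurable_fun [set: R] (fun s : R => expR (- ((t - s) * c))).
  apply: continuous_measurable_fun => x.
  by apply: continuous_comp; [|exact: continuous_expR];
    apply: cvgN; apply: cvgM; [apply: cvgB; [exact: cvg_cst|exact: cvg_id]|exact: cvg_cst].
have h : (\int[mu]_s (\1_[set` `]-oo, t[] s * expR (- ((t - s) * c)))%:E = c^-1%:E)%E.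
  rewrite -(integral_exp_le t c0) -integral_itv_bndo_bndc; last first.
    by apply/measurable_EFinP; exact: measurable_funTS.
  rewrite [RHS]integral_mkcond; apply: eq_integral => s _; rewrite patchE indicE.
  by case: ifPn; rewrite ?mul1r ?mul0r.
split; last by rewrite /Rintegral h.
apply: ge0_integrable; last by rewrite h ltry.
- by move=> s; rewrite mulr_ge0 ?expR_ge0// indicE.
- by apply: measurable_funM => //; exact: measurable_indic.
Qed.

Let time_modeM M M' t t' m l :
  mu.-integrable setT (EFin \o (fun s => time_mode M t m s * time_mode M' t' l s)) /\
  (m = l -> \int[mu]_s (time_mode M t m s * time_mode M' t' l s) =
   in_disc M m * in_disc M' m * expR (- (`|t - t'| * eigen m)) / (2 * eigen m)).
Proof.
wlog tt : M M' t t' m l / t <= t' => [wl|].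
  have [/wl//|/ltW/wl h] := leP t t'.
  have [h1 h2] := h M' M l m; have E : (fun s => time_mode M t m s * time_mode M' t' l s) =
    (fun s => time_mode M' t' l s * time_mode M t m s) by apply/funext => s; rewrite mulrC.
  by rewrite E; split => // ml; rewrite h2// ml distrC [in_disc M' _ * _]mulrC.
(* For s < t the exponential from time t' factors through time t, which leaves one exponential in t
   - s of rate [eigen m + eigen l]. *)
pose C := in_disc M m * in_disc M' l * expR (- ((t' - t) * eigen l)).
have E : (fun s => time_mode M t m s * time_mode M' t' l s) =
   (fun s => C * (\1_[set` `]-oo, t[] s * expR (- ((t - s) * (eigen m + eigen l))))).
  apply/funext => s; rewrite /time_mode !indicE !mem_setE !in_itv/=.
  case: ltP => st; last by rewrite !mul0r !mulr0.
  rewrite (lt_le_trans st tt) !mul1r /C.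
  have -> : expR (- ((t' - s) * eigen l)) = expR (- ((t' - t) * eigen l)) * expR (- ((t - s) * eigen l)).
    by rewrite -expRD; congr expR; ring.
  have -> : expR (- ((t - s) * (eigen m + eigen l))) = expR (- ((t - s) * eigen m)) * expR (- ((t - s) * eigen l)).
    by rewrite -expRD; congr expR; ring.
  by ring.
rewrite E; have [h1 h2] := iexp t (addr_gt0 (eigen_gt0 m) (eigen_gt0 l)).
split.
  rewrite (_ : _ \o _ = (fun s => C%:E * (\1_[set` `]-oo, t[] s * expR (- ((t - s) * (eigen m + eigen l))))%:E)%E)//.
  exact: integrableZl.
move=> ml; rewrite RintegralZl// h2 -ml /C -ml; have -> : eigen m + eigen m = 2 * eigen m by ring.
by rewrite distrC ger0_norm ?subr_ge0.
Qed.

Lemma inner_field_kernel K M M' t t' y y' : (M <= K)%N -> (M' <= K)%N ->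
  inner (field_kernel M t y) (field_kernel M' t' y') =
  \sum_(k : box K) in_disc M (box_mode k) * in_disc M' (box_mode k) *
    expR (- (`|t - t'| * eigen (box_mode k))) / (2 * eigen (box_mode k)) *
    cos (phase (box_mode k) (y - y')).
Proof.
move=> MK MK'; rewrite (field_kernelE _ _ MK) (field_kernelE _ _ MK').
apply: (@inner_modes_kernel K (time_mode M t) (time_mode M' t') (fun m => in_disc M m * in_disc M' m *
    expR (- (`|t - t'| * eigen m)) / (2 * eigen m))).
- by move=> m l; have [] := time_modeM M M' t t' m l.
- by move=> m; apply/funext => s; rewrite /time_mode in_discN eigenN.
- by move=> m; have [_ ->] := time_modeM M M' t t' m m.
Qed.

Let mtime_mode M t m : measurable_fun [set: R] (time_mode M t m).
Proof.
apply: measurable_funM; first exact: measurable_indic.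
apply: measurable_funM => //; apply: continuous_measurable_fun => x.
by apply: continuous_comp; [|exact: continuous_expR];
    apply: cvgN; apply: cvgM; [apply: cvgB; [exact: cvg_cst|exact: cvg_id]|exact: cvg_cst].
Qed.

Let mcos m (y : R * R) : measurable_fun [set: plane R] (fun x : plane R => cos (phase m (x - y))).
Proof.
have mc : measurable_fun [set: R] (@cos R).
  by apply: continuous_measurable_fun; exact: continuous_cos.
apply: (measurableT_comp mc); rewrite /phase/=.
apply: measurable_funM => //; apply: measurable_funD; apply: measurable_funM => //;
  exact: measurable_funD.
Qed.

Lemma measurable_field_kernel M t y : measurable_fun [set: spacetime R] (field_kernel M t y).
Proof.
rewrite (field_kernelE _ _ (leqnn M)); apply: measurable_sum => k; apply: measurable_funM.
  by apply: measurableT_comp (mtime_mode _ _ _) _; exact: measurable_fst.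
by apply: measurableT_comp (mcos _ _) _; exact: measurable_snd.
Qed.

Lemma square_integrable_field_kernel M t y : square_integrable (field_kernel M t y).
Proof.
split; first by apply: measurable_funTS; exact: measurable_field_kernel.
have := @integrable_modes_kernel M (time_mode M t) (time_mode M t) y y
  (fun m l => (time_modeM M M t t m l).1).
rewrite -(field_kernelE _ _ (leqnn M)) => /integrableP[_]; apply: le_lt_trans.
rewrite (eq_integral (fun z => `|(field_kernel M t y z * field_kernel M t y z)%:E|%E)) //.
by move=> z _; rewrite -expr2 /= ger0_norm ?sqr_ge0.
Qed.

(** By stationarity the renormalization constant is the variance of the Galerkin field at every time
    and point. This is what makes [stationaryN] an exact Wick power. *)
Lemma renormE M t y : renorm M = inner (field_kernel M t y) (field_kernel M t y).
Proof.
rewrite (inner_field_kernel _ _ _ _ (leqnn M) (leqnn M)).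
pose a m (s : R) := \1_[set` `[0, +oo[] s * (in_disc M m * expR (- (s * eigen m))).
have aE : (fun z => \1_[set` `[0, +oo[] z.1 * heat_kernelN M z.1 z.2) = modes_kernel M a 0.
  apply/funext => z; rewrite (heat_kernelNE _ _ (leqnn M)) mulr_sumr.
  by apply: eq_bigr => k _; rewrite /a subr0 !mulrA.
have h c : 0 < c -> mu.-integrable setT (EFin \o (fun s => \1_[set` `[0, +oo[] s * expR (- (s * c)))) /\
    \int[mu]_s (\1_[set` `[0, +oo[] s * expR (- (s * c))) = c^-1.
  move=> c0; have mE : measurable_fun [set: R] (fun s : R => expR (- (s * c))).
    apply: continuous_measurable_fun => x.
    by apply: continuous_comp; [|exact: continuous_expR];
      apply: cvgN; apply: cvgM; [exact: cvg_id|exact: cvg_cst].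
  have I : (\int[mu]_s (\1_[set` `[0, +oo[] s * expR (- (s * c)))%:E = c^-1%:E)%E.
    rewrite -(integral_exp_ge c0) [RHS]integral_mkcond; apply: eq_integral => s _; rewrite patchE indicE.
    by case: ifPn; rewrite ?mul1r ?mul0r.
  split; last by rewrite /Rintegral I.
  apply: ge0_integrable; last by rewrite I ltry.
  - by move=> s; rewrite mulr_ge0 ?expR_ge0// indicE.
  - by apply: measurable_funM => //; exact: measurable_indic.
have aM m l : (fun s => a m s * a l s) = (fun s => in_disc M m * in_disc M l *
    (\1_[set` `[0, +oo[] s * expR (- (s * (eigen m + eigen l))))).
  apply/funext => s; rewrite /a !indicE; case: (_ \in _); last by rewrite !mul0r !mulr0.
  have -> : expR (- (s * (eigen m + eigen l))) = expR (- (s * eigen m)) * expR (- (s * eigen l)).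
    by rewrite -expRD; congr expR; ring.
  by rewrite !mul1r; ring.
transitivity (inner (modes_kernel M a 0) (modes_kernel M a 0)).
  by rewrite -aE; apply: eq_Rintegral => z _; rewrite expr2.
rewrite (@inner_modes_kernel M a a (fun m => in_disc M m * in_disc M m / (2 * eigen m))).
- by apply: eq_bigr => k _; rewrite !subrr normr0 mul0r oppr0 expR0 mulr1.
- move=> m l; rewrite aM; have [h1 _] := h _ (addr_gt0 (eigen_gt0 m) (eigen_gt0 l)).
  rewrite (_ : _ \o _ = (fun s => (in_disc M m * in_disc M l)%:E * (\1_[set` `[0, +oo[] s * expR (- (s * (eigen m + eigen l))))%:E)%E)//.
  exact: integrableZl.
- by move=> m; apply/funext => s; rewrite /a in_discN eigenN.
- move=> m; rewrite aM; have [h1 h2] := h _ (addr_gt0 (eigen_gt0 m) (eigen_gt0 m)).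
  by rewrite RintegralZl// h2; congr (_ / _); ring.
Qed.

End HeatKernels.

(** * Convergence of the heat kernels *)

Section LatticeSums.
Context {R : realType}.
Local Notation eigen := (@eigen R).

Lemma expRN_le_powR (s : R) : 0 <= s ->
  exists2 C : R, 0 < C & forall x, 0 < x -> expR (- x) <= C * x `^ (- s).
Proof.
move=> s0; pose k := (Num.truncn s).+1.
have sk : s <= k%:R by apply: ltW; exact: truncnS_gt.
(* For x >= 1 a single term of the exponential series suffices; for x < 1 the right-hand side is at
   least 1. *)
exists (k.+1)`!%:R => [|x x0]; first by rewrite ltr0n fact_gt0.
have [x1|x1] := leP 1 x.
  have h : x `^ s <= (k.+1)`!%:R * expR x.
    apply: (@le_trans _ _ (x ^+ k.+1)).
      rewrite -powR_mulrn ?(ltW x0)//; apply: ler_powR => //; apply: le_trans sk _.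
      by rewrite ler_nat.
    have := expR_ge1Dxn k (ltW x0) => h.
    rewrite -ler_pdivrMl ?ltr0n ?fact_gt0// mulrC; apply: le_trans h.
    by rewrite lerDr.
  rewrite expRN powRN ler_pdivlMr ?powR_gt0//.
  by rewrite mulrC ler_pdivrMr ?expR_gt0.
apply: (@le_trans _ _ 1); first by rewrite -expR0 ler_expR oppr_le0 ltW.
apply: (@le_trans _ _ (1 * 1)); first by rewrite mulr1.
apply: ler_pM => //; first by rewrite ler1n fact_gt0.
rewrite powRN -[leLHS]invr1 lef_pV2 ?posrE ?powR_gt0//.
by apply: le_trans (ge0_ler_powR s0 _ _ (ltW x1)) _; rewrite ?powR1 ?nnegrE ?ler01 ?(ltW x0).
Qed.

(** Cauchy condensation: the indices from 2^k - 1 up to, but excluding, 2^(k+1) - 1 contribute at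
    most [rho ^+ k]. *)
Lemma zeta_bounded (s : R) : 1 < s -> exists B : R, forall n,
  \sum_(0 <= i < n) (i.+1)%:R `^ (- s) <= B.
Proof.
move=> s1; pose rho : R := 2 `^ (1 - s); have r0 : 0 <= rho by exact: powR_ge0.
have r1 : rho < 1.
  by rewrite /rho /powR pnatr_eq0/= expR_lt1 pmulr_llt0 ?subr_lt0// ln_gt0// ltr1n.
exists ((1 - rho)^-1) => n.
have h k : \sum_(0 <= i < (2 ^ k).-1) (i.+1)%:R `^ (- s) <= \sum_(0 <= j < k) rho ^+ j.
  elim: k => [|k IH]; first by rewrite !big_geq.
  rewrite (big_cat_nat (n := (2 ^ k).-1))//=; last first.
    by rewrite -!subn1 leq_sub2r// leq_exp2l.
  rewrite big_nat_recr//=; apply: lerD => //.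
  rewrite big_nat_cond; apply: (@le_trans _ _ (\sum_((2 ^ k).-1 <= i < (2 ^ k.+1).-1) (2 ^ k)%:R `^ (- s))).
    rewrite [leRHS]big_nat_cond; apply: ler_sum => i /andP[/andP[i1 _] _].
    rewrite !powRN lef_pV2 ?posrE ?powR_gt0 ?ltr0n ?expn_gt0//.
    apply: ge0_ler_powR; rewrite ?nnegrE ?ler_nat//; first by rewrite ltW// (lt_trans ltr01).
    by move: i1; rewrite -subn1; have := expn_gt0 2 k; lia.
  have -> : \sum_((2 ^ k).-1 <= i < (2 ^ k.+1).-1) (2 ^ k)%:R `^ (- s) = (2 ^ k)%:R `^ (- s) * (2 ^ k)%:R.
    rewrite sumr_const_nat [RHS]mulr_natr; congr (_ *+ _).
    by rewrite expnS; have := expn_gt0 2 k; lia.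
  have -> : (2 ^ k)%:R = 2 `^ k%:R :> R by rewrite natrX powR_mulrn.
  rewrite -powRrM -powRD; last by rewrite pnatr_eq0 implybT.
  rewrite -[X in _ <= X]powR_mulrn// -powRrM.
  by have -> : k%:R * - s + k%:R = (1 - s) * k%:R by ring.
apply: (@le_trans _ _ (\sum_(0 <= i < (2 ^ n).-1) (i.+1)%:R `^ (- s))).
  rewrite [leRHS](big_cat_nat (n := n))//=.
    by rewrite lerDl sumr_ge0// => i _; exact: powR_ge0.
  by have := ltn_expl n (isT : (1 < 2)%N); lia.
apply: le_trans (h n) _; rewrite big_mkord.
have := subrX1 rho n => e; rewrite -[leRHS]mul1r ler_pdivlMr ?subr_gt0//.
rewrite mulrC -[X in X * _]opprB mulNr -e opprB lerBlDr lerDl; exact: exprn_ge0.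
Qed.

Lemma sum_centered (h : nat -> R) K : (forall i, 0 <= h i) ->
  \sum_(i < K.*2.+1) h `|(i%:Z - K%:Z)%R|%N <= 2 * \sum_(0 <= i < K.+1) h i.
Proof.
move=> h0; rewrite -(big_mkord xpredT (fun i => h `|(i%:Z - K%:Z)%R|%N)).
rewrite (big_cat_nat (n := K))//=; last by lia.
rewrite mulr2n mulrDl mul1r; apply: lerD.
  rewrite big_nat_rev/= add0n big_nat_recl//=.
  apply: (@le_trans _ _ (\sum_(0 <= i < K) h i.+1)); last by rewrite lerDr.
  rewrite big_nat_cond [leRHS]big_nat_cond; apply: ler_sum => i /andP[/andP[_ iK] _].
  by rewrite (_ : `|_|%N = i.+1)//; lia.
rewrite -{1}[K]add0n big_addn (_ : (K.*2.+1 - K)%N = K.+1); last by lia.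
by apply: ler_sum => i _; rewrite (_ : `|_|%N = i)//; lia.
Qed.

Lemma box_sum_split K (f g : int -> R) :
  \sum_(k : box K) f (box_mode k).1 * g (box_mode k).2 =
  (\sum_(i < K.*2.+1) f (i%:Z - K%:Z)) * (\sum_(i < K.*2.+1) g (i%:Z - K%:Z)).
Proof.
rewrite -(pair_bigA _ (fun i j : 'I_K.*2.+1 => f (i%:Z - K%:Z) * g (j%:Z - K%:Z)))/=.
by rewrite big_distrl/=; apply: eq_bigr => i _; rewrite big_distrr.
Qed.

(** Splits sums over Z^2 into products of one-dimensional sums: powers of [eigen] with exponent
    below -1 are then summable by [zeta_bounded]. *)
Lemma eigen_ge_prod m : (`|m.1|.+1)%:R * (`|m.2|.+1)%:R <= eigen m.
Proof.
rewrite eigenE; set a := `|m.1|%N; set b := `|m.2|%N.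
have e (z : int) : (z%:~R : R) ^+ 2 = (`|z|%N%:R) ^+ 2.
  by rewrite -real_normK ?num_real// -intr_norm natr_absz.
rewrite !e -/a -/b -![_%:R ^+ 2]natrX -natrD -natrM.
have p1 : 1 <= pi ^+ 2 :> R by rewrite exprn_ege1// (le_trans _ (@pi_ge2 R))// ler1n.
apply: (@le_trans _ _ (1 + 4 * 1 * (a ^ 2 + b ^ 2)%:R)).
  by rewrite mulr1 -natrM nat1r ler_nat; nia.
by rewrite lerD2l ler_wpM2r// ler_wpM2l.
Qed.

Lemma lattice_sum_bounded (s : R) : 1 < s -> exists2 B : R, 0 < B & forall K,
  \sum_(k : box K) eigen (box_mode k) `^ (- s) <= B.
Proof.
move=> s1; have [B hB] := zeta_bounded s1; have s0 : 0 <= s by rewrite ltW// (lt_trans ltr01).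
have B0 : 0 < B by apply: lt_le_trans (hB 1); rewrite big_nat1 powR1.
exists ((2 * B) ^+ 2) => [|K]; first by rewrite exprn_gt0// mulr_gt0.
pose f (z : int) : R := (`|z|%N.+1)%:R `^ (- s).
apply: (@le_trans _ _ (\sum_(k : box K) f (box_mode k).1 * f (box_mode k).2)).
  apply: ler_sum => k _; rewrite /f -powRM// !powRN lef_pV2 ?posrE ?powR_gt0 ?eigen_gt0 ?mulr_gt0 ?ltr0n//.
  apply: ge0_ler_powR; rewrite ?nnegrE ?(ltW (eigen_gt0 _)) ?mulr_ge0//; exact: eigen_ge_prod.
have h : \sum_(i < K.*2.+1) f (i%:Z - K%:Z) <= 2 * B.
  apply: le_trans (@sum_centered (fun i => i.+1%:R `^ (- s)) K _) _; first by move=> i; exact: powR_ge0.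
  by rewrite ler_wpM2l.
rewrite box_sum_split -expr2 ler_pXn2r// nnegrE; last by rewrite mulr_ge0// ltW.
by apply: sumr_ge0 => i _; exact: powR_ge0.
Qed.

Definition disc_partial (F : int * int -> R) M : R :=
  \sum_(k : box M) in_disc M (box_mode k) * F (box_mode k).

Lemma in_disc_ge0 M m : 0 <= @in_disc R M m.
Proof. exact: ler0n. Qed.

Lemma in_disc_le1 M m : @in_disc R M m <= 1.
Proof. by rewrite /in_disc lern1 leq_b1. Qed.

Lemma in_disc_le M M' m : (M <= M')%N -> @in_disc R M m <= in_disc M' m.
Proof.
move=> MM; rewrite /in_disc ler_nat; case: (boolP (m \in disc M)) => // /set_mem h.
by rewrite mem_set// /disc/=; apply: le_trans h _; rewrite ler_nat.
Qed.

Lemma in_disc0 M m : ~~ in_box M m -> @in_disc R M m = 0.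
Proof. by move=> h; rewrite /in_disc memNset// => /disc_in_box; exact/negP. Qed.

Lemma disc_partialE K M F : (M <= K)%N ->
  disc_partial F M = \sum_(k : box K) in_disc M (box_mode k) * F (box_mode k).
Proof.
move=> MK; rewrite (@big_box _ _ _ (fun m => in_disc M m * F m) MK)// => m /in_disc0 ->.
by rewrite mul0r.
Qed.

Lemma le_disc_partial F M M' : (forall m, 0 <= F m) -> (M <= M')%N ->
  disc_partial F M <= disc_partial F M'.
Proof.
move=> F0 MM; rewrite (disc_partialE _ MM); apply: ler_sum => k _.
by rewrite ler_wpM2r// in_disc_le.
Qed.

Lemma cvg_disc_partial F g B : (forall m, `|F m| <= g m) -> (forall M, disc_partial g M <= B) ->
  cvgn (disc_partial F).
Proof.
move=> Fg gB.
have g0 m : 0 <= g m by exact: le_trans (Fg m).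
have cg h : (forall m, 0 <= h m <= 2 * g m) -> cvgn (disc_partial h).
  move=> hg; apply: nondecreasing_is_cvgn.
    by move=> M M' MM; apply: le_disc_partial => // m; have /andP[] := hg m.
  exists (2 * B) => _ [M _ <-]; apply: (@le_trans _ _ (2 * disc_partial g M)); last by rewrite ler_wpM2l.
  rewrite /disc_partial mulr_sumr; apply: ler_sum => k _; rewrite mulrCA.
  by rewrite ler_wpM2l ?in_disc_ge0//; have /andP[] := hg (box_mode k).
(* Adding the majorant makes all terms nonnegative, so that both partial sums are monotone. *)
have -> : disc_partial F = disc_partial (fun m => F m + g m) \- disc_partial g.
  apply/funext => M; rewrite /disc_partial /= -sumrB; apply: eq_bigr => k _; ring.
apply: is_cvgB; apply: cg => m; have := Fg m; have := g0 m; rewrite ler_norml => g0m /andP[h1 h2].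
  by apply/andP; split; lra.
by apply/andP; split; lra.
Qed.

Lemma heat_bound (r : R) : 0 < r -> exists B : R, forall M,
  disc_partial (fun m => expR (- (r * eigen m))) M <= B.
Proof.
move=> r0; have [C C0 hC] := expRN_le_powR (ler0n R 2).
have [B B0 hB] := lattice_sum_bounded (ltr1n R 2 : 1 < 2).
exists (C * r `^ (- 2) * B) => M.
apply: (@le_trans _ _ (\sum_(k : box M) C * r `^ (- 2) * eigen (box_mode k) `^ (- 2))).
  apply: ler_sum => k _; apply: (@le_trans _ _ (expR (- (r * eigen (box_mode k))))).
    by rewrite ler_piMl ?expR_ge0// in_disc_le1.
  rewrite -mulrA -powRM ?(ltW r0) ?(ltW (eigen_gt0 _))//.
  by apply: hC; rewrite mulr_gt0 ?eigen_gt0.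
by rewrite -mulr_sumr ler_wpM2l// mulr_ge0 ?(ltW C0) ?powR_ge0.
Qed.

Lemma heat_kernelN_partial M r (x : R * R) :
  heat_kernelN M r x = disc_partial (fun m => expR (- (r * eigen m)) * cos (phase m x)) M.
Proof. by rewrite (heat_kernelNE _ _ (leqnn M)); apply: eq_bigr => k _; rewrite mulrA. Qed.

Let heat_dom (r : R) m (x : R * R) :
  `|expR (- (r * eigen m)) * cos (phase m x)| <= expR (- (r * eigen m)).
Proof. by rewrite normrM ger0_norm ?expR_ge0// ler_piMr ?expR_ge0// ler_norml cos_geN1 cos_le1. Qed.

Lemma cvg_heat_kernelN r (x : R * R) : 0 < r ->
  heat_kernelN M r x @[M --> \oo] --> heat_kernel r x.
Proof.
move=> r0; have [B hB] := heat_bound r0.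
have := cvg_disc_partial (F := fun m => expR (- (r * eigen m)) * cos (phase m x)) (fun m => heat_dom r m x) hB.
by rewrite (_ : disc_partial _ = (fun M => heat_kernelN M r x))//; apply/funext => M; rewrite heat_kernelN_partial.
Qed.

Lemma heat_kernelN_bounded r : 0 < r -> exists B : R, forall M x, `|heat_kernelN M r x| <= B.
Proof.
move=> r0; have [B hB] := heat_bound r0; exists B => M x; apply: le_trans (hB M).
rewrite heat_kernelN_partial; apply: le_trans (ler_norm_sum _ _ _) _; apply: ler_sum => k _.
by rewrite normrM ger0_norm ?in_disc_ge0// ler_wpM2l ?in_disc_ge0.
Qed.

Lemma rtrig_heat_kernelN M r : rtrig M (@heat_kernelN R M r).
Proof.
apply: rtrig_Re; apply: (eq_is_trig (f := fun x => \sum_(k : box M | box_mode k \in @disc R M)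
   (expR (- (r * eigen (box_mode k))))%:C%C * fourier_mode (box_mode k) x)).
  by move=> x; rewrite (@fsbig_box _ M)// => m /disc_in_box.
by apply: is_trig_sum => k _; apply/is_trigZ/is_trig_mode/box_modeP.
Qed.

End LatticeSums.

(** A subsequence with summable squared errors converges almost everywhere; Fatou's lemma along it
    transfers the moment bound to the limit. *)
Lemma fatou_L2 (R : realType) d (T : measurableType d) (mu : {measure set T -> \bar R})
    (Y : nat -> T -> R) (X : T -> R) q (A : R) k0 :
  (forall k, measurable_fun setT (Y k)) -> measurable_fun setT X ->
  (\int[mu]_w ((X w - Y k w) ^+ 2)%:E)%E @[k --> \oo] --> (0 : \bar R)%E ->
  (forall k, (k0 <= k)%N -> (\int[mu]_w ((Y k w) ^+ (2 * q))%:E <= A%:E)%E) ->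
  (\int[mu]_w ((X w) ^+ (2 * q))%:E <= A%:E)%E.
Proof.
move=> mY mX XY YA.
have ex j : exists k, (k0 <= k)%N /\ (\int[mu]_w ((X w - Y k w) ^+ 2)%:E <= (2^-1 ^+ j)%:E)%E.
  have : \forall k \near \oo, (k0 <= k)%N /\ (\int[mu]_w ((X w - Y k w) ^+ 2)%:E <= (2^-1 ^+ j)%:E)%E.
    near=> k; split; first by near: k; exact: nbhs_infty_ge.
    near: k; move/fine_cvgP: XY => [fin /cvgrPdist_le].
    have e0 : 0 < 2^-1 ^+ j :> R by rewrite exprn_gt0.
    move=> /(_ _ e0) h; near=> k.
    have kf : (\int[mu]_w ((X w - Y k w) ^+ 2)%:E)%E \is a fin_num by near: k.
    rewrite -(fineK kf) lee_fin.
    have : `|0 - fine (\int[mu]_w ((X w - Y k w) ^+ 2)%:E)%E| <= 2^-1 ^+ j by near: k.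
    by rewrite sub0r normrN; apply: le_trans; exact: ler_norm.
  by move=> [k _ /(_ k (leqnn k))]; exists k.
have [f hf] := choice ex.
have mD j : measurable_fun setT (fun w => ((X w - Y (f j) w) ^+ 2)%:E).
  by apply/measurable_EFinP; apply: measurable_funX; apply: measurable_funB.
pose S w : \bar R := (\sum_(0 <= j <oo) ((X w - Y (f j) w) ^+ 2)%:E)%E.
have S0 w : (0 <= S w)%E by apply: nneseries_ge0 => j _ _; rewrite lee_fin sqr_ge0.
have mS : measurable_fun setT S.
  by apply: ge0_emeasurable_sum => // j w _ _; rewrite lee_fin sqr_ge0.
have IS : mu.-integrable setT S.
  apply/integrableP; split => //.
  rewrite (_ : (fun w => `|S w|%E) = S); last by apply/funext => w; rewrite gee0_abs.
  rewrite integral_nneseries//; last by move=> j w _; rewrite lee_fin sqr_ge0.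
  apply: (@le_lt_trans _ _ (\sum_(0 <= j <oo) (2^-1 ^+ j : R)%:E)%E).
    by apply: lee_nneseries => j *; [apply: integral_ge0 => w _; rewrite lee_fin sqr_ge0|have [] := hf j].
  apply: (@le_lt_trans _ _ 2%:E); last exact: ltry.
  apply: lime_le; first by apply: is_cvg_nneseries => j _ _; rewrite lee_fin exprn_ge0.
  apply: nearW => k; rewrite sumEFin lee_fin big_mkord.
  have := subrX1 (2^-1 : R) k; have : 0 <= (2^-1 : R) ^+ k by rewrite exprn_ge0.
  by lra.
have ae : {ae mu, forall w, Y (f j) w @[j --> \oo] --> X w}.
  have := integrable_ae measurableT IS; apply: filterS => w /(_ I) Sw.
  have c : cvgn (series (fun j => (X w - Y (f j) w) ^+ 2)).
    apply: nondecreasing_is_cvgn; first by apply: nondecreasing_series => j _ _; exact: sqr_ge0.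
    exists (fine (S w)) => _ [k _ <-]; rewrite -lee_fin fineK// /series/= -sumEFin.
    by apply: nneseries_lim_ge => j _ _; rewrite lee_fin sqr_ge0.
  have /cvg_series_cvg_0/cvgrPdist_lt h := c.
  apply/cvgrPdist_lt => e e0; have /h := exprn_gt0 2 e0; apply: filterS => j.
  rewrite sub0r normrN ger0_norm ?sqr_ge0// => hj.
  by rewrite -(ltr_pXn2r (n := 2)) ?nnegrE ?(ltW e0)// real_normK ?num_real.
have mp k : measurable_fun setT (fun w => ((Y k w) ^+ (2 * q))%:E).
  by apply/measurable_EFinP; exact: measurable_funX.
have p0 (x : R) : (0 <= (x ^+ (2 * q))%:E)%E by rewrite lee_fin exprM exprn_ge0 ?sqr_ge0.
apply: (@le_trans _ _ (\int[mu]_w limn_einf (fun j => ((Y (f j) w) ^+ (2 * q))%:E))%E).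
  apply: ae_ge0_le_integral => //.
  - by apply/measurable_EFinP; exact: measurable_funX.
  - move=> w _; rewrite limn_einf_lim; apply: lime_ge; first exact: is_cvg_einfs.
    by apply: nearW => k; apply: le_ereal_inf_tmp => _ [j _ <-].
  - rewrite (_ : (fun w => limn_einf _) = (fun w => - limn_esup (fun j => - ((Y (f j) w) ^+ (2 * q))%:E))%E).
      apply: measurableT_comp => //; apply: measurable_fun_limn_esup => j.
      exact: measurableT_comp.
    by apply/funext => w; rewrite limn_esupN oppeK.
  - apply: filterS ae => w cw _.
    have h : ((Y (f j) w) ^+ (2 * q))%:E @[j --> \oo] --> ((X w) ^+ (2 * q))%:E.
      by apply: cvg_EFin; [exact: nearW|exact: (continuous_cvg _ (@exprn_continuous _ _ _) cw)].
    by rewrite (is_cvg_limn_einfE (cvgP _ h)) (cvg_lim _ h).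
apply: le_trans (fatou mu measurableT (fun j => mp (f j)) (fun j w _ => p0 _)) _.
rewrite limn_einf_lim; apply: lime_le; first exact: is_cvg_einfs.
apply: nearW => k; apply: ge_ereal_inf; exists (\int[mu]_w ((Y (f k) w) ^+ (2 * q))%:E)%E.
  by exists k => /=.
by apply: YA; have [] := hf k.
Unshelve. all: by end_near. Qed.

(** * Approximation of the Wick kernels by pure tensors *)

Section KernelApproximation.
Context {R : realType}.
Local Notation S := (spacetime R).

Lemma cvg_prod_ord n (f : 'I_n -> nat -> R) (l : 'I_n -> R) :
  (forall i, f i k @[k --> \oo] --> l i) -> (\prod_i f i k) @[k --> \oo] --> \prod_i l i.
Proof.
elim: n f l => [|n IH] f l fl.
  by rewrite big_ord0; under eq_fun do rewrite big_ord0; exact: cvg_cst.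
rewrite big_ord_recl; under eq_fun do rewrite big_ord_recl.
by apply: cvgM; [exact: fl|apply: IH => i; exact: fl].
Qed.

Lemma rtrig_bounded D (g : R * R -> R) : rtrig D g -> exists2 B : R, 0 <= B & forall x, `|g x| <= B.
Proof.
move=> /rtrigP[c gc].
exists (\sum_(k : box D) (`|complex.Re (c (box_mode k))| + `|complex.Im (c (box_mode k))|)).
  by apply: sumr_ge0 => k _; exact: addr_ge0.
move=> x; rewrite gc; apply: le_trans (ler_norm_sum _ _ _) _; apply: ler_sum => k _.
apply: le_trans (ler_normB _ _) _; rewrite !normrM; apply: lerD; apply: ler_piMr => //.
  by rewrite ler_norml cos_geN1 cos_le1.
by rewrite ler_norml sin_geN1 sin_le1.
Qed.

Definition wick_kernelN K n t (phi : R * R -> R) (z : n.-tuple S) : R :=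
  (\prod_(i < n) \1_[set` `]-oo, t[] (tnth z i).1) *
  distr_of_fun (fun y => \prod_(i < n)
    heat_kernelN K (t - (tnth z i).1) ((tnth z i).2 - y)) phi.

Let rtrig_integrand K n t D phi (z : n.-tuple S) : rtrig D phi ->
  rtrig (n * K + D) (fun y => (\prod_(i < n)
    heat_kernelN K (t - (tnth z i).1) ((tnth z i).2 - y)) * phi y).
Proof.
move=> phiD; apply: rtrigM => //; apply: rtrig_prod => i.
have := rtrig_opp (rtrig_shift (tnth z i).2 (rtrig_heat_kernelN K (t - (tnth z i).1))).
by congr rtrig; apply/funext => y; rewrite [- y + _]addrC.
Qed.

(** The exact grid quadrature turns the pairing with [phi] into a finite sum of pure tensors of
    [field_kernel], the form required by [integral_n_tensor]. *)
Lemma wick_kernelN_tensor K n t D L phi (z : n.-tuple S) : rtrig D phi -> (n * K + D < L)%N ->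
  wick_kernelN K t phi z = \sum_(k : 'I_L * 'I_L) (L%:R ^- 2 * phi (grid_point k)) *
    \prod_(i < n) field_kernel K t (grid_point k) (tnth z i).
Proof.
move=> phiD DL; rewrite /wick_kernelN /distr_of_fun (rtrig_Rintegral (rtrig_integrand K t z phiD) DL).
rewrite /ravg mulrA mulr_sumr; apply: eq_bigr => k _.
rewrite /field_kernel big_split/=; ring.
Qed.

Lemma wick_kernelN_eq0 K n t phi (z : n.-tuple S) i : (tnth z i).1 = t -> wick_kernelN K t phi z = 0.
Proof.
move=> zi; rewrite /wick_kernelN (bigD1 i)//= indicE zi memNset ?mul0r//=.
by rewrite in_itv/= ltxx.
Qed.

(** If some time lies beyond t, both sides vanish. Otherwise all heat kernels are taken at positive
    times, where the truncations are bounded uniformly in [K], and dominated convergence applies on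
    the torus. *)
Lemma cvg_wick_kernelN n t D phi (z : n.-tuple S) : rtrig D phi ->
  (forall i, (tnth z i).1 != t) ->
  wick_kernelN K t phi z @[K --> \oo] --> wick_kernel t phi z.
Proof.
move=> phiD zt; rewrite /wick_kernelN /wick_kernel.
have -> : \prod_(i < n) \1_[set` `]-oo, t]] (tnth z i).1 = \prod_(i < n) \1_[set` `]-oo, t[] (tnth z i).1 :> R.
  apply: eq_bigr => i _; rewrite !indicE; congr (nat_of_bool _)%:R; apply/idP/idP => /set_mem h; apply/mem_set; move: h.
    by rewrite /= !in_itv/= lt_neqAle zt.
  by rewrite /= !in_itv/=; exact: ltW.
have [[i ti]|lt] := pselect (exists i, t <= (tnth z i).1).
  rewrite (bigD1 i)//= indicE memNset; last by rewrite /= in_itv/= ltNge ti.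
  by rewrite !mul0r; under eq_fun do rewrite mul0r; exact: cvg_cst.
have {}lt i : 0 < t - (tnth z i).1.
  by rewrite subr_gt0 ltNge; apply/negP => h; apply: lt; exists i.
apply: cvgM; first exact: cvg_cst.
have [B B0 hB] := rtrig_bounded phiD.
have /choice[b hb] : forall i, exists b : R, forall M x, `|heat_kernelN M (t - (tnth z i).1) x| <= b.
  by move=> i; exact: heat_kernelN_bounded.
have mT : measurable (@torus R) by exact: measurableX.
pose F K (y : plane R) := (\prod_(i < n) heat_kernelN K (t - (tnth z i).1) ((tnth z i).2 - y)) * phi y.
pose G (y : plane R) := (\prod_(i < n) heat_kernel (t - (tnth z i).1) ((tnth z i).2 - y)) * phi y.
have mF K : measurable_fun (@torus R) (EFin \o F K).
  by have /integrableP[] := rtrig_integrable (rtrig_integrand K t z phiD).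
have FG y : F K y @[K --> \oo] --> G y.
  apply: cvgM; last exact: cvg_cst.
  by apply: cvg_prod_ord => i; exact: cvg_heat_kernelN.
have FGe y : (EFin \o F K) y @[K --> \oo] --> (EFin \o G) y.
  by apply: cvg_EFin; [exact: nearW|exact: FG].
have mG : measurable_fun (@torus R) (EFin \o G).
  by apply: (emeasurable_fun_cvg (fun K => EFin \o F K)) => // y _; exact: FGe.
have ig : (@plane_measure R).-integrable torus (EFin \o cst ((\prod_i b i) * B)).
  by apply: rtrig_integrable; exact: (rtrig_cst 0).
have Fb K y : (`|(EFin \o F K) y| <= (EFin \o cst ((\prod_i b i) * B)%R) y)%E.
  rewrite /= lee_fin normrM; apply: ler_pM => //.
  by rewrite normr_prod; apply: ler_prod => i _; rewrite normr_ge0 hb.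
have [iG _ c] := dominated_convergence (mu := @plane_measure R) mT mF mG
  (aeW _ (fun y _ => FGe y)) ig (aeW _ (fun y K _ => Fb K y)).
have ifin : (\int[@plane_measure R]_(x in torus) (EFin \o G) x)%E \is a fin_num by exact: integrable_fin_num.
rewrite /= -(fineK ifin) in c; exact: fine_cvg c.
Qed.

End KernelApproximation.

Lemma cvg_sum_ord (R : realType) n (f : 'I_n -> nat -> R) (l : 'I_n -> R) :
  (forall i, f i k @[k --> \oo] --> l i) -> (\sum_i f i k) @[k --> \oo] --> \sum_i l i.
Proof.
elim: n f l => [|n IH] f l fl.
  by rewrite big_ord0; under eq_fun do rewrite big_ord0; exact: cvg_cst.
rewrite big_ord_recl; under eq_fun do rewrite big_ord_recl.
by apply: cvgD; [exact: fl|apply: IH => i; exact: fl].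
Qed.

(** * Moments of multiple integrals *)

Section WienerMoments.
Context {R : realType}.
Local Notation S := (spacetime R).

Lemma integral_n0 n : integral_n ((fun=> 0%E) : n.-tuple S -> \bar R) = 0%E.
Proof. by elim: n => [//|n IH] /=; rewrite IH integral0. Qed.

Lemma integral_n_sum n (I : Type) (s : seq I) (F : I -> n.-tuple S -> R) :
  (forall i p, 0 <= F i p) -> (forall i, measurable_fun [set: n.-tuple S] (F i)) ->
  integral_n (fun z => (\sum_(i <- s) F i z)%:E) = (\sum_(i <- s) integral_n (fun z => (F i z)%:E))%E.
Proof.
move=> F0 mF; elim: s => [|i s IH].
  by rewrite big_nil -(integral_n0 n); congr integral_n; apply/funext => z; rewrite big_nil.
rewrite big_cons -IH -integral_nD.
- by congr integral_n; apply/funext => z; rewrite big_cons EFinD.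
- by move=> p; rewrite lee_fin.
- exact/measurable_EFinP.
- by move=> p; rewrite lee_fin sumr_ge0.
- by apply/measurable_EFinP; exact: measurable_sum.
Qed.

Lemma time_slice_null (t : R) : (@spacetime_measure R) [set z | z.1 = t] = 0%E.
Proof.
have -> : [set z : S | z.1 = t] = [set t] `*` setT by apply/seteqP; split=> -[a b] //= [].
rewrite [LHS](product_measure1E (@lebesgue_measure R) (@plane_measure R))//.
by rewrite [X in (X * _)%E](_ : _ = 0)%E ?mul0e//; exact: lebesgue_measure_set1.
Qed.

Lemma inner_cut (f f' g g' : S -> R) (ts : seq R) :
  square_integrable f -> square_integrable f' -> square_integrable g -> square_integrable g' ->
  (forall z, z.1 \notin ts -> f' z = f z) -> (forall z, z.1 \notin ts -> g' z = g z) ->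
  inner f' g' = inner f g.
Proof.
move=> [mf _] [mf' _] [mg _] [mg' _] ff gg; congr fine; apply: ae_eq_integral.
- exact: measurable_cylinder.
- by apply/measurable_EFinP; exact: measurable_funM.
- by apply/measurable_EFinP; exact: measurable_funM.
pose mu : {measure set S -> \bar R} := @spacetime_measure R.
have : {ae mu, forall z, z.1 \notin ts}.
  elim: ts {ff gg} => [|t ts IH]; first exact: aeW.
  have h : {ae mu, forall z, z.1 != t}.
    exists [set z | z.1 = t]; split; [|exact: time_slice_null|].
      have -> : [set z : S | z.1 = t] = [set t] `*` setT by apply/seteqP; split=> -[a b] //= [].
      exact: measurableX.
    by move=> z /= /negP; rewrite negbK => /eqP.
  apply: negligibleS (negligibleU h IH) => z /=; rewrite inE negb_or => /negP.
  by rewrite negb_and => /orP[/negP|/negP] ?; [left|right].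
by apply: negligibleS => z /= hz zt; apply: hz => _; rewrite ff// gg.
Qed.

Context {d : measure_display} {Omega : measurableType d} (P : probability Omega R).
Variable xi : (S -> R) -> {RV P >-> R}.
Hypothesis xi_white : white_noise xi.

Section Moments.
Variables (n r : nat) (t sg : 'I_r -> R) (X : 'I_r -> Omega -> R) (D : nat) (phi : R * R -> R).
Variables (V : finType) (c : V -> R) (h : V -> S -> R) (eps : R) (K0 : nat).
Hypotheses (n13 : (1 <= n <= 3)%N) (sg1 : forall i, sg i ^+ 2 <= 1) (phiD : rtrig D phi).
Hypothesis XF : forall i, multiple_integral xi (@wick_kernel R n (t i) phi) (X i).
Hypotheses (h2 : forall v, square_integrable (h v)) (mh : forall v, measurable_fun [set: S] (h v)).
Hypothesis eps0 : 0 < eps.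
Hypothesis Feps : forall K, (K0 <= K)%N ->
  (integral_n (fun z : n.-tuple S => ((\sum_i sg i * wick_kernelN K (t i) phi z -
     \sum_v c v * \prod_i h v (tnth z i)) ^+ 2)%:E) <= eps%:E)%E.

Let Y w := \sum_v c v * wick_poly (inner (h v) (h v)) n (xi (h v) w).

(** [wick_kernel] set to 0 on the slice of time [t i], where the truncated kernels vanish as well.
    Convergence then holds everywhere, and [F i] is measurable as a pointwise limit. *)
Let F i (z : n.-tuple S) := if [forall j, (tnth z j).1 != t i] then wick_kernel (t i) phi z else 0.

Let F_cvg i z : wick_kernelN K (t i) phi z @[K --> \oo] --> F i z.
Proof.
rewrite /F; case: ifPn => [/forallP h1|]; first exact: cvg_wick_kernelN phiD h1.
rewrite negb_forall => /existsP[j]; rewrite negbK => /eqP zj.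
by under eq_fun do rewrite (wick_kernelN_eq0 _ _ zj); exact: cvg_cst.
Qed.

Let mN K i : measurable_fun [set: n.-tuple S] (fun z => wick_kernelN K (t i) phi z).
Proof.
rewrite (_ : (fun z => _) = (fun z => \sum_(k : 'I_(n * K + D).+1 * 'I_(n * K + D).+1)
   ((n * K + D).+1%:R ^- 2 * phi (grid_point k)) *
    \prod_(j < n) field_kernel K (t i) (grid_point k) (tnth z j))); last first.
  by apply/funext => z; exact: wick_kernelN_tensor phiD _.
exact: (measurable_tensor _ (fun k _ => measurable_field_kernel _ _ _)).
Qed.

Let mF i : measurable_fun [set: n.-tuple S] (F i).
Proof. by apply: measurable_fun_cvg (fun K => mN K i) _ => z _; exact: F_cvg. Qed.

Let G (z : n.-tuple S) := \sum_v c v * \prod_i h v (tnth z i).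

Let mG : measurable_fun [set: n.-tuple S] G.
Proof. exact: (measurable_tensor _ (fun v _ => mh v)). Qed.

Let FG_le : (integral_n (fun z : n.-tuple S => ((\sum_i sg i * F i z - G z) ^+ 2)%:E) <= eps%:E)%E.
Proof.
apply: (integral_n_cvg_le (F := fun K z => (\sum_i sg i * wick_kernelN K (t i) phi z - G z) ^+ 2) (K := K0)) => //.
- by move=> K z; exact: sqr_ge0.
- move=> K; apply: measurable_funX; apply: measurable_funB => //.
  by apply: measurable_sum => i; apply: measurable_funM.
- move=> z; have cG : cst (G z) k @[k --> \oo] --> G z by exact: cvg_cst.
  apply: (continuous_cvg _ (@exprn_continuous _ 2 _)); apply: cvgB cG.
  apply: (@cvg_sum_ord _ r (fun i K => sg i * wick_kernelN K (t i) phi z)) => i.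
  by apply: cvgM; [exact: cvg_cst|exact: F_cvg].
Qed.

Section Step.
Variable e : 'I_r -> @elementary R n.
Hypothesis e_le : forall i, (integral_n (fun z : n.-tuple S =>
  ((wick_kernel (t i) phi z - elementary_fun (e i) z) ^+ 2)%:E) <= eps%:E)%E.

Let W : finType := ({i : 'I_r & {ffun 'I_n -> 'I_(el_size (e i))}} + V)%type.

Let b (v : W) : R := match v with
  | inl p => sg (tag p) * el_coef (tagged p)
  | inr v => - c v end.

(** A [tau] that is not injective has coefficient 0. Replacing its factors by 0 makes every product
    run over an orthogonal family, as [is_wick] demands. *)
Let g (v : W) (j : 'I_n) : S -> R := match v with
  | inl p => if injectiveb (tagged p) then \1_(el_set (tagged p j)) else cst 0
  | inr v => h v end.

(** The same functions set to 0 on the time slices: inner products are unchanged, and the tensor sum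
    becomes comparable with the kernels [F i] pointwise. *)
Let gc (v : W) (j : 'I_n) (z : S) : R := match v with
  | inl p => if z.1 == t (tag p) then 0 else g v j z
  | inr v => h v z end.

Let Yv (v : W) (w : Omega) : R := match v with
  | inl p => \prod_j xi (g v j) w
  | inr v => wick_poly (inner (h v) (h v)) n (xi (h v) w) end.

Let mcut (s : R) (f : S -> R) : measurable_fun [set: S] f ->
  measurable_fun [set: S] (fun z : S => if z.1 == s then 0 else f z).
Proof.
move=> mf; rewrite (_ : (fun z => _) = (fun z : S => f z * \1_(~` [set s]) z.1)); last first.
  apply/funext => z; rewrite indicE; case: eqP => [->|zs]; first by rewrite memNset ?mulr0//=; apply.
  by rewrite mem_set ?mulr1//=.
have m1 : measurable_fun [set: R] (\1_(~` [set s]) : R -> R) by apply: measurable_indic; exact: measurableC.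
by apply: measurable_funM => //; apply: measurableT_comp m1 _; exact: measurable_fst.
Qed.

Let mg v j : measurable_fun [set: S] (g v j).
Proof.
case: v => [p|v]; last exact: mh.
by rewrite /g; case: ifP => _; [apply: measurable_indic; exact: el_measurable|exact: measurable_cst].
Qed.

Let mgc v j : measurable_fun [set: S] (gc v j).
Proof. by case: v => [p|v]; [apply: mcut; exact: mg|exact: mh]. Qed.

Let g2 v j : square_integrable (g v j).
Proof.
split; first by apply: measurable_funTS; exact: mg.
case: v => [p|v]; last by have [] := h2 v.
rewrite /g; case: ifP => _; last first.
  by rewrite integral0_eq// => z _; rewrite /= expr0n.
rewrite (eq_integral (fun z => (\1_(el_set (tagged p j)) z)%:E)); last first.
  by move=> z _; rewrite indicE; case: (_ \in _); rewrite ?expr1n ?expr0n.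
rewrite integral_indic ?setIidl; first exact: el_finite.
- exact: el_cylinder.
- exact: measurable_cylinder.
- exact: el_measurable.
Qed.

Let gc2 v j : square_integrable (gc v j).
Proof.
split; first by apply: measurable_funTS; exact: mgc.
have [_] := g2 v j; apply: le_lt_trans; apply: ge0_le_integral_lower => z _.
  by rewrite lee_fin sqr_ge0.
rewrite lee_fin; case: v => [p|v] //=; case: ifP => _ //.
by rewrite expr0n/= sqr_ge0.
Qed.

Let gcE v u j : inner (gc v j) (gc u j) = inner (g v j) (g u j).
Proof.
apply: (@inner_cut _ _ _ _ [seq t i | i : 'I_r]) => //.
  move=> z zt; case: v => [p|v] //=; case: ifP => // /eqP ztp; case/negP: zt; rewrite ztp.
  by apply: map_f; rewrite mem_enum.
move=> z zt; case: u => [p|u] //=; case: ifP => // /eqP ztp; case/negP: zt; rewrite ztp.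
by apply: map_f; rewrite mem_enum.
Qed.

Let gY v : is_wick xi (g v) (Yv v).
Proof.
case: v => [p|v]; last by left; exists (h v).
right; split => // i j ij; rewrite /g; case: (boolP (injectiveb (tagged p))) => [/injectiveP inj|_]; last first.
  by rewrite /inner; under eq_Rintegral do rewrite mul0r; rewrite /Rintegral integral0.
transitivity (\int[@spacetime_measure R]_(z in cylinder) (0 : R)); last by rewrite /Rintegral integral0.
apply: eq_Rintegral => z _; rewrite !indicE -natrM mulnb.
case: andP => // -[/set_mem z1 /set_mem z2].
have := el_disjoint (e := e (tag p)) I I (ex_intro _ z (conj z1 z2)).
by move=> /inj /eqP; rewrite (negbTE ij).
Qed.

Let eltE (p : {i : 'I_r & {ffun 'I_n -> 'I_(el_size (e i))}}) (x : R) (y : R) :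
  (injective (tagged p) -> x = y) -> b (inl p) * x = sg (tag p) * (el_coef (tagged p) * y).
Proof.
rewrite /b => xy; case: (pselect (injective (tagged p))) => [/xy ->|/el_diagonal ->]; first by rewrite mulrA.
by rewrite mulr0 !mul0r mulr0.
Qed.

Let sumY w : \sum_v b v * Yv v w = \sum_i sg i * elementary_int xi (e i) w - Y w.
Proof.
rewrite big_sumType/=; congr (_ + _); last by rewrite -sumrN; apply: eq_bigr => v _; rewrite mulNr.
under [RHS]eq_bigr do rewrite /elementary_int mulr_sumr.
rewrite (sig_big_dep xpredT (fun _ _ => true) (fun i (tau : {ffun 'I_n -> 'I_(el_size (e i))}) =>
  sg i * (el_coef tau * \prod_j xi \1_(el_set (tau j)) w)))/=.
apply: eq_bigr => p _; apply: eltE => inj; apply: eq_bigr => j _.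
by rewrite /g; case: (injectiveP (tagged p)).
Qed.

Let ecut i (z : n.-tuple S) := if [forall j, (tnth z j).1 != t i] then elementary_fun (e i) z else 0.

Let sumG z : \sum_v b v * \prod_j gc v j (tnth z j) = \sum_i sg i * ecut i z - G z.
Proof.
rewrite big_sumType/=; congr (_ + _); last by rewrite -sumrN; apply: eq_bigr => v _; rewrite mulNr.
transitivity (\sum_i \sum_(tau : {ffun 'I_n -> 'I_(el_size (e i))}) sg i * (el_coef tau *
   \prod_(j < n) (if (tnth z j).1 == t i then 0 else \1_(el_set (tau j)) (tnth z j)))).
  rewrite (sig_big_dep xpredT (fun _ _ => true) (fun i (tau : {ffun 'I_n -> 'I_(el_size (e i))}) =>
   sg i * (el_coef tau * \prod_(j < n) (if (tnth z j).1 == t i then 0 else \1_(el_set (tau j)) (tnth z j)))))/=.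
  apply: eq_bigr => p _; apply: eltE => inj; apply: eq_bigr => j _.
  by rewrite /gc /g; case: (injectiveP (tagged p)).
apply: eq_bigr => i _; rewrite -mulr_sumr; congr (_ * _); rewrite /ecut; case: ifPn => [/forallP zt|].
  by apply: eq_bigr => tau _; congr (_ * _); apply: eq_bigr => j _; rewrite (negbTE (zt j)).
rewrite negb_forall => /existsP[j]; rewrite negbK => zj.
by rewrite big1// => tau _; rewrite (bigD1 j)//= zj mul0r mulr0.
Qed.

Let mecut i : measurable_fun [set: n.-tuple S] (ecut i).
Proof.
rewrite (_ : ecut i = (fun z => \sum_(tau : {ffun 'I_n -> 'I_(el_size (e i))}) el_coef tau *
   \prod_(j < n) (if (tnth z j).1 == t i then 0 else \1_(el_set (tau j)) (tnth z j)))).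
  apply: (@measurable_tensor R n {ffun 'I_n -> 'I_(el_size (e i))} (fun tau => el_coef tau)
     (fun tau j z => if z.1 == t i then 0 else \1_(el_set (tau j)) z)) => tau j.
  by apply: mcut; apply: measurable_indic; exact: el_measurable.
apply/funext => z; rewrite /ecut; case: ifPn => [/forallP zt|].
  by apply: eq_bigr => tau _; congr (_ * _); apply: eq_bigr => j _; rewrite (negbTE (zt j)).
rewrite negb_forall => /existsP[j]; rewrite negbK => zj.
by rewrite big1// => tau _; rewrite (bigD1 j)//= zj mul0r mulr0.
Qed.

(** The error splits into the r approximation errors of the kernels and the error in [FG_le]: r + 1
    terms of squared norm at most [eps], whence the factor [r.+1%:R ^+ 2]. *)
Let gram_le : \sum_v \sum_u b v * b u * \prod_i inner (g v i) (g u i) <= r.+1%:R ^+ 2 * eps.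
Proof.
rewrite -lee_fin.
have -> : (\sum_v \sum_u b v * b u * \prod_i inner (g v i) (g u i))%:E =
    integral_n (fun z : n.-tuple S => ((\sum_v b v * \prod_j gc v j (tnth z j)) ^+ 2)%:E).
  rewrite integral_n_tensor//; congr EFin; apply: eq_bigr => v _; apply: eq_bigr => u _.
  by congr (_ * _); apply: eq_bigr => j _; rewrite gcE.
pose H (o : option 'I_r) (z : n.-tuple S) := match o with
  | Some i => (F i z - ecut i z) ^+ 2 | None => (\sum_i sg i * F i z - G z) ^+ 2 end.
have H0 o z : 0 <= H o z by case: o => [i|]; exact: sqr_ge0.
have mH o : measurable_fun [set: n.-tuple S] (H o).
  case: o => [i|]; apply: measurable_funX.
    by apply: measurable_funB; [exact: mF|exact: mecut].
  by apply: measurable_funB; [apply: measurable_sum => i; apply: measurable_funM|exact: mG].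
have He o : (integral_n (fun z : n.-tuple S => (H o z)%:E) <= eps%:E)%E.
  case: o => [i|]; last exact: FG_le.
  apply: le_trans (e_le i); apply: le_integral_n => z; rewrite lee_fin ?sqr_ge0//.
  by rewrite /= /F /ecut; case: ifP => // _; rewrite subrr expr0n/= sqr_ge0.
apply: (@le_trans _ _ (integral_n (fun z : n.-tuple S => (r.+1%:R%:E * (\sum_o H o z)%:E)%E))).
  apply: le_integral_n => z; first by rewrite lee_fin sqr_ge0.
  rewrite sumG -EFinM lee_fin.
  pose x (o : option 'I_r) : R := match o with
    | Some i => - (sg i * (F i z - ecut i z)) | None => \sum_i sg i * F i z - G z end.
  have optE (f : option 'I_r -> R) : \sum_o f o = f None + \sum_i f (Some i).
    rewrite (bigD1 None)//=; congr (_ + _).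
    rewrite (reindex_omap Some id)/=; last by case.
    by apply: eq_bigl => i; rewrite eqxx.
  have -> : \sum_i sg i * ecut i z - G z = \sum_o x o.
    rewrite optE /= addrAC -big_split/=; congr (_ - _); apply: eq_bigr => i _; ring.
  have := sum_cauchy_schwarz (index_enum (option 'I_r)) (fun=> 1) x.
  under eq_bigr do rewrite mul1r.
  move=> /le_trans; apply; under eq_bigr do rewrite expr1n.
  rewrite sumr_const card_option card_ord ler_wpM2l//; apply: ler_sum => -[i|] _ //=.
  by rewrite sqrrN exprMn ler_piMl ?sqr_ge0.
rewrite integral_nZ//; last 2 first.
- by move=> z; rewrite lee_fin sumr_ge0.
- by apply/measurable_EFinP; exact: measurable_sum.
rewrite integral_n_sum// expr2 -mulrA EFinM lee_wpmul2l ?lee_fin//.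
apply: (@le_trans _ _ (\sum_(o : option 'I_r) eps%:E)%E); first exact: lee_sum.
by rewrite sumEFin lee_fin sumr_const card_option card_ord mulr_natl.
Qed.

Lemma elementary_moment_le q :
  (\int[P]_w ((\sum_i sg i * elementary_int xi (e i) w - Y w) ^+ (2 * q.+1))%:E <=
   (((q.*2.+1)%:R ^+ n * (n`!%:R * (r.+1%:R ^+ 2 * eps))) ^+ q.+1)%:E)%E.
Proof.
have m2 := is_wick_second_moment xi_white b g2 gY.
have hyp := is_wick_hypercontractive xi_white b g2 gY q.
have fm := is_wick_finite_moments xi_white b g2 gY.
have ifin : P.-integrable setT (EFin \o (fun w => (\sum_v b v * Yv v w) ^+ (2 * q.+1))).
  by have [_] := fm.
rewrite (eq_integral (fun w => ((\sum_v b v * Yv v w) ^+ (2 * q.+1))%:E)); last first.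
  by move=> w _; rewrite sumY.
rewrite -(fineK (integrable_fin_num measurableT ifin)) lee_fin.
apply: (@le_trans _ _ (\int[P]_w ((\sum_v b v * Yv v w) ^+ 2 ^+ q.+1))).
  by apply: ler_of_eq; apply: eq_Rintegral => w _; rewrite exprM.
apply: le_trans hyp _; rewrite exprMn ler_wpM2l ?exprn_ge0//.
rewrite ler_pXn2r// ?nnegrE; last 2 first.
- by rewrite /Rintegral fine_ge0// integral_ge0// => w _; rewrite lee_fin sqr_ge0.
- by rewrite !mulr_ge0 ?exprn_ge0 ?(ltW eps0).
apply: le_trans m2 _; by rewrite ler_wpM2l// gram_le.
Qed.

Lemma measurable_elementary_error :
  measurable_fun setT (fun w => \sum_i sg i * elementary_int xi (e i) w - Y w).
Proof.
have [m _] := is_wick_finite_moments xi_white b g2 gY.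
by move: m; congr measurable_fun; apply/funext => w; rewrite sumY.
Qed.
End Step.

(** The elementary functions are eventually within [eps] of the kernels, the same [eps] as the error
    to be estimated. Hypercontractivity therefore holds along the sequence with a fixed constant,
    and [fatou_L2] passes to the limit. *)
Lemma multiple_integral_moment_le q :
  (\int[P]_w ((\sum_i sg i * X i w - Y w) ^+ (2 * q.+1))%:E <=
   (((q.*2.+1)%:R ^+ n * (n`!%:R * (r.+1%:R ^+ 2 * eps))) ^+ q.+1)%:E)%E.
Proof.
have mX i : measurable_fun setT (X i) by have [] := XF i.
have /choice[e he] : forall i, exists e : nat -> @elementary R n,
    (integral_n (fun z => ((wick_kernel (t i) phi z - elementary_fun (e k) z) ^+ 2)%:E) @[k --> \oo]
       --> (0 : \bar R)%E) /\
    ((\int[P]_w ((X i w - elementary_int xi (e k) w) ^+ 2)%:E)%E @[k --> \oo]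
       --> (0 : \bar R)%E).
  by move=> i; have [_] := XF i.
have mE k : measurable_fun setT (fun w => \sum_i sg i * elementary_int xi (e i k) w - Y w).
  exact: measurable_elementary_error.
have mY : measurable_fun setT Y.
  apply: measurable_sum => v; apply: measurable_funM => //.
  have mx : measurable_fun setT (fun w => xi (h v) w) by exact: measurable_funPT.
  case: n n13 => [|[|[|[|m]]]]//= _.
  - by apply: measurable_funB => //; exact: measurable_funX.
  - by apply: measurable_funB; [exact: measurable_funX|apply: measurable_funM].
have mI i k : measurable_fun setT (elementary_int xi (e i k)).
  apply: measurable_sum => tau; apply: measurable_funM => //.
  by apply: measurable_prod => j _; exact: measurable_funPT.
have near0 (u : nat -> \bar R) : u k @[k --> \oo] --> (0 : \bar R)%E -> (forall k, 0 <= u k)%E ->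
    \forall k \near \oo, (u k <= eps%:E)%E.
  move=> u0 up; have /fine_cvgP[fin /cvgrPdist_le h'] := u0.
  near=> k; have kf : u k \is a fin_num by near: k.
  rewrite -(fineK kf) lee_fin.
  have : `|0 - fine (u k)| <= eps by near: k; exact: h'.
  by rewrite sub0r normrN; apply: le_trans; exact: ler_norm.
have [k0 _ hk0] : \forall k \near \oo, forall i, (integral_n (fun z : n.-tuple S =>
  ((wick_kernel (t i) phi z - elementary_fun (e i k) z) ^+ 2)%:E) <= eps%:E)%E.
  apply: filter_forall => i; apply: near0; first by have [] := he i.
  by move=> k; apply: integral_n_ge0 => z; rewrite lee_fin sqr_ge0.
apply: (fatou_L2 (Y := fun k w => \sum_i sg i * elementary_int xi (e i k) w - Y w) (k0 := k0)).
- exact: mE.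
- by apply: measurable_funB => //; apply: measurable_sum => i; apply: measurable_funM.
- apply: (squeeze_cvge (f := cst 0%E) (h := fun k => (r%:R%:E * \sum_i \int[P]_w ((X i w - elementary_int xi (e i k) w) ^+ 2)%:E)%E)).
  + apply: nearW => k; apply/andP; split; first by apply: integral_ge0 => w _; rewrite lee_fin sqr_ge0.
    have mD i : measurable_fun setT (fun w => (X i w - elementary_int xi (e i k) w) ^+ 2).
      by apply: measurable_funX; apply: measurable_funB.
    rewrite -ge0_integral_sum//; last 2 first.
    * by move=> i; exact/measurable_EFinP.
    * by move=> i w _; rewrite lee_fin sqr_ge0.
    rewrite -ge0_integralZl//; last 2 first.
    * by apply: emeasurable_sum => i; exact/measurable_EFinP.
    * by move=> w _; apply: sume_ge0 => i _; rewrite lee_fin sqr_ge0.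
    apply: ge0_le_integral_lower => w _; first by rewrite lee_fin sqr_ge0.
    rewrite sumEFin -EFinM lee_fin.
    rewrite (_ : _ - Y w - _ = \sum_i (sg i * X i w - sg i * elementary_int xi (e i k) w)); last first.
      by rewrite sumrB; ring.
    apply: le_trans (sqr_sum_le _) _; rewrite ler_wpM2l//; apply: ler_sum => i _.
    by rewrite -mulrBr exprMn ler_piMl ?sqr_ge0.
  + exact: cvg_cst.
  + rewrite -[X in _ --> X](mule0 r%:R%:E); apply: cvgeZl => //.
    have hc : (\sum_(i < r) \int[P]_w ((X i w - elementary_int xi (e i k) w) ^+ 2)%:E)%E @[k --> \oo]
        --> (\sum_(i < r) (0 : \bar R))%E.
      apply: cvg_nnesum => i _; last by have [] := he i.
      by apply: nearW => k; apply: integral_ge0 => w _; rewrite lee_fin sqr_ge0.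
    by rewrite big1 in hc.
- by move=> k /hk0 hk; exact: elementary_moment_le.
Unshelve. all: by end_near. Qed.

End Moments.
End WienerMoments.

(** * Lattice convolutions *)

Section LatticeTensor.
Context {R : realType}.
Local Notation eigen := (@eigen R).

Lemma exists_max (J : finType) (x : J -> R) (j : J) : exists i, forall o, x o <= x i.
Proof.
by case: (@Order.TotalTheory.arg_maxP _ R J j xpredT x isT) => i _ h; exists i => o; exact: h.
Qed.

(* The left-hand side is a weighted geometric mean of the summands on the right,
   hence at most the largest of them. *)
Lemma prod_powR_le (J : finType) (j : J) (x a : J -> R) (s : R) :
  (forall o, 1 <= x o) -> (forall o, a o <= s) -> \sum_o a o = #|J|.-1%:R * s ->
  \prod_o x o `^ (- a o) <= \sum_i \prod_(o | o != i) x o `^ (- s).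
Proof.
move=> x1 as_ sa; have [i xi] := exists_max x j.
have x0 o : 0 < x o by exact: lt_le_trans (x1 o).
have P0 k (Q : pred J) (b : J -> R) : 0 <= \prod_(o | Q o && k o) x o `^ b o.
  by apply: prodr_ge0 => o _; exact: powR_ge0.
apply: (@le_trans _ _ (\prod_(o | o != i) x o `^ (- s))); last first.
  rewrite [leRHS](bigD1 i)//= lerDl; apply: sumr_ge0 => k _.
  by apply: prodr_ge0 => o _; exact: powR_ge0.
have -> : \prod_o x o `^ (- a o) =
    (\prod_(o | o != i) x o `^ (- s)) * (x i `^ (- a i) * \prod_(o | o != i) x o `^ (s - a o)).
  rewrite (bigD1 i)//= mulrCA; congr (_ * _); rewrite -big_split/=; apply: eq_bigr => o _.
  rewrite -powRD; last by rewrite (gt_eqF (x0 o)) implybT.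
  by congr (_ `^ _); ring.
apply: ler_piMr; first by apply: prodr_ge0 => o _; exact: powR_ge0.
apply: (@le_trans _ _ (x i `^ (- a i) * \prod_(o | o != i) x i `^ (s - a o))).
  rewrite ler_wpM2l ?powR_ge0//; apply: ler_prod => o _; rewrite powR_ge0/=.
  by apply: ge0_ler_powR; rewrite ?subr_ge0 ?nnegrE ?(ltW (x0 _)).
have prodE (Q : pred J) (b : J -> R) : \prod_(o | Q o) x i `^ b o = x i `^ (\sum_(o | Q o) b o).
  elim/big_rec2: _ => [|o y1 y2 _ ->]; first by rewrite powRr0.
  by rewrite powRD// (gt_eqF (x0 i)) implybT.
rewrite prodE -powRD; last by rewrite (gt_eqF (x0 i)) implybT.
rewrite sumrB [X in X - _](_ : _ = #|J|.-1%:R * s); last first.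
  by rewrite (eq_bigl (fun o => o \in predC1 i))// sumr_const cardC1 mulr_natl.
rewrite -sa (bigD1 i)//= (_ : - a i + _ = 0) ?powRr0//; ring.
Qed.

Definition box_index D (m : int * int) : box D :=
  (inord `|(m.1 + D%:Z)%R|%N, inord `|(m.2 + D%:Z)%R|%N).

Lemma box_indexK D m : in_box D m -> box_mode (box_index D m) = m.
Proof.
case: m => a b; rewrite /in_box /box_mode/= => /andP[h1 h2].
by rewrite !inordK; [congr pair; lia|lia|lia].
Qed.

Lemma sum_in_box n K (f : 'I_n -> int * int) : (forall j, in_box K (f j)) ->
  in_box (n * K) (\sum_j f j).
Proof.
elim: n f => [|n IH] f fK; first by rewrite big_ord0 /in_box.
by rewrite big_ord_recl mulSn; apply: in_boxD => //; apply: IH.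
Qed.

Lemma sum_inj_le (I J : finType) (h : I -> J) (F : J -> R) : injective h -> (forall j, 0 <= F j) ->
  \sum_i F (h i) <= \sum_j F j.
Proof.
move=> hi F0; rewrite -(big_map h xpredT F) big_uniq/= ?map_inj_uniq ?index_enum_uniq//.
by rewrite [leRHS](bigID (mem (map h (index_enum I))))/= lerDl sumr_ge0.
Qed.

(** There are n + 1 eigenvalues, those of the n frequencies and that of their sum, and the exponents
    add up to n s with s > 1. By [prod_powR_le] it suffices to sum the products with one factor
    omitted; any n of these n + 1 frequencies determine the last one, so each such sum is at most
    [B ^+ n]. *)
Lemma lattice_convolution_bounded n (mu lambda : R) : (0 < n)%N -> 0 <= mu -> mu < lambda -> lambda <= 1 ->
  exists2 C : R, 0 < C & forall K (j0 : 'I_n),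
  \sum_(f : {ffun 'I_n -> box K}) (\prod_j (eigen (box_mode (f j)))^-1) *
     (eigen (box_mode (f j0)) `^ mu * eigen (\sum_j box_mode (f j)) `^ (- lambda)) <= C.
Proof.
move=> n0 mu0 mul l1; pose s := 1 + (lambda - mu) / n%:R; have nR : 0 < n%:R :> R by rewrite ltr0n.
have s1 : 1 < s by rewrite ltrDl divr_gt0// subr_gt0.
have [B B0 hB] := lattice_sum_bounded s1.
exists (n.+1%:R * B ^+ n) => [|K j0]; first by rewrite mulr_gt0// exprn_gt0.
pose x (f : {ffun 'I_n -> box K}) (o : option 'I_n) : R := match o with
  | Some j => eigen (box_mode (f j)) | None => eigen (\sum_j box_mode (f j)) end.
pose a (o : option 'I_n) : R := match o with
  | Some j => 1 - mu * (j == j0)%:R | None => lambda end.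
have optsum (F : option 'I_n -> R) : \sum_o F o = F None + \sum_i F (Some i).
  rewrite (bigD1 None)//=; congr (_ + _).
  rewrite (reindex_omap Some id)/=; last by case.
  by apply: eq_bigl => i; rewrite eqxx.
have optprod (Q : pred (option 'I_n)) (F : option 'I_n -> R) :
   \prod_(o | Q o) F o = (if Q None then F None else 1) * \prod_(i | Q (Some i)) F (Some i).
  rewrite big_mkcond (bigD1 None)//= [in RHS]big_mkcond; congr (_ * _).
  rewrite (reindex_omap Some id)/=; last by case.
  by apply: eq_bigl => i; rewrite eqxx.
have x1 f o : 1 <= x f o by case: o => [j|]; exact: eigen_ge1.
have le_as o : a o <= s.
  apply: (@le_trans _ _ 1); last exact: ltW.
  case: o => [j|] //=; by rewrite gerBl mulr_ge0.
have sum_a : \sum_o a o = #|{: option 'I_n}|.-1%:R * s.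
  rewrite optsum card_option card_ord/= sumrB sumr_const card_ord.
  rewrite -mulr_sumr (bigD1 j0)//= eqxx big1 ?addr0; last by move=> j /negbTE ->.
  rewrite mulr1 /s mulrDr mulr1 mulrCA divff ?gt_eqF// mulr1; ring.
apply: (@le_trans _ _ (\sum_(f : {ffun 'I_n -> box K}) \sum_i \prod_(o | o != i) x f o `^ (- s))).
  apply: ler_sum => f _; apply: le_trans (prod_powR_le None (x1 f) le_as sum_a).
  rewrite optprod/= [X in _ <= X]mulrC; apply: ler_of_eq.
  rewrite mulrA; congr (_ * _); rewrite (bigD1 j0)//= [in RHS](bigD1 j0)//= eqxx mulr1.
  rewrite mulrAC -[(eigen _)^-1]powR_inv1 ?(ltW (eigen_gt0 _))// -powRD; last first.
    by rewrite (gt_eqF (eigen_gt0 _)) implybT.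
  congr (_ `^ _ * _); first by ring.
  apply: eq_bigr => j /negbTE ->; rewrite mulr0 subr0 powR_inv1//; exact: ltW (eigen_gt0 _).
rewrite exchange_big/= optsum -natr1 addrC mulrDl mul1r; apply: lerD; last first.
  under eq_bigr do rewrite optprod/= mul1r.
  rewrite -(bigA_distr_bigA (fun _ k => eigen (box_mode k) `^ (- s)))/= prodr_const card_ord.
  by rewrite lerXn2r ?nnegrE ?(ltW B0) ?hB//; apply: sumr_ge0 => k _; exact: powR_ge0.
rewrite -[n in n%:R](card_ord n) mulr_natl -sumr_const; apply: ler_sum => i _.
(* When the factor of frequency i is omitted, the total takes its place as a free variable; this
   change of variables is injective and lands in a box n times larger. *)
pose h (f : {ffun 'I_n -> box K}) : {ffun 'I_n -> box (n * K)} :=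
  [ffun j => box_index (n * K) (if j == i then \sum_j box_mode (f j) else box_mode (f j))].
have hK (f : {ffun 'I_n -> box K}) j : box_mode (h f j) = if j == i then \sum_j box_mode (f j) else box_mode (f j).
  rewrite ffunE box_indexK//; case: ifP => _; first by apply: sum_in_box => ?; exact: box_modeP.
  by apply: in_box_le (box_modeP _); rewrite leq_pmull.
have hi : injective h.
  move=> f g fg; have E j := congr1 (fun u : {ffun 'I_n -> box (n * K)} => box_mode (u j)) fg.
  have Ej j : j != i -> f j = g j.
    by move=> ji; have := E j; rewrite /= !hK (negbTE ji) => /box_mode_inj.
  apply/ffunP => j; have [->|] := eqVneq j i; last exact: Ej.
  have := E i; rewrite /= !hK eqxx (bigD1 i)//= [in RHS](bigD1 i)//=.
  rewrite (eq_bigr (fun j => box_mode (g j))) => [/addIr/box_mode_inj//|k ki].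
  by rewrite Ej.
apply: (@le_trans _ _ (\sum_f \prod_j eigen (box_mode (h f j)) `^ (- s))).
  apply: ler_sum => f _; apply: ler_of_eq; rewrite optprod/= [RHS](bigD1 i)//= hK eqxx; congr (_ * _).
  by apply: eq_big => [//|j ji]; rewrite hK; move: ji; rewrite (inj_eq Some_inj) => /negbTE ->.
apply: le_trans (@sum_inj_le _ _ h (fun f => \prod_j eigen (box_mode (f j)) `^ (- s)) hi _) _.
  by move=> f; apply: prodr_ge0 => j _; exact: powR_ge0.
rewrite -(bigA_distr_bigA (fun _ k => eigen (box_mode k) `^ (- s)))/= prodr_const card_ord.
by rewrite lerXn2r ?nnegrE ?(ltW B0) ?hB//; apply: sumr_ge0 => k _; exact: powR_ge0.
Qed.

End LatticeTensor.

(** * L^2 norms of combinations of truncated kernels *)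

Section TensorGram.
Context {R : realType}.
Local Notation S := (spacetime R).
Local Notation eigen := (@eigen R).
Local Notation Rc := R[i].

Lemma box_sum_even K (w : int * int -> R) (z : R * R) : (forall m, w (- m) = w m) ->
  (\sum_(k : box K) w (box_mode k) * cos (phase (box_mode k) z))%:C%C =
  \sum_(k : box K) (w (box_mode k))%:C%C * fourier_mode (box_mode k) z.
Proof.
move=> wN; pose op (k : box K) : box K := (rev_ord k.1, rev_ord k.2).
have opK : involutive op by move=> [k l]; rewrite /op/= !rev_ordK.
have opE k : box_mode (op k) = - box_mode k.
  case: k => k l; rewrite /box_mode/=; have := ltn_ord k; have := ltn_ord l.
  by move=> hl hk; congr pair => /=; lia.
have s0 : \sum_(k : box K) w (box_mode k) * sin (phase (box_mode k) z) = 0.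
  set T := LHS; suff : T = - T by move=> h; lra.
  rewrite {1}/T (reindex_inj (inv_inj opK))/= -sumrN; apply: eq_bigr => k _.
  by rewrite opE wN phaseNl sinN mulrN.
rewrite rmorph_sum/=; apply/eqP; rewrite eq_complex !raddf_sum; apply/andP; split; apply/eqP.
  by apply: eq_bigr => k _; rewrite /= mul0r subr0.
rewrite big1// -[LHS]s0; apply: eq_bigr => k _; by rewrite /= mul0r addr0.
Qed.

Context (n : nat) (A : finType) (sg tm : A -> R) (M : A -> nat) (D K L : nat) (phi : R * R -> R).
Hypotheses (phiD : rtrig D phi) (MK : forall a, (M a <= K)%N) (KL : (n * K + D < L)%N).

Definition grid_coef (l : int * int) : Rc := grid_avg L (fun y => (phi y)%:C%C * fourier_mode l y).

Let rho a a' m : R := in_disc (M a) m * in_disc (M a') m * expR (- (`|tm a - tm a'| * eigen m)) / (2 * eigen m).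

Definition gram_weight (f : {ffun 'I_n -> box K}) : R :=
  \sum_a \sum_a' sg a * sg a' * \prod_j (in_disc (M a) (box_mode (f j)) * in_disc (M a') (box_mode (f j)) *
    expR (- (`|tm a - tm a'| * eigen (box_mode (f j))))).

Let rhoN a a' m : rho a a' (- m) = rho a a' m.
Proof. by rewrite /rho !in_discN eigenN. Qed.

Let innerX a a' y y' : (inner (field_kernel (M a) (tm a) y) (field_kernel (M a') (tm a') y') ^+ n)%:C%C =
  \sum_(f : {ffun 'I_n -> box K}) (\prod_j rho a a' (box_mode (f j)))%:C%C *
    (fourier_mode (\sum_j box_mode (f j)) y * (fourier_mode (\sum_j box_mode (f j)) y')^*%C).
Proof.
rewrite (inner_field_kernel _ _ _ _ (MK a) (MK a')) rmorphXn/= (box_sum_even _ _ (rhoN a a')).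
rewrite -[n in LHS](card_ord n) -prodr_const bigA_distr_bigA/=; apply: eq_bigr => f _.
by rewrite big_split/= -rmorph_prod -mode_sum modeDr modeNr modeNl.
Qed.

(** The n-th power of the covariance expands over n-tuples of frequencies, and the double grid sum
    against [phi] produces the squared modulus of its coefficient at the total frequency. Signs,
    times and cutoffs are collected in [gram_weight]. *)
Lemma gram_tensor :
  integral_n (fun z : n.-tuple S => ((\sum_a sg a * wick_kernelN (M a) (tm a) phi z) ^+ 2)%:E) =
  (\sum_(f : {ffun 'I_n -> box K}) (\prod_j (2 * eigen (box_mode (f j)))^-1) *
     (normc (grid_coef (\sum_j box_mode (f j))) ^+ 2 * gram_weight f))%:E.
Proof.
pose G := ('I_L * 'I_L)%type; pose c (v : A * G) := sg v.1 * (L%:R ^- 2 * phi (grid_point v.2)).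
pose h (v : A * G) (j : 'I_n) := field_kernel (M v.1) (tm v.1) (grid_point v.2 : R * R).
transitivity (integral_n (fun z : n.-tuple S => ((\sum_v c v * \prod_j h v j (tnth z j)) ^+ 2)%:E)).
  congr integral_n; apply/funext => z; congr (_ ^+ 2)%:E.
  rewrite -(pair_bigA _ (fun a k => c (a, k) * \prod_j h (a, k) j (tnth z j)))/=.
  apply: eq_bigr => a _; rewrite (wick_kernelN_tensor _ _ phiD (L := L)); last first.
    by apply: leq_ltn_trans KL; rewrite leq_add2r leq_mul2l MK orbT.
  by rewrite mulr_sumr; apply: eq_bigr => k _; rewrite /c/= !mulrA.
rewrite integral_n_tensor; last by move=> v j; exact: square_integrable_field_kernel.
congr EFin; apply: (@complexI R).
pose W a a' (f : {ffun 'I_n -> box K}) : Rc := (\prod_j rho a a' (box_mode (f j)))%:C%C.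
pose Q (f : {ffun 'I_n -> box K}) (k : G) : Rc := ((L%:R ^- 2 * phi (grid_point k))%:C)%C * fourier_mode (\sum_j box_mode (f j)) (grid_point k).
have [Q' Q'E] : exists Q', forall f k, Q' f k = (Q f k)^*%C by exists (fun f k => (Q f k)^*%C).
transitivity (\sum_a \sum_a' \sum_f (sg a * sg a')%:C%C * W a a' f * ((\sum_k Q f k) * (\sum_k Q' f k))).
  rewrite rmorph_sum/= -(pair_bigA _ (fun a k => (\sum_u c (a, k) * c u * \prod_j inner (h (a, k) j) (h u j))%:C%C))/=.
  apply: eq_bigr => a _.
  transitivity (\sum_k \sum_a' \sum_k' \sum_f (sg a * sg a')%:C%C * W a a' f * (Q f k * Q' f k')).
    apply: eq_bigr => k _; rewrite rmorph_sum/=.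
    rewrite -(pair_bigA _ (fun a' k' => (c (a, k) * c (a', k') * \prod_j inner (h (a, k) j) (h (a', k') j))%:C%C))/=.
    apply: eq_bigr => a' _; apply: eq_bigr => k' _.
    have -> : \prod_j inner (h (a, k) j) (h (a', k') j) = inner (field_kernel (M a) (tm a) (grid_point k))
      (field_kernel (M a') (tm a') (grid_point k')) ^+ n.
      by rewrite -[n in RHS](card_ord n) -prodr_const; apply: eq_bigr.
    transitivity ((c (a, k) * c (a', k'))%:C%C * (inner (field_kernel (M a) (tm a) (grid_point k))
      (field_kernel (M a') (tm a') (grid_point k')) ^+ n)%:C%C); first exact: rmorphM.
    rewrite innerX mulr_sumr; apply: eq_bigr => f _.
    have -> : Q' f k' = (L%:R ^- 2 * phi (grid_point k'))%:C%C * (fourier_mode (\sum_j box_mode (f j)) (grid_point k'))^*%C.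
      by rewrite Q'E rmorphM/= oppr0.
    rewrite /W /Q /c !(rmorphM (real_complex R)); ring.
  rewrite exchange_big/=; apply: eq_bigr => a' _.
  under eq_bigr do rewrite exchange_big/=.
  rewrite exchange_big/=; apply: eq_bigr => f _.
  under eq_bigr do rewrite -mulr_sumr.
  rewrite -mulr_sumr; congr (_ * _); rewrite mulr_suml; apply: eq_bigr => k _.
  by rewrite mulr_sumr.
under eq_bigr do rewrite exchange_big/=.
rewrite exchange_big/= rmorph_sum/=; apply: eq_bigr => f _.
have QE : \sum_k Q f k = grid_coef (\sum_j box_mode (f j)).
  by rewrite /grid_coef /grid_avg mulr_sumr; apply: eq_bigr => k _; rewrite /Q rmorphM/= mulrA.
have Q'S : \sum_k Q' f k = (grid_coef (\sum_j box_mode (f j)))^*%C.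
  by rewrite -QE rmorph_sum; apply: eq_bigr => k _; exact: Q'E.
rewrite QE Q'S -normc_sqr.
under eq_bigr do rewrite -mulr_suml.
rewrite -mulr_suml [RHS]rmorphM/= [X in _ = _ * X]rmorphM/= [RHS]mulrCA mulrC; congr (_ * _).
rewrite /gram_weight -rmorphM mulr_sumr rmorph_sum/=; apply: eq_bigr => a _.
rewrite mulr_sumr rmorph_sum/=; apply: eq_bigr => a' _.
rewrite /W -rmorphM mulrCA; congr (_ * _)%:C%C.
by rewrite -big_split/=; apply: eq_bigr => j _; rewrite /rho mulrC.
Qed.

End TensorGram.

Section GramBound.
Context {R : realType}.
Local Notation S := (spacetime R).
Local Notation eigen := (@eigen R).
Local Notation Rc := R[i].

Lemma grid_avg_conj L (f : R * R -> Rc) : grid_avg L (fun x => (f x)^*%C) = (grid_avg L f)^*%C.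
Proof.
rewrite /grid_avg rmorphM rmorph_sum; congr (_ * _).
by apply/eqP; rewrite eq_complex/= oppr0 !eqxx.
Qed.

(** Taking the real part averages the coefficients at l and - l, which obey the same bound because
    [eigen] is even. *)
Lemma grid_coef_le D K L (a : int * int -> Rc) (B lambda : R) l :
  (forall m, normc (a m) ^+ 2 <= B * eigen m `^ (- lambda)) -> (K + D < L)%N -> in_box K l ->
  normc (grid_coef L (fun x => complex.Re (trig D a x)) l) ^+ 2 <= B * eigen l `^ (- lambda).
Proof.
move=> aB KL lK; have nx (x : R) : 0 <= x -> normc (x%:C%C : Rc) = x by move=> x0; rewrite normc_real ger0_norm.
have e m : in_box K m -> normc (cut D a m) ^+ 2 <= B * eigen m `^ (- lambda).
  move=> _; rewrite /cut; case: ifP => _; first exact: aB.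
  by rewrite ComplexField.Normc.normc0 expr0n/=; apply: le_trans (aB m); exact: sqr_ge0.
have -> : grid_coef L (fun x => complex.Re (trig D a x)) l =
    (2^-1 : R)%:C%C * (cut D a (- l) + (cut D a l)^*%C).
  have /andP[l1 l2] : (`|(l.1)%R|%N + D < L)%N && (`|(l.2)%R|%N + D < L)%N.
    by move: lK; rewrite /in_box => /andP[h1 h2]; lia.
  have h1 : grid_avg L (fun x => trig D a x * fourier_mode l x) = cut D a (- l).
    rewrite -(grid_avg_trig (L := L) (D := D) a (m := - l)) /=; [|by lia|by lia].
    by apply: eq_grid_avg => x; rewrite opprK.
  have h2 : grid_avg L (fun x => (trig D a x)^*%C * fourier_mode l x) = (cut D a l)^*%C.
    rewrite -(grid_avg_trig (L := L) (D := D) a (m := l))// -grid_avg_conj.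
    apply: eq_grid_avg => x; rewrite rmorphM modeNl; congr (_ * _).
    by case: (fourier_mode _ _) => u v /=; rewrite opprK.
  rewrite -h1 -h2 -[in RHS]/(grid_avg L (fun x => trig D a x * fourier_mode l x)).
  rewrite /grid_coef /grid_avg -mulrDr -big_split/= mulrCA; congr (_ * _); rewrite mulr_sumr.
  apply: eq_bigr => k _; rewrite -mulrDl mulrA; congr (_ * _).
  case: (trig D a _) => u v; apply/eqP; rewrite eq_complex/=; apply/andP.
  by split; apply/eqP; field.
rewrite ComplexField.Normc.normcM nx; last by rewrite invr_ge0.
have h1 := e (- l); rewrite in_boxN eigenN in h1; have {h1} := h1 lK; have := e l lK.
set p := normc (cut D a l); set q := normc (cut D a (- l)); set T := B * _ => hp hq.
have t := le_normcD (cut D a (- l)) (cut D a l)^*%C; rewrite normc_conj -/p -/q in t.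
have p0 : 0 <= p by exact: normc_ge0. have q0 : 0 <= q by exact: normc_ge0.
apply: (@le_trans _ _ ((2^-1 * (q + p)) ^+ 2)).
  by rewrite lerXn2r ?nnegrE ?mulr_ge0 ?invr_ge0 ?normc_ge0 ?addr_ge0// ler_wpM2l ?invr_ge0.
by have := sqr_ge0 (p - q); nra.
Qed.

Lemma one_sub_exp_le (kappa u : R) : 0 <= kappa <= 1 -> 0 <= u -> 1 - expR (- u) <= u `^ kappa.
Proof.
move=> /andP[k0 k1] u0; have [u1|u1] := leP 1 u.
  apply: (@le_trans _ _ 1); first by rewrite gerBl expR_ge0.
  by rewrite -[leLHS](powRr0 u); exact: ler_powR.
apply: (@le_trans _ _ u); first by have := expR_ge1Dx (- u); lra.
move: u0; rewrite le_eqVlt => /predU1P[<-|u0]; first exact: powR_ge0.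
have u01 : 0 < u <= 1 by rewrite u0 ltW.
by apply: le_trans (ger_powR u01 k1); rewrite powRr1// ltW.
Qed.

(* [te] switches on the increment in time, [be] the subtraction of the Galerkin
   approximation. *)
Definition diff_sign (te be : bool) (a : bool * bool) : R :=
  (if a.1 then 1 else - te%:R) * (if a.2 then 1 else - be%:R).

Definition time_gain (kappa : R) (te : bool) (t s : R) : R := if te then `|t - s| `^ kappa else 1.

Definition level_gain (gam : R) (be : bool) (N : nat) : R := if be then N%:R `^ (- (2 * gam)) else 1.

Lemma time_gain_ge0 kappa te t s : 0 <= time_gain kappa te t s.
Proof. by rewrite /time_gain; case: te; rewrite ?powR_ge0. Qed.

Lemma level_gain_ge0 gam be N : 0 <= level_gain gam be N.
Proof. by rewrite /level_gain; case: be; rewrite ?powR_ge0. Qed.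

(** The weight factors. The increment in time contributes 2 (1 - [E]), a kappa-th power of the time
    difference times an eigenvalue. The difference of the two cutoffs vanishes unless some frequency
    exceeds N, in which case the largest eigenvalue [X1] is at least N^2. Both gains are paid for by
    powers of [X1]. *)
Lemma gram_weight_le n (gam kappa : R) te be t s N K (f : {ffun 'I_n -> box K}) :
  (0 < n)%N -> 0 <= gam -> 0 <= kappa <= 1 -> (0 < N)%N -> (N <= K)%N ->
  0 <= gram_weight (diff_sign te be) (fun a => if a.1 then t else s) (fun a => if a.2 then K else N) f <=
  2 * n%:R * time_gain kappa te t s * level_gain gam be N *
    \sum_j eigen (box_mode (f j)) `^ (gam + kappa).
Proof.
move=> n0 gam0 kap N0 NK; have /andP[kap0 kap1] := kap.
pose x j := eigen (box_mode (f j)).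
have x1 j : 1 <= x j by exact: eigen_ge1.
have [j0 hj0] := exists_max x (Ordinal n0); set X1 := x j0 in hj0.
have X1_ge1 : 1 <= X1 by exact: x1.
pose dN : R := \prod_j in_disc N (box_mode (f j)); pose dK : R := \prod_j in_disc K (box_mode (f j)).
pose E := expR (- (`|t - s| * \sum_j x j)).
have ind01 M m : in_disc M m ^+ 2 = in_disc M m :> R.
  by rewrite /in_disc; case: (_ \in _); rewrite ?expr1n ?expr0n.
have indNK m : in_disc N m * in_disc K m = in_disc N m :> R.
  have := in_disc_le (R := R) m NK; rewrite /in_disc; case: (m \in disc N); rewrite ?mul0r// mul1r.
  by case: (m \in disc K) => //; rewrite ler_nat.
have PE a a' : \prod_j (in_disc (if a.2 then K else N) (box_mode (f j)) * in_disc (if a'.2 then K else N) (box_mode (f j)) *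
    expR (- (`|(if a.1 then t else s) - (if a'.1 then t else s)| * eigen (box_mode (f j))))) =
    (if a.2 && a'.2 then dK else dN) * (if a.1 == a'.1 then 1 else E) :> R.
  rewrite big_split/=; congr (_ * _).
    case: a.2; case: a'.2 => /=; apply: eq_bigr => j _; rewrite ?indNK// -?expr2 ?ind01//.
    by rewrite mulrC indNK.
  have h (r : R) : \prod_j expR (- (r * eigen (box_mode (f j)))) = expR (- (r * \sum_j x j)).
    by rewrite mulr_sumr -sumrN expR_sum.
  rewrite h; case: a.1; case: a'.1 => /=; rewrite ?subrr ?normr0 ?mul0r ?oppr0 ?expR0//.
  by rewrite distrC.
have -> : gram_weight (diff_sign te be) (fun a => if a.1 then t else s) (fun a => if a.2 then K else N) f =
    (1 + te%:R - 2 * te%:R * E) * (dK - be%:R * dN).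
  rewrite /gram_weight; under eq_bigr do under eq_bigr do rewrite PE.
  rewrite -(pair_bigA _ (fun a1 a2 => \sum_a' diff_sign te be (a1, a2) * diff_sign te be a' *
     ((if a2 && a'.2 then dK else dN) * (if a1 == a'.1 then 1 else E))))/=.
  have h a1 a2 : \sum_a' diff_sign te be (a1, a2) * diff_sign te be a' *
     ((if a2 && a'.2 then dK else dN) * (if a1 == a'.1 then 1 else E)) =
     \sum_b1 \sum_b2 diff_sign te be (a1, a2) * diff_sign te be (b1, b2) *
     ((if a2 && b2 then dK else dN) * (if a1 == b1 then 1 else E)).
    by rewrite (pair_bigA _ (fun b1 b2 => diff_sign te be (a1, a2) * diff_sign te be (b1, b2) *
     ((if a2 && b2 then dK else dN) * (if a1 == b1 then 1 else E)))); apply: eq_bigr => -[].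
  under eq_bigr do under eq_bigr do rewrite h.
  rewrite !big_bool/= /diff_sign/=.
  by clear h; case: te; case: be => /=; ring.
have dN0 : 0 <= dN by apply: prodr_ge0 => j _; exact: in_disc_ge0.
have dNK : dN <= dK by apply: ler_prod => j _; rewrite in_disc_ge0 in_disc_le.
have dK1 : dK <= 1.
  have -> : 1 = \prod_(j < n) 1 :> R by rewrite big1.
  by apply: ler_prod => j _; rewrite in_disc_ge0 in_disc_le1.
have E1 : E <= 1 by rewrite -expR0 ler_expR oppr_le0 mulr_ge0// sumr_ge0// => j _; exact: le_trans (x1 j).
have E0 : 0 < E by exact: expR_gt0.
have W1 : 0 <= 1 + te%:R - 2 * te%:R * E <= 2 * n%:R * time_gain kappa te t s * X1 `^ kappa.
  rewrite /time_gain; case: te => /=.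
    apply/andP; split; first by lra.
    apply: (@le_trans _ _ (2 * (`|t - s| * \sum_j x j) `^ kappa)).
      have := @one_sub_exp_le kappa (`|t - s| * \sum_j x j) kap; rewrite -/E => h.
      have := h (mulr_ge0 (normr_ge0 _) (sumr_ge0 _ (fun j _ => le_trans ler01 (x1 j)))); lra.
    rewrite -!mulrA ler_wpM2l// mulrCA.
    rewrite powRM//; last by apply: sumr_ge0 => j _; exact: le_trans (x1 j).
    rewrite ler_wpM2l ?powR_ge0//.
    apply: (@le_trans _ _ ((n%:R * X1) `^ kappa)).
      apply: ge0_ler_powR; rewrite ?nnegrE ?mulr_ge0 ?(le_trans ler01 X1_ge1)//.
        by apply: sumr_ge0 => j _; exact: le_trans (x1 j).
      rewrite -[n in n%:R](card_ord n) mulr_natl -sumr_const; apply: ler_sum => j _; exact: hj0.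
    rewrite powRM ?(le_trans ler01 X1_ge1)// ler_wpM2r ?powR_ge0//.
    by rewrite -[leRHS](powRr1 (ler0n R n)); apply: ler_powR; rewrite ?ler1n.
  rewrite mulr0 mul0r subr0 addr0 ler01 mulr1/=; apply: (@le_trans _ _ (1 * 1)); first by rewrite mulr1.
  apply: ler_pM => //; first by rewrite -natrM ler1n muln_gt0.
  by rewrite -[leLHS](powRr0 X1); exact: ler_powR.
have W2 : 0 <= dK - be%:R * dN <= level_gain gam be N * X1 `^ gam.
  have X1gam : 1 <= X1 `^ gam by rewrite -[leLHS](powRr0 X1); exact: ler_powR.
  rewrite /level_gain; case: be => /=; last by rewrite mul0r subr0 (le_trans dN0 dNK) mul1r (le_trans dK1).
  rewrite mul1r subr_ge0 dNK/=; have [[j hj]|h] := pselect (exists j, ~ @disc R N (box_mode (f j))); last first.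
    have -> : dN = 1.
      rewrite /dN big1// => j _; rewrite /in_disc mem_set//; apply: contrapT => hj; apply: h; by exists j.
    by apply: (@le_trans _ _ 0); [rewrite subr_le0|rewrite mulr_ge0 ?powR_ge0].
  apply: (@le_trans _ _ 1); first by rewrite lerBlDr (le_trans dK1)// lerDl.
  have NR : 0 < N%:R :> R by rewrite ltr0n.
  have NX : N%:R ^+ 2 <= X1.
    apply: le_trans (hj0 j); rewrite /x /eigen.
    have : N%:R < norm2 (lattice (box_mode (f j))) :> R by rewrite ltNge; apply/negP.
    set r := norm2 _ => hr.
    have p1 : 1 <= pi ^+ 2 :> R by rewrite exprn_ege1// (le_trans _ (@pi_ge2 R))// ler1n.
    have r2 : N%:R ^+ 2 <= r ^+ 2 by rewrite lerXn2r ?nnegrE ?(ltW NR) ?(ltW hr)//; exact: le_trans (ltW NR) (ltW hr).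
    by have := sqr_ge0 r; nra.
  rewrite powRN ler_pdivlMl ?powR_gt0// mulr1 powRrM -powR_mulrn ?(ltW NR)// in NX *.
  by apply: ge0_ler_powR => //; rewrite nnegrE ?powR_ge0// (le_trans ler01).
move: W1 W2 => /andP[w1 W1] /andP[w2 W2].
rewrite mulr_ge0//=; apply: le_trans (ler_pM w1 w2 W1 W2) _.
rewrite mulrACA -!mulrA; do 2 (rewrite ler_wpM2l//).
rewrite ler_wpM2l ?time_gain_ge0// ler_wpM2l ?level_gain_ge0// mulrC -powRD; last first.
  by rewrite (gt_eqF (lt_le_trans ltr01 X1_ge1)) implybT.
by rewrite (bigD1 j0)//= lerDl sumr_ge0// => j _; exact: powR_ge0.
Qed.

(** The exponent [gam + kappa] lost on a single frequency is paid for by the decay of exponent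
    [lambda] of the test function at the total frequency. *)
Lemma gram_bound n (gam kappa lambda : R) : (0 < n)%N -> 0 <= gam -> 0 <= kappa -> gam + kappa < lambda -> lambda <= 1 ->
  exists2 C : R, 0 < C & forall te be t s N K D (a : int * int -> Rc) B, (0 < N)%N -> (N <= K)%N ->
  (forall m, normc (a m) ^+ 2 <= B * eigen m `^ (- lambda)) ->
  (integral_n (fun z : n.-tuple S => ((\sum_(i : bool * bool) diff_sign te be i *
     wick_kernelN (if i.2 then K else N) (if i.1 then t else s) (fun x => complex.Re (trig D a x)) z) ^+ 2)%:E)
   <= (C * B * time_gain kappa te t s * level_gain gam be N)%:E)%E.
Proof.
move=> n0 gam0 kap0 gkl l1.
have [C C0 hC] := lattice_convolution_bounded n0 (addr_ge0 gam0 kap0) gkl l1.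
exists (2 * n%:R * n%:R * C) => [|te be t s N K D a B N0 NK aB]; first by rewrite !mulr_gt0 ?ltr0n.
have kap : 0 <= kappa <= 1 by rewrite kap0/=; lra.
have B0 : 0 <= B.
  by have h := le_trans (sqr_ge0 _) (aB 0); rewrite pmulr_lge0 ?powR_gt0 ?eigen_gt0 in h.
have phiD : rtrig D (fun x => complex.Re (trig D a x)) by apply: rtrig_Re; exists a.
rewrite (gram_tensor (K := K) (L := (n * K + D).+1) _ _ phiD)//; last by move=> [? []].
rewrite lee_fin.
have g0 := level_gain_ge0 gam be N; have t0 := time_gain_ge0 kappa te t s.
pose Q := B * (2 * n%:R * time_gain kappa te t s * level_gain gam be N).
apply: (@le_trans _ _ (\sum_(f : {ffun 'I_n -> box K}) \sum_j0 Q * ((\prod_j (eigen (box_mode (f j)))^-1) *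
     (eigen (box_mode (f j0)) `^ (gam + kappa) * eigen (\sum_j box_mode (f j)) `^ (- lambda))))).
  apply: ler_sum => f _; rewrite -mulr_sumr -mulr_sumr [leRHS]mulrCA.
  have /andP[w0 w1] := gram_weight_le te be t s f n0 gam0 kap N0 NK.
  apply: ler_pM.
  - by apply: prodr_ge0 => j _; rewrite invr_ge0 mulr_ge0 ?(ltW (eigen_gt0 _)).
  - apply: mulr_ge0; first exact: sqr_ge0.
    exact: w0.
  - apply: ler_prod => j _; rewrite invr_ge0 mulr_ge0 ?(ltW (eigen_gt0 _))//= lef_pV2 ?posrE ?mulr_gt0 ?eigen_gt0//.
    by rewrite ler_peMl ?(ltW (eigen_gt0 _))// ler1n.
  - rewrite -mulr_suml; apply: (@le_trans _ _ ((B * eigen (\sum_j box_mode (f j)) `^ (- lambda)) *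
      (2 * n%:R * time_gain kappa te t s * level_gain gam be N * \sum_j eigen (box_mode (f j)) `^ (gam + kappa)))).
      apply: ler_pM => //; first exact: sqr_ge0.
      by apply: grid_coef_le aB _ (sum_in_box _) => // j; exact: box_modeP.
    by apply: ler_of_eq; rewrite /Q; ring.
rewrite exchange_big/=; apply: (@le_trans _ _ (\sum_(j0 < n) Q * C)).
  have Q0 : 0 <= Q by rewrite /Q; repeat apply: mulr_ge0.
  by apply: ler_sum => j _; rewrite -mulr_sumr; apply: ler_wpM2l => //; exact: hC.
by rewrite sumr_const card_ord -mulr_natl /Q; apply: ler_of_eq; ring.
Qed.
End GramBound.

(** * Test functions and distributions *)

Section TestFunctions.
Context {R : realType}.
Local Notation axis := (@axis R).

(** [plane] carries the product sigma-algebra. The function is a pointwise limit of its values at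
    the lower left corners of squares of side 1/(n + 1), and each of these approximations is
    constant on countably many measurable rectangles. *)
Lemma continuous_plane_measurable (f : R * R -> R) : continuous f ->
  measurable_fun [set: plane R] (f : plane R -> R).
Proof.
move=> cf; pose q n (x : R) : R := (Num.floor (n.+1%:R * x))%:~R / n.+1%:R.
have qx x : q n x @[n --> \oo] --> x.
  apply/cvgrPdist_le => e e0; near=> n.
  have n0 : 0 < n.+1%:R :> R by rewrite ltr0n.
  have -> : x - q n x = (n.+1%:R * x - (Num.floor (n.+1%:R * x))%:~R) / n.+1%:R.
    by rewrite /q mulrBl mulrAC divff ?gt_eqF// mul1r.
  rewrite normrM normfV [`|n.+1%:R|]gtr0_norm// ler_pdivrMr//.
  have /andP[h1 h2] := Num.Theory.floor_itv (n.+1%:R * x : R).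
  apply: (@le_trans _ _ 1).
    rewrite ger0_norm ?subr_ge0//; move: h2; rewrite intrD1 => h2; lra.
  rewrite -ler_pdivrMl// mulr1; apply: (@le_trans _ _ n%:R); last by rewrite ler_nat.
  near: n; exact: nbhs_infty_ger.
apply: (measurable_fun_cvg (h := fun n (z : plane R) => f (q n z.1, q n z.2))); last first.
  move=> -[x y] _ /=; have cz : (q n x, q n y) @[n --> \oo] --> ((x, y) : R * R) by exact: (cvg_pair (qx x) (qx y)).
  exact: (cvg_comp (fun n => (q n x, q n y) : R * R) f cz (cf (x, y))).
move=> n _ A mA; rewrite setTI.
pose fl (x : R) := Num.floor (n.+1%:R * x).
have mfl (a : int) : measurable [set x : R | fl x = a].
  have -> : [set x : R | fl x = a] = [set` `[a%:~R / n.+1%:R, (a + 1)%:~R / n.+1%:R[].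
    have n0 : 0 < n.+1%:R :> R by rewrite ltr0n.
    apply/seteqP; split=> x /=; rewrite in_itv/= ler_pdivrMr// ltr_pdivlMr//.
      by move=> <-; rewrite [x * _]mulrC; exact: Num.Theory.floor_itv.
    by rewrite mulrC => h; apply/eqP; rewrite Num.Theory.floor_eq.
  exact: measurable_itv.
pose F (p : int * int) : set (plane R) := if `[< A (f (p.1%:~R / n.+1%:R, p.2%:~R / n.+1%:R)) >]
  then [set x | fl x = p.1] `*` [set y | fl y = p.2] else set0.
have -> : (fun z : plane R => f (q n z.1, q n z.2)) @^-1` A = \bigcup_p F p.
  apply/seteqP; split=> [z /= Az|z [p _]].
    by exists (fl z.1, fl z.2) => //; rewrite /F; case: asboolP.
  by rewrite /F; case: asboolP => //= Ap [/= h1 h2]; rewrite /q -/(fl z.1) -/(fl z.2) h1 h2.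
apply: countable_bigcupT_measurable => [|p]; first exact: countableP.
by rewrite /F; case: asboolP => // _; apply: measurableX; exact: mfl.
Unshelve. all: by end_near. Qed.

Lemma continuous_torus_bounded (f : R * R -> R) : continuous f ->
  exists2 B : R, 0 <= B & forall x, torus x -> `|f x| <= B.
Proof.
move=> cf; have K : compact ([set` `[(0 : R), 1]] `*` [set` `[(0 : R), 1]]).
  by apply: compact_setX; exact: segment_compact.
have /compact_bounded[B [_ hB]] := continuous_compact (continuous_subspaceT cf) K.
have /(_ (`|B| + 1)) h := hB.
exists (`|B| + 1) => [|x [x1 x2]]; first by rewrite addr_ge0.
apply: h; first by apply: le_lt_trans (ler_norm B) _; rewrite ltrDl.
exists x => //; split => /=; [move: x1|move: x2]; rewrite /= !in_itv/= => /andP[-> /ltW ->]//.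
Qed.

Lemma plane_measure_torus : (@plane_measure R torus = 1)%E.
Proof.
rewrite /torus [LHS](product_measure1E (@lebesgue_measure R) (@lebesgue_measure R))//.
have e : (@lebesgue_measure R [set` `[0%R, 1%R[] = 1)%E.
  by rewrite lebesgue_measure_itv/= lte_fin ltr01 -EFinB subr0.
by transitivity (1 * 1 : \bar R)%E; [congr mule; exact: e|rewrite mul1e].
Qed.

Lemma continuous_torus_integrable (f : R * R -> R) : continuous f ->
  (@plane_measure R).-integrable torus (EFin \o f).
Proof.
move=> cf; have mT : measurable (@torus R) by exact: measurableX.
apply: measurable_bounded_integrable => //.
- by rewrite [X in (X < _)%E](plane_measure_torus) ltry.
- by apply: measurable_funTS; exact: continuous_plane_measurable.
- have [B _ hB] := continuous_torus_bounded cf; exists B; split; first exact: num_real.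
  by move=> M BM x Tx; apply: le_trans (hB _ Tx) (ltW BM).
Qed.

Lemma C_n_continuous k (f : R * R -> R) : C_n k f -> continuous f.
Proof. by case: k => [|k] []. Qed.

Lemma C_nS k (f : R * R -> R) : C_n k.+1 f -> C_n k f.
Proof.
elim: k f => [|k IH] f; first by move=> [cf _]; split.
move=> [cf h]; split=> // i; have [d c] := h i; split => //; exact: IH.
Qed.

Lemma C_nD k (f g : R * R -> R) : C_n k f -> C_n k g -> C_n k (fun x => f x + g x).
Proof.
elim: k f g => [|k IH] f g [cf hf] [cg hg].
  by split=> // x; apply: cvgD; [exact: cf|exact: cg].
split=> [x|i]; first by apply: cvgD; [exact: cf|exact: cg].
have [df f'] := hf i; have [dg g'] := hg i; split=> [x|]; first exact: derivableD.
rewrite (_ : (fun x => _) = (fun x => 'D_(axis i) f x + 'D_(axis i) g x)); first exact: IH.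
by apply/funext => x; apply: deriveD.
Qed.

Lemma C_n_cst k (c : R) : C_n k (fun _ : R * R => c).
Proof.
elim: k c => [|k IH] c; first by split=> // x; exact: cvg_cst.
split=> [x|i]; first exact: cvg_cst.
split=> [x|]; first exact: derivable_cst.
have -> : (fun x => 'D_(axis i) (fun _ : R * R => c) x) = (fun=> 0); last exact: IH.
by apply/funext => x; apply: derive_cst.
Qed.

Lemma C_nM k (f g : R * R -> R) : C_n k f -> C_n k g -> C_n k (fun x => f x * g x).
Proof.
elim: k f g => [|k IH] f g hf hg; have cf := C_n_continuous hf; have cg := C_n_continuous hg.
  by split=> // x; apply: cvgM; [exact: cf|exact: cg].
split=> [x|i]; first by apply: cvgM; [exact: cf|exact: cg].
have [df f'] := hf.2 i; have [dg g'] := hg.2 i; split=> [x|]; first exact: derivableM.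
rewrite (_ : (fun x => _) = (fun x => f x * 'D_(axis i) g x + g x * 'D_(axis i) f x)).
  by apply: C_nD; apply: IH => //; exact: C_nS.
by apply/funext => x; apply: deriveM.
Qed.

Lemma dir_deriveE (f : R * R -> R) (x v : R * R) (g : R -> R) : (forall h : R, f (h *: v + x) = g h) ->
  (derivable g 0 1 -> derivable f x v) /\ 'D_v f x = 'D_1 g 0.
Proof.
move=> fg; have E : (fun h : R => h^-1 *: ((f \o shift x) (h *: v) - f x)) =
    (fun h : R => h^-1 *: ((g \o shift 0) (h *: (1 : R)) - g 0)).
  apply/funext => h; rewrite /= addr0 -fg -fg scale0r add0r.
  by rewrite /GRing.scale/= mulr1.
by rewrite /derivable /derive E.
Qed.

Lemma phase_axis m (h : R) (x : R * R) i :
  phase m (h *: axis i + x) = (2 * pi * (if i then m.1 else m.2)%:~R) * h + phase m x.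
Proof. by rewrite /phase; case: i => /=; rewrite /GRing.scale/=; ring. Qed.

Lemma continuous_phase m : continuous (@phase R m).
Proof.
move=> x; apply: cvgM; first exact: cvg_cst.
apply: cvgD; (apply: cvgM; first exact: cvg_cst); [exact: cvg_fst|exact: cvg_snd].
Qed.

Lemma C_n_cos k m (c a : R) : C_n k (fun x : R * R => c * cos (phase m x + a)).
Proof.
elim: k c a => [|k IH] c a.
  split=> // x; apply: cvgM; first exact: cvg_cst.
  apply: continuous_comp; last exact: continuous_cos.
  by apply: cvgD; [exact: continuous_phase|exact: cvg_cst].
split=> [|i]; first exact: C_n_continuous (IH c a).
pose b : R := 2 * pi * (if i then m.1 else m.2)%:~R.
have E x : (derivable (fun x : R * R => c * cos (phase m x + a)) x (axis i)) /\
    'D_(axis i) (fun x : R * R => c * cos (phase m x + a)) x = (c * b) * cos (phase m x + (a + pi / 2)).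
  have [] := @dir_deriveE (fun x : R * R => c * cos (phase m x + a)) x (axis i)
    (fun h => c * cos (b * h + (phase m x + a))).
    by move=> h; rewrite phase_axis addrA.
  have d := is_deriveZ c (is_derive_cos_scale b (phase m x + a) 0).
  have [d1 d2] := d; move=> /(_ d1) h1; rewrite d2 => ->; split=> //.
  rewrite /GRing.scale/= mulr0 add0r addrA [cos (_ + pi / 2)]cosD cos_pihalf sin_pihalf.
  ring.
split=> [x|]; first by have [] := E x.
rewrite (_ : (fun x => _) = (fun x => (c * b) * cos (phase m x + (a + pi / 2)))); first exact: IH.
by apply/funext => x; have [] := E x.
Qed.

Lemma test_functionD (f g : R * R -> R) : test_function f -> test_function g -> test_function (fun x => f x + g x).
Proof.
by move=> [pf sf] [pg sg]; split=> [i x|k]; [rewrite pf pg|exact: C_nD].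
Qed.

Lemma test_functionM (f g : R * R -> R) : test_function f -> test_function g -> test_function (fun x => f x * g x).
Proof.
by move=> [pf sf] [pg sg]; split=> [i x|k]; [rewrite pf pg|exact: C_nM].
Qed.

Lemma test_function_cst c : test_function (fun _ : R * R => c).
Proof. by split=> // k; exact: C_n_cst. Qed.

Lemma test_functionZ c (f : R * R -> R) : test_function f -> test_function (fun x => c * f x).
Proof. by move=> tf; apply: test_functionM tf; exact: test_function_cst. Qed.

Lemma test_functionX k (f : R * R -> R) : test_function f -> test_function (fun x => f x ^+ k).
Proof.
move=> tf; elim: k => [|k IH]; first by under eq_fun do rewrite expr0; exact: test_function_cst.
by under eq_fun do rewrite exprS; exact: test_functionM.
Qed.

Lemma test_function_cos m a : test_function (fun x : R * R => cos (phase m x + a)).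
Proof.
split=> [i x|k]; last by have := C_n_cos k m 1 a; under eq_fun do rewrite mul1r.
have := mode_periodic m i x; rewrite /fourier_mode => -[hc hs].
by rewrite cosD hc hs -cosD.
Qed.

Lemma test_function_sum (I : Type) (s : seq I) (f : I -> R * R -> R) :
  (forall i, test_function (f i)) -> test_function (fun x => \sum_(i <- s) f i x).
Proof.
move=> h; elim: s => [|i s IH]; first by under eq_fun do rewrite big_nil; exact: test_function_cst.
by under eq_fun do rewrite big_cons; exact: test_functionD.
Qed.

Lemma rtrig_test D (f : R * R -> R) : rtrig D f -> test_function f.
Proof.
move=> /rtrigP[c fc]; rewrite (_ : f = (fun x => \sum_(k : box D) (complex.Re (c (box_mode k)) * cos (phase (box_mode k) x + 0) +
   (- complex.Im (c (box_mode k))) * cos (phase (box_mode k) x + (- (pi / 2)))))); last first.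
  by apply/funext => x; rewrite fc; apply: eq_bigr => k _; rewrite addr0 sin_cos mulNr.
apply: test_function_sum => k.
by apply: test_functionD; apply: test_functionZ; exact: test_function_cos.
Qed.

Lemma test_function_continuous (f : R * R -> R) : test_function f -> continuous f.
Proof. by move=> [_ /(_ 0%N)]; exact: C_n_continuous. Qed.

Definition distr_linear (u : @torus_distribution R) : Prop :=
  forall c f g, test_function f -> test_function g -> u (fun x => f x + c * g x) = u f + c * u g.

Lemma distr_of_fun_linear f : continuous f -> distr_linear (distr_of_fun f).
Proof.
move=> cf c g h tg th; rewrite /distr_of_fun.
have mT : measurable (@torus R) by exact: measurableX.
have i1 k : test_function k -> (@plane_measure R).-integrable torus (EFin \o (fun x => f x * k x)).
  move=> tk; apply: continuous_torus_integrable => x.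
  by apply: cvgM; [exact: cf|exact: (test_function_continuous tk)].
have i2 : (@plane_measure R).-integrable torus (EFin \o (fun x => c * (f x * h x))).
  rewrite (_ : _ \o _ = (fun x => c%:E * (f x * h x)%:E)%E)//.
  by apply: integrableZl => //; exact: i1.
rewrite -RintegralZl//; last exact: i1.
rewrite -RintegralD//; last exact: i1.
by apply: eq_Rintegral => x _; ring.
Qed.

Lemma in_besov_linear chi theta a (u : @torus_distribution R) : in_besov chi theta a u -> distr_linear u.
Proof.
move=> [v [tv _ vu]] c f g tf tg.
have tfg : test_function (fun x => f x + c * g x) by apply: test_functionD => //; exact: test_functionZ.
have h1 := vu _ tfg; have h2 : (distr_of_fun (v k) f + c * distr_of_fun (v k) g) @[k --> \oo] --> u f + c * u g.
  by apply: cvgD; [exact: vu|apply: cvgM; [exact: cvg_cst|exact: vu]].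
have E : (fun k => distr_of_fun (v k) (fun x => f x + c * g x)) =
    (fun k => distr_of_fun (v k) f + c * distr_of_fun (v k) g).
  by apply/funext => k; rewrite (distr_of_fun_linear (test_function_continuous (tv k))).
by rewrite E in h1; exact: cvg_unique h1 h2.
Qed.

Lemma distr_linear0 u : distr_linear u -> u (fun=> 0) = 0.
Proof.
move=> lu; have := lu 1 _ _ (test_function_cst 0) (test_function_cst 0).
rewrite (_ : (fun x => _) = (fun=> 0)); last by apply/funext => x; rewrite mulr0 addr0.
by rewrite mul1r => h; lra.
Qed.

Lemma distr_linear_sum u (I : Type) (s : seq I) (c : I -> R) (f : I -> R * R -> R) : distr_linear u ->
  (forall i, test_function (f i)) -> u (fun x => \sum_(i <- s) c i * f i x) = \sum_(i <- s) c i * u (f i).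
Proof.
move=> lu tf; elim: s => [|i s IH].
  by rewrite big_nil -[RHS](distr_linear0 lu); congr u; apply/funext => x; rewrite big_nil.
rewrite big_cons -IH addrC -lu//; last by apply: test_function_sum => j; exact: test_functionZ.
by congr u; apply/funext => x; rewrite big_cons addrC.
Qed.

Lemma distr_linear_sub u v : distr_linear u -> distr_linear v -> distr_linear (distr_sub u v).
Proof. by move=> lu lv c f g tf tg; rewrite /distr_sub lu// lv//; ring. Qed.

(** [heat_kernelN N 0] is the Dirichlet kernel of the disc, so the value at a point of the Galerkin
    projection is a pairing with a test function. *)
Lemma galerkinE u N (y : R * R) : distr_linear u ->
  galerkin N u y = u (fun x => heat_kernelN N 0 (y - x)).
Proof.
move=> lu; rewrite /galerkin (@fsbig_box _ N); last by move=> m /disc_in_box.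
rewrite raddf_sum big_mkcond.
transitivity (u (fun x => \sum_(k : box N) in_disc N (box_mode k) * cos (phase (box_mode k) (y - x)))); last first.
  congr u; apply/funext => x; rewrite (heat_kernelNE _ _ (leqnn N)); apply: eq_bigr => k _.
  by rewrite mul0r oppr0 expR0 mulr1.
have tc (m : int * int) : test_function (fun x => cos (phase m (y - x))).
  rewrite (_ : (fun x => _) = (fun x => cos (phase (- m) x + phase m y))); first exact: test_function_cos.
  by apply/funext => x; rewrite phaseDr phaseNr phaseNl addrC.
rewrite distr_linear_sum//; apply: eq_bigr => k _; rewrite /in_disc.
case: (_ \in _); rewrite ?mul0r ?mul1r//; set m := box_mode k.
rewrite /fourier_coef /fourier_mode/=.
have -> : (fun x => cos (phase m (y - x))) =
   (fun x => cos (phase m y) * cos (phase (- m) x + 0) + (- sin (phase m y)) * cos (phase (- m) x + (- (pi / 2)))).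
  apply/funext => x; rewrite addr0 -sin_cos phaseDr phaseNr phaseNl sinN cosN cosB.
  by rewrite mulrNN.
rewrite lu; [|by apply: test_functionZ; exact: test_function_cos|exact: test_function_cos].
have z0 : u (fun x => cos (phase m y) * cos (phase (- m) x + 0)) = cos (phase m y) * u (fun x => cos (phase (- m) x + 0)).
  have := lu (cos (phase m y)) _ _ (test_function_cst 0) (test_function_cos (- m) 0).
  by rewrite (distr_linear0 lu) add0r => <-; congr u; apply/funext => x; rewrite add0r.
rewrite z0 mulrC mulNr [sin _ * _]mulrC; congr (_ * u _ - u _ * _); apply/funext => x.
  by rewrite addr0.
by rewrite -sin_cos.
Qed.

Lemma rtrig_galerkin N u : rtrig N (@galerkin R N u).
Proof.
apply: rtrig_Re; apply: (eq_is_trig (f := fun x => \sum_(k : box N | box_mode k \in @disc R N)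
   fourier_coef u (box_mode k) * fourier_mode (box_mode k) x)).
  by move=> x; rewrite (@fsbig_box _ N)// => m /disc_in_box.
by apply: is_trig_sum => k _; apply/is_trigZ/is_trig_mode/box_modeP.
Qed.

End TestFunctions.

Lemma time_gain_gt0 (R : realType) (kappa : R) te t s : t != s -> 0 < time_gain kappa te t s.
Proof. by move=> ts; rewrite /time_gain; case: te => //; rewrite powR_gt0// normr_gt0 subr_eq0. Qed.

Lemma level_gain_gt0 (R : realType) (gam : R) be N : (0 < N)%N -> 0 < level_gain gam be N.
Proof. by move=> N0; rewrite /level_gain; case: be => //; rewrite powR_gt0// ltr0n. Qed.

(** * Moments of the error against trigonometric polynomials *)

Section WickProcess.
Context {R : realType} {d : measure_display} {Omega : measurableType d} (P : probability Omega R).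
Local Notation S := (spacetime R).
Local Notation eigen := (@eigen R).
Variable xi : (S -> R) -> {RV P >-> R}.
Hypothesis xi_white : white_noise xi.
Variables (chi theta : R * R -> R) (T alpha : R) (Z : nat -> R -> Omega -> @torus_distribution R).
Hypothesis Z_wick : stationary_wick_powers chi theta xi T alpha Z.

Lemma Z_linear n t w : (1 <= n <= 3)%N -> 0 <= t <= T -> distr_linear (Z n t w).
Proof. by move=> /Z_wick[_ /(_ w)[h _]] /h; exact: in_besov_linear. Qed.

Lemma rtrig_heat_shift N r (y : R * R) : rtrig N (fun x => heat_kernelN N r (y - x)).
Proof.
have := rtrig_opp (rtrig_shift y (rtrig_heat_kernelN N r)).
by congr rtrig; apply/funext => x; rewrite [- x + _]addrC.
Qed.

Lemma heat_kernelN_complex K N r (x : R * R) : (N <= K)%N -> (heat_kernelN N r x)%:C%C =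
  \sum_(k : box K) (in_disc N (box_mode k) * expR (- (r * eigen (box_mode k))))%:C%C * fourier_mode (box_mode k) x.
Proof.
move=> NK; rewrite (heat_kernelNE _ _ NK).
rewrite (box_sum_even (w := fun m => in_disc N m * expR (- (r * eigen m))) _)// => m.
by rewrite in_discN eigenN.
Qed.

(** By orthogonality the Dirichlet kernel of order N cuts the heat kernel of order K down to order
    N. The truncated kernel of the Galerkin field is therefore independent of K as soon as K >=
    N. *)
Lemma heat_reproducing K N r (x y : R * R) : (N <= K)%N ->
  distr_of_fun (fun y' => heat_kernelN K r (x - y')) (fun y' => heat_kernelN N 0 (y - y')) =
  heat_kernelN N r (x - y).
Proof.
move=> NK; pose L := (K + N + K).+1.
rewrite /distr_of_fun (rtrig_Rintegral (D := K + N) (L := L)); last 2 first.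
- by apply: rtrigM; exact: rtrig_heat_shift.
- by rewrite /L; lia.
apply: (@complexI R); rewrite -ravgE (heat_kernelN_complex _ _ NK).
pose a (k : box K) : R := in_disc K (box_mode k) * expR (- (r * eigen (box_mode k))).
pose b (k : box K) : R := in_disc N (box_mode k) * expR (- (0 * eigen (box_mode k))).
rewrite (eq_grid_avg L (g := fun y' => \sum_k \sum_l ((a k)%:C%C * fourier_mode (box_mode k) x *
   ((b l)%:C%C * fourier_mode (- box_mode l) y)) * fourier_mode (box_mode l - box_mode k) y')); last first.
  move=> y'; rewrite rmorphM/= (heat_kernelN_complex _ _ (leqnn K)).
  have -> : (heat_kernelN N 0 (y - y'))%:C%C = (heat_kernelN N 0 (y' - y))%:C%C :> R[i].
    congr (_%:C%C); rewrite !(heat_kernelNE _ _ NK); apply: eq_bigr => k _; congr (_ * _).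
    by rewrite -opprB phaseNr cosN.
  rewrite (heat_kernelN_complex _ _ NK) mulr_suml; apply: eq_bigr => k _; rewrite mulr_sumr; apply: eq_bigr => l _.
  rewrite /a /b modeDl !modeDr !modeNr; ring.
rewrite grid_avg_sum; apply: eq_bigr => k _; rewrite grid_avg_sum (bigD1 k)//= big1 ?addr0 => [|l lk]; last first.
  rewrite grid_avgZ grid_avg_mode ?subr_eq0 ?(inj_eq (@box_mode_inj K)) ?(negbTE lk) ?mulr0//=;
  by move: (box_modeP k) (box_modeP l); rewrite /in_box /L => /andP[/= h1 h2] /andP[/= h3 h4]; lia.
rewrite grid_avgZ subrr grid_avg_mode ?eqxx ?mulr1//.
rewrite /a /b mul0r oppr0 expR0 mulr1 modeDr modeNr.
have : in_disc K (box_mode k) * in_disc N (box_mode k) = in_disc N (box_mode k) :> R.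
  have := in_disc_le (R := R) (box_mode k) NK; rewrite /in_disc; case: (_ \in disc N); rewrite ?mulr0// mulr1.
  by case: (_ \in disc K) => //; rewrite ler_nat.
by move=> hh; rewrite -[in RHS]hh !(rmorphM (real_complex R)); ring.
Qed.

Lemma measurable_Z n t phi : (1 <= n <= 3)%N -> 0 <= t <= T -> test_function phi ->
  measurable_fun setT (fun w => Z n t w phi).
Proof. by move=> /Z_wick[h _] tT tphi; have [] := h t phi tT tphi. Qed.

(** In [multiple_integral_moment_le] the kernel error is 0 for K >= N, so the bound holds for every
    [eps] and the second moment of the difference vanishes. *)
Lemma galerkin_ae N t y : 0 <= t <= T ->
  {ae P, forall w, galerkin N (Z 1 t w) y = xi (field_kernel N t y) w}.
Proof.
move=> tT; pose phi := (fun x => heat_kernelN N 0 (y - x)).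
have phiD : rtrig N phi by exact: rtrig_heat_shift.
have tphi := rtrig_test phiD.
have GE w : galerkin N (Z 1 t w) y = Z 1 t w phi by rewrite (galerkinE _ _ (Z_linear w _ tT)).
pose X w := Z 1 t w phi - xi (field_kernel N t y) w.
have mX : measurable_fun setT X.
  by apply: measurable_funB; [exact: measurable_Z|exact: measurable_funPT].
have bound eps : 0 < eps -> (\int[P]_w ((X w) ^+ 2)%:E <= (4 * eps)%:E)%E.
  move=> e0.
  have := @multiple_integral_moment_le R _ _ P xi xi_white 1 1 (fun=> t) (fun=> 1) (fun=> fun w => Z 1 t w phi) N phi
    unit (fun=> 1) (fun=> field_kernel N t y) eps N isT _ phiD _ _ _ e0 _ 0.
  move=> h; apply: le_trans _ (le_trans (h _ _ _ _ _) _).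
  - apply: ge0_le_integral_lower => w _; rewrite lee_fin ?sqr_ge0//.
    by rewrite muln1 big_ord1 big_const card_unit/= addr0 !mul1r.
  - by move=> _; rewrite expr1n.
  - by move=> _; have [/(_ _ _ tT tphi)] := Z_wick (isT : (1 <= 1 <= 3)%N).
  - by move=> _; exact: square_integrable_field_kernel.
  - by move=> _; exact: measurable_field_kernel.
  - move=> K NK.
    rewrite (_ : (fun z => _) = (fun=> 0%E)) ?integral_n0 ?lee_fin ?(ltW e0)//.
    apply/funext => z; rewrite !big_ord1 /wick_kernelN !big_ord1 big_const/= card_unit/= addr0 !mul1r.
    rewrite [X in _ * X](_ : _ = heat_kernelN N (t - (tnth z ord0).1) ((tnth z ord0).2 - y)); last first.
      rewrite -(heat_reproducing _ _ _ NK); congr distr_of_fun; apply/funext => y'; by rewrite big_ord1.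
    by rewrite /field_kernel subrr expr0n.
  - by rewrite lee_fin !expr1 !mul1r -natrX.
have I0 : (\int[P]_w ((X w) ^+ 2)%:E = 0)%E.
  apply/eqP; rewrite eq_le integral_ge0 ?andbT; last by move=> w _; rewrite lee_fin sqr_ge0.
  apply/lee_addgt0Pr => e e0; rewrite add0e; have := bound (e / 4) (divr_gt0 e0 (ltr0n _ 4)).
  by rewrite mulrC divfK.
have /(ae_eq_integral_abs P measurableT) ae : measurable_fun setT (fun w => ((X w) ^+ 2)%:E).
  by apply/measurable_EFinP; exact: measurable_funX.
have : ae_eq P setT (fun w => ((X w) ^+ 2)%:E) (cst 0%E).
  apply/ae; rewrite -[RHS]I0; apply: eq_integral => w _; by rewrite gee0_abs// lee_fin sqr_ge0.
apply: filterS => w /(_ I) [] /eqP; rewrite sqrf_eq0 subr_eq0 => /eqP h.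
by rewrite GE h.
Qed.

(** With [be = false] the bare Wick power remains, so that its size and the size of the error follow
    from one estimate. *)
Definition approx_error (be : bool) N n t w (phi : R * R -> R) : R :=
  Z n t w phi - be%:R * distr_of_fun (stationaryN Z N n t w) phi.

Lemma rtrig_stationaryN N n t w : (1 <= n <= 3)%N -> rtrig (3 * N) (stationaryN Z N n t w).
Proof.
move=> n13; have g := rtrig_galerkin N (Z 1 t w).
have gX k : (k <= 3)%N -> rtrig (3 * N) (fun x => galerkin N (Z 1 t w) x ^+ k).
  by move=> k3; apply: rtrig_le (rtrigX k g); rewrite leq_mul2r k3 orbT.
case: n n13 => [|[|[|[|n]]]]//= _.
- by have := gX 1%N isT; congr rtrig.
- by apply: rtrigD; [exact: gX|exact: rtrig_cst].
- apply: rtrigD; first exact: gX.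
  have := rtrigZ (- (3 * renorm N)) (gX 1%N isT); congr rtrig; apply/funext => x; by rewrite expr1 mulNr.
Qed.

Lemma measurable_approx_error be N n t D phi : (1 <= n <= 3)%N -> 0 <= t <= T -> rtrig D phi ->
  measurable_fun setT (fun w => approx_error be N n t w phi).
Proof.
move=> n13 tT phiD; apply: measurable_funB; first exact: measurable_Z (rtrig_test phiD).
apply: measurable_funM => //.
rewrite (_ : (fun w => _) = (fun w => (3 * N + D).+1%:R ^- 2 * \sum_(k : 'I_(3 * N + D).+1 * 'I_(3 * N + D).+1)
   (wick_poly (renorm N) n (Z 1 t w (fun x => heat_kernelN N 0 (grid_point k - x))) * phi (grid_point k)))); last first.
  apply/funext => w; rewrite /distr_of_fun (rtrig_Rintegral (rtrigM (rtrig_stationaryN N t w n13) phiD) (ltnSn _)).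
  rewrite /ravg; congr (_ * _); apply: eq_bigr => k _; rewrite /stationaryN galerkinE//; exact: Z_linear.
apply: measurable_funM => //; apply: measurable_sum => k; apply: measurable_funM => //.
have m1 : measurable_fun setT (fun w => Z 1 t w (fun x => heat_kernelN N 0 (grid_point k - x))).
  by apply: measurable_Z => //; apply: rtrig_test; exact: rtrig_heat_shift.
case: n n13 => [|[|[|[|n]]]]//= _.
- by apply: measurable_funB => //; exact: measurable_funX.
- by apply: measurable_funB; [exact: measurable_funX|apply: measurable_funM].
Qed.

Lemma approx_error_moment n (gam kappa lambda : R) q : (1 <= n <= 3)%N -> 0 <= gam -> 0 <= kappa ->
  gam + kappa < lambda -> lambda <= 1 ->
  exists2 C : R, 0 < C & forall (te be : bool) t s N D (a : int * int -> R[i]) B, (0 < N)%N ->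
  0 <= t <= T -> 0 <= s <= T -> t != s -> 0 < B ->
  (forall m, normc (a m) ^+ 2 <= B * eigen m `^ (- lambda)) ->
  (\int[P]_w ((approx_error be N n t w (fun x => complex.Re (trig D a x)) -
      te%:R * approx_error be N n s w (fun x => complex.Re (trig D a x))) ^+ (2 * q.+1))%:E <=
   ((C * B * time_gain kappa te t s * level_gain gam be N) ^+ q.+1)%:E)%E.
Proof.
move=> n13 gam0 kap0 gkl l1; have n0 : (0 < n)%N by case/andP: n13.
have [C C0 hC] := gram_bound n0 gam0 kap0 gkl l1.
(* [3%:R ^+ 2] is [r.+1%:R ^+ 2] for the r = 2 multiple integrals, at the times t and s. *)
exists ((q.*2.+1)%:R ^+ n * (n`!%:R * (3%:R ^+ 2 * C))).
  by rewrite !mulr_gt0 ?exprn_gt0 ?ltr0n ?fact_gt0.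
move=> te be t s N D a B N0 tT sT ts B0 aB; set phi := (fun x => complex.Re (trig D a x)).
have phiD : rtrig D phi by apply: rtrig_Re; exists a.
have tphi := rtrig_test phiD.
pose eps := C * B * time_gain kappa te t s * level_gain gam be N.
have eps0 : 0 < eps.
  by rewrite /eps !mulr_gt0 ?time_gain_gt0 ?level_gain_gt0.
pose L := (3 * N + D).+1; pose V := (bool * ('I_L * 'I_L))%type.
pose tm (a1 : bool) := if a1 then t else s; pose sg1 (a1 : bool) : R := if a1 then 1 else - te%:R.
pose c (v : V) := sg1 v.1 * (be%:R * (L%:R ^- 2 * phi (grid_point v.2))).
pose h (v : V) := field_kernel N (tm v.1) (grid_point v.2 : R * R).
pose tI (i : 'I_2) := tm (i == ord0); pose sgI (i : 'I_2) := sg1 (i == ord0).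
have tmT a1 : 0 <= tm a1 <= T by case: a1.
have sum2 (F : bool -> R) : \sum_(i < 2) F (i == ord0) = F true + F false.
  by rewrite big_ord_recl big_ord1.
have key := @multiple_integral_moment_le R _ _ P xi xi_white n 2 tI sgI (fun i w => Z n (tI i) w phi) D phi
  V c h eps N n13 _ phiD _ _ _ eps0 _ q.
have ae : {ae P, forall w, (approx_error be N n t w phi - te%:R * approx_error be N n s w phi) =
    \sum_i sgI i * Z n (tI i) w phi - \sum_v c v * wick_poly (inner (h v) (h v)) n (xi (h v) w)}.
  (* Only finitely many grid points and times occur, so the exceptional sets of [galerkin_ae] can be
     united. *)
  have : {ae P, forall w, forall v : V, galerkin N (Z 1 (tm v.1) w) (grid_point v.2) = xi (h v) w}.
    by apply: filter_forall => v; exact: galerkin_ae.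
  apply: filterS => w hw.
  have dE a1 : distr_of_fun (stationaryN Z N n (tm a1) w) phi =
      \sum_k (L%:R ^- 2 * phi (grid_point k)) * wick_poly (inner (h (a1, k)) (h (a1, k))) n (xi (h (a1, k)) w).
    rewrite /distr_of_fun (rtrig_Rintegral (rtrigM (rtrig_stationaryN N (tm a1) w n13) phiD) (ltnSn _)).
    rewrite /ravg -/L mulr_sumr; apply: eq_bigr => k _; rewrite /stationaryN (hw (a1, k)).
    by rewrite (renormE N (tm a1) (grid_point k)) /h/=; ring.
  rewrite (sum2 (fun a1 => sg1 a1 * Z n (tm a1) w phi)).
  rewrite -(pair_bigA _ (fun a1 k => c (a1, k) * wick_poly (inner (h (a1, k)) (h (a1, k))) n (xi (h (a1, k)) w)))/=.
  rewrite big_bool/= /approx_error.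
  have cE a1 : \sum_k c (a1, k) * wick_poly (inner (h (a1, k)) (h (a1, k))) n (xi (h (a1, k)) w) =
     sg1 a1 * (be%:R * distr_of_fun (stationaryN Z N n (tm a1) w) phi).
    by rewrite dE !mulr_sumr; apply: eq_bigr => k _; rewrite /c/=; ring.
  by rewrite !cE /sg1 /tm; ring.
have mapp t' : 0 <= t' <= T -> measurable_fun setT (fun w => approx_error be N n t' w phi).
  by move=> t'T; exact: measurable_approx_error phiD.
rewrite (ae_eq_integral (fun w => ((\sum_i sgI i * Z n (tI i) w phi -
   \sum_v c v * wick_poly (inner (h v) (h v)) n (xi (h v) w)) ^+ (2 * q.+1))%:E))//; last 3 first.
- apply/measurable_EFinP; apply: measurable_funX; apply: measurable_funB; first exact: mapp.
  by apply: measurable_funM => //; exact: mapp.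
- apply/measurable_EFinP; apply: measurable_funX; apply: measurable_funB.
    by apply: measurable_sum => i; apply: measurable_funM => //; apply: measurable_Z => //; exact: tmT.
  apply: measurable_sum => v; apply: measurable_funM => //.
  have mx : measurable_fun setT (fun w => xi (h v) w) by exact: measurable_funPT.
  case: n n13 {n0 hC key ae mapp} => [|[|[|[|m]]]]//= _.
  + by apply: measurable_funB => //; exact: measurable_funX.
  + by apply: measurable_funB; [exact: measurable_funX|apply: measurable_funM].
- by apply: filterS ae => w -> _.
apply: le_trans (key _ _ _ _ _) _.
- by move=> i; rewrite /sgI /sg1; case: ifP => _; rewrite ?expr1n// sqrrN exprn_ile1 ?lern1 ?leq_b1.
- by move=> i; have [h1 _] := Z_wick n13; exact: (h1 _ _ (tmT _) tphi).
- by move=> v; exact: square_integrable_field_kernel.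
- by move=> v; exact: measurable_field_kernel.
- move=> K NK; apply: le_trans (hC te be t s N K D a B N0 NK aB).
  apply: le_integral_n => z; rewrite lee_fin ?sqr_ge0//; apply: ler_of_eq; congr (_ ^+ 2).
  have sum2' (F : bool -> R) : \sum_(i < 2) F (i == ord0) = \sum_(a1 : bool) F a1 by rewrite sum2 big_bool.
  rewrite (sum2' (fun a1 => sg1 a1 * wick_kernelN K (tm a1) phi z)).
  rewrite -(pair_bigA _ (fun a1 k => c (a1, k) * \prod_j h (a1, k) (tnth z j)))/=.
  rewrite -(pair_bigA _ (fun a1 a2 => diff_sign te be (a1, a2) * wick_kernelN (if a2 then K else N) (tm a1) phi z))/=.
  have cE a1 : \sum_k c (a1, k) * \prod_j h (a1, k) (tnth z j) = sg1 a1 * (be%:R * wick_kernelN N (tm a1) phi z).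
    rewrite (wick_kernelN_tensor (L := L) _ _ phiD); last first.
      by rewrite /L ltnS leq_add2r leq_mul2r; case/andP: n13 => _ ->; rewrite orbT.
    by rewrite !mulr_sumr; apply: eq_bigr => k _; rewrite /c/=; ring.
  rewrite -sumrB; apply: eq_bigr => a1 _; rewrite cE big_bool/= /diff_sign /sg1/=.
  by move: (wick_kernelN K _ _ _) (wick_kernelN N _ _ _) => p1 p2; ring.
- rewrite lee_fin; apply: ler_of_eq; congr (_ ^+ _); rewrite /eps; ring.
Qed.

End WickProcess.

(** * Chaining in time *)

Section Chaining.
Context {R : realType} {d : measure_display} {Omega : measurableType d} (P : probability Omega R).

Lemma bernoulli_le (x : R) n : 0 <= x <= 1 -> 1 - n%:R * x <= (1 - x) ^+ n.
Proof.
move=> /andP[x0 x1]; elim: n => [|n IH]; first by rewrite mul0r subr0 expr0.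
rewrite exprS; apply: le_trans (ler_wpM2l _ IH); last by rewrite subr_ge0.
by rewrite -natr1; have := mulr_ge0 (ler0n R n) (sqr_ge0 x); nra.
Qed.

Lemma exists_root (s : R) n : 0 <= s -> exists2 r : R, 0 <= r & r ^+ n.+1 = s.
Proof.
move=> s0; exists (s `^ (n.+1%:R)^-1); first exact: powR_ge0.
by rewrite -powR_mulrn ?powR_ge0// -powRrM mulVf ?pnatr_eq0// powRr1.
Qed.

Lemma sum_expr_le (rho : R) k : 0 <= rho < 1 -> \sum_(0 <= i < k) rho ^+ i <= (1 - rho)^-1.
Proof.
move=> /andP[r0 r1]; rewrite big_mkord; have := subrX1 rho k => e.
rewrite -[leRHS]mul1r ler_pdivlMr ?subr_gt0//.
rewrite mulrC -[X in X * _]opprB mulNr -e opprB lerBlDr lerDl; exact: exprn_ge0.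
Qed.

Lemma nneseries_geometric_le (u : nat -> \bar R) (A rho : R) : 0 <= rho < 1 -> 0 <= A ->
  (forall k, 0 <= u k)%E -> (forall k, u k <= (A * rho ^+ k)%:E)%E ->
  (\sum_(0 <= k <oo) u k <= (A / (1 - rho))%:E)%E.
Proof.
move=> rho01 A0 u0 uA; apply: lime_le; first by apply: is_cvg_nneseries => k _ _; exact: u0.
apply: nearW => k; apply: (@le_trans _ _ (\sum_(0 <= i < k) (A * rho ^+ i)%:E)%E).
  by apply: lee_sum => i _.
by rewrite sumEFin lee_fin -mulr_sumr ler_wpM2l// sum_expr_le.
Qed.

Variables (X : R -> Omega -> R) (T A : R) (Q : nat).
Hypotheses (T0 : 0 < T) (A0 : 0 <= A) (Q0 : (0 < Q)%N).
Hypothesis mX : forall t, 0 <= t <= T -> measurable_fun setT (X t).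
Hypothesis cX : forall w t, 0 <= t <= T -> forall e, 0 < e -> exists2 r, 0 < r &
  forall s, 0 <= s <= T -> `|s - t| < r -> `|X s w - X t w| < e.
Hypothesis X0A : (\int[P]_w ((X 0 w) ^+ (2 * Q))%:E <= A%:E)%E.
Hypothesis XA : forall t s, 0 <= t <= T -> 0 <= s <= T -> t != s ->
  (\int[P]_w ((X t w - X s w) ^+ (2 * Q))%:E <= (A * (`|t - s| / T) ^+ 2)%:E)%E.

(** Increments of level k are allowed the size of the k-th power of this ratio. By Bernoulli's
    inequality its power [2 * Q] is at least 3/4, so weighting the increments by the inverse powers
    turns their decay 1/2 per level into at most 2/3. *)
Definition chain_ratio : R := 1 - (8 * Q%:R)^-1.
Let rho := chain_ratio.

Let Q1 : 1 <= Q%:R :> R. Proof. by rewrite ler1n. Qed.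

Let h8 : ((0 : R) < (8 * (Q%:R : R))^-1) && ((8 * (Q%:R : R))^-1 <= (8 : R)^-1).
Proof.
have Qp : 0 < Q%:R :> R by rewrite ltr0n.
apply/andP; split; first by rewrite invr_gt0 mulr_gt0.
by rewrite lef_pV2 ?posrE ?mulr_gt0//; have := Q1; lra.
Qed.

Let rho01 : 0 < rho < 1.
Proof. by rewrite /rho /chain_ratio; move: h8 => /andP[h1 h2]; apply/andP; split; lra. Qed.

Let rhoQ : 3 / 4 <= rho ^+ (2 * Q).
Proof.
have h := @bernoulli_le (8 * Q%:R)^-1 (2 * Q).
have Qn : Q%:R != 0 :> R by rewrite pnatr_eq0 -lt0n.
apply: le_trans (h _); last by move: h8 => /andP[h1 h2]; apply/andP; split; lra.
by rewrite natrM (_ : 2%:R * Q%:R * _ = 4^-1); [lra|field].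
Qed.

Let pt k i : R := i%:R * T / 2 ^+ k.

Let ptT k i : (i <= 2 ^ k)%N -> 0 <= pt k i <= T.
Proof.
move=> ik; rewrite /pt divr_ge0 ?mulr_ge0 ?exprn_ge0 ?(ltW T0)//= ler_pdivrMr ?exprn_gt0//.
by rewrite mulrC ler_wpM2l ?(ltW T0)// -natrX ler_nat.
Qed.

Let inc k i w := X (pt k i.+1) w - X (pt k i) w.

Let V k w : R := \sum_(0 <= i < 2 ^ k) inc k i w ^+ (2 * Q).

Let p0 (x : R) : 0 <= x ^+ (2 * Q). Proof. by rewrite exprM exprn_ge0 ?sqr_ge0. Qed.

Let V0 k w : 0 <= V k w. Proof. by apply: sumr_ge0 => i _. Qed.

Let minc k i : (i < 2 ^ k)%N -> measurable_fun setT (inc k i).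
Proof. by move=> ik; apply: measurable_funB; apply: mX; apply: ptT => //; exact: ltnW. Qed.

Let mV k : measurable_fun setT (V k).
Proof.
rewrite (_ : V k = (fun w => \sum_(i < 2 ^ k) inc k i w ^+ (2 * Q))); last first.
  by apply/funext => w; rewrite /V big_mkord.
by apply: measurable_sum => i; apply: measurable_funX; exact: minc.
Qed.

Definition chain_const : R := 2 ^+ (2 * Q) * ((1 - rho)^-1) ^+ (2 * Q).

(** A measurable majorant of the supremum in time: a weighted sum of the powers [2 * Q] of all
    dyadic increments. If the series is at most s^(2Q), each increment of level k is at most s
    rho^k. *)
Definition chain_bound w : \bar R :=
  (chain_const%:E * ((X 0 w ^+ (2 * Q))%:E + \sum_(0 <= k <oo) ((rho ^+ (2 * Q))^-1 ^+ k * V k w)%:E))%E.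

Let r0 : 0 <= (rho ^+ (2 * Q))^-1. Proof. by rewrite invr_ge0. Qed.

Let c0 : 0 <= chain_const.
Proof. by rewrite /chain_const mulr_ge0. Qed.

Let term0 k w : (0 <= ((rho ^+ (2 * Q))^-1 ^+ k * V k w)%:E)%E.
Proof. by rewrite lee_fin mulr_ge0 ?exprn_ge0. Qed.

Let mterm k : measurable_fun setT (fun w => ((rho ^+ (2 * Q))^-1 ^+ k * V k w)%:E).
Proof. by apply/measurable_EFinP; apply: measurable_funM. Qed.

Let mser : measurable_fun setT (fun w => \sum_(0 <= k <oo) ((rho ^+ (2 * Q))^-1 ^+ k * V k w)%:E)%E.
Proof. by apply: ge0_emeasurable_sum. Qed.

Let m00 : measurable_fun setT (X 0). Proof. by apply: mX; rewrite lexx ltW. Qed.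

Lemma measurable_chain_bound : measurable_fun setT chain_bound.
Proof.
apply: measurable_funeM; apply: emeasurable_funD => //.
by apply/measurable_EFinP; exact: measurable_funX.
Qed.

Lemma chain_bound_ge0 w : (0 <= chain_bound w)%E.
Proof.
by rewrite mule_ge0 ?lee_fin// adde_ge0 ?lee_fin//; apply: nneseries_ge0 => k _ _; exact: term0.
Qed.

Lemma integral_chain_bound : (\int[P]_w chain_bound w <= (4 * chain_const * A)%:E)%E.
Proof.
have m0 : measurable_fun setT (fun w => (X 0 w ^+ (2 * Q))%:E).
  by apply/measurable_EFinP; exact: measurable_funX.
rewrite ge0_integralZl//; last 2 first.
- exact: emeasurable_funD.
- by move=> w _; rewrite adde_ge0 ?lee_fin//; apply: nneseries_ge0 => k _ _; exact: term0.
rewrite ge0_integralD//; last 2 first.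
- by move=> w _; rewrite lee_fin.
- by move=> w _; apply: nneseries_ge0 => k _ _; exact: term0.
rewrite integral_nneseries// (_ : (4 * _ * A)%:E = chain_const%:E * (A%:E + (3 * A)%:E))%E; last first.
  by rewrite -EFinD -EFinM; congr EFin; ring.
rewrite lee_wpmul2l ?lee_fin//; apply: leeD => //.
have -> : 3 * A = A / (1 - 2 / 3) by field.
apply: nneseries_geometric_le => //; first by apply/andP; split; lra.
  by move=> k; apply: integral_ge0 => w _; exact: term0.
move=> k; under eq_integral do rewrite EFinM.
rewrite ge0_integralZl//; last 3 first.
- exact/measurable_EFinP.
- by move=> w _; rewrite lee_fin.
- by rewrite lee_fin exprn_ge0.
(* There are 2^k increments of length T 2^(-k), each of moment at most A 4^(-k). *)
have IV : (\int[P]_w (V k w)%:E <= (A * 2^-1 ^+ k)%:E)%E.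
  under eq_integral do rewrite /V big_mkord -sumEFin.
  rewrite ge0_integral_sum//; last 2 first.
  - by move=> i; apply/measurable_EFinP; apply: measurable_funX; exact: minc.
  - by move=> i w _; rewrite lee_fin.
  apply: (@le_trans _ _ (\sum_(i < 2 ^ k) (A * (4^-1) ^+ k)%:E)%E).
    apply: lee_sum => i _; apply: le_trans (XA (ptT (ltn_ord i)) (ptT (ltnW (ltn_ord i))) _) _.
      rewrite /pt eq_sym; apply/eqP => /(mulIf (invr_neq0 (lt0r_neq0 (exprn_gt0 k (ltr0n R 2)))))/(mulIf (lt0r_neq0 T0))/eqP.
      by rewrite eqr_nat ltn_eqF.
    rewrite lee_fin; apply: ler_of_eq; congr (_ * _); rewrite /pt -mulrBl -mulrBl -natrB// subSnn mul1r.
    rewrite ger0_norm ?divr_ge0 ?(ltW T0)// mulrAC divff ?lt0r_neq0// mul1r -exprVn exprAC; congr (_ ^+ _).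
    by rewrite exprVn -natrX.
  rewrite sumEFin lee_fin sumr_const card_ord -[_ *+ (2 ^ k)]mulr_natr natrX -mulrA -exprMn; apply: ler_of_eq.
  by congr (_ * _ ^+ _); field.
apply: (@le_trans _ _ (((rho ^+ (2 * Q))^-1 ^+ k)%:E * (A * 2^-1 ^+ k)%:E)%E).
  by rewrite lee_wpmul2l// lee_fin exprn_ge0.
rewrite -EFinM lee_fin mulrCA ler_wpM2l// -exprMn lerXn2r ?nnegrE ?mulr_ge0//.
have rq0 : 0 < rho ^+ (2 * Q) by apply: lt_le_trans rhoQ; rewrite divr_gt0.
have : (rho ^+ (2 * Q))^-1 <= (3 / 4)^-1 by rewrite lef_pV2 ?posrE ?rhoQ// divr_gt0.
have -> : (3 / 4)^-1 = 4 / 3 :> R by field.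
lra.
Qed.

(** Induction on the level: a point of level k + 1 is a point of level k, or lies one increment to
    the right of such a point. *)
Let dyadic_le w s k i : (\sum_(0 <= k <oo) ((rho ^+ (2 * Q))^-1 ^+ k * V k w)%:E <= (s ^+ (2 * Q))%:E)%E -> 0 <= s ->
  (i <= 2 ^ k)%N -> `|X (pt k i) w| <= `|X 0 w| + s * \sum_(0 <= l < k.+1) rho ^+ l.
Proof.
move=> Vs s0; have incle l j : (j < 2 ^ l)%N -> `|inc l j w| <= s * rho ^+ l.
  move=> jl; have rh : 0 < rho by case/andP: rho01.
  rewrite -(ler_pXn2r (n := (2 * Q)%N)) ?nnegrE ?mulr_ge0 ?exprn_ge0 ?(ltW rh)//; last by rewrite muln_gt0.
  rewrite -normrX (ger0_norm (p0 _)) exprMn exprAC.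
  have : ((rho ^+ (2 * Q))^-1 ^+ l * V l w) <= s ^+ (2 * Q).
    rewrite -lee_fin; apply: le_trans Vs.
    apply: le_trans _ (nneseries_lim_ge l.+1 _); last by move=> *; exact: term0.
    by rewrite big_nat_recr//= leeDr// sume_ge0// => *; exact: term0.
  rewrite exprVn ler_pdivrMl ?exprn_gt0// mulrC; apply: le_trans.
  by rewrite /V (bigD1_seq j) ?iota_uniq ?mem_index_iota//= lerDl sumr_ge0.
elim: k i => [|k IH] i ik.
  rewrite big_nat1 expr0 mulr1; case: i ik => [|[|//]] _.
    by rewrite /pt mul0r mul0r lerDl.
  have := incle 0%N 0%N isT; rewrite expr0 mulr1 /inc => h.
  have e : X (pt 0 1) w = X 0 w + (X (pt 0 1) w - X (pt 0 0) w) by rewrite /pt mul0r mul0r; ring.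
  by rewrite e; apply: le_trans (ler_normD _ _) _; rewrite lerD2l.
have pt2 j : pt k.+1 j.*2 = pt k j.
  by rewrite /pt exprS -mul2n natrM; field; rewrite expf_neq0.
have half j : (j <= 2 ^ k)%N -> `|X (pt k.+1 j.*2) w| <= `|X 0 w| + s * \sum_(0 <= l < k.+1) rho ^+ l.
  by rewrite pt2; exact: IH.
have rh : 0 < rho by case/andP: rho01.
rewrite big_nat_recr//= mulrDr addrA.
have i2 : (i./2 <= 2 ^ k)%N by rewrite -(doubleK (2 ^ k)%N) half_leq// -mul2n -expnS.
have [ei|oi] := boolP (odd i); last first.
  have -> : i = (i./2).*2 by rewrite -[LHS]odd_double_half (negbTE oi).
  by apply: le_trans (half _ i2) _; rewrite lerDl mulr_ge0 ?exprn_ge0 ?(ltW rh).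
have iE : i = (i./2).*2.+1 by rewrite -[LHS]odd_double_half ei.
have i3 : ((i./2).*2 < 2 ^ k.+1)%N by rewrite -iE.
rewrite iE; have := incle k.+1 _ i3; have := half _ i2; rewrite /inc.
set a := X (pt k.+1 (i./2).*2) w; set b := X (pt k.+1 (i./2).*2.+1) w => h1 h2.
have -> : b = a + (b - a) by ring.
by apply: le_trans (ler_normD _ _) _; exact: lerD.
Qed.

(** At dyadic times the path is at most |X_0| + s/(1 - rho), and [chain_const] is the constant that
    makes this at most r. Continuity of the path reaches the other times. *)
Lemma chain_bound_le w t r : 0 <= t <= T -> 0 <= r -> (chain_bound w <= (r ^+ (2 * Q))%:E)%E -> `|X t w| <= r.
Proof.
move=> tT r0'; rewrite /chain_bound; set S := (\sum_(0 <= k <oo) _)%E => hb.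
have S0 : (0 <= S)%E by apply: nneseries_ge0 => k _ _; exact: term0.
have rh : 0 < rho by case/andP: rho01. have rh1 : 0 < 1 - rho by rewrite subr_gt0; case/andP: rho01.
have cp : 0 < chain_const by rewrite /chain_const mulr_gt0 ?exprn_gt0 ?invr_gt0.
have Sfin : S \is a fin_num.
  rewrite ge0_fin_numE// ltNge; apply/negP; rewrite leye_eq => /eqP SE.
  by move: hb; rewrite SE addey ?ltNyr// gt0_muley ?lte_fin// leye_eq.
have [s s0 sE] : exists2 s, 0 <= s & s ^+ (2 * Q) = fine S.
  have := @exists_root (fine S) (2 * Q).-1; rewrite prednK ?muln_gt0//; apply; exact: fine_ge0.
have SE : S = (s ^+ (2 * Q))%:E by rewrite sE fineK.
move: hb; rewrite SE -EFinD -EFinM lee_fin => hb.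
have main : `|X 0 w| + s * (1 - rho)^-1 <= r.
  rewrite -(ler_pXn2r (n := (2 * Q)%N)) ?nnegrE ?muln_gt0 ?addr_ge0 ?mulr_ge0 ?invr_ge0 ?(ltW rh1)//.
  apply: le_trans hb; set u := `|X 0 w|; set v := s * _.
  have u0 : 0 <= u by exact: normr_ge0. have v0 : 0 <= v by rewrite mulr_ge0 ?invr_ge0 ?(ltW rh1).
  apply: (@le_trans _ _ (2 ^+ (2 * Q) * (u ^+ (2 * Q) + v ^+ (2 * Q)))).
    wlog uv : u v u0 v0 / u <= v => [wl|].
      have [/wl|/ltW/wl] := leP u v; first exact.
      by rewrite [v + u]addrC [v ^+ _ + _]addrC; exact.
    apply: (@le_trans _ _ ((2 * v) ^+ (2 * Q))).
      by rewrite lerXn2r ?nnegrE ?addr_ge0 ?mulr_ge0//; lra.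
    by rewrite exprMn ler_wpM2l// lerDr exprn_ge0.
  rewrite /chain_const -mulrA ler_wpM2l// mulrDr; apply: lerD.
    have -> : u ^+ (2 * Q) = X 0 w ^+ (2 * Q) by rewrite /u -normrX ger0_norm.
    rewrite ler_peMl// exprn_ege1// invf_ge1//; lra.
  by rewrite /v exprMn mulrC.
apply/ler_addgt0Pr => e e0; have [dl dl0 hd] := cX w tT e0.
have [k kd] : exists k, T / 2 ^+ k < dl.
  have Tdl : 0 < T / dl by rewrite divr_gt0.
  exists (Num.truncn (T / dl)).+1; rewrite ltr_pdivrMr ?exprn_gt0// mulrC -ltr_pdivrMr//.
  apply: lt_le_trans (truncnS_gt _) _; rewrite -natrX ler_nat; exact: ltnW (ltn_expl _ _).
pose i := Num.truncn (t * 2 ^+ k / T); have /andP[t0 t1] := tT.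
have q0 : 0 <= t * 2 ^+ k / T by rewrite divr_ge0 ?mulr_ge0 ?exprn_ge0 ?(ltW T0).
have /andP[i1 i2] : i%:R <= t * 2 ^+ k / T < i.+1%:R by exact: truncn_itv.
have ik : (i <= 2 ^ k)%N.
  rewrite -(ler_nat R) natrX; apply: le_trans i1 _; rewrite ler_pdivrMr// mulrC ler_wpM2l ?exprn_ge0//.
have pk : 0 < 2 ^+ k :> R by exact: exprn_gt0.
have close : `|pt k i - t| < dl.
  apply: le_lt_trans kd; rewrite distrC ger0_norm; last first.
    by rewrite subr_ge0 /pt ler_pdivrMr// -ler_pdivlMr.
  rewrite /pt lerBlDr -mulrDl -[X in X + _]mul1r -mulrDl ler_pdivlMr// nat1r.
  by rewrite -ler_pdivrMr// ltW.
have := hd _ (ptT ik) close; have Sle : (S <= (s ^+ (2 * Q))%:E)%E by rewrite SE.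
have := dyadic_le Sle s0 ik.
have hs : s * \sum_(0 <= l < k.+1) rho ^+ l <= s * (1 - rho)^-1.
  by rewrite ler_wpM2l// sum_expr_le// ltW//=; case/andP: rho01.
move=> h1 h2; have -> : X t w = X (pt k i) w - (X (pt k i) w - X t w) by ring.
by apply: le_trans (ler_normB _ _) _; apply: lerD (ltW h2); apply: le_trans h1 _; apply: le_trans main; rewrite lerD2l.
Qed.

End Chaining.

(** * Dyadic blocks *)

Section Blocks.
Context {R : realType}.
Local Notation Rc := R[i].
Local Notation e := (@fourier_mode R).
Local Notation eigen := (@eigen R).
Variables (chi theta : R * R -> R).
Hypothesis CT : dyadic_partition chi theta.

(* Blocks are indexed by [k = j + 1 >= 0]. *)
Definition symbol k : R * R -> R := if k is k'.+1 then dyadic theta k' else chi.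

Lemma norm2_ge0 (z : R * R) : 0 <= norm2 z.
Proof. exact: sqrtr_ge0. Qed.

Lemma norm2_sqr (z : R * R) : norm2 z ^+ 2 = z.1 ^+ 2 + z.2 ^+ 2.
Proof. by rewrite /norm2 sqr_sqrtr// addr_ge0 ?sqr_ge0. Qed.

Lemma norm2_scale (c : R) (z : R * R) : 0 < c -> norm2 (z.1 / c, z.2 / c) = norm2 z / c.
Proof.
move=> c0; apply/eqP; rewrite -(@eqrXn2 _ 2) ?divr_ge0 ?norm2_ge0 ?(ltW c0)//.
by rewrite [(_ / c) ^+ 2]exprMn !norm2_sqr/= !exprMn -mulrDl.
Qed.

Lemma norm2N (z : R * R) : norm2 (- z) = norm2 z.
Proof. by rewrite /norm2/= !sqrrN. Qed.

Lemma latticeN m : lattice (- m) = - lattice m :> R * R.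
Proof. by rewrite /lattice/= !mulrNz. Qed.

Lemma symbol_lt k z : symbol k z != 0 -> norm2 z < 4 / 3 * 2 ^+ k.
Proof.
case: k => [|k] /= h; first by rewrite expr0 mulr1; apply: (chi_supp CT); exact: subset_closure.
have [+ _] := theta_supp CT (subset_closure (h : [set z | theta z != 0] (z.1 / 2 ^+ k, z.2 / 2 ^+ k))).
rewrite /obal/= norm2_scale ?exprn_gt0// ltr_pdivrMr ?exprn_gt0// exprS => h'.
by move: h'; set y := 2 ^+ k; lra.
Qed.

Lemma symbol_ge k z : symbol k.+1 z != 0 -> 3 / 4 * 2 ^+ k <= norm2 z.
Proof.
move=> h; have [_] := theta_supp CT (subset_closure (h : [set z | theta z != 0] (z.1 / 2 ^+ k, z.2 / 2 ^+ k))).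
by rewrite /obal/= norm2_scale ?exprn_gt0// ltr_pdivrMr ?exprn_gt0// => /negP; rewrite -leNgt.
Qed.

Lemma symbol_ge0 k z : 0 <= symbol k z.
Proof. by case: k => [|k]; [exact: chi_ge0 CT _|exact: theta_ge0 CT _]. Qed.

Lemma symbolN k z : symbol k (- z) = symbol k z.
Proof.
case: k => [|k]; first by apply: (chi_radial CT); exact: norm2N.
apply: (theta_radial CT); rewrite /norm2/=; congr Num.sqrt; by rewrite !mulNr !sqrrN.
Qed.

(** The symbols of index above n vanish at z, so the series in [partition1] is eventually
    constant. *)
Lemma symbol_sum n z : norm2 z < 3 / 4 * 2 ^+ n -> \sum_(0 <= k < n.+1) symbol k z = 1.
Proof.
move=> zn; have c := partition1 CT z.
rewrite big_nat_recl//=; apply/esym/(cvg_unique _ c) => //.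
apply: cvg_near_cst; exists n => // m /= nm.
rewrite (big_cat_nat (n := n))//=; have -> : \sum_(n <= i < m) dyadic theta i z = 0; last by rewrite addr0.
rewrite big_nat_cond big1// => k /andP[/andP[nk _] _].
apply/eqP; apply: contraTT zn => h; rewrite -leNgt; apply: le_trans (@symbol_ge k z h).
by rewrite ler_wpM2l ?divr_ge0// ler_eXn2l ?ltr1n.
Qed.

Lemma symbol_le1 k z : symbol k z <= 1.
Proof.
have [n zn] : exists n, norm2 z < 3 / 4 * 2 ^+ n /\ (k <= n)%N.
  pose n := maxn k (Num.truncn (norm2 z * 4 / 3)).+1; exists n; split; last exact: leq_maxl.
  have h : norm2 z * 4 / 3 < (Num.truncn (norm2 z * 4 / 3)).+1%:R by exact: truncnS_gt.
  have h2 : (Num.truncn (norm2 z * 4 / 3)).+1%:R <= 2 ^+ n :> R.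
    rewrite -natrX ler_nat; apply: leq_trans (ltnW (ltn_expl n (isT : (1 < 2)%N))); exact: leq_maxr.
  by have := lt_le_trans h h2; set y := 2 ^+ n; lra.
rewrite -(symbol_sum zn.1) (big_cat_nat (n := k))//= ?(leqW zn.2)//.
rewrite [X in _ + X]big_ltn ?ltnS ?zn.2// addrCA lerDl addr_ge0// sumr_ge0// => i _; exact: symbol_ge0.
Qed.

Lemma norm2_in_box m D : norm2 (lattice m : R * R) <= D%:R -> in_box D m.
Proof. by move=> h; apply: (@disc_in_box R). Qed.

Lemma symbol_in_box k m : ~~ in_box (2 ^ k.+1) m -> symbol k (lattice m) = 0.
Proof.
move=> mD; apply/eqP; apply: contraR mD => /symbol_lt h; apply: norm2_in_box; apply: ltW (lt_le_trans h _).
by rewrite natrX exprS; have : 0 < 2 ^+ k :> R by [exact: exprn_gt0]; lra.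
Qed.

Definition blk k (c : int * int -> Rc) (x : R * R) : Rc :=
  trig (2 ^ k.+1) (fun m => (symbol k (lattice m))%:C%C * c m) x.

Lemma blkE K k c x : (2 ^ k.+1 <= K)%N -> blk k c x = trig K (fun m => (symbol k (lattice m))%:C%C * c m) x.
Proof.
move=> kK; rewrite /blk /trig (@big_box _ _ _ (fun m => (symbol k (lattice m))%:C%C * c m * e m x) kK)// => m.
by move=> /symbol_in_box ->; rewrite !mul0r.
Qed.

Lemma blockE j u x : -1 <= j -> block chi theta j u x = blk `|(j + 1)%R|%N (fourier_coef u) x.
Proof.
move=> j1; have [k kE] : exists k : nat, j = k%:Z - 1 by exists `|(j + 1)%R|%N; lia.
have -> : `|(j + 1)%R|%N = k by rewrite kE; lia.
have E : block_symbol chi theta j = symbol k.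
  rewrite kE; case: k {kE} => [|k] //; by have -> : k.+1%:Z - 1 = k%:Z by lia.
by rewrite /block E /blk /trig (fsbigT_box (D := (2 ^ k.+1)%N))// => m /symbol_in_box ->; rewrite !mul0r.
Qed.

(** The Besov weight 2^(j a) with j = k - 1, in accordance with the shifted index of blocks. *)
Definition bweight (a : R) k : R := 2 `^ ((k%:R - 1) * a).

Lemma bweight_gt0 a k : 0 < bweight a k. Proof. exact: powR_gt0. Qed.

Lemma continuous_trig_normc D c : continuous (fun x => normc (trig D c x) : R).
Proof.
have cf (f : R * R -> Rc) : is_trig D f -> continuous (fun x => complex.Re (f x)) /\ continuous (fun x => complex.Im (f x)).
  move=> fD; split; apply: test_function_continuous; first exact: rtrig_test (rtrig_Re fD).
  exact: rtrig_test (rtrig_Im fD).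
have [c1 c2] := cf _ (ex_intro _ c (fun=> erefl)).
move=> x; rewrite (_ : (fun x => normc _) = (fun x => Num.sqrt (complex.Re (trig D c x) ^+ 2 + complex.Im (trig D c x) ^+ 2))).
  apply: (continuous_comp (f := fun x => complex.Re (trig D c x) ^+ 2 + complex.Im (trig D c x) ^+ 2)); last exact: sqrt_continuous.
  by apply: cvgD; apply: (continuous_cvg _ (@exprn_continuous _ _ _)); [exact: c1|exact: c2].
by apply/funext => y; case: (trig D c y).
Qed.

(** If the bound failed at a point, it would fail by continuity on an open rectangle around it,
    which has positive measure. *)
Lemma ae_le_everywhere (g : R * R -> R) (r : R) : continuous g ->
  {ae (@plane_measure R), forall x, (g x)%:E <= r%:E}%E -> forall x, g x <= r.
Proof.
move=> cg [N [mN N0 hN]] x; rewrite leNgt; apply/negP => gx.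
have gr : 0 < g x - r by rewrite subr_gt0.
have /cvgrPdist_lt /(_ _ gr) := cg x.
case => -[U V] /= [/nbhs_ballP[r1 /= r10 hU] /nbhs_ballP[r2 /= r20 hV]] UV.
pose A := [set` `]x.1 - r1, x.1 + r1[] `*` [set` `]x.2 - r2, x.2 + r2[] : set (plane R).
have AN : A `<=` N.
  move=> [y1 y2] [/= h1 h2]; apply: hN => /=; apply/negP; rewrite lee_fin -ltNge; suff : `|g x - g (y1, y2)| < g x - r by rewrite ltr_norml => /andP[_]; lra.
  apply: (UV (y1, y2)); split => /=; [apply: hU|apply: hV]; rewrite /ball/= distrC ltr_distl.
    by move: h1; rewrite in_itv.
  by move: h2; rewrite in_itv.
have mA : measurable A by apply: measurableX; exact: measurable_itv.
have : (@plane_measure R A <= 0)%E by rewrite -N0; apply: le_measure; rewrite ?inE.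
rewrite [X in (X <= _)%E](product_measure1E (@lebesgue_measure R) (@lebesgue_measure R)); try exact: measurable_itv.
have pos (c p : R) : 0 < p -> (0 < @lebesgue_measure R [set` `](c - p)%R, (c + p)%R[])%E.
  move=> p0; rewrite lebesgue_measure_itv/= lte_fin ltrD2l gtrN// -EFinB lte_fin; lra.
by rewrite leNgt mule_gt0 ?pos.
Qed.

(** Removes the essential supremum: blocks are trigonometric polynomials, hence continuous. Every
    later Besov estimate is stated in this pointwise form. *)
Lemma besov_norm_leP a u r : (besov_norm chi theta a u <= r%:E)%E <->
  (forall k x, bweight a k * normc (blk k (fourier_coef u) x) <= r).
Proof.
have wE (k : nat) : 2 `^ ((k%:Z - 1)%:~R * a) = bweight a k by rewrite /bweight intrB.
split=> [h k x|h].
  have : ((2 `^ ((k%:Z - 1)%:~R * a))%R%:E * ess_sup (@plane_measure R)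
        (fun x => (normc (block chi theta (k%:Z - 1) u x))%:E) <= r%:E)%E.
    by apply: le_trans h; apply: ereal_sup_ubound; exists (k%:Z - 1) => //=; lia.
  rewrite wE -lee_pdivlMl ?bweight_gt0// => /ess_supP; rewrite -EFinM => hae.
  rewrite -ler_pdivlMl ?bweight_gt0//; apply: (ae_le_everywhere (g := fun x => normc (blk k (fourier_coef u) x))).
    exact: continuous_trig_normc.
  apply: filterS hae => y; rewrite blockE; last by lia.
  by have -> : `|(k%:Z - 1 + 1)%R|%N = k by lia.
apply: ub_ereal_sup => _ [j /= j1 <-]; have [k kE] : exists k : nat, j = k%:Z - 1 by exists `|(j + 1)%R|%N; lia.
rewrite kE wE -lee_pdivlMl ?bweight_gt0//; apply/ess_supP; apply: aeW => x.
rewrite -EFinM lee_fin ler_pdivlMl ?bweight_gt0// blockE; last by lia.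
by have -> : `|(k%:Z - 1 + 1)%R|%N = k by lia.
Qed.

Lemma normc_coef_le D (c : int * int -> Rc) (B : R) m : in_box D m ->
  (forall x, normc (trig D c x) <= B) -> normc (c m) <= B.
Proof.
move=> mD cB; pose L := (D + D).+1.
have -> : c m = grid_avg L (fun x => trig D c x * e (- m) x).
  rewrite grid_avg_trig /cut ?mD//; by move: mD; rewrite /in_box /L => /andP[h1 h2]; lia.
have Lp : 0 < L%:R :> R by rewrite ltr0n.
rewrite /grid_avg ComplexField.Normc.normcM normc_real ger0_norm ?invr_ge0 ?exprn_ge0//.
rewrite ler_pdivrMl ?exprn_gt0//; apply: le_trans (normc_sum _ _ _) _.
apply: (@le_trans _ _ (\sum_(k : 'I_L * 'I_L) B)).
  by apply: ler_sum => k _; rewrite ComplexField.Normc.normcM normc_mode mulr1.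
by rewrite sumr_const card_prod card_ord -(mulr_natl B) natrM expr2.
Qed.

Lemma exists_scale (x : R) : 1 <= x -> exists n, x < 2 ^+ n /\ 2 ^+ n <= 4 * x.
Proof.
move=> x1; have x0 : 0 <= x by exact: le_trans x1.
have /andP[h1 h2] := truncn_itv x0; set N := Num.truncn x in h1 h2.
have N0 : (0 < N)%N by rewrite truncn_gt0 x1.
have /andP[h3 h4] := trunc_log_bounds (isT : (1 < 2)%N) N0.
exists (trunc_log 2 N).+1; split.
  by apply: lt_le_trans h2 _; rewrite -natrX ler_nat.
have h5 : (2 ^ trunc_log 2 N)%:R <= N%:R :> R by rewrite ler_nat.
by rewrite exprS -natrX; lra.
Qed.

Lemma sum_bweight_le a n : 0 < a -> \sum_(0 <= k < n.+1) 2 `^ (k%:R * a) <= (1 - 2 `^ (- a))^-1 * 2 `^ (n%:R * a) :> R.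
Proof.
move=> a0; rewrite big_nat_rev/= add0n.
have r01 : 0 <= (2 : R) `^ (- a) < 1.
  by rewrite powR_ge0/= /powR pnatr_eq0/= expR_lt1 mulNr oppr_lt0 mulr_gt0// ln_gt0// ltr1n.
rewrite (eq_big_nat _ _ (F2 := fun i => (2 `^ (- a)) ^+ i * 2 `^ (n%:R * a))); last first.
  move=> i /andP[_ i_n]; rewrite -powR_mulrn ?powR_ge0// -powRrM -powRD; last by rewrite pnatr_eq0 implybT.
  by rewrite subSS natrB//; congr (_ `^ _); ring.
by rewrite -mulr_suml ler_wpM2r ?powR_ge0// sum_expr_le.
Qed.

(** The blocks up to the scale of m add up to the coefficient, and each block bounds its own
    coefficients by its supremum. The growth [eigen m] is crude but serves only convergence and
    continuity arguments. *)
Lemma coef_le alpha : 0 < alpha < 1 -> exists2 C : R, 0 < C & forall (c : int * int -> Rc) r m, 0 <= r ->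
  (forall k x, bweight (- alpha) k * normc (blk k c x) <= r) -> normc (c m) <= C * eigen m * r.
Proof.
move=> /andP[a0 a1]; set C1 : R := (1 - 2 `^ (- alpha))^-1.
have C10 : 0 < C1.
  by rewrite invr_gt0 subr_gt0 /powR pnatr_eq0/= expR_lt1 mulNr oppr_lt0 mulr_gt0// ln_gt0// ltr1n.
exists (C1 * 12) => [|c r m r0 cr]; first by rewrite mulr_gt0.
have [|n [n1 n2]] := @exists_scale (1 + 4 / 3 * norm2 (lattice m : R * R)).
  by rewrite lerDl mulr_ge0 ?divr_ge0 ?norm2_ge0.
have mn : norm2 (lattice m : R * R) < 3 / 4 * 2 ^+ n by move: n1; set y := 2 ^+ n; lra.
have -> : c m = \sum_(0 <= k < n.+1) (symbol k (lattice m))%:C%C * c m.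
  by rewrite -mulr_suml -rmorph_sum (symbol_sum mn) mul1r.
apply: le_trans (normc_sum _ _ _) _.
apply: (@le_trans _ _ (\sum_(0 <= k < n.+1) 2 `^ (k%:R * alpha) * r)).
  apply: ler_sum => k _; have h x : normc (blk k c x) <= 2 `^ (k%:R * alpha) * r.
    have := cr k x; rewrite -ler_pdivlMl ?bweight_gt0// => /le_trans; apply.
    rewrite ler_wpM2r// /bweight -powRN; apply: ler_powR; first by rewrite ler1n.
    by rewrite mulrN opprK mulrBl; lra.
  have [mD|mD] := boolP (in_box (2 ^ k.+1) m); first exact: (normc_coef_le mD h).
  by rewrite symbol_in_box// mul0r ComplexField.Normc.normc0 mulr_ge0 ?powR_ge0.
rewrite -mulr_suml ler_wpM2r//; apply: le_trans (sum_bweight_le _ a0) _.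
rewrite -/C1 -mulrA ler_wpM2l ?(ltW C10)//.
apply: (@le_trans _ _ (2 ^+ n)).
  rewrite -powR_mulrn//; apply: ler_powR; first by rewrite ler1n.
  by rewrite ler_piMr// ltW.
apply: (le_trans n2); rewrite /eigen; set y := norm2 _.
have p1 : 1 <= pi ^+ 2 :> R by rewrite exprn_ege1// (le_trans _ (@pi_ge2 R))// ler1n.
by have := sqr_ge0 (y - 1); have := sqr_ge0 y; nra.
Qed.

End Blocks.

Lemma test_mode_Re (R : realType) m : test_function (fun x : R * R => complex.Re (fourier_mode m x)).
Proof.
by apply: (rtrig_test (D := `|m.1|%N + `|m.2|%N)); apply: rtrig_Re; apply: is_trig_mode; rewrite /in_box leq_addr leq_addl.
Qed.

Lemma test_mode_Im (R : realType) m : test_function (fun x : R * R => complex.Im (fourier_mode m x)).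
Proof.
by apply: (rtrig_test (D := `|m.1|%N + `|m.2|%N)); apply: rtrig_Im; apply: is_trig_mode; rewrite /in_box leq_addr leq_addl.
Qed.

Lemma mode_sum_value (R : realType) (u : @torus_distribution R) (I : finType) (z : I -> R[i]) (n : I -> int * int) : distr_linear u ->
  u (fun y => complex.Re (\sum_i z i * fourier_mode (n i) y)) = complex.Re (\sum_i z i * fourier_coef u (- n i)).
Proof.
move=> lu; transitivity (u (fun y => \sum_(k <- index_enum I) 1 *
   (complex.Re (z k) * complex.Re (fourier_mode (n k) y) + (- complex.Im (z k)) * complex.Im (fourier_mode (n k) y)))).
  congr u; apply/funext => y; rewrite raddf_sum; apply: eq_bigr => k _; rewrite mul1r.
  by case: (z _) => a b /=; rewrite mulNr.
have tR := @test_mode_Re R; have tI := @test_mode_Im R.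
rewrite distr_linear_sum//; last by move=> k; apply: test_functionD; exact: test_functionZ.
rewrite raddf_sum; apply: eq_bigr => k _; rewrite mul1r /fourier_coef opprK.
rewrite lu//; last exact: test_functionZ.
have := lu (complex.Re (z k)) _ _ (test_function_cst 0) (tR (n k)).
rewrite (distr_linear0 lu) add0r => h.
have -> : u (fun y => complex.Re (z k) * complex.Re (fourier_mode (n k) y)) = complex.Re (z k) * u (fun y => complex.Re (fourier_mode (n k) y)).
  by rewrite -h; congr u; apply/funext => y; rewrite add0r.
by case: (z _) => a b /=; rewrite mulNr.
Qed.

(** * Suprema in time and space of the error *)

Section WickSup.
Context {R : realType} {d : measure_display} {Omega : measurableType d} (P : probability Omega R).
Local Notation S := (spacetime R).
Local Notation eigen := (@eigen R).
Local Notation Rc := R[i].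
Variable xi : (S -> R) -> {RV P >-> R}.
Hypothesis xi_white : white_noise xi.
Variables (chi theta : R * R -> R).
Hypothesis CT : dyadic_partition chi theta.
Variables (T alpha : R).
Hypotheses (T0 : 0 < T) (alpha01 : 0 < alpha < 1).
Variable Z : nat -> R -> Omega -> @torus_distribution R.
Hypothesis Z_wick : stationary_wick_powers chi theta xi T alpha Z.

Lemma trig_linear_value (u : @torus_distribution R) D (c : int * int -> Rc) : distr_linear u ->
  u (fun y => complex.Re (trig D c y)) =
  complex.Re (\sum_(k : box D) c (box_mode k) * fourier_coef u (- box_mode k)).
Proof. exact: mode_sum_value. Qed.

(** Blocks are complex valued while distributions act on real functions. The factor ['i] selects the
    imaginary part, so each part of a block at x becomes a pairing with a real trigonometric
    polynomial. *)
Definition block_test (b : bool) k (x : R * R) (m : int * int) : Rc :=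
  (if b then 'i%C else 1) * ((symbol chi theta k (lattice m))%:C%C * fourier_mode (- m) x).

Lemma block_test_value b k x u : distr_linear u ->
  u (fun y => complex.Re (trig (2 ^ k.+1) (block_test b k x) y)) =
  if b then - complex.Im (blk chi theta k (fourier_coef u) x) else complex.Re (blk chi theta k (fourier_coef u) x).
Proof.
move=> lu; rewrite trig_linear_value//.
pose op (j : box (2 ^ k.+1)) : box (2 ^ k.+1) := (rev_ord j.1, rev_ord j.2).
have opK : involutive op by move=> [j l]; rewrite /op/= !rev_ordK.
have opE j : box_mode (op j) = - box_mode j.
  case: j => j l; rewrite /box_mode/=; have := ltn_ord j; have := ltn_ord l.
  by move=> hl hj; congr pair => /=; lia.
rewrite (reindex_inj (inv_inj opK))/=.
have -> : \sum_(j : box (2 ^ k.+1)) block_test b k x (box_mode (op j)) * fourier_coef u (- box_mode (op j)) =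
    (if b then 'i%C else 1) * blk chi theta k (fourier_coef u) x.
  rewrite /blk /trig mulr_sumr; apply: eq_bigr => j _; rewrite opE opprK /block_test opprK latticeN (symbolN CT).
  by ring.
by case: b; rewrite ?mul1r//; case: (blk _ _ _ _ _) => p q /=; rewrite mul0r mul1r sub0r.
Qed.

(** On the support of the symbol [eigen m] is at most [200 * 4 ^+ k], so a symbol bounded by 1 can
    be traded for decay of exponent [lambda]. The constant covers 1 + 64 * 16/9, with pi^2 <= 16. *)
Lemma block_test_coef b k x m lambda : 0 <= lambda ->
  normc (block_test b k x m) ^+ 2 <= (200 * 4 ^+ k) `^ lambda * eigen m `^ (- lambda).
Proof.
move=> l0; have ni : normc (if b then 'i%C else 1 : Rc) = 1.
  by case: b; rewrite /= ?expr0n ?expr1n/= ?add0r ?addr0 sqrtr1.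
have n0 := symbol_ge0 CT k (lattice m).
rewrite /block_test !ComplexField.Normc.normcM ni mul1r normc_mode mulr1 normc_real ger0_norm//.
have [s0|s0] := eqVneq (symbol chi theta k (lattice m)) 0.
  by rewrite s0 expr0n/= mulr_ge0 ?powR_ge0.
apply: (@le_trans _ _ 1); first by rewrite exprn_ile1// symbol_le1.
rewrite powRN ler_pdivlMr ?powR_gt0 ?eigen_gt0// mul1r.
apply: ge0_ler_powR => //; rewrite ?nnegrE ?(ltW (eigen_gt0 _)) ?mulr_ge0 ?exprn_ge0//.
have h := symbol_lt CT s0; rewrite /eigen.
have p4 : pi ^+ 2 <= 16 :> R.
  have p0 := @pi_ge0 R; have p1 := @pihalf_lt2 R.
  by nra.
have h2 : norm2 (lattice m : R * R) ^+ 2 <= (4 / 3 * 2 ^+ k) ^+ 2.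
  by rewrite lerXn2r ?nnegrE ?norm2_ge0 ?mulr_ge0 ?exprn_ge0 ?(ltW h).
have e4 : (4 / 3 * 2 ^+ k) ^+ 2 = 16 / 9 * 4 ^+ k :> R.
  by rewrite exprMn -exprM mulnC exprM; congr (_ * _ ^+ _); field.
rewrite e4 in h2; have k1 : 1 <= 4 ^+ k :> R by rewrite exprn_ege1// ler1n.
set y := norm2 _ ^+ 2 in h2 *; have y0 : 0 <= y by exact: sqr_ge0.
apply: (@le_trans _ _ (1 + 4 * 16 * (16 / 9 * 4 ^+ k))); last by lra.
rewrite lerD2l; apply: ler_pM => //; first by rewrite mulr_ge0// sqr_ge0.
by rewrite ler_wpM2l.
Qed.

Lemma approx_error_linear be N n t w : (1 <= n <= 3)%N -> 0 <= t <= T -> distr_linear (approx_error Z be N n t w).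
Proof.
move=> n13 tT c f g tf tg; rewrite /approx_error (Z_linear Z_wick w n13 tT)//.
by rewrite (distr_of_fun_linear (test_function_continuous (rtrig_test (rtrig_stationaryN Z N t w n13))))//; ring.
Qed.

Lemma Z_trig_continuous n w D (c : int * int -> Rc) : (1 <= n <= 3)%N -> forall t, 0 <= t <= T ->
  forall e, 0 < e -> exists2 r, 0 < r & forall s, 0 <= s <= T -> `|s - t| < r ->
  `|Z n s w (fun y => complex.Re (trig D c y)) - Z n t w (fun y => complex.Re (trig D c y))| < e.
Proof.
move=> n13 t tT e e0; have [C C0 hC] := coef_le CT alpha01.
pose K := \sum_(k : box D) normc (c (box_mode k)) * (C * eigen (box_mode k)).
have K0 : 0 <= K.
  by apply: sumr_ge0 => k _; rewrite !mulr_ge0 ?normc_ge0 ?(ltW C0) ?(ltW (eigen_gt0 _)).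
have [_ bp] := (Z_wick n13).2 w.
have e1 : 0 < e / (K + 1) by rewrite divr_gt0// ltr_wpDl.
have [r r0 hr] := bp t tT _ e1; exists r => // s sT st.
have lu : distr_linear (distr_sub (Z n s w) (Z n t w)) by apply: distr_linear_sub; apply: (Z_linear Z_wick).
have -> : Z n s w (fun y => complex.Re (trig D c y)) - Z n t w (fun y => complex.Re (trig D c y)) =
   distr_sub (Z n s w) (Z n t w) (fun y => complex.Re (trig D c y)) by [].
rewrite trig_linear_value//; apply: le_lt_trans (normr_Re _) _.
apply: le_lt_trans (normc_sum _ _ _) _.
have hb := (besov_norm_leP CT (- alpha) _ _).1 (ltW (hr s sT st)).
apply: (@le_lt_trans _ _ (K * (e / (K + 1)))).
  rewrite /K mulr_suml; apply: ler_sum => k _; rewrite ComplexField.Normc.normcM -!mulrA.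
  rewrite ler_wpM2l ?normc_ge0// -(eigenN (box_mode k)) mulrA; exact: hC _ _ _ (ltW e1) hb.
rewrite mulrCA gtr_pMr// ltr_pdivrMr ?mul1r ?ltrDl//; exact: ltr_wpDl.
Qed.

Lemma galerkin_continuous N y w : forall t, 0 <= t <= T ->
  forall e, 0 < e -> exists2 r, 0 < r & forall s, 0 <= s <= T -> `|s - t| < r ->
  `|galerkin N (Z 1 s w) y - galerkin N (Z 1 t w) y| < e.
Proof.
move=> t tT e e0; have [c cE] := rtrig_heat_shift N 0 y.
have E : (fun x => heat_kernelN N 0 (y - x)) = (fun x => complex.Re (trig N c x)).
  by apply/funext => x; rewrite -cE.
have [r r0 h] := @Z_trig_continuous 1 w N c isT t tT e e0.
exists r => // s sT st; rewrite !galerkinE ?E; first exact: h.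
- exact: (Z_linear Z_wick).
- exact: (Z_linear Z_wick).
Qed.


Lemma path_continuousP (f : R -> R) :
  (forall t, 0 <= t <= T -> f @ within [set s | 0 <= s <= T] (nbhs t) --> f t) <->
  (forall t, 0 <= t <= T -> forall e, 0 < e -> exists2 r, 0 < r & forall s, 0 <= s <= T -> `|s - t| < r ->
     `|f s - f t| < e).
Proof.
split=> h t tT.
  move=> e e0; have /cvgrPdist_lt/(_ _ e0) := h t tT.
  move=> /nbhs_ballP[r /= r0 hr]; exists r => // s sT st; rewrite distrC; apply: hr => //.
  by rewrite /ball/= distrC.
apply/cvgrPdist_lt => e e0; have [r r0 hr] := h t tT e e0.
by apply/nbhs_ballP; exists r => //= s; rewrite /ball/= => st sT; rewrite distrC; apply: hr => //; rewrite distrC.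
Qed.

Lemma continuous_wick_poly (a : R) n : continuous (wick_poly a n).
Proof.
case: n => [|[|[|[|n]]]] x /=; try exact: cvg_cst.
- exact: cvg_id.
- by apply: cvgB; [exact: exprn_continuous|exact: cvg_cst].
- by apply: cvgB; [exact: exprn_continuous|apply: cvgM; [exact: cvg_cst|exact: cvg_id]].
Qed.

Lemma approx_error_continuous be N n w D (c : int * int -> Rc) : (1 <= n <= 3)%N -> forall t, 0 <= t <= T ->
  forall e, 0 < e -> exists2 r, 0 < r & forall s, 0 <= s <= T -> `|s - t| < r ->
  `|approx_error Z be N n s w (fun y => complex.Re (trig D c y)) -
    approx_error Z be N n t w (fun y => complex.Re (trig D c y))| < e.
Proof.
move=> n13; pose phi := fun y => complex.Re (trig D c y).
apply/(path_continuousP (fun s => approx_error Z be N n s w phi)) => t tT.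
have rphi : rtrig D phi by apply: rtrig_Re; exists c.
have E s : distr_of_fun (stationaryN Z N n s w) phi = ravg (3 * N + D).+1 (fun x => stationaryN Z N n s w x * phi x).
  by rewrite /distr_of_fun (rtrig_Rintegral (D := 3 * N + D) (L := (3 * N + D).+1))//; apply: rtrigM => //; exact: rtrig_stationaryN.
have FF : Filter (within [set s | 0 <= s <= T] (nbhs t)) by exact: within_filter.
apply: cvgB; first by apply: ((path_continuousP (fun s => Z n s w phi)).2 _ t tT); exact: Z_trig_continuous.
apply: cvgM; first exact: cvg_cst.
rewrite (_ : (fun s => distr_of_fun (stationaryN Z N n s w) phi) = fun s => ravg (3 * N + D).+1 (fun x => stationaryN Z N n s w x * phi x)); last by apply/funext => s; rewrite E.
rewrite E /ravg; apply: cvgM; first exact: cvg_cst.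
apply: cvg_big => [|k _]; first exact: add_continuous.  apply: cvgM; last exact: cvg_cst.
have g : (fun s => galerkin N (Z 1 s w) (grid_point k)) @ within [set s | 0 <= s <= T] (nbhs t) --> galerkin N (Z 1 t w) (grid_point k).
  by apply: ((path_continuousP (fun s => galerkin N (Z 1 s w) (grid_point k))).2 _ t tT); exact: galerkin_continuous.
exact: (continuous_cvg _ (@continuous_wick_poly (renorm N) n _)).
Qed.

Lemma powR_4 (a : R) : 4 `^ a = 2 `^ a * 2 `^ a :> R.
Proof. by rewrite -powRM//; congr (_ `^ _); ring. Qed.

(* The supremum over [t] need not be measurable: [X] is a measurable majorant of its power. *)
Theorem wick_sup n gam kappa lambda q : (1 <= n <= 3)%N -> 0 <= gam -> 0 <= kappa -> gam + kappa < lambda ->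
  lambda < alpha -> 2 <= kappa * q.+1%:R -> 1 < q.+1%:R * (alpha - lambda) ->
  exists2 C : R, 0 < C & forall be N, (0 < N)%N -> exists X : Omega -> \bar R,
   [/\ measurable_fun setT X, forall w, (0 <= X w)%E,
    (\int[P]_w X w <= (C * level_gain gam be N ^+ q.+1)%:E)%E &
    forall w t r, 0 <= t <= T -> 0 <= r -> (X w <= (r ^+ (2 * q.+1))%:E)%E ->
      (besov_norm chi theta (- alpha) (approx_error Z be N n t w) <= r%:E)%E].
Proof.
move=> n13 g0 k0 gkl la kq ql; have /andP[a0 a1] := alpha01.
set Q := q.+1 in kq ql *; have Q0 : 0 < Q%:R :> R by rewrite ltr0n.
have l1 : lambda <= 1 by lra. have l0 : 0 < lambda by lra.
have [C0 C00 hC] := approx_error_moment xi_white Z_wick q n13 g0 k0 gkl l1.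
pose cc : R := chain_const Q.
have cc0 : 0 <= cc.
  by rewrite /cc /chain_const mulr_ge0 ?exprn_ge0// invr_ge0 /chain_ratio subKr invr_ge0 mulr_ge0.
(* Ratio of the series over blocks: 4^k grid points, moments of order 4^(k lambda Q), and the Besov
   weight 4^(- k alpha Q). *)
pose rho : R := 4 `^ (1 - Q%:R * (alpha - lambda)).
have rho01 : 0 <= rho < 1.
  by rewrite /rho powR_ge0/= /powR pnatr_eq0/= expR_lt1 pmulr_llt0 ?ln_gt0 ?ltr1n//; lra.
(* The power of T rescales increments to |t - s| / T, whose exponent [kappa * Q%:R] is at least 2;
   the summand 1 covers the value at time 0. *)
pose TK : R := 1 + T `^ (kappa * Q%:R).
pose K0 : R := (2 * 2 `^ alpha) ^+ (2 * Q) * (2 * (25 * Q%:R ^+ 2) * (4 * cc * ((C0 * 200 `^ lambda) ^+ Q * TK))).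
have TK0 : 0 <= TK by rewrite addr_ge0 ?powR_ge0.
have K00 : 0 <= K0.
  by have C0' := ltW C00; rewrite /K0; repeat first [assumption | apply: mulr_ge0 | apply: exprn_ge0 | exact: powR_ge0 | by []].
exists (K0 / (1 - rho) + 1) => [|be N N0].
  by rewrite ltr_wpDl// divr_ge0// subr_ge0; case/andP: rho01 => _ /ltW.
set g := level_gain gam be N; have gg0 : 0 <= g by exact: level_gain_ge0.
(* The grid of [nikolskii] for a block of degree [2 ^ k.+1] raised to the power Q. *)
pose L k := (Q * 2 ^ k.+1).*2.+1.
pose X k b (y : R * R) t w := approx_error Z be N n t w (fun z => complex.Re (trig (2 ^ k.+1) (block_test b k y) z)).
pose B k : R := (200 * 4 ^+ k) `^ lambda.
have B0 k : 0 < B k by rewrite powR_gt0// mulr_gt0// exprn_gt0.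
pose A k : R := (C0 * B k * g) ^+ Q * TK.
have A0 k : 0 <= A k by rewrite mulr_ge0// exprn_ge0// !mulr_ge0 ?(ltW C00) ?(ltW (B0 k)).
have mX k b y t : 0 <= t <= T -> measurable_fun setT (X k b y t).
  move=> tT; apply: (measurable_approx_error Z_wick be N n13 tT (D := (2 ^ k.+1)%N)).
  by apply: rtrig_Re; exists (block_test b k y).
have cX k b y w t : 0 <= t <= T -> forall e, 0 < e -> exists2 r, 0 < r & forall s, 0 <= s <= T -> `|s - t| < r ->
    `|X k b y s w - X k b y t w| < e by exact: approx_error_continuous.
have zT : (0 : R) <= 0 <= T by rewrite lexx ltW.
have TT : 0 <= T <= T by rewrite lexx ltW.
(* With the increment switched off the second time is a dummy; T is chosen because it differs from
   0. *)
have X0A k b y : (\int[P]_w ((X k b y 0 w) ^+ (2 * Q))%:E <= (A k)%:E)%E.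
  have := hC false be 0 T N (2 ^ k.+1)%N (block_test b k y) (B k) N0 zT TT (negbT (lt_eqF T0)) (B0 k) (fun m => block_test_coef b k y m (ltW l0)).
  rewrite /= (_ : (fun w => _) = (fun w => ((X k b y 0 w) ^+ (2 * Q))%:E)); last by apply/funext => w; rewrite mul0r subr0.
  move=> /le_trans; apply; rewrite lee_fin /time_gain mulr1 -/g /A ler_peMr ?exprn_ge0 ?mulr_ge0 ?(ltW C00) ?(ltW (B0 k))//.
  by rewrite lerDl powR_ge0.
have XA k b y t s : 0 <= t <= T -> 0 <= s <= T -> t != s ->
   (\int[P]_w ((X k b y t w - X k b y s w) ^+ (2 * Q))%:E <= (A k * (`|t - s| / T) ^+ 2)%:E)%E.
  move=> tT sT ts.
  have := hC true be t s N (2 ^ k.+1)%N (block_test b k y) (B k) N0 tT sT ts (B0 k) (fun m => block_test_coef b k y m (ltW l0)).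
  rewrite /= (_ : (fun w => _) = (fun w => ((X k b y t w - X k b y s w) ^+ (2 * Q))%:E)); last by apply/funext => w; rewrite mul1r.
  move=> /le_trans; apply; rewrite lee_fin /time_gain -/g /A.
  rewrite mulrAC exprMn -!mulrA ler_wpM2l ?exprn_ge0 ?mulr_ge0 ?(ltW C00) ?(ltW (B0 k))//.
  have u01 : 0 < `|t - s| / T <= 1.
    rewrite divr_gt0 ?normr_gt0 ?subr_eq0//= ler_pdivrMr// mul1r ler_norml; move/andP: tT => [? ?]; move/andP: sT => [? ?].
    by apply/andP; split; lra.
  have -> : `|t - s| = (`|t - s| / T) * T by rewrite divfK// gt_eqF.
  rewrite mulfK ?gt_eqF//; set u := `|t - s| / T in u01 *; case/andP: u01 => u0 u1.
  rewrite -powR_mulrn ?powR_ge0// -powRrM powRM ?(ltW u0) ?(ltW T0)// mulrC.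
  apply: ler_pM; rewrite ?powR_ge0 ?lerDr//.
  by rewrite -powR_mulrn ?(ltW u0)//; apply: ger_powR => //; apply/andP.
(* The factor 2 comes from bounding the modulus by the sum of the real and imaginary parts. *)
pose wt k : R := (2 * bweight (- alpha) k) ^+ (2 * Q).
have wt0 k : 0 < wt k by rewrite exprn_gt0// mulr_gt0// bweight_gt0.
pose cb k w := (\sum_(b : bool) \sum_(y : 'I_(L k) * 'I_(L k)) chain_bound (X k b (grid_point y)) T Q w)%E.
have cb0' k b (y : R * R) w : (0 <= chain_bound (X k b y) T Q w)%E by exact: chain_bound_ge0.
have cb0 k w : (0 <= cb k w)%E by apply: sume_ge0 => b _; apply: sume_ge0 => y _; exact: cb0'.
have mcb' k b (y : R * R) : measurable_fun setT (chain_bound (X k b y) T Q).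
  refine (@measurable_chain_bound R d Omega (X k b y) T Q T0 _) => t tT; exact: mX.
have mcb k : measurable_fun setT (cb k).
  by apply: emeasurable_sum => b; apply: emeasurable_sum => y.
pose S w := (\sum_(0 <= k <oo) (wt k)%:E * cb k w)%E.
have S0k k w : (0 <= (wt k)%:E * cb k w)%E by rewrite mule_ge0// lee_fin ltW.
exists S; split.
- by apply: ge0_emeasurable_sum => // k _; exact: measurable_funeM.
- by move=> w; apply: nneseries_ge0.
- rewrite integral_nneseries//; last by move=> k; exact: measurable_funeM.
  apply: (@le_trans _ _ ((K0 * g ^+ Q / (1 - rho))%:E)); last first.
    rewrite lee_fin mulrAC ler_wpM2r ?exprn_ge0// lerDl//.
  apply: nneseries_geometric_le => //; first by rewrite mulr_ge0// exprn_ge0.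
    by move=> k; apply: integral_ge0.
  move=> k; rewrite ge0_integralZl//; last by rewrite lee_fin ltW.
  have h : (\int[P]_w cb k w <= (2 * (L k)%:R ^+ 2 * (4 * cc * A k))%:E)%E.
    rewrite ge0_integral_sum//; last 2 first.
    - by move=> b; apply: emeasurable_sum => y.
    - by move=> b w _; apply: sume_ge0 => y _; exact: cb0'.
    apply: (@le_trans _ _ (\sum_(b : bool) ((L k)%:R ^+ 2 * (4 * cc * A k))%:E)%E); last first.
      by rewrite sumEFin lee_fin sumr_const card_bool mulr2n le_eqVlt; apply/orP; left; apply/eqP; ring.
    apply: lee_sum => b _; rewrite ge0_integral_sum//.
    apply: (@le_trans _ _ (\sum_(y : 'I_(L k) * 'I_(L k)) (4 * cc * A k)%:E)%E); last first.
      by rewrite sumEFin lee_fin sumr_const card_prod card_ord -(mulr_natl (4 * cc * A k)) natrM -expr2.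
    apply: lee_sum => y _.
    apply: (integral_chain_bound T0 (A0 k) (ltn0Sn q)); [move=> t tT; exact: mX|exact: X0A|exact: XA].
  apply: (@le_trans _ _ ((wt k)%:E * (2 * (L k)%:R ^+ 2 * (4 * cc * A k))%:E)%E).
    by rewrite lee_wpmul2l// lee_fin ltW.
  rewrite -EFinM lee_fin.
  have Lk : (L k)%:R ^+ 2 <= 25 * Q%:R ^+ 2 * 4 ^+ k :> R.
    have -> : 25 * Q%:R ^+ 2 * 4 ^+ k = (5 * Q%:R * 2 ^+ k) ^+ 2 :> R.
      by rewrite !exprMn -[(2 ^+ k) ^+ 2]exprM [(k * 2)%N]mulnC exprM; congr (_ * _ * _ ^+ _); ring.
    rewrite lerXn2r ?nnegrE ?mulr_ge0 ?exprn_ge0 ?(ltW Q0)// -natrX -!natrM ler_nat /L expnS.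
    by have : (0 < Q * 2 ^ k)%N by [rewrite muln_gt0 expn_gt0]; rewrite mulnCA -(mulnA 5); move: (Q * 2 ^ k)%N => z; clear; lia.
  apply: (@le_trans _ _ (wt k * (2 * (25 * Q%:R ^+ 2 * 4 ^+ k) * (4 * cc * A k)))).
    have cA : 0 <= 4 * cc * A k by apply: mulr_ge0; [apply: mulr_ge0|exact: A0].
    by apply: ler_wpM2l; [exact: ltW|apply: ler_wpM2r; [exact: cA|apply: ler_wpM2l]].
  rewrite le_eqVlt; apply/orP; left; apply/eqP.
  have -> : wt k = (2 * 2 `^ alpha) ^+ (2 * Q) * (4 `^ (- (k%:R * alpha))) ^+ Q.
    rewrite /wt /bweight (_ : (k%:R - 1) * - alpha = alpha + - (k%:R * alpha)); last by ring.
    rewrite powRD; last by rewrite pnatr_eq0 implybT.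
    by rewrite mulrA exprMn powR_4 [X in _ * X = _]exprM expr2.
  have -> : A k = (C0 * 200 `^ lambda) ^+ Q * ((4 ^+ k) `^ lambda) ^+ Q * g ^+ Q * TK.
    by rewrite /A /B powRM// ?exprn_ge0// mulrA !exprMn.
  have -> : rho ^+ k = (4 `^ (- (k%:R * alpha))) ^+ Q * (((4 ^+ k) `^ lambda) ^+ Q * 4 ^+ k).
    rewrite /rho -(@powR_mulrn _ 4)// -!powR_mulrn ?powR_ge0// -!powRrM -!powRD ?pnatr_eq0 ?implybT//.
    by congr (_ `^ _); ring.
  by rewrite /K0; ring.
- move=> w t r tT r0 Sr; apply/(besov_norm_leP CT) => k x.
  have bw := bweight_gt0 (- alpha) k : 0 < bweight (- alpha) k.
  set u := approx_error Z be N n t w; have lu : distr_linear u by exact: approx_error_linear.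
  pose r1 := r / (2 * bweight (- alpha) k).
  have r10 : 0 <= r1 by rewrite divr_ge0// mulr_ge0// ltW.
  have cbr : (cb k w <= (r1 ^+ (2 * Q))%:E)%E.
    rewrite /r1 expr_div_n -/(wt k) mulrC EFinM lee_pdivlMl//; apply: le_trans Sr.
    apply: le_trans _ (nneseries_lim_ge k.+1 _); last by move=> *; exact: S0k.
    by rewrite big_nat_recr//= leeDr// sume_ge0.
  have fb b : `|if b then complex.Im (blk chi theta k (fourier_coef u) x) else complex.Re (blk chi theta k (fourier_coef u) x)| <= r1.
    have tr : is_trig (2 ^ k.+1) (blk chi theta k (fourier_coef u)) by eexists => z.
    pose f z : R := if b then complex.Im (blk chi theta k (fourier_coef u) z) else complex.Re (blk chi theta k (fourier_coef u) z).
    have trf : rtrig (2 ^ k.+1) f by rewrite /f; case: (b); [exact: rtrig_Im|exact: rtrig_Re].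
    have nk := nikolskii Q x trf.
    rewrite -(@ler_pXn2r _ (2 * Q)) ?nnegrE//; rewrite normc_real in nk.
    apply: (le_trans nk); rewrite -lee_fin; apply: le_trans cbr.
    rewrite -sumEFin; apply: (@le_trans _ _ (\sum_(y : 'I_(L k) * 'I_(L k)) chain_bound (X k b (grid_point y)) T Q w)%E); last first.
      by rewrite /cb (bigD1 b)//= leeDl// sume_ge0// => c _; apply: sume_ge0 => y _; exact: cb0'.
    apply: lee_sum => y _; rewrite normc_real.
    have -> : `|f (grid_point y)| = `|X k b (grid_point y) t w|.
      by rewrite /X -/u block_test_value// /f; case: (b) => //; rewrite normrN.
    have := cb0' k b (grid_point y) w; case E : (chain_bound _ _ _ _) => [s| |] //; last by move=> _; exact: leey.
    rewrite lee_fin => s0; have [p p0 ps] := exists_root (2 * Q).-1 s0.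
    have Xp : `|X k b (grid_point y) t w| <= p.
      apply: (chain_bound_le T0 (ltn0Sn q) _ tT p0); [exact: cX|]; rewrite E lee_fin -ps.
      by rewrite prednK ?muln_gt0.
    by rewrite lee_fin -ps prednK ?muln_gt0// lerXn2r.
  have := fb true; have := fb false => /= fR fI.
  rewrite mulrC -ler_pdivlMr//; apply: le_trans (normc_le _) _.
  by apply: le_trans (lerD fR fI) _; rewrite /r1 le_eqVlt; apply/orP; left; apply/eqP; field; rewrite gt_eqF.
Qed.

End WickSup.

(** * From majorants to expected suprema; the estimate for stationary powers *)

Section WickMoments.
Context {R : realType} {d : measure_display} {Omega : measurableType d} (P : probability Omega R).
Local Notation S := (spacetime R).
Variable xi : (S -> R) -> {RV P >-> R}.
Hypothesis xi_white : white_noise xi.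
Variables (chi theta : R * R -> R).
Hypothesis CT : dyadic_partition chi theta.
Variables (T alpha : R).
Hypotheses (T0 : 0 < T) (alpha01 : 0 < alpha < 1).
Variable Z : nat -> R -> Omega -> @torus_distribution R.
Hypothesis Z_wick : stationary_wick_powers chi theta xi T alpha Z.

(** One majorant serves the three Wick powers and their errors. The majorants of the errors are
    divided by their expected size [G N], which brings them to the scale of the others; everything
    that follows is then pathwise in terms of [y]. *)
Theorem wick_sup_all gam (q0 : R) : 0 <= gam < alpha -> exists2 q : nat, q0 <= q.+1%:R &
  exists2 C : R, 0 < C & forall N, (0 < N)%N -> exists Y : Omega -> \bar R,
   [/\ measurable_fun setT Y, forall w, (0 <= Y w)%E, (\int[P]_w Y w <= C%:E)%E &
    forall w (y : R), 0 <= y -> (Y w <= (y ^+ (2 * q.+1))%:E)%E -> forall n t, (1 <= n <= 3)%N -> 0 <= t <= T ->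
      (besov_norm chi theta (- alpha) (Z n t w) <= y%:E)%E /\
      (besov_norm chi theta (- alpha)
        (distr_sub (Z n t w) (distr_of_fun (stationaryN Z N n t w))) <= (N%:R `^ (- gam) * y)%:E)%E].
Proof.
(* Three equal gaps: [kappa = h], [lambda = gam + 2 * h] and [alpha = gam + 3 * h]. The choice of
   [q] then meets both largeness conditions of [wick_sup]. *)
move=> /andP[g0 ga]; pose h := (alpha - gam) / 3; have h0 : 0 < h by rewrite /h; lra.
pose q := (Num.truncn (`|q0| + 2 / h + 2)%R).
have qh : `|q0| + 2 / h + 2 < q.+1%:R by exact: truncnS_gt.
have h20 := divr_gt0 (ltr0n R 2) h0; have q00 := ler_norm q0; have q01 := normr_ge0 q0.
exists q; first by lra.
have qh2 : 2 <= h * q.+1%:R by rewrite mulrC -ler_pdivrMr//; lra.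
pose G N : R := level_gain gam true N ^+ q.+1.
have GE N : G N = (N%:R `^ (- gam)) ^+ (2 * q.+1).
  rewrite /G /level_gain exprM; congr (_ ^+ _); rewrite -powR_mulrn ?powR_ge0// -powRrM; congr (_ `^ _); ring.
have G0 N : (0 < N)%N -> 0 < G N by move=> N0; rewrite GE exprn_gt0// powR_gt0// ltr0n.
have i3 (i : 'I_3) : (1 <= i.+1 <= 3)%N by rewrite /= ltn_ord.
have sup (i : 'I_3) := @wick_sup _ _ _ P xi xi_white chi theta CT T alpha T0 alpha01 Z Z_wick i.+1 gam h (gam + 2 * h) q (i3 i) g0 (ltW h0).
have H (i : 'I_3) : exists C : R, 0 < C /\ forall (be : bool) N, (0 < N)%N -> exists X : Omega -> \bar R,
   [/\ measurable_fun setT X, forall w, (0 <= X w)%E,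
    (\int[P]_w X w <= (C * level_gain gam be N ^+ q.+1)%:E)%E &
    forall w t r, 0 <= t <= T -> 0 <= r -> (X w <= (r ^+ (2 * q.+1))%:E)%E ->
      (besov_norm chi theta (- alpha) (approx_error Z be N i.+1 t w) <= r%:E)%E].
  by have [| | | |C C0 hC] := sup i; rewrite /h in h0 qh2 *; try lra; exists C.
have [C hC] := choice H.
have C0 i : 0 < C i by have [] := hC i.
exists (\sum_i (C i + C i)) => [|N N0].
  by rewrite big_ord_recl ltr_pwDl ?addr_gt0// sumr_ge0// => i _; rewrite addr_ge0// ltW.
have HX (ib : 'I_3 * bool) : exists X : Omega -> \bar R, [/\ measurable_fun setT X, forall w, (0 <= X w)%E,
    (\int[P]_w X w <= (C ib.1 * level_gain gam ib.2 N ^+ q.+1)%:E)%E &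
    forall w t r, 0 <= t <= T -> 0 <= r -> (X w <= (r ^+ (2 * q.+1))%:E)%E ->
      (besov_norm chi theta (- alpha) (approx_error Z ib.2 N ib.1.+1 t w) <= r%:E)%E].
  by case: ib => i b; have [_ /(_ b N N0)] := hC i.
have [X hX] := choice HX.
have mX ib : measurable_fun setT (X ib) by have [] := hX ib.
have X0 ib w : (0 <= X ib w)%E by have [] := hX ib.
have Gi0 : 0 < (G N)^-1 by rewrite invr_gt0 G0.
pose Y w := (\sum_(i < 3) (X (i, false) w + ((G N)^-1)%:E * X (i, true) w))%E.
have t0 i w : (0 <= X (i, false) w + ((G N)^-1)%:E * X (i, true) w)%E.
  by rewrite adde_ge0// mule_ge0// lee_fin ltW.
have mt (i : 'I_3) : measurable_fun setT (fun w => X (i, false) w + ((G N)^-1)%:E * X (i, true) w)%E.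
  by apply: emeasurable_funD => //; exact: measurable_funeM.
exists Y; split.
- exact: emeasurable_sum.
- by move=> w; apply: sume_ge0 => i _.
- rewrite ge0_integral_sum// -sumEFin; apply: lee_sum => i _.
  rewrite ge0_integralD//; last 2 first.
  + by move=> w _; rewrite mule_ge0// lee_fin ltW.
  + exact: measurable_funeM.
  rewrite ge0_integralZl// ?lee_fin ?(ltW Gi0)// EFinD; apply: leeD.
    by have [_ _ + _] := hX (i, false); rewrite /= /level_gain expr1n mulr1.
  rewrite lee_pdivrMl ?G0//; have [_ _ + _] := hX (i, true); rewrite -/(G N) => /le_trans; apply.
  by rewrite -EFinM lee_fin mulrC.
- move=> w y y0 Yy [|n] t //= n3 tT; have [i iE] : exists i : 'I_3, i = n :> nat by exists (Ordinal n3).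
  have Yi : (X (i, false) w + ((G N)^-1)%:E * X (i, true) w <= (y ^+ (2 * q.+1))%:E)%E.
    by apply: le_trans Yy; rewrite /Y (bigD1 i)//= leeDl// sume_ge0.
  split.
    have [_ _ _ /(_ w t y tT y0)] := hX (i, false); rewrite /= iE.
    have -> : approx_error Z false N n.+1 t w = Z n.+1 t w by apply/funext => phi; rewrite /approx_error mul0r subr0.
    by apply; apply: le_trans Yi; rewrite leeDl// mule_ge0// lee_fin ltW.
  have [_ _ _ /(_ w t (N%:R `^ (- gam) * y) tT)] := hX (i, true); rewrite /= iE.
  have -> : approx_error Z true N n.+1 t w = distr_sub (Z n.+1 t w) (distr_of_fun (stationaryN Z N n.+1 t w)).
    by apply/funext => phi; rewrite /approx_error mul1r.
  apply; first by rewrite mulr_ge0// powR_ge0.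
  rewrite exprMn -GE EFinM -lee_pdivrMl ?G0//; apply: le_trans Yi; rewrite leeDr//.
Qed.

(** Writing a finite value of [Y] as a power of its root [y] turns the pathwise implication into the
    pointwise bound of [f] by a multiple of 1 + [Y]. Only this majorant is measurable, so [f] is
    integrated by [ge0_le_integral_lower]. *)
Lemma integral_sup_le (Y : Omega -> \bar R) (f : Omega -> \bar R) (C K : R) q :
  measurable_fun setT Y -> (forall w, (0 <= Y w)%E) -> (\int[P]_w Y w <= C%:E)%E -> 0 < K ->
  (forall w, (0 <= f w)%E) ->
  (forall w y, 0 <= y -> (Y w <= (y ^+ (2 * q.+1))%:E)%E -> (f w <= (K * (1 + y) ^+ (2 * q.+1))%:E)%E) ->
  (\int[P]_w f w <= (K * 2 ^+ (2 * q.+1) * (1 + C))%:E)%E.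
Proof.
move=> mY Y0 YC K0 f0 fY; pose M : R := K * 2 ^+ (2 * q.+1).
have M0 : 0 < M by rewrite mulr_gt0// exprn_gt0.
apply: (@le_trans _ _ (\int[P]_w (M%:E * (1 + Y w)))%E).
  apply: ge0_le_integral_lower => w _ //; case E : (Y w) (Y0 w) => [s| |] //; last first.
    by move=> _; rewrite addey// gt0_muley ?lte_fin// leey.
  rewrite lee_fin => s0; have [y y0 ys] := exists_root (2 * q.+1).-1 s0.
  rewrite prednK ?muln_gt0// in ys; apply: le_trans (fY w y y0 _) _; first by rewrite E ys.
  rewrite -EFinD -EFinM lee_fin /M -mulrA ler_wpM2l ?(ltW K0)// -ys.
  have [y1|y1] := leP y 1.
    apply: (@le_trans _ _ (2 ^+ (2 * q.+1))); first by rewrite lerXn2r ?nnegrE//; lra.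
    by rewrite ler_peMr ?exprn_ge0// lerDl exprn_ge0.
  apply: (@le_trans _ _ ((2 * y) ^+ (2 * q.+1))); first by rewrite lerXn2r ?nnegrE//; lra.
  by rewrite exprMn ler_wpM2l ?exprn_ge0// lerDr.
rewrite ge0_integralZl//; last 3 first.
- by apply: emeasurable_funD.
- by move=> w _; rewrite adde_ge0.
- by rewrite lee_fin ltW.
rewrite -/M [leRHS]EFinM lee_wpmul2l ?lee_fin ?(ltW M0)// ge0_integralD//.
by rewrite integral_cst// mul1e EFinD leeD//; rewrite (_ : _ [set: _] = 1%E)//; exact: probability_setT.
Qed.

(** Uses 1 + N^2 <= 2 N^2, which produces the power of 2; the base 1 + N^2 is at least 1, so the
    exponent may be weakened from [gam] to [alpha - delta]. *)
Lemma rate_le gam delta (p : R) N : (0 < N)%N -> 0 <= p -> 0 <= gam -> alpha - delta <= gam ->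
  (N%:R `^ (- gam)) `^ p <= 2 `^ (gam * p / 2) * (1 + N%:R ^+ 2) `^ (- (p * (alpha - delta) / 2)) :> R.
Proof.
move=> N0 p0 g0 ad; have Nr : 1 <= N%:R :> R by rewrite ler1n.
set n : R := N%:R in Nr *; have n0 : 0 < n by lra.
have s0 : 0 < 1 + n ^+ 2 by rewrite ltr_pwDl// sqr_ge0.
apply: (@le_trans _ _ (2 `^ (gam * p / 2) * (1 + n ^+ 2) `^ (- (gam * p / 2)))); last first.
  rewrite ler_wpM2l ?powR_ge0//; apply: ler_powR; first by rewrite lerDl sqr_ge0.
  by rewrite lerN2 [gam * p]mulrC; apply: ler_wpM2r => //; apply: ler_wpM2l.
rewrite -powRrM !powRN (_ : - gam * p = - (gam * p)) ?powRN; last by ring.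
rewrite ler_pdivlMr ?powR_gt0// mulrC ler_pdivrMr ?powR_gt0//.
have -> : n `^ (gam * p) = (n ^+ 2) `^ (gam * p / 2).
  by rewrite -powR_mulrn ?(ltW n0)// -powRrM; congr (_ `^ _); field.
rewrite -powRM ?sqr_ge0//; apply: ge0_ler_powR; rewrite ?nnegrE ?(ltW s0) ?mulr_ge0 ?sqr_ge0//; nra.
Qed.

Lemma besov_norm_ge0 a u : (0 <= besov_norm chi theta a u)%E.
Proof.
rewrite leNgt; apply/negP => h.
have [r r0 hr] : exists2 r : R, r < 0 & (besov_norm chi theta a u <= r%:E)%E.
  by case: (besov_norm _ _ _ _) h => [s| |]// s0; [exists s|exists (- 1)]; rewrite ?ltrN10 ?leNye.
have := (besov_norm_leP CT _ _ _).1 hr 0 0; apply/negP; rewrite -ltNge (lt_le_trans r0)// mulr_ge0 ?normc_ge0//.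
by rewrite ltW// bweight_gt0.
Qed.

Theorem stationary_error n p delta : (1 <= n <= 3)%N -> 0 < p -> 0 < delta ->
  exists C : R, forall N : nat, (1 <= N)%N ->
     (\int[P]_w ereal_sup
        [set besov_norm chi theta (- alpha)
               (distr_sub (Z n t w) (distr_of_fun (stationaryN Z N n t w))) `^ p
        | t in [set t : R | (0 <= t <= T)%R]]
      <= (C * (1 + N%:R ^+ 2) `^ (- (p * (alpha - delta) / 2)))%R%:E)%E.
Proof.
move=> n13 p0 d0; have /andP[a0 a1] := alpha01.
have [gam [g0 ga gd]] : exists gam, [/\ 0 <= gam, gam < alpha & alpha - delta <= gam].
  (* The maximum with 0 handles [delta] larger than [alpha]. *)
  exists (Num.max 0 (alpha - delta)); split; rewrite ?le_max ?lexx ?orbT// gt_max a0/=; lra.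
have [q qp [C C0 hC]] := @wick_sup_all gam p (introT andP (conj g0 ga)).
exists (2 `^ (gam * p / 2) * 2 ^+ (2 * q.+1) * (1 + C)) => N N0.
have [Y [mY Y0 YC hY]] := hC N N0; pose a : R := N%:R `^ (- gam).
have a0' : 0 < a by rewrite powR_gt0// ltr0n.
apply: (@le_trans _ _ ((a `^ p * 2 ^+ (2 * q.+1) * (1 + C))%:E)); last first.
  rewrite lee_fin; have := rate_le N0 (ltW p0) g0 gd; rewrite -/a => h.
  rewrite -mulrA mulrAC -[in leRHS]mulrA [in leRHS]mulrAC -[in leRHS]mulrA.
  rewrite [leRHS](_ : _ = (2 `^ (gam * p / 2) * (1 + N%:R ^+ 2) `^ (- (p * (alpha - delta) / 2))) * (2 ^+ (2 * q.+1) * (1 + C))); last by move: (_ `^ _) (_ `^ _) (2 ^+ _) => x y z; ring.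
  by rewrite ler_wpM2r// mulr_ge0 ?exprn_ge0// addr_ge0// ltW.
apply: (integral_sup_le mY Y0 YC); first by rewrite powR_gt0.
  move=> w; apply: le_trans (ereal_sup_ubound _); last by exists 0 => //=; rewrite lexx ltW.
  exact: poweR_ge0.
move=> w y y0 Yy; apply: ub_ereal_sup => _ [t /= tT <-].
have [_ h] := hY w y y0 Yy n t n13 tT.
have b0 : (0 <= besov_norm chi theta (- alpha) (distr_sub (Z n t w) (distr_of_fun (stationaryN Z N n t w))))%E.
  exact: besov_norm_ge0.
apply: (@le_trans _ _ (((a * y) `^ p)%:E)).
  by rewrite -poweR_EFin; apply: (gt0_ler_poweR (ltW p0)) => //; rewrite in_itv/= ?b0 ?leey ?lee_fin ?mulr_ge0 ?(ltW a0').
rewrite lee_fin powRM ?(ltW a0')// ler_wpM2l ?powR_ge0//.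
apply: (@le_trans _ _ ((1 + y) `^ p)).
  by apply: ge0_ler_powR; rewrite ?nnegrE ?(ltW p0)//; lra.
rewrite -powR_mulrn; last by lra.
by apply: ler_powR; [lra|rewrite natrM; lra].
Qed.

End WickMoments.

(** * Fourier multipliers *)

Section Multiplier.
Context {R : realType}.
Local Notation Rc := R[i].
Local Notation e := (@fourier_mode R).
Local Notation e1 := ((1, 0) : int * int).
Local Notation e2 := ((0, 1) : int * int).

Lemma trig_translate D D' (c : int * int -> Rc) v x : (forall m, ~~ in_box D m -> c m = 0) ->
  (forall m, ~~ in_box D' m -> c (m - v) = 0) ->
  trig D' (fun m => c (m - v)) x = e v x * trig D c x.
Proof.
move=> c0 c0'; rewrite /trig mulr_sumr -(@fsbigT_box _ D' (fun m => c (m - v) * e m x)); last by move=> m /c0' ->; rewrite mul0r.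
rewrite -(@fsbigT_box _ D (fun m => e v x * (c m * e m x))); last by move=> m /c0 ->; rewrite mul0r mulr0.
rewrite (reindex_fsbigT (fun m => m + v)); last first.
  by exists (fun m => m - v) => m; rewrite ?addrK ?subrK.
by apply: eq_fsbigr => m _; rewrite addrK modeDl [e m x * e v x]mulrC mulrCA.
Qed.

Lemma trig_supp D D' (c : int * int -> Rc) x : (forall m, ~~ in_box D m -> c m = 0) ->
  (forall m, ~~ in_box D' m -> c m = 0) -> trig D c x = trig D' c x.
Proof.
move=> h h'; rewrite /trig -(@fsbigT_box _ D (fun m => c m * e m x)) -1?(@fsbigT_box _ D' (fun m => c m * e m x))// => m.
  by move=> /h' ->; rewrite mul0r.
by move=> /h ->; rewrite mul0r.
Qed.

(** Coefficients of a product. Only [a] is cut to the box, so [c] may be the coefficients of a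
    distribution. *)
Definition mulc D (a c : int * int -> Rc) (m : int * int) : Rc :=
  \sum_(k : box D) a (box_mode k) * c (m - box_mode k).

Lemma mulc_supp D D' a c m : (forall m, ~~ in_box D' m -> c m = 0) -> ~~ in_box (D + D') m -> mulc D a c m = 0.
Proof.
move=> c0 mD; rewrite /mulc big1// => k _; rewrite c0 ?mulr0//.
apply: contra mD => h; rewrite -(subrK (box_mode k) m) addrC; apply: in_boxD => //; exact: box_modeP.
Qed.

Lemma trig_mulc D D' a c x : (forall m, ~~ in_box D' m -> c m = 0) ->
  trig (D + D') (mulc D a c) x = trig D a x * trig D' c x.
Proof.
move=> c0; rewrite {1}/trig /mulc.
transitivity (\sum_(k : box D) a (box_mode k) * trig (D + D') (fun m => c (m - box_mode k)) x).
  rewrite /trig; under eq_bigr do rewrite mulr_suml; rewrite exchange_big/=.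
  by apply: eq_bigr => k _; rewrite mulr_sumr; apply: eq_bigr => l _; rewrite mulrA.
rewrite [trig D a x]/trig mulr_suml; apply: eq_bigr => k _; rewrite (@trig_translate D')// ?mulrA//.
move=> m mD; apply: c0; apply: contra mD => h.
rewrite -(subrK (box_mode k) m) addrC; apply: in_boxD => //; exact: box_modeP.
Qed.

Lemma ravg_le L (f g : R * R -> R) : (forall x, f x <= g x) -> ravg L f <= ravg L g.
Proof. by move=> fg; rewrite /ravg ler_wpM2l ?invr_ge0 ?exprn_ge0//; apply: ler_sum. Qed.

Lemma ravg_comb L (f g : R * R -> R) (a b : R) : ravg L (fun x => a * f x + b * g x) = a * ravg L f + b * ravg L g.
Proof. by rewrite /ravg big_split/= -!mulr_sumr mulrDr [L%:R ^- 2 * (a * _)]mulrCA [L%:R ^- 2 * (b * _)]mulrCA. Qed.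

Lemma grid_avg_le L (f : R * R -> Rc) : normc (grid_avg L f) <= ravg L (fun x => normc (f x)).
Proof.
rewrite /grid_avg ComplexField.Normc.normcM normc_real ger0_norm ?invr_ge0 ?exprn_ge0// /ravg.
by rewrite ler_wpM2l ?invr_ge0 ?exprn_ge0//; exact: normc_sum.
Qed.

Lemma ravg_trig_sqr_le L D (c : int * int -> Rc) (M : R) : (D.*2 < L)%N -> (forall m, normc (c m) <= M) ->
  ravg L (fun x => normc (trig D c x) ^+ 2) <= D.*2.+1%:R ^+ 2 * M ^+ 2.
Proof.
move=> DL cM; have M0 : 0 <= M := le_trans (normc_ge0 _) (cM 0).
rewrite /ravg -parsevalr//; apply: (@le_trans _ _ (\sum_(k : box D) M ^+ 2)).
  by apply: ler_sum => k _; rewrite lerXn2r ?nnegrE ?normc_ge0.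
by rewrite sumr_const card_prod !card_ord -(mulr_natl (M ^+ 2)) natrM expr2.
Qed.

(** A weak form of Jordan's inequality: the mean value theorem with cos >= 1/2 on [0, 1], then
    monotonicity of the sine up to pi/2. *)
Lemma sin_ge (x : R) : 0 <= x <= pi / 2 -> x / 4 <= sin x.
Proof.
move=> /andP[x0 x2]; have p2 := @pihalf_lt2 R; have p1 := @pihalf_ge1 R.
have sin_le (y : R) : 0 <= y -> sin y <= y.
  move=> y0; have [->|/negbTE yn0] := eqVneq y 0; first by rewrite sin0.
  have yp : 0 < y by rewrite lt_neqAle eq_sym yn0.
  have [z _ ] := @MVT R sin cos 0 y yp (fun z _ => is_derive_sin z) (continuous_subspaceT (@continuous_sin R)).
  by rewrite sin0 !subr0 => ->; rewrite ler_piMl// cos_le1.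
have cos_ge (y : R) : 0 <= y -> y <= 1 -> 1 / 2 <= cos y.
  move=> y0 y1; have -> : y = y / 2 + y / 2 by field.
  rewrite cosD; have h := cos2Dsin2 (y / 2); have s1 := sin_le (y / 2); have s0 : 0 <= sin (y / 2).
    by apply: sin_ge0_pi; apply/andP; split; lra.
  have : sin (y / 2) <= 1 / 2 by have := s1 (divr_ge0 y0 (ler0n _ 2)); lra.
  by nra.
have small (y : R) : 0 <= y -> y <= 1 -> y / 2 <= sin y.
  move=> y0 y1; have [->|/negbTE yn0] := eqVneq y 0; first by rewrite sin0 mul0r.
  have yp : 0 < y by rewrite lt_neqAle eq_sym yn0.
  have [z] := @MVT R sin cos 0 y yp (fun z _ => is_derive_sin z) (continuous_subspaceT (@continuous_sin R)).
  rewrite in_itv/= => /andP[z0 zy]; rewrite sin0 !subr0 => ->.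
  have := cos_ge z (ltW z0) (le_trans (ltW zy) y1); nra.
have [x1|x1] := leP x 1; first by have := small x x0 x1; lra.
have : sin 1 <= sin x.
  by rewrite ltW// ltr_sin// in_itv/=; apply/andP; split; lra.
by have := small 1 ler01 (lexx _); lra.
Qed.

(** Telescoping, since (a + c)^(-2) is at most 1/(a (a + c)), the difference of 1/a and 1/(a + c)
    divided by c. *)
Lemma sum_inv_sqr_le (c : R) n : 0 < c -> \sum_(0 <= j < n.+1) (1 + c * j%:R) ^- 2 <= 1 + c^-1 * (1 - (1 + c * n%:R)^-1).
Proof.
move=> c0; elim: n => [|n IH]; first by rewrite big_nat1 mulr0 addr0 expr1n invr1 subrr mulr0 addr0.
rewrite big_nat_recr//=; apply: le_trans (lerD IH (lexx _)) _.
set a := 1 + c * n%:R; have a0 : 0 < a by rewrite ltr_pwDl// mulr_ge0// ltW.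
have -> : 1 + c * n.+1%:R = a + c by rewrite /a -natr1; ring.
have ac : 0 < a + c by rewrite addr_gt0.
have E : c^-1 * (1 - (a + c)^-1) - c^-1 * (1 - a^-1) = a^-1 * (a + c)^-1.
  by field; rewrite !gt_eqF.
suff : (a + c) ^- 2 <= a^-1 * (a + c)^-1 by lra.
by rewrite -exprVn expr2 ler_wpM2r ?invr_ge0 ?(ltW ac)// lef_pV2 ?posrE// lerDl ltW.
Qed.

(** The summand is the inverse of 1 + 4^k |e_1(x) - 1|^2, a weight at least 1 + (2^k d)^2 where d is
    the distance from x to the integers. Its average is of order 2^(-k); points beyond 1/2 are
    reflected by [rev_ord]. *)
Lemma sum_inv_weight_le k L : (2 ^ k <= L)%N ->
  L%:R^-1 * \sum_(j < L) (1 + 4 ^+ k * (4 * sin (pi * (j%:R / L%:R)) ^+ 2))^-1 <= 8 / 2 ^+ k :> R.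
Proof.
move=> kL; have k0 : 0 < 2 ^+ k :> R by rewrite exprn_gt0.
have Lk : 2 ^+ k <= L%:R :> R by rewrite -natrX ler_nat.
have L0 : 0 < L%:R :> R := lt_le_trans k0 Lk.
have Ln0 : (0 < L)%N by rewrite -(ltr0n R).
pose c : R := 2 ^+ k / L%:R; have c0 : 0 < c by rewrite divr_gt0.
have k4 : 4 ^+ k = (2 ^+ k) ^+ 2 :> R by rewrite -exprM mulnC exprM; congr (_ ^+ _); ring.
pose g (x : R) := 2 * (1 + c * x) ^- 2.
have g0 x : 0 <= x -> 0 <= g x by move=> x0; rewrite mulr_ge0// invr_ge0 exprn_ge0// addr_ge0// mulr_ge0// ltW.
have key (u : R) : 0 <= u -> u <= 1 / 2 -> (1 + 4 ^+ k * (4 * sin (pi * u) ^+ 2))^-1 <= g (u * L%:R).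
  move=> u0 u1; have p2 := @pi_ge2 R.
  have hs : pi * u / 4 <= sin (pi * u) by apply: sin_ge; apply/andP; split; nra.
  have s2 : u ^+ 2 <= 4 * sin (pi * u) ^+ 2 by have : u / 2 <= sin (pi * u) by [nra]; nra.
  have cu : c * (u * L%:R) = 2 ^+ k * u by rewrite /c; field; rewrite gt_eqF.
  rewrite /g cu; set y := 2 ^+ k * u; have y0 : 0 <= y by rewrite mulr_ge0// ltW.
  have y2 : y ^+ 2 <= 4 ^+ k * (4 * sin (pi * u) ^+ 2) by rewrite /y exprMn k4 ler_wpM2l// sqr_ge0.
  apply: (@le_trans _ _ (1 + y ^+ 2)^-1).
    by rewrite lef_pV2 ?posrE ?lerD2l// ltr_pwDl// ?sqr_ge0//; exact: le_trans (sqr_ge0 y) y2.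
  have y1 : 0 < 1 + y ^+ 2 by rewrite ltr_pwDl// sqr_ge0.
  rewrite ler_pdivlMr ?exprn_gt0//; last by lra.
  rewrite ler_pdivrMl//; have gen (z : R) : (1 + z) ^+ 2 <= (1 + z ^+ 2) * 2 by [have := sqr_ge0 (1 - z); nra]; exact: gen.
have gm x y : 0 <= x -> x <= y -> g y <= g x.
  move=> x0 xy; rewrite /g ler_wpM2l// lef_pV2 ?posrE ?exprn_gt0 ?ltr_pwDl// ?mulr_ge0 ?(ltW c0)//; last exact: le_trans xy.
  have h : 1 + c * x <= 1 + c * y by rewrite lerD2l ler_wpM2l// ltW.
  have hx : 0 <= 1 + c * x by rewrite addr_ge0// mulr_ge0// ltW.
  by rewrite lerXn2r ?nnegrE// (le_trans hx).
have term (j : 'I_L) : (1 + 4 ^+ k * (4 * sin (pi * (j%:R / L%:R)) ^+ 2))^-1 <= g j%:R + g (rev_ord j)%:R.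
  have jL : j%:R <= L%:R :> R by rewrite ler_nat ltnW.
  set u : R := j%:R / L%:R; have u0 : 0 <= u by rewrite divr_ge0.
  have uL : u * L%:R = j%:R by rewrite divfK// gt_eqF.
  have [u1|u1] := leP u (1 / 2).
    by apply: le_trans (key u u0 u1) _; rewrite uL lerDl g0.
  have -> : sin (pi * u) = sin (pi * (1 - u)).
    by rewrite mulrBr mulr1 sinB sinpi cospi mul0r sub0r mulN1r opprK.
  have u2 : u <= 1 by rewrite ler_pdivrMr// mul1r.
  apply: le_trans (key (1 - u) _ _) _; [by lra|by lra|].
  apply: (@le_trans _ _ (g (rev_ord j)%:R)); last by rewrite lerDr g0.
  by apply: gm => //; rewrite mulrBl mul1r uL /= natrB// -natr1; lra.
have gs : \sum_(j < L) g j%:R <= 2 * (1 + c^-1).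
  rewrite -(big_mkord xpredT (fun j => g j%:R)) -mulr_sumr ler_wpM2l//.
  have := sum_inv_sqr_le L c0; rewrite big_nat_recr//=.
  have t1 : 0 <= (1 + c * L%:R) ^- 2 by rewrite invr_ge0 sqr_ge0.
  have t2 : c^-1 * (1 - (1 + c * L%:R)^-1) <= c^-1.
    by rewrite ler_piMr ?invr_ge0 ?(ltW c0)// lerBlDr lerDl invr_ge0 addr_ge0 ?mulr_ge0 ?(ltW c0).
  by move: t1 t2; lra.
apply: (@le_trans _ _ (L%:R^-1 * (2 * (1 + c^-1) + 2 * (1 + c^-1)))).
  rewrite ler_wpM2l ?invr_ge0 ?(ltW L0)//; apply: le_trans (ler_sum _ (fun j _ => term j)) _.
  rewrite big_split/= lerD// (reindex_inj rev_ord_inj)/=.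
  by under eq_bigr do rewrite -[(L - (L - _.+1).+1)%N]/(rev_ord (rev_ord _) : nat) rev_ordK.
rewrite /c invf_div; have -> : L%:R^-1 * (2 * (1 + L%:R / 2 ^+ k) + 2 * (1 + L%:R / 2 ^+ k)) = 4 * L%:R^-1 + 4 / 2 ^+ k :> R.
  by field; rewrite !gt_eqF.
have : L%:R^-1 <= (2 ^+ k)^-1 :> R by rewrite lef_pV2.
by lra.
Qed.

Lemma normc_mode_sub1 (x : R * R) : normc (e e1 x - 1) ^+ 2 = 4 * sin (pi * x.1) ^+ 2 /\
  normc (e e2 x - 1) ^+ 2 = 4 * sin (pi * x.2) ^+ 2.
Proof.
have key (a : R) : normc ((cos (a + a) +i* sin (a + a))%C - 1) ^+ 2 = 4 * sin a ^+ 2.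
  rewrite /= sqr_sqrtr ?addr_ge0 ?sqr_ge0// cosD sinD; have h := cos2Dsin2 a.
  have -> : cos a * cos a = 1 - sin a ^+ 2 by rewrite -h; ring.
  have -> : sin a * cos a + cos a * sin a = 2 * (sin a * cos a) by ring.
  have c2 : cos a ^+ 2 = 1 - sin a ^+ 2 by rewrite -h; ring.
  have -> : (2 * (sin a * cos a) - 0) ^+ 2 = 4 * sin a ^+ 2 * cos a ^+ 2 by ring.
  rewrite c2.
  by ring.
have E1 : phase e1 x = pi * x.1 + pi * x.1 by rewrite /phase/=; ring.
have E2 : phase e2 x = pi * x.2 + pi * x.2 by rewrite /phase/=; ring.
by rewrite /fourier_mode E1 E2 !key.
Qed.

(** Symbols that behave like M f(m / 2^k) with f smooth and compactly supported, expressed by finite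
    differences. The mixed second difference matches a weight that is a product over the two
    coordinates. *)
Definition mult k (M : R) (s : int * int -> R) : Prop :=
  [/\ forall m, ~~ in_box (2 ^ k.+1) m -> s m = 0,
      forall m, `|s m| <= M,
      forall m, `|s (m + e1) - s m| <= M / 2 ^+ k,
      forall m, `|s (m + e2) - s m| <= M / 2 ^+ k &
      forall m, `|s (m + e1 + e2) - s (m + e1) - s (m + e2) + s m| <= M / 4 ^+ k].

(** Multiplying the kernel by e_1 - 1 or e_2 - 1 differences its coefficients, so Parseval bounds
    the weighted L^2 norm by the differences in [mult]. The inverse weight has average at most
    64/4^k. The two halves give 32 M and 162 M. *)
Lemma mult_kernel_le k M s L : 0 < M -> mult k M s -> (2 ^ k.+4 < L)%N ->
  ravg L (fun x => normc (trig (2 ^ k.+1) (fun m => (s m)%:C%C) x)) <= 200 * M.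
Proof.
move=> M0 [s0 sM s1 s2 s12] kL; set D := (2 ^ k.+1)%N; set K := trig D _.
have k0 : 0 < 2 ^+ k :> R by rewrite exprn_gt0.
have k4 : 4 ^+ k = (2 ^+ k) ^+ 2 :> R by rewrite -exprM mulnC exprM; congr (_ ^+ _); ring.
have k40 : 0 < 4 ^+ k :> R by rewrite exprn_gt0.
pose w1 (u : R) := 1 + 4 ^+ k * (4 * sin (pi * u) ^+ 2).
have w10 u : 0 < w1 u by rewrite ltr_pwDl// mulr_ge0 ?exprn_ge0// mulr_ge0// sqr_ge0.
(* This value balances the two terms of the next bound: both become multiples of M. *)
pose lam := M * 4 ^+ k; have lam0 : 0 < lam by rewrite mulr_gt0.
have DE : D = (2 * 2 ^ k)%N by rewrite /D expnS.
have k1 : (0 < 2 ^ k)%N by rewrite expn_gt0.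
have kL' : (16 * 2 ^ k < L)%N by move: kL; rewrite !expnS !mulnA.
apply: (@le_trans _ _ (ravg L (fun x => lam / 2 * ((w1 x.1)^-1 * (w1 x.2)^-1) + (2 * lam)^-1 * (w1 x.1 * w1 x.2 * normc (K x) ^+ 2)))).
  (* AM-GM: [2 |K| <= lam / w + w |K|^2 / lam] *)
  apply: ravg_le => x; set p := normc (K x); rewrite -invfM; set w := w1 x.1 * w1 x.2.
  have wp : 0 < w by rewrite mulr_gt0.
  have -> : lam / 2 * w^-1 + (2 * lam)^-1 * (w * p ^+ 2) = p + (2 * lam * w)^-1 * (lam - w * p) ^+ 2.
    by field; rewrite !gt_eqF.
  by rewrite lerDl mulr_ge0 ?sqr_ge0// invr_ge0 !mulr_ge0 ?ltW.
rewrite ravg_comb.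
have A1 : ravg L (fun x => (w1 x.1)^-1 * (w1 x.2)^-1) <= 64 / 4 ^+ k.
  have -> : ravg L (fun x => (w1 x.1)^-1 * (w1 x.2)^-1) = (L%:R^-1 * \sum_(j < L) (w1 (j%:R / L%:R))^-1) ^+ 2.
    rewrite /ravg exprMn exprVn; congr (_ * _); rewrite expr2 mulr_suml.
    rewrite -(pair_bigA _ (fun i j : 'I_L => (w1 (i%:R / L%:R))^-1 * (w1 (j%:R / L%:R))^-1))/=.
    by apply: eq_bigr => i _; rewrite mulr_sumr.
  have -> : 64 / 4 ^+ k = (8 / 2 ^+ k) ^+ 2 :> R by rewrite k4; field; rewrite gt_eqF.
  rewrite lerXn2r ?nnegrE ?mulr_ge0 ?invr_ge0 ?sumr_ge0 ?(ltW k0)//; first by move=> j _; rewrite invr_ge0 ltW.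
  by apply: sum_inv_weight_le; lia.
have A2 : ravg L (fun x => w1 x.1 * w1 x.2 * normc (K x) ^+ 2) <= 324 * 4 ^+ k * M ^+ 2.
  pose c1 (m : int * int) : Rc := (s (m - e1) - s m)%:C%C.
  pose c2 (m : int * int) : Rc := (s (m - e2) - s m)%:C%C.
  pose c12 (m : int * int) : Rc := (s (m - e2 - e1) - s (m - e2) - (s (m - e1) - s m))%:C%C.
  have inb (D0 : nat) m v : in_box 1 v -> in_box D0 (m - v) -> in_box D0.+1 m.
    by move=> v1 h; rewrite -(subrK v m) -addn1; exact: in_boxD.
  have out D0 m v (v1 : in_box 1 v) : ~~ in_box D0.+1 m -> ~~ in_box D0 (m - v).
    by apply: contra => h; exact: inb h.
  have out0 D0 m : ~~ in_box D0.+1 m -> ~~ in_box D0 m by apply: contra; apply: in_box_le.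
  have sub (D0 : nat) (a : int * int -> R) v x : in_box 1 v -> (forall m, ~~ in_box D0 m -> a m = 0) ->
     trig D0.+1 (fun m => (a (m - v) - a m)%:C%C : Rc) x = (e v x - 1) * trig D0 (fun m => (a m)%:C%C) x.
    move=> v1 a0; rewrite mulrBl mul1r -(@trig_translate D0 D0.+1 (fun m => (a m)%:C%C)); first last.
    - by move=> m /(out _ _ _ v1) /a0 ->.
    - by move=> m /a0 ->.
    rewrite (@trig_supp D0 D0.+1 (fun m => (a m)%:C%C)); first last.
    - by move=> m /out0 /a0 ->.
    - by move=> m /a0 ->.
    by rewrite /trig -sumrB; apply: eq_bigr => j _; rewrite rmorphB mulrBl.
  have t0 x : K x = trig D.+2 (fun m => (s m)%:C%C) x.
    by apply: trig_supp => m; [move=> /s0 ->|move=> /out0/out0/s0 ->].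
  have t1 x : (e e1 x - 1) * K x = trig D.+2 c1 x.
    rewrite -(sub D s e1)//; apply: trig_supp => m; [move=> h|move=> /out0 h].
      by rewrite (s0 _ (out D m e1 isT h)) (s0 _ (out0 _ _ h)) subrr.
    by rewrite /c1 (s0 _ (out D m e1 isT h)) (s0 _ (out0 _ _ h)) subrr.
  have t2 x : (e e2 x - 1) * K x = trig D.+2 c2 x.
    rewrite -(sub D s e2)//; apply: trig_supp => m; [move=> h|move=> /out0 h].
      by rewrite (s0 _ (out D m e2 isT h)) (s0 _ (out0 _ _ h)) subrr.
    by rewrite /c2 (s0 _ (out D m e2 isT h)) (s0 _ (out0 _ _ h)) subrr.
  have t12 x : (e e2 x - 1) * ((e e1 x - 1) * K x) = trig D.+2 c12 x.
    rewrite -(sub D s e1)// -(sub D.+1 (fun m => s (m - e1) - s m) e2)// => m h.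
    by rewrite (s0 _ (out D m e1 isT h)) (s0 _ (out0 _ _ h)) subrr.
  have E x : w1 x.1 * w1 x.2 * normc (K x) ^+ 2 =
      1 * (1 * normc (trig D.+2 (fun m => (s m)%:C%C) x) ^+ 2 + 4 ^+ k * normc (trig D.+2 c1 x) ^+ 2) +
      4 ^+ k * (1 * normc (trig D.+2 c2 x) ^+ 2 + 4 ^+ k * normc (trig D.+2 c12 x) ^+ 2).
    rewrite -t12 -t2 -t1 -t0 !ComplexField.Normc.normcM !exprMn /w1.
    by have [<- <-] := normc_mode_sub1 x; ring.
  rewrite (funext E).
  rewrite ravg_comb !ravg_comb !mul1r.
  have DL : (D.+2.*2 < L)%N by rewrite DE; lia.
  have Db : D.+2.*2.+1%:R ^+ 2 <= 81 * 4 ^+ k :> R.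
    have -> : 81 * 4 ^+ k = (9 * 2 ^+ k) ^+ 2 :> R by rewrite k4; ring.
    by rewrite lerXn2r ?nnegrE ?mulr_ge0 ?(ltW k0)// -natrX -natrM ler_nat DE; lia.
  have bd c (B : R) : (forall m, normc (c m) <= B) -> ravg L (fun x => normc (trig D.+2 c x) ^+ 2) <= 81 * 4 ^+ k * B ^+ 2.
    by move=> cB; apply: le_trans (ravg_trig_sqr_le DL cB) _; rewrite ler_wpM2r// sqr_ge0.
  have h0 := bd (fun m => (s m)%:C%C) M; have h1 := bd c1 (M / 2 ^+ k); have h2 := bd c2 (M / 2 ^+ k).
  have h12 := bd c12 (M / 4 ^+ k).
  have {}h0 : ravg L (fun x => normc (trig D.+2 (fun m => (s m)%:C%C) x) ^+ 2) <= 81 * 4 ^+ k * M ^+ 2.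
    by apply: h0 => m; rewrite normc_real.
  have {}h1 : 4 ^+ k * ravg L (fun x => normc (trig D.+2 c1 x) ^+ 2) <= 81 * 4 ^+ k * M ^+ 2.
    rewrite -ler_pdivlMl//; apply: le_trans (h1 _) _ => [m|].
      by rewrite normc_real distrC -{1}(subrK e1 m).
    by rewrite k4 le_eqVlt; apply/orP; left; apply/eqP; field; rewrite gt_eqF.
  have {}h2 : 4 ^+ k * ravg L (fun x => normc (trig D.+2 c2 x) ^+ 2) <= 81 * 4 ^+ k * M ^+ 2.
    rewrite -ler_pdivlMl//; apply: le_trans (h2 _) _ => [m|].
      by rewrite normc_real distrC -{1}(subrK e2 m).
    by rewrite k4 le_eqVlt; apply/orP; left; apply/eqP; field; rewrite gt_eqF.
  have {}h12 : 4 ^+ k * (4 ^+ k * ravg L (fun x => normc (trig D.+2 c12 x) ^+ 2)) <= 81 * 4 ^+ k * M ^+ 2.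
    rewrite -ler_pdivlMl// -ler_pdivlMl//; apply: le_trans (h12 _) _ => [m|].
      rewrite normc_real; have := s12 (m - e2 - e1); rewrite subrK subrK.
      have -> : m - e2 - e1 + e2 = m - e1 by rewrite -[m - e2 - e1]addrAC subrK.
      by apply: le_trans; rewrite le_eqVlt; apply/orP; left; apply/eqP; congr `|_|; ring.
    by rewrite k4 le_eqVlt; apply/orP; left; apply/eqP; field; rewrite gt_eqF.
  by rewrite mulrDr; lra.
have B1 : lam / 2 * ravg L (fun x => (w1 x.1)^-1 * (w1 x.2)^-1) <= 32 * M.
  apply: le_trans (ler_wpM2l _ A1) _; first by rewrite divr_ge0// ltW.
  by rewrite /lam le_eqVlt; apply/orP; left; apply/eqP; field; rewrite gt_eqF.
have B2 : (2 * lam)^-1 * ravg L (fun x => w1 x.1 * w1 x.2 * normc (K x) ^+ 2) <= 162 * M.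
  apply: le_trans (ler_wpM2l _ A2) _; first by rewrite invr_ge0 mulr_ge0// ltW.
  by rewrite /lam le_eqVlt; apply/orP; left; apply/eqP; field; rewrite !gt_eqF.
lra.
Qed.

(** Convolution with the kernel of the symbol, realised as an average over a grid fine enough for
    both degrees; the L^1 norm of the kernel on that grid is [mult_kernel_le]. *)
Theorem multiplier_le k M s D (c : int * int -> Rc) (B : R) x : 0 < M -> mult k M s ->
  (forall m, ~~ in_box D m -> c m = 0) -> (forall y, normc (trig D c y) <= B) ->
  normc (trig (2 ^ k.+1) (fun m => (s m)%:C%C * c m) x) <= 200 * M * B.
Proof.
move=> M0 sM c0 cB; have [s0 _ _ _ _] := sM; pose K := trig (2 ^ k.+1) (fun m => (s m)%:C%C).
pose L := (2 ^ k.+4 + D).+1.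
have kk : (2 ^ k.+1 <= 2 ^ k.+4)%N by rewrite leq_exp2l//; lia.
have B0 : 0 <= B := le_trans (normc_ge0 _) (cB 0).
have -> : trig (2 ^ k.+1) (fun m => (s m)%:C%C * c m) x = grid_avg L (fun y => trig D c (x - y) * K y).
  rewrite (@trig_supp _ D); first last.
  - by move=> m /c0 ->; rewrite mulr0.
  - by move=> m /s0 ->; rewrite mul0r.
  rewrite (eq_grid_avg L (g := fun y => \sum_(l : box D) (c (box_mode l) * e (box_mode l) x) * (K y * e (- box_mode l) y))); last first.
    move=> y; rewrite /trig mulr_suml; apply: eq_bigr => l _.
    by rewrite modeDr modeNr -!mulrA; congr (_ * (_ * _)); rewrite mulrC.
  rewrite grid_avg_sum /trig; apply: eq_bigr => l _; rewrite grid_avgZ grid_avg_trig; first last.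
  - by have := box_modeP l; rewrite /in_box /L => /andP[_ h]; lia.
  - by have := box_modeP l; rewrite /in_box /L => /andP[h _]; lia.
  rewrite /cut; case: ifPn => [_|/s0 ->]; last by rewrite mul0r mul0r mulr0.
  by rewrite [RHS]mulrC mulrA.
apply: le_trans (grid_avg_le _ _) _; apply: (@le_trans _ _ (ravg L (fun y => B * normc (K y) + 0 * 0))).
  by apply: ravg_le => y; rewrite mul0r addr0 ComplexField.Normc.normcM ler_wpM2r ?normc_ge0.
rewrite (ravg_comb L (fun y => normc (K y)) (fun=> 0)) mul0r addr0 mulrC ler_wpM2r//.
by apply: mult_kernel_le => //; rewrite /L; lia.
Qed.

End Multiplier.

(** * Block symbols and heat symbols as multipliers *)

Section SymbolMultipliers.
Context {R : realType}.
Local Notation Rc := R[i].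
Local Notation eigen := (@eigen R).
Local Notation axis := (@axis R).
Local Notation e1 := ((1, 0) : int * int).
Local Notation e2 := ((0, 1) : int * int).

Lemma continuous_box_bounded (f : R * R -> R) (B : R) : continuous f ->
  exists2 M : R, 0 < M & forall z, `|z.1| <= B -> `|z.2| <= B -> `|f z| <= M.
Proof.
move=> cf; have K : compact ([set` `[- B, B]] `*` [set` `[- B, B]]).
  by apply: compact_setX; exact: segment_compact.
have /compact_bounded[M [_ hM]] := continuous_compact (continuous_subspaceT cf) K.
have /(_ (`|M| + 1)) h := hM.
exists (`|M| + 1) => [|z z1 z2]; first by rewrite ltr_wpDl.
apply: h; first by apply: le_lt_trans (ler_norm M) _; rewrite ltrDl.
by exists z => //; split; rewrite /= in_itv/= -ler_norml.
Qed.

Lemma is_derive_along i (f : R * R -> R) (z : R * R) (s : R) : derivable f (z + s *: axis i) (axis i) ->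
  is_derive s 1 (fun r => f (z + r *: axis i)) ('D_(axis i) f (z + s *: axis i)).
Proof.
move=> df; have E : (fun h : R => h^-1 *: (f (z + (h *: (1 : R) + s) *: axis i) - f (z + s *: axis i))) =
    (fun h : R => h^-1 *: (f (h *: axis i + (z + s *: axis i)) - f (z + s *: axis i))).
  apply/funext => h; rewrite [h *: (1 : R)]mulr1 scalerDl.
  by congr (_ *: (f _ - _)); rewrite addrCA.
by apply: DeriveDef; [rewrite /derivable E|rewrite /derive E].
Qed.

Lemma axis_MVT i (f : R * R -> R) (z : R * R) (h : R) : 0 < h -> (forall x, derivable f x (axis i)) ->
  exists s, [/\ 0 <= s, s <= h & f (z + h *: axis i) - f z = h * 'D_(axis i) f (z + s *: axis i)].
Proof.
move=> h0 df; have D s := is_derive_along (df (z + s *: axis i)).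
have [|s] := MVT h0 (fun s _ => D s).
  apply: continuous_subspaceT => s; apply: differentiable_continuous; apply/derivable1_diffP.
  exact: (@ex_derive _ _ _ _ _ _ _ (D s)).
rewrite in_itv/= => /andP[s0 sh] E; exists s; split; [exact: ltW|exact: ltW|].
by rewrite -[in f z](addr0 z) -(scale0r (axis i)) E subr0 mulrC.
Qed.

(** The mixed difference is a difference along the first axis of a difference along the second, and
    the mean value theorem is applied once to each. The radii are generous: rescaled lattice points
    near the support stay within 14, and steps of length at most 1 then stay within 20. *)
Lemma smooth_differences (f : R * R -> R) : smooth f -> exists2 M : R, 0 < M & forall z (h : R), 0 < h -> h <= 1 ->
  `|z.1| <= 14 -> `|z.2| <= 14 ->
  [/\ `|f z| <= M, forall i, `|f (z + h *: axis i) - f z| <= M * h &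
    `|f (z + h *: axis true + h *: axis false) - f (z + h *: axis true) - f (z + h *: axis false) + f z| <= M * h ^+ 2].
Proof.
move=> sf; have [cf d1] := sf 1%N; have [_ d2] := sf 2%N.
have [dt [ct dtt]] := d2 true; have [dft cft] := dtt false.
have [df [cdf _]] := d2 false.
have [M0 M00 h0] := continuous_box_bounded 20 cf.
have [M1 M10 h1] := continuous_box_bounded 20 ct.
have [M2 M20 h2] := continuous_box_bounded 20 cdf.
have [M3 M30 h3] := continuous_box_bounded 20 cft.1.
exists (M0 + M1 + M2 + M3) => [|z h hp hl1 z1 z2]; first by rewrite !addr_gt0.
have nb (a b : R) : `|a| <= 14 -> 0 <= b -> b <= 1 -> `|a + b| <= 20.
  by rewrite !ler_norml => /andP[a1 a2] b0 b1; apply/andP; split; lra.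
split; first by apply: (le_trans (h0 z _ _)); [lra|lra|lra].
- case.
    have [s [s0 sh ->]] := axis_MVT z hp dt; rewrite normrM gtr0_norm// mulrC ler_wpM2r ?(ltW hp)//.
    apply: (le_trans (h1 _ _ _)); rewrite /= /GRing.scale/= ?mulr1 ?mulr0 ?addr0; [apply: nb; lra|lra|lra].
  have [s [s0 sh ->]] := axis_MVT z hp df; rewrite normrM gtr0_norm// mulrC ler_wpM2r ?(ltW hp)//.
  apply: (le_trans (h2 _ _ _)); rewrite /= /GRing.scale/= ?mulr1 ?mulr0 ?addr0; [lra|apply: nb; lra|lra].
pose b := h *: axis false.
pose D s := is_deriveB (is_derive_along (dt (z + b + s *: axis true))) (is_derive_along (dt (z + s *: axis true))).
have [|s] := MVT hp (fun s _ => D s).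
  apply: continuous_subspaceT => s; apply: differentiable_continuous; apply/derivable1_diffP.
  exact: (@ex_derive _ _ _ _ _ _ _ (D s)).
rewrite in_itv/= => /andP[s0 sh] E.
have {}E : (f (z + b + h *: axis true) - f (z + h *: axis true)) - (f (z + b + 0 *: axis true) - f (z + 0 *: axis true)) =
  ('D_(axis true) f (z + b + s *: axis true) - 'D_(axis true) f (z + s *: axis true)) * (h - 0) := E.
rewrite !scale0r !addr0 subr0 in E.
have [s' [s'0 s'h E']] := axis_MVT (z + s *: axis true) hp dft.
rewrite addrAC in E'; rewrite E' in E.
have -> : f (z + h *: axis true + h *: axis false) - f (z + h *: axis true) - f (z + h *: axis false) + f z =
    h * 'D_(axis false) ('D_(axis true) f) (z + s *: axis true + s' *: axis false) * h.
  by rewrite -E /b [z + h *: axis false + _]addrAC; ring.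
rewrite !normrM (gtr0_norm hp) mulrAC -expr2 mulrC ler_wpM2r ?sqr_ge0//.
apply: (le_trans (h3 _ _ _)); rewrite /= /GRing.scale/= ?mulr1 ?mulr0 ?addr0; [apply: nb; lra|apply: nb; lra|lra].
Qed.

Variables (chi theta : R * R -> R).
Hypothesis CT : dyadic_partition chi theta.
Local Notation symbol := (symbol chi theta).

Lemma out_corner D m v : in_box 1 v -> ~~ in_box D.+1 m -> ~~ in_box D (m + v).
Proof.
move=> v1; apply: contra => h; rewrite -(addrK v m) -addn1; apply: in_boxD => //.
by rewrite in_boxN.
Qed.

Lemma intr_norm_le (i : int) n : (`|i| <= n)%N -> `|i%:~R : R| <= n%:R.
Proof. by move=> h; rewrite -intr_norm -[n%:R]/((n%:Z)%:~R) ler_int; lia. Qed.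

Lemma in_box_corner D m v : 0 <= v.1 <= 1 /\ 0 <= v.2 <= 1 -> in_box D (m + v) ->
  (`|m.1| <= D.+1)%N /\ (`|m.2| <= D.+1)%N.
Proof. by case: m v => [a b] [c d] /=; rewrite /in_box/= => -[? ?] /andP[? ?]; split; lia. Qed.

Lemma corner_dist (a v v' : int) : 0 <= v <= 1 -> 0 <= v' <= 1 -> `|(a + v') - (a + v)| <= 1.
Proof. lia. Qed.

Lemma symbol_mult : exists2 M : R, 0 < M & forall k, mult k M (fun m => symbol k (lattice m)).
Proof.
have [M1 M10 h1] := smooth_differences (chi_smooth CT).
have [M2 M20 h2] := smooth_differences (theta_smooth CT).
exists (4 * (M1 + M2)) => [|k]; first by rewrite mulr_gt0// addr_gt0.
(* Treats [chi] and [theta] together. The scale c is 1 for block 0 and 2^(k-1) for block k >= 1, so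
   2^k <= 2c in both cases. *)
have [f [c [M [fM c1 [c2 MM] E]]]] : exists (f : R * R -> R) (c : R) (M : R), [/\ (forall z (h : R), 0 < h -> h <= 1 ->
    `|z.1| <= 14 -> `|z.2| <= 14 -> [/\ `|f z| <= M, forall i, `|f (z + h *: axis i) - f z| <= M * h &
    `|f (z + h *: axis true + h *: axis false) - f (z + h *: axis true) - f (z + h *: axis false) + f z| <= M * h ^+ 2]),
    1 <= c, 2 ^+ k <= 2 * c /\ 0 < M <= M1 + M2 & forall m, symbol k (lattice m) = f (c^-1 *: lattice m)].
  case: k => [|k].
    exists chi, 1, M1; split=> //; first by rewrite expr0; split; [lra|apply/andP; split; lra].
    by move=> m /=; rewrite invr1 scale1r.
  exists theta, (2 ^+ k), M2; split=> //; first by rewrite exprn_ege1// ler1n.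
    by split; [rewrite exprS|apply/andP; split; lra].
  by move=> m; rewrite /=/dyadic /lattice /=; congr theta; rewrite mulrC [_ / _]mulrC.
have c0 : 0 < c by lra. have k0 : 0 < 2 ^+ k :> R by rewrite exprn_gt0.
have k1 : 1 <= 2 ^+ k :> R by rewrite exprn_ege1// ler1n.
have ck : c^-1 <= 2 / 2 ^+ k by rewrite ler_pdivlMr// ler_pdivrMl// mulrC.
have ci0 : 0 < c^-1 by rewrite invr_gt0.
have ci1 : c^-1 <= 1 by rewrite invf_le1.
have k4 : 4 ^+ k = (2 ^+ k) ^+ 2 :> R by rewrite -exprM mulnC exprM; congr (_ ^+ _); ring.
have /andP[M0 MM'] := MM.
have main m : [/\ `|symbol k (lattice m)| <= 4 * (M1 + M2),
   `|symbol k (lattice (m + e1)) - symbol k (lattice m)| <= 4 * (M1 + M2) / 2 ^+ k,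
   `|symbol k (lattice (m + e2)) - symbol k (lattice m)| <= 4 * (M1 + M2) / 2 ^+ k &
   `|symbol k (lattice (m + e1 + e2)) - symbol k (lattice (m + e1)) - symbol k (lattice (m + e2)) + symbol k (lattice m)| <= 4 * (M1 + M2) / 4 ^+ k].
  have MM0 : 0 <= 4 * (M1 + M2) by lra.
  (* Outside the box enlarged by 2 all four corners of the lattice square lie off the support. *)
  have [mD|mD] := boolP (in_box (2 ^ k.+1).+2 m); last first.
    have mD' : ~~ in_box (2 ^ k.+1).+1 m by apply: contra mD; apply: in_box_le.
    have mD'' : ~~ in_box (2 ^ k.+1) m by apply: contra mD'; apply: in_box_le.
    have z0 := symbol_in_box CT mD''; have z1 := symbol_in_box CT (out_corner (isT : in_box 1 e1) mD').
    have z2 := symbol_in_box CT (out_corner (isT : in_box 1 e2) mD').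
    have z3 := symbol_in_box CT (out_corner (isT : in_box 1 e2) (out_corner (isT : in_box 1 e1) mD)).
    by rewrite z0 z1 z2 z3 !subr0 addr0 normr0; split=> //; rewrite divr_ge0// exprn_ge0.
  have [b1 b2] : `|m.1%:~R : R| <= 2 * 2 ^+ k + 2 /\ `|m.2%:~R : R| <= 2 * 2 ^+ k + 2.
    have E2 : (2 * 2 ^+ k + 2 : R) = ((2 ^ k.+1).+2)%:R by rewrite -(addn2 (2 ^ k.+1)) natrD natrX exprS.
    by case/andP: mD => ? ?; rewrite E2; split; exact: intr_norm_le.
  have bnd (a : R) : `|a| <= 2 * 2 ^+ k + 2 -> `|c^-1 * a| <= 14.
    move=> h; rewrite normrM gtr0_norm// ler_pdivrMl//; apply: (le_trans h); lra.
  have E1 : c^-1 *: lattice (m + e1) = c^-1 *: lattice m + c^-1 *: axis true.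
    by rewrite /lattice/axis/= -scalerDr; congr (_ *: _); congr pair; rewrite /= intrD.
  have E2 : c^-1 *: lattice (m + e2) = c^-1 *: lattice m + c^-1 *: axis false.
    by rewrite /lattice/axis/= -scalerDr; congr (_ *: _); congr pair; rewrite /= intrD.
  have E3 : c^-1 *: lattice (m + e1 + e2) = c^-1 *: lattice m + c^-1 *: axis true + c^-1 *: axis false.
    by rewrite /lattice/axis/= -!scalerDr; congr (_ *: _); congr pair; rewrite /= !intrD.
  have [f0 f1 f2] := fM (c^-1 *: lattice m) c^-1 ci0 ci1 (bnd _ b1) (bnd _ b2).
  have d1 : M * c^-1 <= 4 * (M1 + M2) / 2 ^+ k.
    apply: (@le_trans _ _ (M * (2 / 2 ^+ k))); first by rewrite ler_wpM2l// ltW.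
    by rewrite mulrA ler_wpM2r ?invr_ge0 ?(ltW k0)//; lra.
  have d2 : M * c^-1 ^+ 2 <= 4 * (M1 + M2) / 4 ^+ k.
    apply: (@le_trans _ _ (M * (2 / 2 ^+ k) ^+ 2)).
      by rewrite ler_wpM2l ?(ltW M0)// lerXn2r ?nnegrE ?(ltW ci0) ?divr_ge0 ?(ltW k0).
    rewrite exprMn exprVn -k4 mulrA ler_wpM2r ?invr_ge0 ?exprn_ge0//; lra.
  rewrite !E E1 E2 E3; split; [lra| | |]; first exact: le_trans (f1 true) d1.
    exact: le_trans (f1 false) d1.
  exact: le_trans f2 d2.
split=> [m mD|m|m|m|m]; first exact: (symbol_in_box CT mD).
all: by have [? ? ? ?] := main m.
Qed.

(** A lattice point next to the support of block k still has an eigenvalue of order 4^k. The factor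
    64 covers small k, where [eigen m'] is merely known to be at least 1. *)
Lemma eigen_corner k m m' : symbol k (lattice m) != 0 -> `|m'.1 - m.1| <= 1 -> `|m'.2 - m.2| <= 1 ->
  4 ^+ k / 64 <= eigen m'.
Proof.
move=> sm h1 h2; have g1 := eigen_ge1 m' : 1 <= eigen m'.
have [k3|k3] := leP (4 ^+ k : R) 64; first by apply: le_trans g1; rewrite ler_pdivrMr// mul1r.
case: k sm k3 => [|k] sm k3; first by move: k3; rewrite expr0; lra.
have := symbol_ge CT sm; set p : R := 2 ^+ k => ge; have p0 : 0 <= p by rewrite exprn_ge0.
have k4 : 4 ^+ k.+1 = 4 * p ^+ 2 :> R.
  by rewrite exprS /p -exprM mulnC exprM; congr (_ * _ ^+ _); ring.
rewrite k4 in k3 *.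
have ge2 : (3 / 4 * p) ^+ 2 <= norm2 (lattice m) ^+ 2.
  by rewrite lerXn2r ?nnegrE ?mulr_ge0 ?norm2_ge0//.
rewrite norm2_sqr /= in ge2; rewrite /eigen norm2_sqr/=.
have q1 : `|m'.1%:~R - m.1%:~R : R| <= 1 by rewrite -intrB -intr_norm (ler_int _ _ 1).
have q2 : `|m'.2%:~R - m.2%:~R : R| <= 1 by rewrite -intrB -intr_norm (ler_int _ _ 1).
move: ge2 q1 q2; set a : R := m.1%:~R; set b : R := m.2%:~R; set a' : R := m'.1%:~R; set b' : R := m'.2%:~R.
rewrite !ler_norml => ge2 /andP[q1 q1'] /andP[q2 q2'].
have r1 : a ^+ 2 / 2 - 1 <= a' ^+ 2 by have := sqr_ge0 (2 * a' - a); nra.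
have r2 : b ^+ 2 / 2 - 1 <= b' ^+ 2 by have := sqr_ge0 (2 * b' - b); nra.
have p2 : 4 <= pi ^+ 2 :> R by have := @pi_ge2 R; nra.
have s0 : 0 <= a' ^+ 2 + b' ^+ 2 by rewrite addr_ge0 ?sqr_ge0.
have : 16 * (a' ^+ 2 + b' ^+ 2) <= 4 * pi ^+ 2 * (a' ^+ 2 + b' ^+ 2) by rewrite ler_wpM2r//; lra.
rewrite exprMn in ge2; lra.
Qed.

(** Here c is the smaller of the two arguments. Keeping it at an endpoint lets the decay be read off
    at a corner of a lattice square. *)
Lemma exp_diff_le (a b : R) : exists c, (c = a \/ c = b) /\ `|expR (- a) - expR (- b)| <= `|a - b| * expR (- c).
Proof.
have key x y : x <= y -> `|expR (- x) - expR (- y)| <= `|x - y| * expR (- x).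
  move=> xy; rewrite ger0_norm ?subr_ge0 ?ler_expR ?lerN2// distrC ger0_norm ?subr_ge0//.
  have -> : expR (- y) = expR (- (y - x)) * expR (- x) by rewrite -expRD; congr expR; ring.
  rewrite -{1}[expR (- x)]mul1r -mulrBl ler_wpM2r ?expR_ge0//; have := expR_ge1Dx (- (y - x)); lra.
have [ab|/ltW ab] := leP a b; first by exists a; split; [left|exact: key].
by exists b; split; [right|rewrite distrC [`|a - b|]distrC; exact: key].
Qed.

Definition heat_symbol (t : R) k (m : int * int) : R := symbol k (lattice m) * expR (- (t * eigen m)).

Lemma exp_poly_le (s K : R) : 0 <= s -> 0 <= K -> exists2 C : R, 0 < C & forall y, 0 < y ->
  (1 + K * y + (K * y) ^+ 2) * expR (- y) <= C * y `^ (- s).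
Proof.
move=> s0 K0; have [C0 C00 h0] := expRN_le_powR s0.
have [C1 C10 h1] := expRN_le_powR (addr_ge0 s0 ler01).
have [C2 C20 h2] := expRN_le_powR (addr_ge0 s0 (ler0n R 2)).
exists (C0 + K * C1 + K ^+ 2 * C2) => [|y y0].
  have a1 : 0 <= K * C1 by apply: mulr_ge0 => //; exact: ltW.
  have a2 : 0 <= K ^+ 2 * C2 by apply: mulr_ge0; [exact: sqr_ge0|exact: ltW].
  lra.
have E1 : y * y `^ (- (s + 1)) = y `^ (- s).
  by rewrite -{1}[y](powRr1 (ltW y0)) -powRD ?(gt_eqF y0) ?implybT//; congr (_ `^ _); ring.
have E2 : y ^+ 2 * y `^ (- (s + 2)) = y `^ (- s).
  by rewrite -powR_mulrn ?(ltW y0)// -powRD ?(gt_eqF y0) ?implybT//; congr (_ `^ _); ring.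
have i1 : y * expR (- y) <= C1 * y `^ (- s).
  by rewrite -E1 mulrCA ler_wpM2l ?(ltW y0)//; exact: h1.
have i2 : y ^+ 2 * expR (- y) <= C2 * y `^ (- s).
  by rewrite -E2 mulrCA ler_wpM2l ?sqr_ge0//; exact: h2.
have i0 := h0 y y0.
have j1 := ler_wpM2l K0 i1; have j2 := ler_wpM2l (sqr_ge0 K) i2.
rewrite !mulrDl mul1r exprMn -!mulrA; lra.
Qed.

(** The exponential factors over the coordinates, so its differences are products of one-dimensional
    ones. With [y = t * 4 ^+ k / 64], a lower bound for t times the eigenvalue near the support,
    each difference costs [K * y / 2 ^+ k]; these powers of y are absorbed by exp(- y), which also
    leaves the power - s. *)
Lemma heat_symbol_mult (s : R) : 0 <= s -> exists2 C : R, 0 < C & forall t k, 0 < t ->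
  mult k (C * (t * 4 ^+ k) `^ (- s)) (heat_symbol t k).
Proof.
move=> s0; have [M M0 hM] := symbol_mult.
(* 64 bounds 4 pi^2, [9 * 2 ^+ k] bounds |2i + 1| near the block, and the last 64 undoes the
   division in [y]. *)
pose K : R := 64 * (9 * 64); have K0 : 0 <= K by rewrite /K !mulr_ge0.
have [C C0 hC] := exp_poly_le s0 K0.
exists (4 * (M + 1) * C * 64 `^ s) => [|t k t0]; first by rewrite !mulr_gt0 ?powR_gt0// addr_gt0.
have k0 : 0 < 2 ^+ k :> R by rewrite exprn_gt0.
have k1 : 1 <= 2 ^+ k :> R by rewrite exprn_ege1// ler1n.
have k4 : 4 ^+ k = (2 ^+ k) ^+ 2 :> R by rewrite -exprM mulnC exprM; congr (_ ^+ _); ring.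
have k40 : 0 < 4 ^+ k :> R by rewrite exprn_gt0.
pose y := t * 4 ^+ k / 64; have y0 : 0 < y by rewrite !mulr_gt0.
pose Q := C * y `^ (- s); have Q0 : 0 < Q by rewrite mulr_gt0// powR_gt0.
have QE : 4 * (M + 1) * C * 64 `^ s * (t * 4 ^+ k) `^ (- s) = 4 * (M + 1) * Q.
  rewrite /Q; have -> : y `^ (- s) = 64 `^ s * (t * 4 ^+ k) `^ (- s).
    rewrite /y powRM ?mulr_ge0 ?(ltW t0) ?(ltW k40)// mulrC; congr (_ * _).
    by rewrite -(powR_inv1 (ler0n R 64)) -powRrM; congr (_ `^ _); ring.
  by rewrite !mulrA.
rewrite QE; have hy := hC y y0; rewrite -/Q in hy.
have Ky0 : 0 <= K * y by rewrite mulr_ge0// ltW.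
have ey0 := expR_ge0 (- y).
have q0 : expR (- y) <= Q by apply: le_trans hy; rewrite ler_peMl// -addrA lerDl addr_ge0// sqr_ge0.
have q1 : K * y * expR (- y) <= Q.
  by apply: le_trans hy; rewrite ler_wpM2r//; have := sqr_ge0 (K * y); lra.
have q2 : (K * y) ^+ 2 * expR (- y) <= Q by apply: le_trans hy; rewrite ler_wpM2r//; lra.
pose E m := expR (- (t * eigen m)); pose f m := symbol k (lattice m).
have [f0 fM f1 f2 f12] := hM k.
have fle m : `|f m| <= 1 by rewrite ger0_norm ?(symbol_ge0 CT)// symbol_le1.
(* Either the block symbol vanishes at all four corners, or one corner is in the support and the
   exponential is controlled at all of them. *)
have vanish m : (f m = 0 /\ f (m + e1) = 0 /\ f (m + e2) = 0 /\ f (m + e1 + e2) = 0) \/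
   [/\ `|E m| <= Q, `|E (m + e1)| <= Q, `|E (m + e1 + e2)| <= Q,
     [/\ `|E (m + e1) - E m| <= Q / 2 ^+ k, `|E (m + e2) - E m| <= Q / 2 ^+ k,
         `|E (m + e1 + e2) - E (m + e1)| <= Q / 2 ^+ k & `|E (m + e1 + e2) - E (m + e2)| <= Q / 2 ^+ k] &
     `|E (m + e1 + e2) - E (m + e1) - E (m + e2) + E m| <= Q / 4 ^+ k].
  have [zz|] := pselect (f m = 0 /\ f (m + e1) = 0 /\ f (m + e2) = 0 /\ f (m + e1 + e2) = 0); first by left.
  move=> nz; right.
  have [v [v01 fv]] : exists v : int * int, (0 <= v.1 <= 1 /\ 0 <= v.2 <= 1) /\ f (m + v) != 0.
    apply: contrapT => h; apply: nz.
    have hz v : 0 <= v.1 <= 1 -> 0 <= v.2 <= 1 -> f (m + v) = 0.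
      by move=> v1 v2; apply/eqP; apply: contrapT => /negP h'; apply: h; exists v.
    have -> : f m = f (m + 0) by rewrite addr0.
    by rewrite -addrA !hz.
  have mb : (`|m.1| <= (2 ^ k.+1).+1)%N /\ (`|m.2| <= (2 ^ k.+1).+1)%N.
    by apply: (in_box_corner v01); apply: contraNT fv => /f0 h; apply/eqP.
  have eg v' : 0 <= v'.1 <= 1 -> 0 <= v'.2 <= 1 -> y <= t * eigen (m + v').
    move=> h1 h2; rewrite /y -mulrA ler_wpM2l ?(ltW t0)//; by case: v01 => w1 w2; apply: (eigen_corner fv); exact: corner_dist.
  have Eb v' : 0 <= v'.1 <= 1 -> 0 <= v'.2 <= 1 -> E (m + v') <= expR (- y).
    by move=> h1 h2; rewrite ler_expR lerN2; exact: eg.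
  have p16 : pi ^+ 2 <= 16 :> R by have p0 := @pi_ge0 R; have p1 := @pihalf_lt2 R; nra.
  have pp0 : 0 <= pi ^+ 2 :> R by exact: sqr_ge0.
  pose u (i : int) : R := 4 * pi ^+ 2 * t * i%:~R ^+ 2.
  have EE m' : E m' = expR (- t) * (expR (- u m'.1) * expR (- u m'.2)).
    by rewrite /E /eigen norm2_sqr/= -!expRD /u; congr expR; ring.
  have du (i : int) : (`|i| <= (2 ^ k.+1).+1)%N -> `|u (i + 1) - u i| <= K * y / 2 ^+ k.
    move=> ib; rewrite /u intrD -mulrBr normrM.
    have -> : (i%:~R + 1%:~R) ^+ 2 - i%:~R ^+ 2 = 2 * i%:~R + 1 :> R by rewrite (_ : 1%:~R = 1 :> R)//; ring.
    have pt0 : 0 <= 4 * pi ^+ 2 * t by apply: mulr_ge0; [rewrite mulr_ge0|exact: ltW].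
    rewrite ger0_norm//.
    have ib' : `|i%:~R : R| <= 2 * 2 ^+ k + 1.
      have -> : (2 * 2 ^+ k + 1 : R) = ((2 ^ k.+1).+1)%:R by rewrite -(addn1 (2 ^ k.+1)) natrD natrX exprS.
      exact: intr_norm_le.
    have i9 : `|2 * i%:~R + 1 : R| <= 9 * 2 ^+ k by move: ib'; rewrite !ler_norml => /andP[? ?]; apply/andP; split; lra.
    have -> : K * y / 2 ^+ k = 64 * t * (9 * 2 ^+ k) by rewrite /K /y k4; field; rewrite gt_eqF.
    apply: ler_pM => //.
    by rewrite ler_wpM2r ?(ltW t0)//; lra.
  have [mb1 mb2] := mb.
  have [c1 [c1E hc1]] := exp_diff_le (u (m.1 + 1)) (u m.1).
  have [c2 [c2E hc2]] := exp_diff_le (u (m.2 + 1)) (u m.2).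
  have corner a b : (a = u (m.1 + 1) \/ a = u m.1) -> (b = u (m.2 + 1) \/ b = u m.2) ->
      expR (- t) * (expR (- a) * expR (- b)) <= expR (- y).
    move=> [->|->] [->|->].
    - by have := Eb (1, 1) isT isT; rewrite EE.
    - by have := Eb (1, 0) isT isT; rewrite EE/= addr0.
    - by have := Eb (0, 1) isT isT; rewrite EE/= addr0.
    - by have := Eb (0, 0) isT isT; rewrite EE/= !addr0.
  have d1 b : (b = u (m.2 + 1) \/ b = u m.2) ->
      `|expR (- t) * (expR (- u (m.1 + 1)) * expR (- b)) - expR (- t) * (expR (- u m.1) * expR (- b))| <= Q / 2 ^+ k.
    move=> hb; rewrite -mulrBr -mulrBl !normrM (ger0_norm (expR_ge0 (- t))) (ger0_norm (expR_ge0 (- b))).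
    apply: (@le_trans _ _ (K * y / 2 ^+ k * (expR (- t) * (expR (- c1) * expR (- b))))).
      rewrite [leRHS]mulrCA ler_wpM2l ?expR_ge0// [leRHS]mulrA ler_wpM2r ?expR_ge0//.
      by apply: le_trans hc1 _; rewrite ler_wpM2r ?expR_ge0//; exact: du.
    apply: (@le_trans _ _ (K * y / 2 ^+ k * expR (- y))).
      by rewrite ler_wpM2l ?divr_ge0 ?(ltW k0)//; exact: corner.
    by rewrite mulrAC ler_wpM2r ?invr_ge0 ?(ltW k0).
  have d2 a : (a = u (m.1 + 1) \/ a = u m.1) ->
      `|expR (- t) * (expR (- a) * expR (- u (m.2 + 1))) - expR (- t) * (expR (- a) * expR (- u m.2))| <= Q / 2 ^+ k.
    move=> ha; rewrite -mulrBr -mulrBr !normrM (ger0_norm (expR_ge0 (- t))) (ger0_norm (expR_ge0 (- a))).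
    apply: (@le_trans _ _ (K * y / 2 ^+ k * (expR (- t) * (expR (- a) * expR (- c2))))).
      rewrite [leRHS]mulrCA ler_wpM2l ?expR_ge0// [leRHS]mulrCA ler_wpM2l ?expR_ge0//.
      by apply: le_trans hc2 _; rewrite ler_wpM2r ?expR_ge0//; exact: du.
    apply: (@le_trans _ _ (K * y / 2 ^+ k * expR (- y))).
      by rewrite ler_wpM2l ?divr_ge0 ?(ltW k0)//; exact: corner.
    by rewrite mulrAC ler_wpM2r ?invr_ge0 ?(ltW k0).
  have E00 : E m = expR (- t) * (expR (- u m.1) * expR (- u m.2)) by exact: EE.
  have E10 : E (m + e1) = expR (- t) * (expR (- u (m.1 + 1)) * expR (- u m.2)) by rewrite EE/= addr0.
  have E01 : E (m + e2) = expR (- t) * (expR (- u m.1) * expR (- u (m.2 + 1))) by rewrite EE/= addr0.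
  have E11 : E (m + e1 + e2) = expR (- t) * (expR (- u (m.1 + 1)) * expR (- u (m.2 + 1))) by rewrite EE/= !addr0.
  have En m' : `|E m'| = E m' by rewrite ger0_norm// expR_ge0.
  rewrite !En E00 E10 E01 E11; split.
  + by apply: le_trans q0; apply: corner; right.
  + by apply: le_trans q0; apply: corner; [left|right].
  + by apply: le_trans q0; apply: corner; left.
  + by split; [apply: d1; right|apply: d2; right|apply: d2; left|apply: d1; left].
  set x' := expR (- u (m.1 + 1)); set x := expR (- u m.1); set z' := expR (- u (m.2 + 1)); set z := expR (- u m.2).
  have -> : expR (- t) * (x' * z') - expR (- t) * (x' * z) - expR (- t) * (x * z') + expR (- t) * (x * z) =
     expR (- t) * ((x' - x) * (z' - z)) by ring.
  rewrite !normrM (ger0_norm (expR_ge0 (- t))).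
  apply: (@le_trans _ _ ((K * y / 2 ^+ k) ^+ 2 * (expR (- t) * (expR (- c1) * expR (- c2))))).
    rewrite [leRHS]mulrCA ler_wpM2l ?expR_ge0//.
    have -> : (K * y / 2 ^+ k) ^+ 2 * (expR (- c1) * expR (- c2)) =
       (K * y / 2 ^+ k * expR (- c1)) * (K * y / 2 ^+ k * expR (- c2)) by ring.
    apply: ler_pM => //.
      by apply: le_trans hc1 _; rewrite ler_wpM2r ?expR_ge0//; exact: du.
    by apply: le_trans hc2 _; rewrite ler_wpM2r ?expR_ge0//; exact: du.
  apply: (@le_trans _ _ ((K * y / 2 ^+ k) ^+ 2 * expR (- y))).
    by rewrite ler_wpM2l ?sqr_ge0//; exact: corner.
  by rewrite exprMn exprVn -k4 mulrAC ler_wpM2r ?invr_ge0 ?(ltW k40).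
have M10 : 0 <= 4 * (M + 1) * Q by rewrite mulr_ge0 ?(ltW Q0)// mulr_ge0// addr_ge0// ltW.
have mulb (a b A B : R) : `|a| <= A -> `|b| <= B -> `|a * b| <= A * B by move=> ? ?; rewrite normrM ler_pM.
have Qk0 : 0 <= Q / 2 ^+ k by rewrite divr_ge0 ?ltW.
have Qk40 : 0 <= Q / 4 ^+ k by rewrite divr_ge0 ?ltW.
have MQk0 : 0 <= M * (Q / 2 ^+ k) by rewrite mulr_ge0// ltW.
have MQk40 : 0 <= M * (Q / 4 ^+ k) by rewrite mulr_ge0// ltW.
rewrite /heat_symbol; split=> [m mD|m|m|m|m].
- by rewrite (symbol_in_box CT mD) mul0r.
- rewrite -/(f m) -/(E m); have [[-> _]|[e _ _ _ _]] := vanish m; first by rewrite mul0r normr0.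
  apply: le_trans (mulb _ _ _ _ (fle m) e) _; rewrite mul1r ler_peMl ?(ltW Q0)//; lra.
- rewrite -!/(f _) -!/(E _); have [[-> [-> _]]|[e00 e10 _ [h _ _ _] _]] := vanish m.
    by rewrite !mul0r subr0 normr0 divr_ge0// ltW.
  have -> : f (m + e1) * E (m + e1) - f m * E m = (f (m + e1) - f m) * E (m + e1) + f m * (E (m + e1) - E m) by ring.
  apply: le_trans (ler_normD _ _) _; apply: le_trans (lerD (mulb _ _ _ _ (f1 m) e10) (mulb _ _ _ _ (fle m) h)) _.
  have -> : 4 * (M + 1) * Q / 2 ^+ k = 4 * (M * (Q / 2 ^+ k)) + 4 * (Q / 2 ^+ k) by ring.
  have -> : M / 2 ^+ k * Q = M * (Q / 2 ^+ k) by ring.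
  lra.
- rewrite -!/(f _) -!/(E _); have [[-> [_ [-> _]]]|[e00 _ _ [_ h _ _] _]] := vanish m.
    by rewrite !mul0r subr0 normr0 divr_ge0// ltW.
  have -> : f (m + e2) * E (m + e2) - f m * E m = (f (m + e2) - f m) * (E (m + e2) - E m) + (f (m + e2) - f m) * E m + f m * (E (m + e2) - E m) by ring.
  have f2' : `|f (m + e2) - f m| <= 2 by apply: le_trans (ler_normB _ _) _; have := fle (m + e2); have := fle m; lra.
  apply: le_trans (ler_normD _ _) _; apply: le_trans (lerD (ler_normD _ _) (mulb _ _ _ _ (fle m) h)) _.
  apply: le_trans (lerD (lerD (mulb _ _ _ _ f2' h) (mulb _ _ _ _ (f2 m) e00)) (lexx _)) _.
  have -> : 4 * (M + 1) * Q / 2 ^+ k = 4 * (M * (Q / 2 ^+ k)) + 4 * (Q / 2 ^+ k) by ring.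
  have -> : M / 2 ^+ k * Q = M * (Q / 2 ^+ k) by ring.
  lra.
- rewrite -!/(f _) -!/(E _); have [[-> [-> [-> ->]]]|[e00 e10 e11 [h1 h2 h3 h4] h5]] := vanish m.
    by rewrite !mul0r !subr0 addr0 normr0 divr_ge0// ltW.
  (* discrete Leibniz rule for the mixed difference *)
  have -> : f (m + e1 + e2) * E (m + e1 + e2) - f (m + e1) * E (m + e1) - f (m + e2) * E (m + e2) + f m * E m =
    (f (m + e1 + e2) - f (m + e1) - f (m + e2) + f m) * E (m + e1 + e2) +
    (f (m + e1) - f m) * (E (m + e1 + e2) - E (m + e1)) + (f (m + e2) - f m) * (E (m + e1 + e2) - E (m + e2)) +
    f m * (E (m + e1 + e2) - E (m + e1) - E (m + e2) + E m) by ring.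
  apply: le_trans (ler_normD _ _) _.
  apply: le_trans (lerD (le_trans (ler_normD _ _) (lerD (ler_normD _ _) (lexx _))) (lexx _)) _.
  apply: le_trans (lerD (lerD (lerD (mulb _ _ _ _ (f12 m) e11) (mulb _ _ _ _ (f1 m) h3)) (mulb _ _ _ _ (f2 m) h4)) (mulb _ _ _ _ (fle m) h5)) _.
  have -> : M / 2 ^+ k * (Q / 2 ^+ k) = M * (Q / 4 ^+ k) by rewrite k4; field; rewrite gt_eqF.
  have -> : 4 * (M + 1) * Q / 4 ^+ k = 4 * (M * (Q / 4 ^+ k)) + 4 * (Q / 4 ^+ k) by ring.
  have -> : M / 4 ^+ k * Q = M * (Q / 4 ^+ k) by ring.
  lra.
Qed.

End SymbolMultipliers.

(** * Products of blocks and the heat semigroup *)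

Section Products.
Context {R : realType}.
Local Notation Rc := R[i].
Local Notation eigen := (@eigen R).
Variables (chi theta : R * R -> R).
Hypothesis CT : dyadic_partition chi theta.
Local Notation symb := (symbol chi theta).
Local Notation bl := (blk chi theta).
Local Notation hsym := (heat_symbol chi theta).
Variables (alpha beta : R).
Hypotheses (alpha01 : 0 < alpha < 1) (alphabeta : alpha < beta).

(** The criterion [besov_norm_leP] on bare coefficient families, so that truncated products can be
    estimated without being presented as distributions. *)
Definition bnd (c : int * int -> Rc) (r : R) : Prop :=
  forall k x, bweight (- alpha) k * normc (bl k c x) <= r.

Lemma bnd_ge0 c r : bnd c r -> 0 <= r.
Proof. by move=> /(_ 0%N 0); apply: le_trans; rewrite mulr_ge0 ?normc_ge0// ltW// bweight_gt0. Qed.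

Lemma bnd_le c r r' : r <= r' -> bnd c r -> bnd c r'.
Proof. by move=> rr cr k x; apply: le_trans (cr k x) rr. Qed.

Lemma blkD k c c' x : bl k (fun m => c m + c' m) x = bl k c x + bl k c' x.
Proof. by rewrite /blk /trig -big_split/=; apply: eq_bigr => l _; rewrite mulrDr mulrDl. Qed.

Lemma blk_sum (I : Type) (s : seq I) k (c : I -> int * int -> Rc) x :
  bl k (fun m => \sum_(i <- s) c i m) x = \sum_(i <- s) bl k (c i) x.
Proof.
rewrite /blk /trig exchange_big/=; apply: eq_bigr => l _.
by rewrite mulr_sumr mulr_suml.
Qed.

Lemma blkZ k (z : R) c x : bl k (fun m => z%:C%C * c m) x = z%:C%C * bl k c x.
Proof. by rewrite /blk /trig mulr_sumr; apply: eq_bigr => l _; rewrite !mulrA [_ * z%:C%C]mulrC. Qed.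

Lemma bndD c c' r r' : bnd c r -> bnd c' r' -> bnd (fun m => c m + c' m) (r + r').
Proof.
move=> cr cr' k x; rewrite blkD; apply: le_trans (lerD (cr k x) (cr' k x)).
by rewrite -mulrDr ler_wpM2l ?(ltW (bweight_gt0 _ _))//; exact: le_normcD.
Qed.

Lemma bndZ (z : R) c r : bnd c r -> bnd (fun m => z%:C%C * c m) (`|z| * r).
Proof.
by move=> cr k x; rewrite blkZ ComplexField.Normc.normcM normc_real mulrCA ler_wpM2l.
Qed.

Lemma bnd_sum n (c : nat -> int * int -> Rc) (r : nat -> R) : (forall k, bnd (c k) (r k)) ->
  bnd (fun m => \sum_(0 <= k < n) c k m) (\sum_(0 <= k < n) r k).
Proof.
move=> cr k x; rewrite blk_sum; apply: le_trans (_ : \sum_(0 <= i < n) bweight (- alpha) k * normc (bl k (c i) x) <= _).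
  by rewrite -mulr_sumr ler_wpM2l ?(ltW (bweight_gt0 _ _))//; exact: normc_sum.
by apply: ler_sum => i _; exact: cr.
Qed.

Lemma eq_bnd c c' r : c =1 c' -> bnd c r -> bnd c' r.
Proof. by move=> /funext ->. Qed.

Lemma blk_le c r k x : bnd c r -> normc (bl k c x) <= 2 `^ (k%:R * alpha) * r.
Proof.
move=> cr; have r0 := bnd_ge0 cr; have := cr k x; rewrite -ler_pdivlMl ?bweight_gt0// => /le_trans; apply.
rewrite ler_wpM2r// /bweight -powRN; apply: ler_powR; first by rewrite ler1n.
by have /andP[a0 _] := alpha01; rewrite mulrN opprK mulrBl; lra.
Qed.

Definition low L (c : int * int -> Rc) m : Rc := \sum_(0 <= i < L.+1) (symb i (lattice m))%:C%C * c m.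

Lemma low_supp L c m : ~~ in_box (2 ^ L.+1) m -> low L c m = 0.
Proof.
move=> mL; rewrite /low big_nat_cond big1// => i /andP[/andP[_ iL] _].
rewrite (symbol_in_box CT) ?mul0r//; apply: contra mL; apply: in_box_le.
by rewrite leq_exp2l// ltnS -ltnS.
Qed.

Lemma low_id L c m : norm2 (lattice m : R * R) < 3 / 4 * 2 ^+ L -> low L c m = c m.
Proof. by move=> mL; rewrite /low -mulr_suml -rmorph_sum (symbol_sum CT mL) mul1r. Qed.

Let Ca : R := (1 - 2 `^ (- alpha))^-1.

Lemma low_le L c r x : bnd c r -> normc (trig (2 ^ L.+1) (low L c) x) <= Ca * 2 `^ (L%:R * alpha) * r.
Proof.
move=> cr; have r0 := bnd_ge0 cr; have /andP[a0 _] := alpha01.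
have -> : trig (2 ^ L.+1) (low L c) x = \sum_(0 <= i < L.+1) bl i c x.
  under [RHS]eq_big_nat => i /andP[_ iL]. rewrite (@blkE _ _ _ CT (2 ^ L.+1)) ?leq_exp2l//. over.
  rewrite /trig exchange_big/=; apply: eq_bigr => l _; rewrite -mulr_suml; congr (_ * _).
apply: le_trans (normc_sum _ _ _) _.
apply: (@le_trans _ _ (\sum_(0 <= i < L.+1) 2 `^ (i%:R * alpha) * r)).
  by apply: ler_sum => i _; exact: blk_le.
by rewrite -mulr_suml ler_wpM2r//; exact: sum_bweight_le.
Qed.

Lemma Ca_gt0 : 0 < Ca.
Proof.
have /andP[a0 _] := alpha01.
by rewrite invr_gt0 subr_gt0 /powR pnatr_eq0/= expR_lt1 mulNr oppr_lt0 mulr_gt0// ln_gt0// ltr1n.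
Qed.

Definition hblk t k (c : int * int -> Rc) (m : int * int) : Rc := (hsym t k m)%:C%C * c m.

Lemma hblk_supp t k c m : ~~ in_box (2 ^ k.+1) m -> hblk t k c m = 0.
Proof. by move=> h; rewrite /hblk /heat_symbol (symbol_in_box CT h) mul0r mul0r. Qed.

(** [multiplier_le] acts on trigonometric polynomials: on the support of symbol k the coefficients
    agree with those of the blocks up to k + 1, whose sum is bounded by [low_le]. *)
Lemma heat_block_le (s : R) : 0 <= s -> exists2 C : R, 0 < C & forall t k c r x, 0 < t -> bnd c r ->
  normc (trig (2 ^ k.+1) (hblk t k c) x) <= C * (t * 4 ^+ k) `^ (- s) * 2 `^ (k%:R * alpha) * r.
Proof.
move=> s0; have [C C0 hC] := heat_symbol_mult CT s0.
exists (200 * C * (Ca * 2 `^ alpha)) => [|t k c r x t0 cr]; first by rewrite !mulr_gt0 ?Ca_gt0 ?powR_gt0.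
have r0 := bnd_ge0 cr.
have -> : trig (2 ^ k.+1) (hblk t k c) x = trig (2 ^ k.+1) (hblk t k (low k.+1 c)) x.
  apply: eq_bigr => l _; congr (_ * _); rewrite /hblk.
  have [s1|s1] := eqVneq (symb k (lattice (box_mode l))) 0; first by rewrite /heat_symbol s1 !mul0r.
  rewrite low_id//; apply: lt_le_trans (symbol_lt CT s1) _; rewrite exprS.
  by have : 0 < 2 ^+ k :> R by [exact: exprn_gt0]; lra.
have t4 : 0 < t * 4 ^+ k by rewrite mulr_gt0// exprn_gt0.
have M0 : 0 < C * (t * 4 ^+ k) `^ (- s) by rewrite mulr_gt0// powR_gt0.
apply: le_trans (multiplier_le x M0 (hC t k t0) (@low_supp k.+1 c) (fun y => low_le k.+1 y cr)) _.
have -> : k.+1%:R * alpha = k%:R * alpha + alpha by rewrite -natr1; ring.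
by rewrite powRD ?pnatr_eq0 ?implybT// le_eqVlt; apply/orP; left; apply/eqP; ring.
Qed.

Lemma in_box_norm2 D m : in_box D m -> norm2 (lattice m : R * R) ^+ 2 <= 2 * D%:R ^+ 2.
Proof.
move=> /andP[h1 h2]; rewrite norm2_sqr /=.
have := @intr_norm_le R _ _ h1; have := @intr_norm_le R _ _ h2; set a : R := m.1%:~R; set b : R := m.2%:~R.
rewrite -(real_normK (num_real a)) -(real_normK (num_real b)) => hb ha.
have D0 : 0 <= D%:R :> R by [].
have : `|a| ^+ 2 <= D%:R ^+ 2 by rewrite lerXn2r ?nnegrE.
have : `|b| ^+ 2 <= D%:R ^+ 2 by rewrite lerXn2r ?nnegrE.
lra.
Qed.

(* Only the low frequencies of [c] contribute to a given block of the product. *)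
Lemma mul_block_le : exists2 C : R, 0 < C & forall k a c (A r : R),
  (forall x, normc (trig (2 ^ k.+1) a x) <= A) -> bnd c r ->
  bnd (mulc (2 ^ k.+1) a c) (C * 2 `^ (k%:R * alpha) * A * r).
Proof.
have [M M0 hM] := symbol_mult CT; have /andP[a0 _] := alpha01.
exists (200 * M * Ca * 2 `^ (5 * alpha)) => [|k a c A r aA cr j x]; first by rewrite !mulr_gt0 ?Ca_gt0 ?powR_gt0.
have r0 := bnd_ge0 cr; have A0 : 0 <= A := le_trans (normc_ge0 _) (aA 0).
(* The frequencies of [c] involved have coordinates at most 4 * 2^(max j k), hence norm below 6 *
   2^(max j k), while [low L] is exact below 12 * 2^(max j k). *)
pose L := (maxn j k + 4)%N; pose D := (2 ^ k.+1)%N.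
have -> : bl j (mulc D a c) x = bl j (mulc D a (low L c)) x.
  apply: eq_bigr => l _; congr (_ * _ * _); apply: eq_bigr => l' _; rewrite low_id//.
  have pj : (2 ^ j.+1 <= 2 ^ (maxn j k).+1)%N by rewrite leq_exp2l// ltnS leq_maxl.
  have pk : (2 ^ k.+1 <= 2 ^ (maxn j k).+1)%N by rewrite leq_exp2l// ltnS leq_maxr.
  have : in_box (2 ^ (maxn j k).+1 + 2 ^ (maxn j k).+1) (box_mode l - box_mode l').
    apply: in_boxD; first exact: in_box_le pj (box_modeP _).
    by rewrite in_boxN; exact: in_box_le pk (box_modeP _).
  move=> /in_box_norm2; rewrite natrD !natrX /L exprD; set y := 2 ^+ maxn j k => h.
  have y0 : 0 < y by rewrite exprn_gt0.
  rewrite -(ltr_pXn2r (ltn0Sn 1)) ?nnegrE ?norm2_ge0//; last by rewrite !mulr_ge0 ?exprn_ge0// ltW.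
  apply: le_lt_trans h _; have : 0 < y ^+ 2 by rewrite exprn_gt0.
  have -> : (3 / 4 * (y * 2 ^+ 4)) ^+ 2 = 144 * y ^+ 2 by field.
  have e2 : 2 ^+ (maxn j k).+1 = 2 * y by rewrite exprS.
  by rewrite e2; have -> : 2 * (2 * y + 2 * y) ^+ 2 = 32 * y ^+ 2 by [ring]; lra.
have hb := multiplier_le x M0 (hM j) (fun m => @mulc_supp R D (2 ^ L.+1) a _ m (@low_supp L c)) (B := A * (Ca * 2 `^ (L%:R * alpha) * r)).
rewrite -ler_pdivlMl ?bweight_gt0//; apply: (le_trans (hb _)).
  move=> y; rewrite trig_mulc; last exact: low_supp.
  by rewrite ComplexField.Normc.normcM; apply: ler_pM; rewrite ?normc_ge0//; exact: low_le.
rewrite ler_pdivlMl ?bweight_gt0//.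
have -> : bweight (- alpha) j * (200 * M * (A * (Ca * 2 `^ (L%:R * alpha) * r))) =
   200 * M * Ca * A * r * (bweight (- alpha) j * 2 `^ (L%:R * alpha)) by ring.
have -> : 200 * M * Ca * 2 `^ (5 * alpha) * 2 `^ (k%:R * alpha) * A * r =
   200 * M * Ca * A * r * (2 `^ (5 * alpha) * 2 `^ (k%:R * alpha)) by ring.
rewrite ler_wpM2l; first by [].
  by rewrite !mulr_ge0 ?(ltW M0) ?(ltW Ca_gt0).
rewrite /bweight -!powRD ?pnatr_eq0 ?implybT//; apply: ler_powR; first by rewrite ler1n.
have -> : (j%:R - 1) * - alpha + L%:R * alpha = (L%:R + 1 - j%:R) * alpha by ring.
rewrite -mulrDl ler_wpM2r ?(ltW a0)// /L natrD.
have : (maxn j k)%:R <= j%:R + k%:R :> R by rewrite -natrD ler_nat geq_max leq_addr leq_addl.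
lra.
Qed.

Definition hsum t K (c : int * int -> Rc) m : Rc := \sum_(0 <= k < K) hblk t k c m.

Lemma mulc_hsum t K h c m : mulc (2 ^ K) (hsum t K h) c m = \sum_(0 <= k < K) mulc (2 ^ k.+1) (hblk t k h) c m.
Proof.
rewrite /mulc /hsum; under eq_bigr do rewrite mulr_suml; rewrite exchange_big/=.
apply: eq_big_nat => k /andP[_ kK].
rewrite (@big_box _ (2 ^ k.+1) (2 ^ K) (fun l => hblk t k h l * c (m - l))) ?leq_exp2l// => l /hblk_supp ->.
by rewrite mul0r.
Qed.

(** Block k of the heat evolution has size (t 4^k)^(-s) 2^(k alpha), and multiplication by it costs
    another 2^(k alpha). With s = (alpha + beta)/2 the terms are geometric of ratio 2^(alpha - beta)
    < 1; this is where [beta > alpha] enters and where the power of t comes from. *)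
Theorem heat_mul_le : exists2 C : R, 0 < C & forall t K h c rho r, 0 < t -> bnd h rho -> bnd c r ->
  bnd (mulc (2 ^ K) (hsum t K h) c) (C * t `^ (- ((alpha + beta) / 2)) * rho * r).
Proof.
have /andP[a0 _] := alpha01; pose s := (alpha + beta) / 2.
have s0 : 0 <= s by rewrite divr_ge0// addr_ge0 ?(ltW a0)// (le_trans (ltW a0))// ltW.
have [C1 C10 h1] := heat_block_le s0; have [C2 C20 h2] := mul_block_le.
pose q : R := 2 `^ (alpha - beta).
have q01 : 0 <= q < 1.
  by rewrite powR_ge0/= /q /powR pnatr_eq0/= expR_lt1 nmulr_rlt0 ?ln_gt0 ?ltr1n// subr_lt0.
exists (C1 * C2 * (1 - q)^-1) => [|t K h c rho r t0 hr cr].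
  by rewrite !mulr_gt0// invr_gt0 subr_gt0; case/andP: q01.
have r0 := bnd_ge0 cr; have rho0 := bnd_ge0 hr.
apply: (eq_bnd (c := fun m => \sum_(0 <= k < K) mulc (2 ^ k.+1) (hblk t k h) c m)).
  by move=> m; rewrite mulc_hsum.
pose A k := C1 * (t * 4 ^+ k) `^ (- s) * 2 `^ (k%:R * alpha) * rho.
have hk k : bnd (mulc (2 ^ k.+1) (hblk t k h) c) (C2 * 2 `^ (k%:R * alpha) * A k * r).
  by apply: h2 => // x; exact: h1.
apply: bnd_le (bnd_sum K hk).
have E k : C2 * 2 `^ (k%:R * alpha) * A k * r = C1 * C2 * t `^ (- s) * rho * r * q ^+ k.
  have -> : q ^+ k = 2 `^ (k%:R * alpha) * 2 `^ (k%:R * alpha) * (4 ^+ k) `^ (- s).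
    rewrite /q -powR_mulrn ?powR_ge0// -powRrM -powRD ?pnatr_eq0 ?implybT//.
    have -> : 4 ^+ k = 2 `^ (2 * k%:R) :> R.
      by rewrite powRrM !powR_mulrn//; congr (_ ^+ _); ring.
    by rewrite -powRrM -powRD ?pnatr_eq0 ?implybT//; congr (_ `^ _); rewrite /s; field.
  by rewrite /A powRM ?(ltW t0) ?exprn_ge0//; ring.
under eq_bigr do rewrite E.
rewrite -mulr_sumr.
have -> : C1 * C2 * (1 - q)^-1 * t `^ (- s) * rho * r = C1 * C2 * t `^ (- s) * rho * r * (1 - q)^-1 by ring.
by rewrite ler_wpM2l ?sum_expr_le// !mulr_ge0 ?powR_ge0// ltW.
Qed.

Lemma symbol_overlap j k z : symb j z != 0 -> symb k z != 0 -> (k <= j.+1)%N.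
Proof.
move=> sj sk; case: k sk => // k sk; rewrite ltnS.
have := le_lt_trans (symbol_ge CT sk) (symbol_lt CT sj); apply: contraTT; rewrite -ltnNge -leNgt => jk.
have : 2 ^+ j.+1 <= 2 ^+ k :> R by rewrite ler_eXn2l// ltr1n.
by rewrite exprS; have : 0 < 2 ^+ j :> R by [exact: exprn_gt0]; lra.
Qed.

Lemma sum_delta_le K a : \sum_(0 <= k < K) (k == a)%:R <= 1 :> R.
Proof.
have -> : \sum_(0 <= k < K) (k == a)%:R = (a < K)%:R :> R.
  elim: K => [|K IH]; first by rewrite big_geq.
  by rewrite big_nat_recr//= IH ltnS [(a <= K)%N]leq_eqVlt [K == a]eq_sym; case: (ltngtP a K) => //=; rewrite ?addr0 ?add0r.
by case: (a < K)%N.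
Qed.

(** [heat_symbol_mult] with exponent 0 is uniform in t, and a block meets at most three heat blocks,
    those of neighbouring index. *)
Theorem heat_bnd : exists2 C : R, 0 < C & forall t K h rho, 0 < t -> bnd h rho -> bnd (hsum t K h) (C * rho).
Proof.
have [C C0 hC] := heat_symbol_mult CT (lexx 0); exists (200 * C * 3) => [|t K h rho t0 hr j x].
  by rewrite !mulr_gt0.
have rho0 := bnd_ge0 hr.
pose B := rho / bweight (- alpha) j; have B0 : 0 <= B by rewrite divr_ge0// ltW// bweight_gt0.
have hB y : normc (bl j h y) <= B by rewrite /B mulrC ler_pdivlMl ?bweight_gt0//; exact: hr.
have CB0 : 0 <= 200 * C * B by apply: mulr_ge0 B0; rewrite mulr_ge0// ltW.
have term k : normc (bl j (hblk t k h) x) <= 200 * C * B * ((k == j.-1)%:R + (k == j)%:R + (k == j.+1)%:R).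
  have -> : bl j (hblk t k h) x = trig (2 ^ k.+1) (fun m => (hsym t k m)%:C%C * ((symb j (lattice m))%:C%C * h m)) x.
    rewrite (@trig_supp _ _ (2 ^ j.+1)); first last.
    - by move=> m /(symbol_in_box CT) ->; rewrite mul0r mulr0.
    - by move=> m; rewrite /heat_symbol => /(symbol_in_box CT) ->; rewrite mul0r mul0r.
    by apply: eq_bigr => l _; rewrite /hblk mulrCA.
  have cases : [|| k == j.-1, k == j | k == j.+1] \/ forall m : int * int, symb k (lattice m) * symb j (lattice m) = 0.
    have [jk|jk] := boolP ((k <= j.+1) && (j <= k.+1))%N; [left|right]; first by clear -jk; lia.
    move=> m; apply/eqP; rewrite mulf_eq0; apply: contraNT jk; rewrite negb_or => /andP[sk sj].
    by rewrite (symbol_overlap sj sk) (symbol_overlap sk sj).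
  case: cases => [kj|z].
    have M0 : 0 < C * (t * 4 ^+ k) `^ (- 0) by rewrite mulr_gt0// powR_gt0// mulr_gt0// exprn_gt0.
    have := multiplier_le (D := (2 ^ j.+1)%N) (c := fun m => (symb j (lattice m))%:C%C * h m) x M0 (hC t k t0) _ hB.
    rewrite oppr0 powRr0 mulr1 => hm; apply: le_trans (hm _) _.
      by move=> m /(symbol_in_box CT) ->; rewrite mul0r.
    rewrite -[leLHS]mulr1; apply: ler_wpM2l => //.
    have n1 := ler0n R (k == j.-1); have n2 := ler0n R (k == j); have n3 := ler0n R (k == j.+1).
    by move: n1 n2 n3; case/or3P: kj => ->; rewrite -[true%:R]/(1 : R); lra.
  rewrite /trig big1 ?ComplexField.Normc.normc0; first by apply: mulr_ge0 => //; rewrite !addr_ge0.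
  move=> l _.
  move/eqP: (z (box_mode l)); rewrite mulf_eq0 /heat_symbol => /orP[]/eqP ->.
    by rewrite mul0r rmorph0 !mul0r.
  by rewrite rmorph0 mul0r mulr0 mul0r.
rewrite -ler_pdivlMl ?bweight_gt0// /hsum blk_sum; apply: le_trans (normc_sum _ _ _) _.
apply: le_trans (ler_sum _ (fun k _ => term k)) _.
rewrite -mulr_sumr !big_split/=.
have -> : (bweight (- alpha) j)^-1 * (200 * C * 3 * rho) = 200 * C * B * 3 by rewrite /B; ring.
apply: ler_wpM2l => //.
have := sum_delta_le K j.-1; have := sum_delta_le K j; have := sum_delta_le K j.+1; lra.
Qed.

Lemma hsumB t K h h' m : hsum t K h m - hsum t K h' m = hsum t K (fun m => h m - h' m) m.
Proof. by rewrite /hsum -sumrB; apply: eq_bigr => k _; rewrite /hblk mulrBr. Qed.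

Lemma mulcBl D (a a' c : int * int -> Rc) m : mulc D a c m - mulc D a' c m = mulc D (fun m => a m - a' m) c m.
Proof. by rewrite /mulc -sumrB; apply: eq_bigr => k _; rewrite mulrBl. Qed.

Lemma mulcBr D (a c c' : int * int -> Rc) m : mulc D a c m - mulc D a c' m = mulc D a (fun m => c m - c' m) m.
Proof. by rewrite /mulc -sumrB; apply: eq_bigr => k _; rewrite mulrBr. Qed.

(** The factor [kap] allows two starting points: Wick powers, with [kap = 1], and the heat
    evolutions themselves, with the constant of [heat_bnd]. In the induction one factor differs at a
    time, so a j-fold product produces j + 1 errors. *)
Theorem heat_power_diff_le : exists2 C : R, 0 < C & forall t K h h' u v (y e kap : R) j,
  0 < t -> bnd h y -> bnd h' y -> bnd (fun m => h m - h' m) e ->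
  bnd u (kap * y) -> bnd v (kap * y) -> bnd (fun m => u m - v m) (kap * e) ->
  let X := C * t `^ (- ((alpha + beta) / 2)) in
  bnd (iter j (mulc (2 ^ K) (hsum t K h)) u) ((X * y) ^+ j * (kap * y)) /\
  bnd (fun m => iter j (mulc (2 ^ K) (hsum t K h)) u m - iter j (mulc (2 ^ K) (hsum t K h')) v m)
    (j.+1%:R * (X * y) ^+ j * kap * e).
Proof.
have [C C0 hC] := heat_mul_le; exists C => // t K h h' u v y e kap j t0 hy hy' he uy vy ue X.
have pw h0 u0 : bnd h0 y -> bnd u0 (kap * y) -> forall j, bnd (iter j (mulc (2 ^ K) (hsum t K h0)) u0) ((X * y) ^+ j * (kap * y)).
  move=> h0y u0y; elim=> [|i IH]; first by rewrite expr0 mul1r.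
  by have := hC t K h0 _ _ _ t0 h0y IH; apply: bnd_le; rewrite exprS /X !mulrA.
split; first exact: pw.
elim: j => [|j IH]; first by apply: bnd_le ue; rewrite expr0 !mul1r.
have b1 := hC t K h _ _ _ t0 hy IH.
have b2 := hC t K _ _ _ _ t0 he (pw _ _ hy' vy j).
apply: (eq_bnd _ (bnd_le _ (bndD b1 b2))); last first.
  by rewrite -/X -[in leRHS]natr1 exprS le_eqVlt; apply/orP; left; apply/eqP; ring.
move=> m /=; rewrite -mulcBr.
have -> : hsum t K (fun m => h m - h' m) = fun m => hsum t K h m - hsum t K h' m.
  by apply/funext => l; rewrite hsumB.
by rewrite -mulcBl addrA subrK.
Qed.

End Products.

(** * Smoothness of the heat semigroup *)

Section SmoothSeries.
Context {R : realType}.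
Local Notation Rc := R[i].
Local Notation e := (@fourier_mode R).
Local Notation eigen := (@eigen R).
Local Notation axis := (@axis R).

Lemma Re_real_mul (f : R) (z : Rc) : f * complex.Re z = complex.Re (f%:C%C * z) /\ f * complex.Im z = complex.Im (f%:C%C * z).
Proof. by case: z => a b /=; split; ring. Qed.

Lemma fourier_coef_mul (u : @torus_distribution R) (f : R * R -> R) D a m : distr_linear u ->
  (forall x, (f x)%:C%C = trig D a x) ->
  fourier_coef (distr_mul f u) m = mulc D a (fourier_coef u) m.
Proof.
move=> lu fa.
have E z x : z * ((f x)%:C%C * e (- m) x) = \sum_(k : box D) (z * a (box_mode k)) * e (box_mode k - m) x.
  by rewrite fa /trig mulr_suml mulr_sumr; apply: eq_bigr => k _; rewrite modeDl !mulrA.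
have V z : u (fun x => complex.Re (z * ((f x)%:C%C * e (- m) x))) = complex.Re (z * mulc D a (fourier_coef u) m).
  rewrite (funext (fun x => congr1 (@complex.Re R) (E z x))) mode_sum_value//; congr complex.Re.
  by rewrite /mulc mulr_sumr; apply: eq_bigr => k _; rewrite opprB mulrA.
have VR := V 1; have VI := V (- 'i%C); apply/eqP; rewrite eq_complex /fourier_coef /distr_mul/=; apply/andP; split; apply/eqP.
  transitivity (u (fun x => complex.Re (1 * ((f x)%:C%C * e (- m) x)))); last by rewrite VR mul1r.
  by congr u; apply/funext => x; rewrite mul1r -(Re_real_mul _ _).1.
have imE (z : Rc) : complex.Re (- 'i%C * z) = complex.Im z by case: z => p q /=; ring.
transitivity (u (fun x => complex.Re (- 'i%C * ((f x)%:C%C * e (- m) x)))); last by rewrite VI imE.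
by congr u; apply/funext => x; rewrite imE -(Re_real_mul _ _).2.
Qed.

Lemma fourier_coef_conj (u : @torus_distribution R) m : distr_linear u ->
  fourier_coef u (- m) = (fourier_coef u m)^*%C.
Proof.
move=> lu; have h := @mode_sum_value R u 'I_1 (fun=> 1) (fun=> m) lu.
have h' := @mode_sum_value R u 'I_1 (fun=> 1) (fun=> - m) lu.
have g := @mode_sum_value R u 'I_1 (fun=> - 'i%C) (fun=> m) lu.
have g' := @mode_sum_value R u 'I_1 (fun=> 'i%C) (fun=> - m) lu.
have r : u (fun x => complex.Re (e m x)) = u (fun x => complex.Re (e (- m) x)).
  by congr u; apply/funext => x; rewrite modeNl; case: (e m x).
have i : u (fun x => complex.Im (e m x)) = - u (fun x => complex.Im (e (- m) x)).
  have gg : u (fun x => complex.Im (e m x)) = complex.Re (- 'i%C * fourier_coef u (- m)).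
    move: g; rewrite big_ord1 => <-; congr u; apply/funext => x; rewrite big_ord1.
    by case: (e m x) => p q /=; ring.
  have gg' : u (fun x => complex.Im (e m x)) = complex.Re ('i%C * fourier_coef u m).
    move: g'; rewrite big_ord1 opprK => <-; congr u; apply/funext => x; rewrite big_ord1 modeNl.
    by case: (e m x) => p q /=; ring.
  by rewrite gg' /fourier_coef/=; ring.
by rewrite /fourier_coef opprK r i /=.
Qed.

Lemma trig_real D (c : int * int -> Rc) x : (forall m, c (- m) = (c m)^*%C) ->
  (complex.Re (trig D c x))%:C%C = trig D c x.
Proof.
move=> cc; have h : (trig D c x)^*%C = trig D c x.
  rewrite /trig rmorph_sum.
  pose op (j : box D) : box D := (rev_ord j.1, rev_ord j.2).
  have opK : involutive op by move=> [j l]; rewrite /op/= !rev_ordK.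
  have opE j : box_mode (op j) = - box_mode j.
    case: j => j l; rewrite /box_mode/=; have := ltn_ord j; have := ltn_ord l.
    by move=> hl hj; congr pair => /=; lia.
  rewrite [RHS](reindex_inj (inv_inj opK))/=; apply: eq_bigr => j _.
  by rewrite opE cc modeNl rmorphM.
by move: h; case: (trig D c x) => p q /= [] h; congr (_ +i* _)%C; lra.
Qed.

Variable D : nat -> nat.

(** Summability of the blocks against every power of [eigen]. The family of conditions is stable
    under differentiation, which raises s by one, so smoothness follows by induction. *)
Definition fast (a : nat -> int * int -> Rc) : Prop := forall s : nat, exists C : R, forall k,
  \sum_(j : box (D k)) normc (a k (box_mode j)) * eigen (box_mode j) ^+ s <= C / 2 ^+ k.

Definition term (a : nat -> int * int -> Rc) k (x : R * R) : R := complex.Re (trig (D k) (a k) x).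

Definition psum a K x := \sum_(0 <= k < K) term a k x.

Definition fsum a x : R := limn (fun K => psum a K x).

Lemma term_le a (C : R) : (forall k, \sum_(j : box (D k)) normc (a k (box_mode j)) * eigen (box_mode j) ^+ 0 <= C / 2 ^+ k) ->
  forall k x, `|term a k x| <= C / 2 ^+ k.
Proof.
move=> h k x; apply: le_trans (normr_Re _) _; apply: le_trans (normc_sum _ _ _) _; apply: le_trans (h k).
by apply: ler_sum => j _; rewrite ComplexField.Normc.normcM normc_mode expr0.
Qed.

Lemma cvg_le_bound (g : nat -> R) (l b : R) K : g n @[n --> \oo] --> l -> (forall n, (K <= n)%N -> g n <= b) -> l <= b.
Proof.
move=> c h; rewrite -(cvg_lim (@Rhausdorff R) c); apply: limr_le; first by apply/cvg_ex; exists l.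
by exists K => // n /= Kn; exact: h.
Qed.

Lemma exists_small (C eps : R) : 0 <= C -> 0 < eps -> exists K, C / 2 ^+ K < eps.
Proof.
move=> C0 eps0; have [|K [K1 _]] := @exists_scale R (1 + C / eps); first by rewrite lerDl divr_ge0// ltW.
exists K; rewrite ltr_pdivrMr ?exprn_gt0// -ltr_pdivrMl// mulrC; apply: lt_trans K1.
by rewrite ltrDr.
Qed.

Lemma geometric_limit (f : nat -> R) (C : R) : (forall k, `|f k.+1 - f k| <= C / 2 ^+ k) ->
  (f @ \oo --> limn f) /\ forall K, `|limn f - f K| <= 2 * C / 2 ^+ K.
Proof.
move=> h; have C0 : 0 <= C by have := le_trans (normr_ge0 _) (h 0%N); rewrite expr0 divr1.
have p0 k : 0 < 2 ^+ k :> R by rewrite exprn_gt0.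
have tail K n : `|f (K + n)%N - f K| <= 2 * C / 2 ^+ K - 2 * C / 2 ^+ (K + n).
  elim: n => [|n IH]; first by rewrite addn0 !subrr normr0.
  have -> : f (K + n.+1)%N - f K = (f (K + n).+1 - f (K + n)%N) + (f (K + n)%N - f K) by rewrite addnS; ring.
  apply: le_trans (ler_normD _ _) _; apply: le_trans (lerD (h _) IH) _.
  rewrite addnS exprS invfM; have := p0 (K + n)%N; move: (2 ^+ (K + n)) => q q0; lra.
have tailK K n : (K <= n)%N -> `|f n - f K| <= 2 * C / 2 ^+ K.
  by move=> Kn; have := tail K (n - K)%N; rewrite subnKC// => /le_trans; apply; rewrite gerBl divr_ge0 ?mulr_ge0 ?(ltW (p0 _)).
have cf : cvgn f.
  apply/cauchy_cvgP/cauchyP => _/posnumP[eps].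
  have [K hK] := exists_small (mulr_ge0 (ler0n R 2) C0) (gt0 eps).
  by exists (f K); exists K => // n /= Kn; rewrite /ball/= distrC; apply: le_lt_trans hK; exact: tailK.
split=> // K; rewrite -[_ - f K]/((limn f) - f K).
have c : `|f n - f K| @[n --> \oo] --> `|limn f - f K|.
  by apply: cvg_norm; apply: cvgB => //; exact: cvg_cst.
by apply: (cvg_le_bound c (K := K)) => n Kn; exact: tailK.
Qed.

Lemma fsum_lim a : fast a -> exists2 C : R, 0 < C & forall x, (psum a K x @[K --> \oo] --> fsum a x) /\
  (forall K, `|fsum a x - psum a K x| <= C / 2 ^+ K) /\ `|fsum a x| <= C.
Proof.
move=> /(_ 0%N)[C h]; have t := term_le h.
have C0 : 0 <= C by have := le_trans (normr_ge0 _) (t 0%N 0); rewrite expr0 divr1.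
exists (2 * C + 1) => [|x]; first by rewrite ltr_wpDl// mulr_ge0.
have [|c1 c2] := @geometric_limit (fun K => psum a K x) C.
  by move=> k; rewrite /psum big_nat_recr//= addrAC subrr add0r.
split=> //; split=> [K|].
  by apply: le_trans (c2 K) _; rewrite ler_wpM2r ?invr_ge0 ?exprn_ge0// lerDl.
by have := c2 0%N; rewrite /psum big_geq// subr0 expr0 divr1 => /le_trans; apply; rewrite lerDl.
Qed.

Lemma continuous_psum a K : continuous (psum a K).
Proof.
move=> x; apply: cvg_big => [|k _]; first exact: add_continuous.
apply: test_function_continuous; apply: rtrig_test; apply: rtrig_Re; by exists (a k).
Qed.

Lemma continuous_fsum a : fast a -> continuous (fsum a).
Proof.
move=> fa x; have [C C0 h] := fsum_lim fa; apply/cvgrPdist_lt => eps eps0.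
have e30 : 0 < eps / 3 by rewrite divr_gt0.
have [K hK] := exists_small (ltW C0) e30.
have /cvgrPdist_lt/(_ _ e30) := @continuous_psum a K x; apply: filterS => y hy.
have [_ [/(_ K) hx _]] := h x; have [_ [/(_ K) hy' _]] := h y.
have -> : fsum a x - fsum a y = (fsum a x - psum a K x) + (psum a K x - psum a K y) - (fsum a y - psum a K y) by ring.
apply: le_lt_trans (ler_normB _ _) _; apply: le_lt_trans (lerD (ler_normD _ _) (lexx _)) _.
by have := le_lt_trans hx hK; have := le_lt_trans hy' hK; lra.
Qed.

Definition dcoef (i : bool) (a : nat -> int * int -> Rc) k (m : int * int) : Rc :=
  (2 * pi * (if i then m.1 else m.2)%:~R)%:C%C * 'i%C * a k m.

Lemma dcoef_weight i (m : int * int) : (2 * pi * (if i then m.1 else m.2)%:~R) ^+ 2 <= eigen m.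
Proof.
rewrite /eigen norm2_sqr/= exprMn; have -> : (2 * pi) ^+ 2 = 4 * pi ^+ 2 :> R by ring.
have p0 : 0 <= 4 * pi ^+ 2 :> R by rewrite mulr_ge0// sqr_ge0.
have h1 := mulr_ge0 p0 (sqr_ge0 (m.1%:~R : R)); have h2 := mulr_ge0 p0 (sqr_ge0 (m.2%:~R : R)).
by rewrite mulrDr; case: i; lra.
Qed.

Lemma fast_dcoef i a : fast a -> fast (dcoef i a).
Proof.
move=> fa s; have [C h] := fa s.+1; exists C => k; apply: le_trans (h k); apply: ler_sum => j _.
rewrite /dcoef !ComplexField.Normc.normcM normc_real exprS mulrA; set m := box_mode j.
rewrite ler_wpM2r ?exprn_ge0 ?(ltW (eigen_gt0 _))// mulrC ler_wpM2l ?normc_ge0//.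
have -> : normc ('i%C : Rc) = 1 by rewrite /= expr0n expr1n add0r sqrtr1.
rewrite mulr1; have h1 := dcoef_weight i m; have := eigen_ge1 m : 1 <= eigen m; move: h1.
set y := 2 * pi * _; set I := eigen m; rewrite -(real_normK (num_real y)); have := normr_ge0 y; move: `|y| => q.
move=> q0 q1 I1; rewrite leNgt; apply/negP => h1; nra.
Qed.

(** Taylor expansion to second order; the squared frequency is at most [eigen m], so one power of
    [eigen] in [fast] pays for the remainder. *)
Lemma taylor_mode i (m : int * int) (h : R) x :
  normc (e m (x + h *: axis i) - e m x - (h * (2 * pi * (if i then m.1 else m.2)%:~R))%:C%C * 'i%C * e m x) <= 3 * h ^+ 2 * eigen m.
Proof.
rewrite modeDr; set y := 2 * pi * _; have -> : e m (h *: axis i) = (cos (h * y) +i* sin (h * y))%C.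
  by rewrite /fourier_mode /phase /lattice; congr (cos _ +i* sin _)%C; rewrite /y; case: i {y}; rewrite /= /GRing.scale/=; ring.
set th := h * y.
have -> : e m x * (cos th +i* sin th)%C - e m x - th%:C%C * 'i%C * e m x =
  e m x * ((cos th - 1) +i* (sin th - th))%C.
  have -> : ((cos th - 1) +i* (sin th - th))%C = (cos th +i* sin th)%C - 1 - th%:C%C * 'i%C :> Rc.
    by apply/eqP; rewrite eq_complex/=; apply/andP; split; apply/eqP; ring.
  ring.
rewrite ComplexField.Normc.normcM normc_mode mul1r; apply: le_trans (normc_le _) _ => /=.
have sinle (z : R) : `|sin z| <= `|z|.
  wlog z0 : z / 0 <= z => [W|].
    have [|/ltW] := leP 0 z; first exact: W.
    by rewrite -oppr_ge0 => /W; rewrite sinN !normrN.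
  have [->|zn] := eqVneq z 0; first by rewrite sin0 normr0.
  have zp : 0 < z by rewrite lt_neqAle eq_sym zn.
  have [q _ ] := @MVT R sin cos 0 z zp (fun q _ => is_derive_sin q) (continuous_subspaceT (@continuous_sin R)).
  by rewrite sin0 !subr0 => ->; rewrite normrM ler_piMl// ler_norml cos_le1 cos_geN1.
have cosle (z : R) : `|cos z - 1| <= z ^+ 2.
  have -> : cos z - 1 = - (2 * sin (z / 2) ^+ 2).
    have {1}-> : z = z / 2 + z / 2 by field.
    rewrite cosD; have := cos2Dsin2 (z / 2); lra.
  have hs := sinle (z / 2); rewrite normrN ger0_norm; last by apply: mulr_ge0 => //; exact: sqr_ge0.
  have : sin (z / 2) ^+ 2 <= (z / 2) ^+ 2 by rewrite -(real_normK (num_real (sin _))) -(real_normK (num_real (z / 2))) lerXn2r ?nnegrE.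
  by have := sqr_ge0 z; rewrite expr_div_n; lra.
have sin2 (z : R) : `|sin z - z| <= 2 * z ^+ 2.
  wlog z0 : z / 0 <= z => [W|].
    have [|/ltW] := leP 0 z; first exact: W.
    by rewrite -oppr_ge0 => /W; rewrite sinN sqrrN opprK -normrN opprD opprK.
  have [z1|/ltW z1] := leP z 1; last first.
    have := sinle z; rewrite (ger0_norm z0) !ler_norml => /andP[? ?]; apply/andP; split; nra.
  have [->|zn] := eqVneq z 0; first by rewrite sin0 subrr normr0 expr0n mulr0.
  have zp : 0 < z by rewrite lt_neqAle eq_sym zn.
  have [q] := @MVT R sin cos 0 z zp (fun q _ => is_derive_sin q) (continuous_subspaceT (@continuous_sin R)).
  rewrite in_itv/= sin0 !subr0 => /andP[q0 qz] ->; have -> : cos q * z - z = z * (cos q - 1) by ring.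
  rewrite normrM ger0_norm// expr2 mulrCA ler_wpM2l//; apply: le_trans (cosle q) _; nra.
apply: (@le_trans _ _ (3 * th ^+ 2)); first by have := cosle th; have := sin2 th; lra.
have hd := ler_wpM2l (sqr_ge0 h) (dcoef_weight i m); rewrite -/y in hd.
by rewrite /th exprMn; lra.
Qed.

(** The quadratic Taylor remainder is uniform over partial sums, hence holds for the limit and gives
    the derivative directly. *)
Lemma fsum_derive i a : fast a -> forall x, is_derive x (axis i) (fsum a) (fsum (dcoef i a) x).
Proof.
move=> fa x; have [C h1] := fa 1%N; have fd := fast_dcoef i fa.
have [C1 C10 l1] := fsum_lim fa; have [C2 C20 l2] := fsum_lim fd.
have tk k h : `|term a k (x + h *: axis i) - term a k x - h * term (dcoef i a) k x| <= 3 * h ^+ 2 * (C / 2 ^+ k).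
  have -> : term a k (x + h *: axis i) - term a k x - h * term (dcoef i a) k x =
    complex.Re (\sum_(j : box (D k)) a k (box_mode j) * (e (box_mode j) (x + h *: axis i) - e (box_mode j) x -
       (h * (2 * pi * (if i then (box_mode j).1 else (box_mode j).2)%:~R))%:C%C * 'i%C * e (box_mode j) x)).
    rewrite /term (Re_real_mul _ _).1 -!raddfB /trig mulr_sumr -!sumrB; congr complex.Re.
    apply: eq_bigr => j _; rewrite /dcoef [(h * _)%:C%C](rmorphM (real_complex R)).
    rewrite !mulrBr; congr (_ - _); rewrite -!mulrA [RHS]mulrCA; congr (_ * _).
    by rewrite [RHS]mulrCA; congr (_ * _); rewrite [RHS]mulrCA.
  apply: le_trans (normr_Re _) _; apply: le_trans (normc_sum _ _ _) _.
  apply: (@le_trans _ _ (3 * h ^+ 2 * \sum_(j : box (D k)) normc (a k (box_mode j)) * eigen (box_mode j) ^+ 1)); last first.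
    by rewrite ler_wpM2l ?h1// mulr_ge0// sqr_ge0.
  rewrite mulr_sumr; apply: ler_sum => j _; rewrite ComplexField.Normc.normcM expr1 [leRHS]mulrCA.
  by rewrite ler_wpM2l ?normc_ge0//; exact: taylor_mode.
have C0 : 0 <= C.
  by have := le_trans (normr_ge0 _) (tk 0%N 1); rewrite expr1n expr0 divr1; lra.
have p0 k : 0 < 2 ^+ k :> R by rewrite exprn_gt0.
have pk K h : `|psum a K (x + h *: axis i) - psum a K x - h * psum (dcoef i a) K x| <= 3 * h ^+ 2 * (2 * C).
  have -> : psum a K (x + h *: axis i) - psum a K x - h * psum (dcoef i a) K x =
     \sum_(0 <= k < K) (term a k (x + h *: axis i) - term a k x - h * term (dcoef i a) k x).
    by rewrite /psum mulr_sumr -!sumrB.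
  apply: le_trans (ler_norm_sum _ _ _) _; apply: le_trans (ler_sum _ (fun k _ => tk k h)) _.
  rewrite -mulr_sumr; apply: ler_wpM2l; first by apply: mulr_ge0 => //; exact: sqr_ge0.
  rewrite -mulr_sumr [leRHS]mulrC; apply: ler_wpM2l => //.
  under eq_bigr do rewrite -exprVn.
  have h2 : 0 <= (2^-1 : R) < 1 by apply/andP; split; lra.
  apply: le_trans (sum_expr_le K h2) _.
  by rewrite le_eqVlt; apply/orP; left; apply/eqP; field.
have fk h : `|fsum a (x + h *: axis i) - fsum a x - h * fsum (dcoef i a) x| <= 3 * h ^+ 2 * (2 * C).
  have c : `|psum a K (x + h *: axis i) - psum a K x - h * psum (dcoef i a) K x| @[K --> \oo] -->
     `|fsum a (x + h *: axis i) - fsum a x - h * fsum (dcoef i a) x|.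
    apply: cvg_norm; apply: cvgB; last by apply: cvgM; [exact: cvg_cst|exact: (l2 x).1].
    by apply: cvgB; [exact: (l1 _).1|exact: (l1 x).1].
  by apply: (cvg_le_bound c (K := 0%N)) => n _; exact: pk.
pose M := 3 * (2 * C) + 1.
have M0 : 0 < M by rewrite ltr_wpDl// mulr_ge0// mulr_ge0.
have cd : (fun h : R => h^-1 *: (fsum a (h *: axis i + x) - fsum a x)) @ 0^' --> fsum (dcoef i a) x.
  apply/cvgrPdist_le => eps eps0; near=> h.
  have h0 : h != 0 by near: h; exact: nbhs_dnbhs_neq.
  have -> : fsum (dcoef i a) x - h^-1 *: (fsum a (h *: axis i + x) - fsum a x) =
     - (h^-1 * (fsum a (x + h *: axis i) - fsum a x - h * fsum (dcoef i a) x)).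
    by rewrite /GRing.scale/= [h *: axis i + x]addrC; field.
  rewrite normrN normrM normfV ler_pdivrMl ?normr_gt0//; apply: le_trans (fk h) _.
  apply: (@le_trans _ _ (`|h| * (`|h| * M))).
    by rewrite mulrA -expr2 real_normK ?num_real// /M; have := sqr_ge0 h; nra.
  by rewrite ler_wpM2l// -ler_pdivlMr//; near: h; apply: dnbhs0_le; rewrite divr_gt0.
by apply: DeriveDef; [apply/cvg_ex; exists (fsum (dcoef i a) x)|exact: cvg_lim cd].
Unshelve. all: by end_near. Qed.

Lemma C_n_fsum n a : fast a -> C_n n (fsum a).
Proof.
elim: n a => [|n IH] a fa; first by split=> //; exact: continuous_fsum.
split; first exact: continuous_fsum.
move=> i; have h := fsum_derive i fa; split=> [x|]; first exact: (@ex_derive _ _ _ _ _ _ _ (h x)).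
rewrite (_ : (fun x => 'D_(axis i) (fsum a) x) = fsum (dcoef i a)); first by apply: IH; exact: fast_dcoef.
by apply/funext => x; exact: (@derive_val _ _ _ _ _ _ _ (h x)).
Qed.

Theorem test_function_fsum a : fast a -> test_function (fsum a).
Proof.
move=> fa; split=> [i x|n]; last exact: C_n_fsum.
rewrite /fsum; congr (limn _); apply/funext => K; apply: eq_bigr => k _; rewrite /term; congr complex.Re.
by apply: eq_bigr => j _; rewrite mode_periodic.
Qed.

End SmoothSeries.

(** * Products with the heat evolution as limits of truncated products *)

Section HeatLimits.
Context {R : realType}.
Local Notation Rc := R[i].
Local Notation e := (@fourier_mode R).
Local Notation eigen := (@eigen R).
Variables (chi theta : R * R -> R).
Hypothesis CT : dyadic_partition chi theta.
Local Notation hblk := (hblk chi theta).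
Local Notation hsum := (hsum chi theta).
Variables (alpha beta : R).
Hypotheses (alpha01 : 0 < alpha < 1) (alphabeta : alpha < beta).
Local Notation bnd := (bnd chi theta alpha).
Local Notation side := (fun k => 2 ^ k.+1)%N.

Lemma hblk_fast t (c : int * int -> Rc) (G : R) : 0 < t -> (forall m, normc (c m) <= G * eigen m) ->
  fast side (fun k => hblk t k c).
Proof.
(* Of the s + 3 powers, s cancel the weight and one the growth of the coefficients; the remaining
   [eigen m ^- 2], of order 16^(-k), beats the 4^k coefficients of a block. *)
move=> t0 cG s; have [C C0 hC] := @expRN_le_powR R (s + 3)%:R (ler0n _ _).
have G0 : 0 <= G.
  by have := le_trans (normc_ge0 _) (cG 0); rewrite pmulr_lge0// eigen_gt0.
pose B := G * C / t ^+ (s + 3) * 64 ^+ 2; have B0 : 0 <= B.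
  by apply: mulr_ge0; [apply: divr_ge0; [apply: mulr_ge0 => //; exact: ltW|rewrite exprn_ge0// ltW]|rewrite sqr_ge0].
exists (25 * B) => k; have k40 : 0 < 4 ^+ k :> R by rewrite exprn_gt0.
have k0 : 0 < 2 ^+ k :> R by rewrite exprn_gt0.
have k1 : 1 <= 2 ^+ k :> R by rewrite exprn_ege1// ler1n.
have k4 : 4 ^+ k = (2 ^+ k) ^+ 2 :> R by rewrite -exprM mulnC exprM; congr (_ ^+ _); ring.
apply: (@le_trans _ _ (\sum_(j : box (2 ^ k.+1)) B / (4 ^+ k) ^+ 2)); last first.
  rewrite sumr_const card_prod !card_ord -(mulr_natl (B / (4 ^+ k) ^+ 2)) natrM -expr2.
  have h : ((2 ^ k.+1).*2.+1)%:R ^+ 2 <= 25 * 4 ^+ k :> R.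
    have -> : 25 * 4 ^+ k = (5 * 2 ^+ k) ^+ 2 :> R by rewrite k4; ring.
    rewrite lerXn2r ?nnegrE ?mulr_ge0 ?(ltW k0)// -natrX -natrM ler_nat expnS.
    have : (0 < 2 ^ k)%N by rewrite expn_gt0.
    by move: (2 ^ k)%N => n n0; clear -n0; lia.
  apply: (@le_trans _ _ (25 * 4 ^+ k * (B / (4 ^+ k) ^+ 2))).
    by apply: ler_wpM2r h; apply: divr_ge0 => //; exact: sqr_ge0.
  have -> : 25 * 4 ^+ k * (B / (4 ^+ k) ^+ 2) = 25 * B / 4 ^+ k by field; rewrite gt_eqF.
  apply: ler_wpM2l; first by apply: mulr_ge0.
  by rewrite lef_pV2 ?posrE// k4 expr2 ler_peMr ?(ltW k0).
apply: ler_sum => j _; set m := box_mode j; have I0 := eigen_gt0 m : 0 < eigen m.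
rewrite /hblk /heat_symbol !ComplexField.Normc.normcM !normc_real normrM (ger0_norm (expR_ge0 _)).
have [s0|s0] := eqVneq (symbol chi theta k (lattice m)) 0.
  by rewrite s0 normr0 !mul0r divr_ge0// sqr_ge0.
have I4 : 4 ^+ k / 64 <= eigen m by apply: (eigen_corner CT s0); rewrite subrr normr0.
have hx := hC _ (mulr_gt0 t0 I0).
rewrite powRN powR_mulrn ?(ltW (mulr_gt0 t0 I0))// in hx.
have f1 : `|symbol chi theta k (lattice m)| <= 1 by rewrite ger0_norm ?(symbol_ge0 CT)// symbol_le1.
apply: (@le_trans _ _ (1 * (C / (t * eigen m) ^+ (s + 3)) * (G * eigen m) * eigen m ^+ s)).
  apply: ler_wpM2r; first by rewrite exprn_ge0// ltW.
  apply: ler_pM; rewrite ?normc_ge0 ?mulr_ge0 ?expR_ge0//.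
  by apply: ler_pM; rewrite ?expR_ge0.
have -> : 1 * (C / (t * eigen m) ^+ (s + 3)) * (G * eigen m) * eigen m ^+ s = G * C / t ^+ (s + 3) * (eigen m ^+ 2)^-1.
  rewrite exprMn [eigen m ^+ (s + 3)]exprD; have i1 : eigen m != 0 by rewrite gt_eqF.
  have i2 : eigen m ^+ s != 0 by rewrite expf_neq0.
  have i3 : t ^+ (s + 3) != 0 by rewrite expf_neq0 ?gt_eqF.
  by move: (t ^+ (s + 3)) (eigen m ^+ s) i2 i3 => a b b0 a0; field; rewrite ?a0 ?b0 ?i1.
set W := G * C / t ^+ (s + 3); have -> : B = W * 64 ^+ 2 by [].
rewrite -[leRHS]mulrA; apply: ler_wpM2l.
  by apply: divr_ge0; [apply: mulr_ge0 => //; exact: ltW|rewrite exprn_ge0// ltW].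
rewrite -[leRHS]invf_div lef_pV2 ?posrE ?divr_gt0 ?exprn_gt0// -expr_div_n.
by rewrite lerXn2r ?nnegrE ?divr_ge0 ?(ltW I0) ?(ltW k40).
Qed.

Lemma psum_hsum t K c x : psum side (fun k => hblk t k c) K x = complex.Re (trig (2 ^ K) (hsum t K c) x).
Proof.
rewrite /psum /term -raddf_sum; congr complex.Re.
under eq_big_nat => k /andP[_ kK].
  rewrite (@trig_supp _ _ (2 ^ K)%N (hblk t k c)); first last.
  - by move=> m h; apply: (hblk_supp CT); apply: contra h; apply: in_box_le; rewrite leq_exp2l.
  - by move=> m; exact: hblk_supp.
  over.
by rewrite /trig exchange_big/=; apply: eq_bigr => j _; rewrite /hsum mulr_suml.
Qed.

(** [heat_semigroup] sums over discs and [fsum] over dyadic blocks. For N >= 2^K the blocks below K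
    lie inside the disc and agree on both sides; the others form small tails. *)
Lemma heat_semigroup_fsum (w : @torus_distribution R) t : 0 < t -> fast side (fun k => hblk t k (fourier_coef w)) ->
  heat_semigroup t w = fsum side (fun k => hblk t k (fourier_coef w)).
Proof.
move=> t0 fa; apply/funext => x; set c := fourier_coef w.
have [C1 h1] := fa 0%N; have [C C0 /(_ x)[_ [h2 _]]] := fsum_lim fa.
have C10 : 0 <= C1.
  have := h1 0%N; rewrite expr0 divr1; apply: le_trans; apply: sumr_ge0 => j _.
  by rewrite mulr_ge0 ?normc_ge0.
apply: cvg_lim => //; apply/cvgrPdist_le => eps eps0.
have [K hK] := exists_small (addr_ge0 (ltW C0) (mulr_ge0 (ler0n R 2) C10)) eps0.
exists (2 ^ K)%N => // N /= KN.
pose T k : Rc := \sum_(j : box N | box_mode j \in @disc R N) hblk t k c (box_mode j) * e (box_mode j) x.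
(* Since N < 2^N, the symbols of index at most N + 1 add up to 1 on the whole disc of radius N. *)
pose K' := N.+2.
have KK' : (K <= K')%N by apply: leq_trans (ltnW (ltn_expl K (isT : (1 < 2)%N))) _; apply: (leq_trans KN); rewrite /K'; clear; lia.
have PE : complex.Re (\sum_(m \in @disc R N) (expR (- (t * eigen m)))%:C%C * c m * e m x) = \sum_(0 <= k < K') complex.Re (T k).
  rewrite (fsbig_box (D := N)); last by move=> m; exact: disc_in_box.
  rewrite -raddf_sum exchange_big/=; congr complex.Re; apply: eq_bigr => j.
  rewrite inE => jN; rewrite -mulr_suml; congr (_ * _).
  rewrite /hblk /heat_symbol -mulr_suml -rmorph_sum -mulr_suml (@symbol_sum _ _ _ CT N.+1) ?mul1r//.
  apply: (le_lt_trans jN); rewrite exprS; have : (N%:R : R) < 2 ^+ N by rewrite -natrX ltr_nat ltn_expl.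
  by have := ler0n R N; lra.
have Tsmall k : (k < K)%N -> complex.Re (T k) = term side (fun k => hblk t k c) k x.
  move=> kK; rewrite /T /term /trig; congr complex.Re.
  rewrite -(@big_box _ (2 ^ k.+1) N (fun m => hblk t k c m * e m x)); first last.
  - by move=> m /(hblk_supp CT) ->; rewrite mul0r.
  - by apply: leq_trans KN; rewrite leq_exp2l.
  rewrite big_mkcond/=; apply: eq_bigr => j _; case: ifPn => // jN.
  rewrite /hblk /heat_symbol; have [->|s0] := eqVneq (symbol chi theta k (lattice (box_mode j))) 0.
    by rewrite mul0r rmorph0 !mul0r.
  move: jN; rewrite notin_setE => -[]; rewrite /disc/=; apply: ltW; apply: lt_le_trans (symbol_lt CT s0) _.
  apply: (@le_trans _ _ (2 ^+ k.+1)).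
    by rewrite exprS; have : 0 < 2 ^+ k :> R by [exact: exprn_gt0]; lra.
  by rewrite -natrX ler_nat; apply: leq_trans KN; rewrite leq_exp2l.
have Tbig k : `|complex.Re (T k)| <= C1 / 2 ^+ k.
  apply: le_trans (normr_Re _) _; apply: le_trans (normc_sum _ _ _) _; apply: le_trans (h1 k).
  pose G m : R := if m \in @disc R N then normc (hblk t k c m) else 0.
  apply: (@le_trans _ _ (\sum_(j : box (2 ^ k.+1)) G (box_mode j))); last first.
    apply: ler_sum => j _; rewrite expr0 mulr1 /G; case: ifP => // _; exact: normc_ge0.
  rewrite -(@fsbigT_box _ (2 ^ k.+1) G); last first.
    by move=> m /(hblk_supp CT) h; rewrite /G h ComplexField.Normc.normc0; case: ifP.
  rewrite (@fsbigT_box _ N G); last first.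
    by move=> m mN; rewrite /G; case: ifPn => //; rewrite inE => /disc_in_box h; rewrite h in mN.
  rewrite big_mkcond; apply: ler_sum => j _; rewrite /G; case: ifP => // _.
  by rewrite ComplexField.Normc.normcM normc_mode mulr1.
rewrite -/(fsum side _ x) PE (big_cat_nat (n := K))//=.
have -> : \sum_(0 <= i < K) complex.Re (T i) = psum side (fun k => hblk t k c) K x.
  by apply: eq_big_nat => k /andP[_ kK]; exact: Tsmall.
rewrite opprD addrA; apply: le_trans (ler_normB _ _) _; apply: le_trans (ltW hK).
rewrite mulrDl; apply: lerD; first exact: h2.
apply: le_trans (ler_norm_sum _ _ _) _; apply: le_trans (ler_sum _ (fun k _ => Tbig k)) _.
rewrite -{1}[K]add0n big_addn.
under eq_bigr do rewrite exprD invfM mulrA -exprVn.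
rewrite -mulr_suml -mulr_sumr; apply: ler_wpM2r; first by rewrite invr_ge0 exprn_ge0.
rewrite mulrC; apply: ler_wpM2r => //.
have h3 : 0 <= (2^-1 : R) < 1 by apply/andP; split; lra.
apply: le_trans (sum_expr_le _ h3) _.
by rewrite le_eqVlt; apply/orP; left; apply/eqP; field.
Qed.

Lemma hsum_conj t K c m : (forall m, c (- m) = (c m)^*%C) -> hsum t K c (- m) = (hsum t K c m)^*%C.
Proof.
move=> cc; rewrite /hsum rmorph_sum; apply: eq_bigr => k _; have hs : heat_symbol chi theta t k (- m) = heat_symbol chi theta t k m by rewrite /heat_symbol latticeN (symbolN CT) eigenN.
by rewrite /hblk cc hs; case: (c m) => p q; apply/eqP; rewrite eq_complex/=; apply/andP; split; apply/eqP; ring.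
Qed.

Lemma distr_linear_mul (u : @torus_distribution R) f : distr_linear u -> test_function f -> distr_linear (distr_mul f u).
Proof.
move=> lu tf c g h tg th; rewrite /distr_mul -lu; try exact: test_functionM.
by congr u; apply/funext => x; ring.
Qed.

Lemma fourier_coef_pow (u w : @torus_distribution R) t K j : distr_linear u -> distr_linear w ->
  fourier_coef (distr_mul (fun x => psum side (fun k => hblk t k (fourier_coef w)) K x ^+ j) u) =
  iter j (mulc (2 ^ K) (hsum t K (fourier_coef w))) (fourier_coef u).
Proof.
move=> lu lw; set F := psum side _ K.
have FE x : (F x)%:C%C = trig (2 ^ K) (hsum t K (fourier_coef w)) x.
  rewrite /F psum_hsum trig_real// => m; apply: hsum_conj => l; exact: fourier_coef_conj.
have tF : test_function F by apply: (rtrig_test (D := (2 ^ K)%N)); exists (hsum t K (fourier_coef w)) => x; rewrite FE.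
elim: j => [|j IH].
  by rewrite /=; congr fourier_coef; apply/funext => phi; rewrite /distr_mul; congr u; apply/funext => x; rewrite expr0 mul1r.
rewrite iterS -IH; apply/funext => m; rewrite -(fourier_coef_mul m _ FE); last first.
  by apply: distr_linear_mul => //; exact: test_functionX.
congr (fourier_coef _ m); apply/funext => phi; rewrite /distr_mul; congr u; apply/funext => x.
by rewrite exprSr mulrA.
Qed.

Lemma distr_of_fun_small (g psi : R * R -> R) (B eps : R) : continuous g -> continuous psi ->
  (forall x, torus x -> `|g x| <= B) -> (forall x, `|psi x| <= eps) -> `|distr_of_fun g psi| <= B * eps.
Proof.
move=> cg cpsi gB pe; have mT : measurable (@torus R : set (plane R)) by exact: measurableX.
have cgp : continuous (fun x => g x * psi x) by move=> x; apply: cvgM; [exact: cg|exact: cpsi].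
rewrite /distr_of_fun; apply: le_trans (le_normr_Rintegral mT (continuous_torus_integrable cgp)) _.
have -> : B * eps = \int[@plane_measure R]_(x in torus) (B * eps).
  by rewrite Rintegral_cst// [fine _](_ : _ = 1) ?mulr1//; exact: (congr1 fine (@plane_measure_torus R)).
apply: le_Rintegral => //.
- apply: continuous_torus_integrable => x; apply: cvg_norm; exact: cgp.
- apply: (@continuous_torus_integrable R (fun=> B * eps)) => x; exact: cvg_cst.
- by move=> x xT; rewrite normrM; apply: ler_pM => //; exact: gB.
Qed.

Lemma pow_diff_le (x y M : R) j : `|x| <= M -> `|y| <= M -> `|x ^+ j - y ^+ j| <= `|x - y| * (j%:R * (1 + M) ^+ j).
Proof.
move=> xM yM; have M0 : 0 <= M := le_trans (normr_ge0 _) xM.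
elim: j => [|j IH]; first by rewrite !expr0 subrr normr0 mul0r mulr0.
have -> : x ^+ j.+1 - y ^+ j.+1 = x * (x ^+ j - y ^+ j) + (x - y) * y ^+ j by rewrite !exprS; ring.
apply: le_trans (ler_normD _ _) _; rewrite !normrM normrX.
have h1 : `|y| ^+ j <= (1 + M) ^+ j.
  by rewrite lerXn2r ?nnegrE//; [rewrite addr_ge0|apply: (le_trans yM); rewrite lerDr].
apply: le_trans (lerD (ler_pM (normr_ge0 _) (normr_ge0 _) xM IH) (ler_wpM2l (normr_ge0 _) h1)) _.
rewrite exprS -natr1; set q := (1 + M) ^+ j; have q0 : 0 <= q by rewrite exprn_ge0// addr_ge0.
have -> : M * (`|x - y| * (j%:R * q)) + `|x - y| * q = `|x - y| * ((M * j%:R + 1) * q) by ring.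
rewrite ler_wpM2l//; have -> : (j%:R + 1) * ((1 + M) * q) = ((j%:R + 1) * (1 + M)) * q by ring.
by rewrite ler_wpM2r//; have := ler0n R j; nra.
Qed.

Lemma fourier_coef_sub (u v : @torus_distribution R) m : fourier_coef (distr_sub u v) m = fourier_coef u m - fourier_coef v m.
Proof. by apply/eqP; rewrite eq_complex/= !eqxx. Qed.

Lemma iter_mulcB D (a c c' : int * int -> Rc) j m :
  iter j (mulc D a) c m - iter j (mulc D a) c' m = iter j (mulc D a) (fun m => c m - c' m) m.
Proof.
elim: j m => [//|j IH] m /=; rewrite mulcBr; congr (mulc D a _ m).
by apply/funext => l; rewrite IH.
Qed.

Lemma bnd_fast (w : @torus_distribution R) t y : 0 < t -> bnd (fourier_coef w) y -> fast side (fun k => hblk t k (fourier_coef w)).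
Proof.
move=> t0 wy; have [C C0 hC] := coef_le CT alpha01.
apply: (@hblk_fast t _ (C * y)) => // m; rewrite mulrAC; exact: hC (bnd_ge0 wy) wy.
Qed.

(** A distribution comes with no continuity in its test function, hence the detour through a smooth
    approximation of [u]. The operators on coefficients are bounded uniformly in [K], which handles
    the change of [u] in the truncated product; for the smooth function the partial sums converge
    uniformly; for the full product the approximation converges against each fixed test function. *)
Theorem heat_pow_coef_lim (u w : @torus_distribution R) t y j m (eps : R) : in_besov chi theta (- alpha) u ->
  distr_linear w -> bnd (fourier_coef w) y -> 0 < t -> 0 < eps ->
  exists K0, forall K, (K0 <= K)%N ->
   normc (iter j (mulc (2 ^ K) (hsum t K (fourier_coef w))) (fourier_coef u) m -
     fourier_coef (distr_mul (fun x => heat_semigroup t w x ^+ j) u) m) <= eps.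
Proof.
move=> ub lw wy t0 eps0; have lu := in_besov_linear ub.
have y0 := bnd_ge0 wy; have fa := bnd_fast t0 wy; set a := fun k => hblk t k (fourier_coef w) in fa.
rewrite (heat_semigroup_fsum t0 fa) -/a; set f := fsum side a.
have tf : test_function f by exact: test_function_fsum.
have [CF CF0 hF] := fsum_lim fa.
have [Cm Cm0 hCm] := heat_mul_le CT alpha01 alphabeta.
have [Cc Cc0 hCc] := coef_le CT alpha01.
pose X := Cm * t `^ (- ((alpha + beta) / 2)) * y.
have X0 : 0 <= X by rewrite !mulr_ge0 ?powR_ge0 ?(ltW Cm0).
have pw K c r i : bnd c r -> bnd (iter i (mulc (2 ^ K) (hsum t K (fourier_coef w))) c) (X ^+ i * r).
  move=> cr; elim: i => [|i IH]; first by rewrite expr0 mul1r.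
  by have := hCm t K _ _ _ _ t0 wy IH; apply: bnd_le; rewrite exprS /X !mulrA.
pose Q := Cc * eigen m * X ^+ j; have Q0 : 0 <= Q.
  by apply: mulr_ge0; [apply: mulr_ge0; [exact: ltW|rewrite ltW// eigen_gt0]|exact: exprn_ge0].
have Q1 : 0 < Q + 1 by rewrite ltr_wpDl.
pose eta := eps / 3 / (Q + 1); have eta0 : 0 < eta by rewrite !divr_gt0.
have [v [tv /fine_cvgP[vfin vb] vu]] := ub.
pose pR x := f x ^+ j * complex.Re (e (- m) x); pose pI x := f x ^+ j * complex.Im (e (- m) x).
have tR := @test_mode_Re R (- m); have tI := @test_mode_Im R (- m).
have tpR : test_function pR by apply: test_functionM => //; exact: test_functionX.
have tpI : test_function pI by apply: test_functionM => //; exact: test_functionX.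
have e60 : 0 < eps / 6 by rewrite divr_gt0.
have /cvgrPdist_lt/(_ _ eta0) nb := vb.
have /cvgrPdist_lt/(_ _ e60) nR := vu _ tpR.
have /cvgrPdist_lt/(_ _ e60) nI := vu _ tpI.
have [i [[[vf vn] vR] vI]] := filter_ex (filterI (filterI (filterI vfin nb) nR) nI).
rewrite /= sub0r normrN in vn.
set vi := distr_of_fun (v i) in vf vn vR vI.
have bi : bnd (fourier_coef (distr_sub u vi)) eta.
  apply/(besov_norm_leP CT); rewrite -(fineK vf) lee_fin; apply: le_trans (ler_norm _) _; exact: ltW.
have cvi : continuous (v i) by apply: test_function_continuous.
have lvi : distr_linear vi by exact: distr_of_fun_linear.
have [B B0 hB] := continuous_torus_bounded cvi.
pose M := 2 * CF; have M0 : 0 <= M by rewrite mulr_ge0// ltW.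
pose J : R := j%:R * (1 + M) ^+ j; have J0 : 0 <= J by rewrite mulr_ge0// exprn_ge0// addr_ge0.
have BCJ : 0 <= B * (CF * J) by apply: mulr_ge0 => //; apply: mulr_ge0 => //; exact: ltW.
have [K0 hK0] := exists_small BCJ e60.
exists K0 => K KK0.
have p0 k : 0 < 2 ^+ k :> R by rewrite exprn_gt0.
have FK x : `|psum side a K x - f x| <= CF / 2 ^+ K by rewrite distrC; have [_ [+ _]] := hF x; apply.
have K1 : CF / 2 ^+ K <= CF by rewrite ler_pdivrMr// ler_peMr ?(ltW CF0)// exprn_ege1// ler1n.
have fM x : `|f x| <= M by have [_ [_ h]] := hF x; apply: (le_trans h); rewrite /M; lra.
have FM x : `|psum side a K x| <= M.
  rewrite -(subrK (f x) (psum _ _ _ _)); apply: le_trans (ler_normD _ _) _.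
  by have [_ [_ h]] := hF x; have := FK x; rewrite /M; lra.
have small (psi : R * R -> R) : test_function psi -> (forall x, `|psi x| <= 1) ->
    `|vi (fun x => psum side a K x ^+ j * psi x) - vi (fun x => f x ^+ j * psi x)| <= eps / 6.
  move=> tpsi psi1.
  have tK : test_function (psum side a K).
    rewrite (_ : psum side a K = fun x => \sum_(k <- index_iota 0 K) term side a k x)//.
    by apply: test_function_sum => k; apply: (rtrig_test (D := side k)); apply: rtrig_Re; exists (a k).
  have t1 : test_function (fun x => psum side a K x ^+ j * psi x) by apply: test_functionM => //; exact: test_functionX.
  have t2 : test_function (fun x => f x ^+ j * psi x) by apply: test_functionM => //; exact: test_functionX.
  have -> : vi (fun x => psum side a K x ^+ j * psi x) - vi (fun x => f x ^+ j * psi x) =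
      vi (fun x => psum side a K x ^+ j * psi x + (-1) * (f x ^+ j * psi x)) by rewrite lvi// mulN1r.
  apply: le_trans (ltW hK0); apply: le_trans (_ : B * (CF / 2 ^+ K * J) <= _); last first.
    rewrite -[leRHS]mulrA; apply: ler_wpM2l => //; rewrite [leLHS]mulrAC.
    apply: ler_wpM2l; first by apply: mulr_ge0 => //; exact: ltW.
    rewrite lef_pV2 ?posrE//.
    by rewrite ler_eXn2l// ltr1n.
  apply: distr_of_fun_small => //.
    by apply: test_function_continuous; apply: test_functionD => //; exact: test_functionZ.
  move=> x; rewrite mulN1r -mulrBl normrM; apply: le_trans (ler_piMr (normr_ge0 _) (psi1 x)) _.
  by apply: le_trans (pow_diff_le j (FM x) (fM x)) _; apply: ler_wpM2r.
have mode1 x : `|complex.Re (e (- m) x)| <= 1 /\ `|complex.Im (e (- m) x)| <= 1.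
  by rewrite -(normc_mode (- m) x); split; [exact: normr_Re|exact: normr_Im].
have s1 : normc (iter j (mulc (2 ^ K) (hsum t K (fourier_coef w))) (fourier_coef u) m -
    iter j (mulc (2 ^ K) (hsum t K (fourier_coef w))) (fourier_coef vi) m) <= eps / 3.
  rewrite iter_mulcB; have b : bnd (fun l => fourier_coef u l - fourier_coef vi l) eta.
    by apply: eq_bnd bi => l; exact: fourier_coef_sub.
  apply: le_trans (hCc _ _ m (bnd_ge0 (pw K _ _ j b)) (pw K _ _ j b)) _.
  rewrite mulrA -/Q /eta mulrA ler_pdivrMr// mulrC ler_wpM2l ?lerDl//.
  by rewrite divr_ge0 ?ltW.
have s2 : normc (iter j (mulc (2 ^ K) (hsum t K (fourier_coef w))) (fourier_coef vi) m -
    fourier_coef (distr_mul (fun x => f x ^+ j) vi) m) <= eps / 3.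
  rewrite -(fourier_coef_pow t K j lvi lw) -/a; apply: le_trans (normc_le _) _; rewrite raddfB [complex.Im (_ - _)]raddfB.
  have h1 := small _ tR (fun x => (mode1 x).1); have h2 := small _ tI (fun x => (mode1 x).2).
  apply: le_trans (lerD h1 h2) _; lra.
have s3 : normc (fourier_coef (distr_mul (fun x => f x ^+ j) vi) m -
    fourier_coef (distr_mul (fun x => f x ^+ j) u) m) <= eps / 3.
  apply: le_trans (normc_le _) _; rewrite raddfB [complex.Im (_ - _)]raddfB.
  rewrite distrC [X in _ + X]distrC.
  apply: le_trans (lerD (ltW vR) (ltW vI)) _; lra.
set z1 := iter j _ (fourier_coef u) m in s1 *; set z2 := iter j _ _ m in s1 s2 *; set z3 := fourier_coef _ m in s2 s3 *.
set z4 := fourier_coef _ m in s3 *.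
have -> : z1 - z4 = (z1 - z2) + (z2 - z3) + (z3 - z4) by rewrite !addrA !subrK.
apply: le_trans (le_normcD _ _) _; apply: le_trans (lerD (le_normcD _ _) (lexx _)) _.
apply: le_trans (lerD (lerD s1 s2) s3) _; lra.
Qed.

(** A block involves finitely many coefficients, so coefficientwise convergence is enough, without
    uniformity in the frequency. *)
Lemma bnd_limit (c : int * int -> Rc) (cK : nat -> int * int -> Rc) r : (forall K, bnd (cK K) r) ->
  (forall m eps, 0 < eps -> exists K0, forall K, (K0 <= K)%N -> normc (cK K m - c m) <= eps) -> bnd c r.
Proof.
move=> cr cl k x; apply/ler_addgt0Pr => eps eps0; have w0 := bweight_gt0 (- alpha) k : 0 < bweight (- alpha) k.
pose n : R := #|{: box (2 ^ k.+1)}|%:R; have n0 : 0 <= n by [].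
pose eta := eps / (bweight (- alpha) k * (n + 1)); have eta0 : 0 < eta by rewrite divr_gt0// mulr_gt0// ltr_wpDl.
have [K0 hK] : exists K, forall j : box (2 ^ k.+1), normc (cK K (box_mode j) - c (box_mode j)) <= eta.
  have /choice[g hg] := fun j : box (2 ^ k.+1) => cl (box_mode j) eta eta0.
  exists (\max_j g j) => j; apply: hg; exact: leq_bigmax.
have -> : blk chi theta k c x = blk chi theta k (cK K0) x + blk chi theta k (fun m => c m - cK K0 m) x.
  by rewrite -blkD; congr (blk _ _ _ _ _); apply/funext => m; rewrite addrC subrK.
apply: le_trans (ler_wpM2l (ltW w0) (le_normcD _ _)) _; rewrite mulrDr; apply: lerD; first exact: cr.
rewrite -ler_pdivlMl//; apply: le_trans (normc_sum _ _ _) _.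
apply: (@le_trans _ _ (\sum_(j : box (2 ^ k.+1)) eta)).
  apply: ler_sum => j _; rewrite !ComplexField.Normc.normcM normc_mode mulr1 normc_real ger0_norm ?(symbol_ge0 CT)//.
  rewrite -(opprB (cK K0 _)) -[leRHS]mul1r; apply: ler_pM; rewrite ?(symbol_ge0 CT) ?normc_ge0 ?(symbol_le1 CT)//.
  by have -> : normc (- (cK K0 (box_mode j) - c (box_mode j))) = normc (cK K0 (box_mode j) - c (box_mode j)) by case: (_ - _) => p q; rewrite /= !sqrrN.
rewrite sumr_const -(mulr_natl eta) -/n.
have -> : (bweight (- alpha) k)^-1 * eps = (n + 1) * eta.
  have n1 : n + 1 != 0 by rewrite gt_eqF// ltr_wpDl.
  by rewrite /eta; field; rewrite n1 gt_eqF.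
by apply: ler_wpM2r; [exact: ltW|rewrite lerDl].
Qed.

End HeatLimits.

(** * Wick powers of the solution started from zero *)

Section WickDifference.
Context {R : realType} {d : measure_display} {Omega : measurableType d} (P : probability Omega R).
Local Notation S := (spacetime R).
Local Notation Rc := R[i].
Local Notation e := (@fourier_mode R).
Variable xi : (S -> R) -> {RV P >-> R}.
Hypothesis xi_white : white_noise xi.
Variables (chi theta : R * R -> R).
Hypothesis CT : dyadic_partition chi theta.
Variables (T alpha : R).
Hypotheses (T0 : 0 < T) (alpha01 : 0 < alpha < 1).
Variable Z : nat -> R -> Omega -> @torus_distribution R.
Hypothesis Z_wick : stationary_wick_powers chi theta xi T alpha Z.
Local Notation bnd := (bnd chi theta alpha).
Local Notation hsum := (hsum chi theta).

Lemma in_besov_test (g : R * R -> R) : test_function g -> in_besov chi theta (- alpha) (distr_of_fun g).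
Proof.
move=> tg; exists (fun=> g); split=> //; last by move=> phi _; exact: cvg_cst.
rewrite (_ : (fun=> _) = cst 0%E); first exact: cvg_cst.
apply/funext => k /=; apply/eqP; rewrite eq_le (besov_norm_ge0 CT) andbT.
apply/(besov_norm_leP CT) => j x; rewrite /blk /trig big1 ?ComplexField.Normc.normc0 ?mulr0// => l _.
by rewrite fourier_coef_sub subrr mulr0 mul0r.
Qed.

Lemma fourier_coef_cst1 m : fourier_coef (distr_of_fun (fun=> 1 : R)) m = (m == 0)%:R.
Proof.
rewrite /fourier_coef /distr_of_fun.
have -> : \int[@plane_measure R]_(x in torus) (1 * complex.Re (e (- m) x)) = (m == 0)%:R.
  transitivity (\int[@plane_measure R]_(x in torus) cos (phase (- m) x + 0)).
    by congr Rintegral; apply/funext => x; rewrite mul1r addr0.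
  by rewrite Rintegral_torus_cos cos0 mulr1 oppr_eq0.
have -> : \int[@plane_measure R]_(x in torus) (1 * complex.Im (e (- m) x)) = 0.
  transitivity (\int[@plane_measure R]_(x in torus) cos (phase (- m) x + - (pi / 2))).
    by congr Rintegral; apply/funext => x; rewrite mul1r /= sin_cos.
  by rewrite Rintegral_torus_cos cosN cos_pihalf mulr0.
by case: (m == 0).
Qed.

Lemma mulc_one D (a : int * int -> Rc) m : (forall m, ~~ in_box D m -> a m = 0) ->
  mulc D a (fourier_coef (distr_of_fun (fun=> 1 : R))) m = a m.
Proof.
move=> a0; have [mD|mD] := boolP (in_box D m); last first.
  rewrite a0// /mulc big1// => k _; rewrite fourier_coef_cst1 subr_eq0; case: eqP => [mk|_]; last by rewrite mulr0.
  by move: mD; rewrite mk box_modeP.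
have [k <-] := in_boxP mD; rewrite /mulc (bigD1 k)//= fourier_coef_cst1 subrr eqxx mulr1 big1 ?addr0// => l lk.
rewrite fourier_coef_cst1 subr_eq0; case: eqP => [/box_mode_inj kl|_]; last by rewrite mulr0.
by rewrite kl eqxx in lk.
Qed.

Lemma hsum_supp t K (h : int * int -> Rc) m : ~~ in_box (2 ^ K) m -> hsum t K h m = 0.
Proof.
move=> mK; rewrite /hsum big_nat_cond big1// => k /andP[/andP[_ kK] _]; apply: (hblk_supp CT).
by apply: contra mK; apply: in_box_le; rewrite leq_exp2l.
Qed.

Lemma distr_of_fun_powM (g v phi : R * R -> R) k :
  distr_of_fun (fun x => g x ^+ k * v x) phi = distr_mul (fun x => g x ^+ k) (distr_of_fun v) phi.
Proof. by rewrite /distr_mul /distr_of_fun; congr Rintegral; apply/funext => x; ring. Qed.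

Lemma distr_of_fun_sum n (c : nat -> R) (F : nat -> R * R -> R) phi : test_function phi ->
  (forall k, test_function (F k)) ->
  distr_of_fun (fun x => \sum_(k < n) c k * F k x) phi = \sum_(k < n) c k * distr_of_fun (F k) phi.
Proof.
move=> tphi tF; have sw (g : R * R -> R) : distr_of_fun g phi = distr_of_fun phi g.
  by rewrite /distr_of_fun; congr Rintegral; apply/funext => x; rewrite mulrC.
rewrite sw (distr_linear_sum (u := distr_of_fun phi) (index_enum 'I_n) (fun k : 'I_n => c k) (f := fun k : 'I_n => F k))//.
  by apply: eq_bigr => k _; rewrite sw.
by apply: distr_of_fun_linear; exact: test_function_continuous.
Qed.

Section Deterministic.
Variable beta : R.
Hypothesis alphabeta : alpha < beta.
Let s : R := (alpha + beta) / 2.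

(** A pathwise statement: randomness enters only through [y], and the rate only through [a]. The
    k-th term of the binomial sum costs k negative powers of t, except that for k = n one factor is
    estimated by [heat_bnd]. *)
Theorem wick_diff_le n : (1 <= n <= 3)%N -> exists2 C : R, 0 < C & forall (N : nat) w t (y a : R),
  0 < t -> t <= T -> 0 <= y -> 0 <= a <= 1 ->
  (forall m r, (1 <= m <= 3)%N -> 0 <= r <= T ->
    (besov_norm chi theta (- alpha) (Z m r w) <= y%:E)%E /\
    (besov_norm chi theta (- alpha) (distr_sub (Z m r w) (distr_of_fun (stationaryN Z N m r w))) <= (a * y)%:E)%E) ->
  (besov_norm chi theta (- alpha) (distr_sub (wick Z n t w) (distr_of_fun (wickN Z N n t w))) <=
    (C * a * (1 + y) ^+ 4 * t `^ (- (s * (n%:R - 1))))%:E)%E.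
Proof.
move=> n13; have /andP[a0 a1] := alpha01; have n1 : (0 < n)%N by case/andP: n13.
have s0 : 0 <= s by rewrite divr_ge0// addr_ge0 ?(ltW a0)// (le_trans (ltW a0))// ltW.
have [C C0 hC] := heat_power_diff_le CT alpha01 alphabeta.
have [C' C'0 hC'] := heat_bnd CT alpha.
(* Compares powers of t on (0, T]: with at most n - 1 singular factors, t^(- s k) is at most W t^(-
   s (n - 1)). *)
pose W : R := (1 + T) `^ (3 * s).
have T1 : 1 <= 1 + T by rewrite lerDl ltW.
have W1 : 1 <= W by rewrite -(powRr0 (1 + T)); apply: ler_powR => //; rewrite mulr_ge0.
pose A : R := 4 * W * (1 + 2 * C) ^+ 3 * (1 + C').
have W0 : 0 < W by exact: lt_le_trans W1.
have C21 : 0 < 1 + 2 * C by lra.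
have C1' : 0 < 1 + C' by lra.
have A0 : 0 < A.
  by apply: mulr_gt0 => //; apply: mulr_gt0; [exact: mulr_gt0|exact: exprn_gt0].
exists (\sum_(0 <= k < n.+1) 'C(n, k)%:R * A).
  rewrite big_nat_recl// bin0 mul1r ltr_pwDl// sumr_ge0// => k _; rewrite mulr_ge0// ltW//.
move=> N w t y a t0 tT y0 /andP[aa0 aa1] hZ.
have tTT : 0 <= t <= T by rewrite ltW.
have zT : (0 : R) <= 0 <= T by rewrite lexx ltW.
pose v m r := stationaryN Z N m r w.
have tv m r : (m <= 3)%N -> test_function (v m r).
  case: m => [_|m m3]; first exact: test_function_cst.
  by apply: (rtrig_test (D := (3 * N)%N)); exact: rtrig_stationaryN.
have lin (g : R * R -> R) : test_function g -> distr_linear (distr_of_fun g).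
  by move=> tg; apply: distr_of_fun_linear; exact: test_function_continuous.
have Zb m r : (1 <= m <= 3)%N -> 0 <= r <= T -> bnd (fourier_coef (Z m r w)) y.
  by move=> m3 rT; apply/(besov_norm_leP CT); have [] := hZ m r m3 rT.
have Eb m r : (1 <= m <= 3)%N -> 0 <= r <= T -> bnd (fun l => fourier_coef (Z m r w) l - fourier_coef (distr_of_fun (v m r)) l) (a * y).
  move=> m3 rT; have [_ /(besov_norm_leP CT) h] := hZ m r m3 rT.
  by apply: eq_bnd h => l; exact: fourier_coef_sub.
have ay : a * y <= y by rewrite ler_piMl.
(* The Galerkin powers are bounded by y + a y <= 2 y through the error; the bound on [Z] is relaxed
   to the same value, as [heat_power_diff_le] takes a common one. *)
have Zb2 m r : (1 <= m <= 3)%N -> 0 <= r <= T -> bnd (fourier_coef (Z m r w)) (2 * y).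
  by move=> m3 rT; apply: bnd_le (Zb m r m3 rT); lra.
have vb m r : (1 <= m <= 3)%N -> 0 <= r <= T -> bnd (fourier_coef (distr_of_fun (v m r))) (2 * y).
  move=> m3 rT; have h := bndD (Zb m r m3 rT) (bndZ (- 1) (Eb m r m3 rT)).
  rewrite normrN1 mul1r in h; apply: (eq_bnd _ (bnd_le _ h)); last by lra.
  by move=> l; rewrite rmorphN1 mulN1r opprB addrC subrK.
set z0 := Z 1 0 w; set v0 := distr_of_fun (v 1 0).
have lz0 : distr_linear z0 by exact: (Z_linear Z_wick).
have lv0 : distr_linear v0 by apply: lin; exact: tv.
have b1 := Zb2 1 0 isT zT; have b2 := vb 1 0 isT zT; have b3 := Eb 1 0 isT zT; rewrite -/z0 -/v0 in b1 b2 b3.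
pose f := heat_semigroup t z0; pose g := heat_semigroup t v0.
have tf : test_function f.
  have fa := bnd_fast CT alpha01 t0 b1; rewrite /f (heat_semigroup_fsum CT t0 fa); exact: test_function_fsum.
have tg : test_function g.
  have fa := bnd_fast CT alpha01 t0 b2; rewrite /g (heat_semigroup_fsum CT t0 fa); exact: test_function_fsum.
pose u m := stationary Z m t w.
have ub m : (m <= 3)%N -> in_besov chi theta (- alpha) (u m).
  rewrite /u /stationary; case: m => [_|m m3]; first by apply: in_besov_test; exact: test_function_cst.
  by have [_ /(_ w)[+ _]] := Z_wick (m3 : (1 <= m.+1 <= 3)%N); apply.
have n3 : (n <= 3)%N by case/andP: n13.
pose Dk k m := fourier_coef (distr_mul (fun x => f x ^+ k) (u (n - k)%N)) m -
  fourier_coef (distr_mul (fun x => g x ^+ k) (distr_of_fun (v (n - k)%N t))) m.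
pose X : R := C * t `^ (- s).
have X0 : 0 <= X by rewrite mulr_ge0 ?powR_ge0 ?(ltW C0).
pose cK k K m := iter k (mulc (2 ^ K) (hsum t K (fourier_coef z0))) (fourier_coef (u (n - k)%N)) m -
  iter k (mulc (2 ^ K) (hsum t K (fourier_coef v0))) (fourier_coef (distr_of_fun (v (n - k)%N t))) m.
have lim k r : (forall K, bnd (cK k K) r) -> bnd (Dk k) r.
  move=> h; apply: (bnd_limit CT h) => m eps eps0; have e2 : 0 < eps / 2 by rewrite divr_gt0.
  have nk3 : (n - k <= 3)%N by rewrite (leq_trans (leq_subr _ _)).
  have [K1 h1] := heat_pow_coef_lim CT alpha01 alphabeta k m (ub _ nk3) lz0 b1 t0 e2.
  have [K2 h2] := heat_pow_coef_lim CT alpha01 alphabeta k m (in_besov_test (tv _ t nk3)) lv0 b2 t0 e2.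
  exists (maxn K1 K2) => K; rewrite geq_max => /andP[k1 k2]; rewrite /cK /Dk.
  have {}h1 := h1 K k1; have {}h2 := h2 K k2.
  set p1 := iter k _ _ m in h1 *; set p2 := iter k _ _ m in h2 *; set q1 := fourier_coef _ m in h1 *.
  set q2 := fourier_coef _ m in h2 *.
  have sw (z1 z2 z3 z4 : Rc) : z1 - z2 - (z3 - z4) = (z1 - z3) + - (z2 - z4).
    by rewrite !opprB [z4 - z3]addrC [z4 - z2]addrC addrACA.
  rewrite sw.
  apply: le_trans (le_normcD _ _) _.
  have -> : normc (- (p2 - q2)) = normc (p2 - q2) by case: (p2 - q2) => i j; rewrite /= !sqrrN.
  lra.
have pw2 (k : nat) : (k <= n.-1)%N -> (X * (2 * y)) ^+ k <= W * (1 + 2 * C) ^+ 3 * (1 + y) ^+ 3 * t `^ (- (s * (n%:R - 1))).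
  move=> kn; have -> : X * (2 * y) = (2 * C * y) * t `^ (- s) by rewrite /X; ring.
  rewrite exprMn.
  have h1 : (2 * C * y) ^+ k <= (1 + 2 * C) ^+ 3 * (1 + y) ^+ 3.
    rewrite -exprMn; have Cy : 0 <= 2 * C * y by rewrite !mulr_ge0// ltW.
    have le1 : 2 * C * y <= (1 + 2 * C) * (1 + y) by have := ltW C0; nra.
    have ge1 : 1 <= (1 + 2 * C) * (1 + y) by have := ltW C0; nra.
    apply: (@le_trans _ _ (((1 + 2 * C) * (1 + y)) ^+ k)); first by rewrite lerXn2r ?nnegrE// (le_trans ler01).
    by apply: ler_weXn2l => //; apply: (leq_trans kn); clear -n3; lia.
  have h2 : (t `^ (- s)) ^+ k <= W * t `^ (- (s * (n%:R - 1))).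
    have -> : (t `^ (- s)) ^+ k = t `^ (s * (n%:R - 1 - k%:R)) * t `^ (- (s * (n%:R - 1))).
      rewrite -powR_mulrn ?powR_ge0// -powRrM -powRD ?(gt_eqF t0) ?implybT//; congr (_ `^ _); ring.
    apply: ler_wpM2r; first exact: powR_ge0.
    have kr : k%:R <= n%:R - 1 :> R by rewrite -(prednK n1) -natr1 addrK ler_nat.
    have nr : n%:R <= 3 :> R by rewrite (ler_nat _ n 3).
    have k0 : 0 <= k%:R :> R by [].
    have ex0 : 0 <= s * (n%:R - 1 - k%:R) by apply: mulr_ge0 => //; lra.
    apply: (@le_trans _ _ ((1 + T) `^ (s * (n%:R - 1 - k%:R)))).
      by apply: ge0_ler_powR; rewrite ?nnegrE ?(ltW t0) ?(le_trans ler01 T1)//; lra.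
    by apply: ler_powR => //; rewrite [3 * s]mulrC; apply: ler_wpM2l => //; lra.
  apply: le_trans (ler_pM _ _ h1 h2) _; rewrite ?exprn_ge0 ?powR_ge0 ?mulr_ge0 ?(ltW C0)//.
  by rewrite le_eqVlt; apply/orP; left; apply/eqP; ring.
pose R0 : R := A * a * (1 + y) ^+ 4 * t `^ (- (s * (n%:R - 1))).
have conv (k : nat) kap : (k <= n.-1)%N -> 0 <= kap -> kap <= 1 + C' -> k.+1%:R * (X * (2 * y)) ^+ k * kap * (a * y) <= R0.
  move=> kn kap0 kapC; have h := pw2 k kn.
  have k4 : k.+1%:R <= 4 :> R by rewrite (ler_nat _ _ 4) ltnS (leq_trans kn)// (leq_trans (leq_pred _)).
  have ay1 : a * y <= a * (1 + y) by apply: ler_wpM2l => //; lra.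
  have -> : R0 = 4 * (W * (1 + 2 * C) ^+ 3 * (1 + y) ^+ 3 * t `^ (- (s * (n%:R - 1)))) * (1 + C') * (a * (1 + y)).
    by rewrite /R0 /A [(1 + y) ^+ 4]exprS; ring.
  have p0 : 0 <= (X * (2 * y)) ^+ k by rewrite exprn_ge0// mulr_ge0// mulr_ge0.
  apply: ler_pM => //; first by rewrite !mulr_ge0.
    by rewrite mulr_ge0.
  by apply: ler_pM => //; [rewrite mulr_ge0|apply: ler_pM].
have bk k : (k <= n)%N -> bnd (Dk k) R0.
  move=> kn; apply: lim => K; have [kn'|nk] := ltnP k n.
    have k1 : (1 <= n - k <= 3)%N by rewrite subn_gt0 kn' (leq_trans (leq_subr _ _)).
    have uE : u (n - k)%N = Z (n - k)%N t w by rewrite /u /stationary; case: eqP k1 => // ->.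
    have one c r : bnd c r -> bnd c (1 * r) by rewrite mul1r.
    have [_ h] := hC t K _ _ _ _ (2 * y) (a * y) 1 k t0 b1 b2 b3
      (one _ _ (Zb2 _ t k1 tTT)) (one _ _ (vb _ t k1 tTT)) (one _ _ (Eb _ t k1 tTT)).
    rewrite /cK uE; apply: bnd_le h; apply: conv => //; last by rewrite lerDl ltW.
    by rewrite -ltnS prednK.
  have {kn nk} -> : k = n by apply/eqP; rewrite eqn_leq kn nk.
  (* For k = n the Wick factor is the constant 1, so the innermost product is the heat evolution
     itself and only n - 1 products remain to be paid for. *)
  have oneE h0 : iter n (mulc (2 ^ K) (hsum t K h0)) (fourier_coef (distr_of_fun (fun=> 1 : R))) =
      iter n.-1 (mulc (2 ^ K) (hsum t K h0)) (hsum t K h0).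
    rewrite -{1}(prednK n1) iterSr; congr (iter _ _ _); apply/funext => m; apply: mulc_one => l; exact: hsum_supp.
  have uE : u (n - n)%N = distr_of_fun (fun=> 1) by rewrite /u subnn.
  have vE : v (n - n)%N t = fun=> 1 by rewrite /v subnn.
  rewrite /cK uE vE !oneE.
  have hd : bnd (fun m => hsum t K (fourier_coef z0) m - hsum t K (fourier_coef v0) m) (C' * (a * y)).
    apply: (eq_bnd _ (hC' t K _ _ t0 b3)) => m; by rewrite -hsumB.
  have [_ h] := hC t K _ _ _ _ (2 * y) (a * y) C' n.-1 t0 b1 b2 b3 (hC' t K _ _ t0 b1) (hC' t K _ _ t0 b2) hd.
  by apply: bnd_le h; apply: conv => //; [exact: ltW|rewrite lerDr].
apply/(besov_norm_leP CT).
(* [bnd_sum] asks for a bound at every index, hence the default 0 for k > n. *)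
have fcE m : fourier_coef (distr_sub (wick Z n t w) (distr_of_fun (wickN Z N n t w))) m =
   \sum_(0 <= k < n.+1) ('C(n, k)%:R * (-1) ^+ k : R)%:C%C * (if (k <= n)%N then Dk k m else 0).
  have key phi : test_function phi -> distr_sub (wick Z n t w) (distr_of_fun (wickN Z N n t w)) phi =
     \sum_(k < n.+1) 'C(n, k)%:R * (-1) ^+ k * (distr_mul (fun x => f x ^+ k) (u (n - k)%N) phi -
        distr_mul (fun x => g x ^+ k) (distr_of_fun (v (n - k)%N t)) phi).
    move=> tphi; rewrite /distr_sub /wick.
    have -> : distr_of_fun (wickN Z N n t w) phi = \sum_(k < n.+1) 'C(n, k)%:R * (-1) ^+ k *
        distr_mul (fun x => g x ^+ k) (distr_of_fun (v (n - k)%N t)) phi.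
      rewrite (_ : wickN Z N n t w = fun x => \sum_(k < n.+1) ('C(n, k)%:R * (-1) ^+ k) * (g x ^+ k * v (n - k)%N t x)).
        rewrite (distr_of_fun_sum _ (fun k => 'C(n, k)%:R * (-1) ^+ k) (F := fun k x => g x ^+ k * v (n - k)%N t x))//.
          by apply: eq_bigr => k _; rewrite distr_of_fun_powM.
        move=> k; apply: test_functionM; first exact: test_functionX.
        by apply: tv; rewrite (leq_trans (leq_subr _ _)).
      by apply/funext => x; apply: eq_bigr => k _; rewrite mulrA.
    by rewrite -sumrB; apply: eq_bigr => k _; rewrite -mulrBr.
  rewrite big_mkord; apply/eqP; rewrite eq_complex /fourier_coef key ?key; try exact: test_mode_Re; try exact: test_mode_Im.
  rewrite [complex.Re _]/= [complex.Im (_ +i* _)%C]/= !raddf_sum; apply/andP; split; apply/eqP; apply: eq_bigr => k _.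
    have kn : (k <= n)%N by rewrite -ltnS.
    rewrite -[RHS]/(complex.Re (('C(n, k)%:R * (-1) ^+ k : R)%:C%C * (if (k <= n)%N then Dk k m else 0))).
    by rewrite kn -(Re_real_mul _ _).1 /Dk raddfB.
  have kn : (k <= n)%N by rewrite -ltnS.
  rewrite -[RHS]/(complex.Im (('C(n, k)%:R * (-1) ^+ k : R)%:C%C * (if (k <= n)%N then Dk k m else 0))).
  by rewrite kn -(Re_real_mul _ _).2 /Dk raddfB.
have fin : bnd (fun m => \sum_(0 <= k < n.+1) ('C(n, k)%:R * (-1) ^+ k : R)%:C%C * (if (k <= n)%N then Dk k m else 0))
    (\sum_(0 <= k < n.+1) 'C(n, k)%:R * R0).
  have RR0 : 0 <= R0.
    by apply: mulr_ge0; [apply: mulr_ge0; [apply: mulr_ge0 => //; exact: ltW|rewrite exprn_ge0// addr_ge0]|exact: powR_ge0].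
  apply: (bnd_sum n.+1 (c := fun k m => ('C(n, k)%:R * (-1) ^+ k : R)%:C%C * (if (k <= n)%N then Dk k m else 0))) => k.
  have -> : 'C(n, k)%:R * R0 = `|'C(n, k)%:R * (-1) ^+ k : R| * R0.
    by rewrite normrM normrX normrN1 expr1n mulr1 ger0_norm.
  have hk : bnd (fun m => if (k <= n)%N then Dk k m else 0) R0.
    case kn : (k <= n)%N; first exact: bk.
    by move=> j x; rewrite /blk /trig big1 ?ComplexField.Normc.normc0 ?mulr0// => l _; rewrite mulr0 mul0r.
  exact: (bndZ _ hk).
apply: (eq_bnd (fun m => esym (fcE m))); apply: bnd_le fin.
rewrite -!mulr_suml /R0 le_eqVlt; apply/orP; left; apply/eqP; ring.
Qed.

End Deterministic.

Theorem wick_error n p beta delta : (1 <= n <= 3)%N -> 0 < p -> alpha < beta -> 0 < delta ->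
  exists C : R, forall N : nat, (1 <= N)%N ->
     (\int[P]_w ereal_sup
        [set (t `^ ((n%:R - 1) * (alpha + beta) * p / 2))%R%:E *
             besov_norm chi theta (- alpha)
               (distr_sub (wick Z n t w) (distr_of_fun (wickN Z N n t w))) `^ p
        | t in [set t : R | (0 < t <= T)%R]]
      <= (C * (1 + N%:R ^+ 2) `^ (- (p * (alpha - delta) / 2)))%R%:E)%E.
Proof.
move=> n13 p0 ab d0; have /andP[a0 a1] := alpha01.
have [gam [g0 ga gd]] : exists gam, [/\ 0 <= gam, gam < alpha & alpha - delta <= gam].
  exists (Num.max 0 (alpha - delta)); split; rewrite ?le_max ?lexx ?orbT// gt_max a0/=; lra.
(* The pathwise bound contains [(1 + y) ^+ 4], whose p-th power has to be at most (1 + y)^(2(q +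
   1)): hence q + 1 >= 2p. *)
have [q qp [C C0 hC]] := wick_sup_all xi_white CT T0 alpha01 Z_wick (2 * p) (introT andP (conj g0 ga)).
have [C1 C10 hC1] := wick_diff_le ab n13.
exists (2 `^ (gam * p / 2) * (C1 `^ p * 2 ^+ (2 * q.+1) * (1 + C))) => N N0.
have [Y [mY Y0 YC hY]] := hC N N0; pose a : R := N%:R `^ (- gam).
have N1 : 1 <= N%:R :> R by rewrite ler1n.
have a0' : 0 < a by rewrite powR_gt0// ltr0n.
have a1' : a <= 1 by rewrite -(powRr0 N%:R); apply: ler_powR => //; rewrite oppr_le0.
apply: (@le_trans _ _ ((C1 `^ p * a `^ p * 2 ^+ (2 * q.+1) * (1 + C))%:E)); last first.
  rewrite lee_fin; have := rate_le N0 (ltW p0) g0 gd; rewrite -/a => h.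
  have -> : C1 `^ p * a `^ p * 2 ^+ (2 * q.+1) * (1 + C) = a `^ p * (C1 `^ p * 2 ^+ (2 * q.+1) * (1 + C)) by ring.
  rewrite [leRHS]mulrAC; apply: ler_wpM2r => //.
  by apply: mulr_ge0; [rewrite mulr_ge0 ?powR_ge0 ?exprn_ge0|rewrite addr_ge0// ltW].
apply: (integral_sup_le mY Y0 YC); first by apply: mulr_gt0; apply: powR_gt0.
  move=> w; apply: le_trans (ereal_sup_ubound _); last by exists T => //=; rewrite T0 lexx.
  by rewrite mule_ge0 ?lee_fin ?powR_ge0 ?poweR_ge0.
move=> w y y0 Yy; apply: ub_ereal_sup => _ [t /= /andP[t0 tT] <-].
have hb := hC1 N w t y a t0 tT y0 (introT andP (conj (ltW a0') a1')) (hY w y y0 Yy).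
set B := besov_norm _ _ _ _ in hb *; have b0 : (0 <= B)%E by exact: (besov_norm_ge0 CT).
set E := t `^ (- _) in hb; have E0 : 0 <= E by exact: powR_ge0.
have y1 : 0 <= 1 + y by lra.
have r0 : 0 <= C1 * a * (1 + y) ^+ 4 * E by rewrite !mulr_ge0 ?exprn_ge0 ?(ltW C10) ?(ltW a0').
apply: (@le_trans _ _ ((t `^ ((n%:R - 1) * (alpha + beta) * p / 2) * (C1 * a * (1 + y) ^+ 4 * E) `^ p)%:E)).
  rewrite EFinM; apply: lee_wpmul2l; first by rewrite lee_fin powR_ge0.
  by rewrite -poweR_EFin; apply: (gt0_ler_poweR (ltW p0)) => //; rewrite in_itv/= ?b0 ?leey ?lee_fin ?r0.
rewrite lee_fin powRM ?mulr_ge0 ?exprn_ge0 ?(ltW C10) ?(ltW a0')//.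
have -> : E `^ p = (t `^ ((n%:R - 1) * (alpha + beta) * p / 2))^-1.
  by rewrite /E -powRrM -powRN; congr (_ `^ _); field.
rewrite mulrCA mulfV ?mulr1; last by rewrite gt_eqF// powR_gt0.
rewrite [(C1 * a * _) `^ p]powRM ?mulr_ge0 ?exprn_ge0 ?(ltW C10) ?(ltW a0')// [(C1 * a) `^ p]powRM ?(ltW C10) ?(ltW a0')//.
apply: ler_wpM2l; first by rewrite mulr_ge0 ?powR_ge0.
rewrite -!powR_mulrn// -powRrM; apply: ler_powR; first by lra.
by rewrite natrM; lra.
Qed.

End WickDifference.

Theorem lemma3p4 (R : realType) (d : measure_display) (Omega : measurableType d)
    (P : probability Omega R)
    (chi theta : R * R -> R) (chi_theta : dyadic_partition chi theta)
    (xi : (spacetime R -> R) -> {RV P >-> R}) (xi_white : white_noise xi)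
    (T alpha : R) (T_gt0 : 0 < T) (alpha01 : 0 < alpha < 1)
    (Z : nat -> R -> Omega -> torus_distribution)
    (Z_wick : stationary_wick_powers chi theta xi T alpha Z)
    (n : nat) (n13 : (1 <= n <= 3)%N) (p : R) (p_gt1 : 1 < p) :
  (forall delta : R, 0 < delta -> exists C : R, forall N : nat, (1 <= N)%N ->
     (\int[P]_w ereal_sup
        [set besov_norm chi theta (- alpha)
               (distr_sub (Z n t w) (distr_of_fun (stationaryN Z N n t w))) `^ p
        | t in [set t : R | (0 <= t <= T)%R]]
      <= (C * (1 + N%:R ^+ 2) `^ (- (p * (alpha - delta) / 2)))%R%:E)%E) /\
  (forall beta : R, alpha < beta ->
   forall delta : R, 0 < delta -> exists C : R, forall N : nat, (1 <= N)%N ->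
     (\int[P]_w ereal_sup
        [set (t `^ ((n%:R - 1) * (alpha + beta) * p / 2))%R%:E *
             besov_norm chi theta (- alpha)
               (distr_sub (wick Z n t w) (distr_of_fun (wickN Z N n t w))) `^ p
        | t in [set t : R | (0 < t <= T)%R]]
      <= (C * (1 + N%:R ^+ 2) `^ (- (p * (alpha - delta) / 2)))%R%:E)%E).
Proof.
have p0 : 0 < p by exact: lt_trans p_gt1.
split=> [delta delta0|beta alphabeta delta delta0].
  exact: (stationary_error xi_white chi_theta T_gt0 alpha01 Z_wick n13 p0 delta0).
exact: (wick_error xi_white chi_theta T_gt0 alpha01 Z_wick n13 p0 alphabeta delta0).
Qed.
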